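(* Let $V$ be a vector superspace over a field $\mathbb F$ of characteristic $0$ with an even endomorphism $\partial$, endowed with a grading $V=\bigoplus_{s\in\mathbb Z_{\ge 0}}V_s$ by $\mathbb F[\partial]$-submodules, and with the associated increasing filtration $\mathrm F^tV=\bigoplus_{s=0}^tV_s$ (so that $\operatorname{gr}V$ is canonically identified with $V$). Let $n\ge1$ and $r\in\mathbb Z$. For $Y\in\operatorname{gr}^rP^{\mathrm{cl}}(V)(n)$, $v\in V^{\otimes n}$ and $f\in\mathcal O_n^{\star T}$, put $$X_{\lambda_1,\dots,\lambda_n}(v\otimes f)=\sum_{p=1}^n\ \sum_{\Gamma\in\mathcal L(n,p)}\ \sum_{a,b\in\mathbb Z_{\ge0}^n}\lambda_1^{(a_1)}\cdots\lambda_n^{(a_n)}\,\Big(F^\Gamma_{a+b}*Y^\Gamma_{\Lambda_1,\dots,\Lambda_p}\big(\partial_1^{(b_1)}\cdots\partial_n^{(b_n)}v\big)\Big),$$ where $F^\Gamma_a\in\mathcal O_p^{\star T}(w_1,\dots,w_p)$ are the coefficients of the $\Gamma$-Fourier transform $\mathcal F^\Gamma_{\lambda_1,\dots,\lambda_n}(f;w_1,\dots,w_p)=\sum_{a\in\mathbb Z_{\ge0}^n}F^\Gamma_a\,\lambda_1^{(a_1)}\cdots\lambda_n^{(a_n)}$ (a finite sum), and where, after the convolution products $*$ are computed, one substitutes $\Lambda_\ell=\lambda_{i^\ell_1}+\dots+\lambda_{i^\ell_{k_\ell}}$ for $\ell=1,\dots,p$, the sum of the $\lambda_i$ over the vertices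 $i$ of the $\ell$-th line of $\Gamma$. Then this formula defines an element $X\in\mathrm F^rP^{\mathrm{ch}}(V)(n)$. The resulting linear map $\operatorname{gr}^rP^{\mathrm{cl}}(V)(n)\to\mathrm F^rP^{\mathrm{ch}}(V)(n)$, $Y\mapsto X$, induces a map $\operatorname{gr}^rP^{\mathrm{cl}}(V)(n)\to\operatorname{gr}^rP^{\mathrm{ch}}(V)(n)$ which is the inverse of the canonical map $$\Phi\colon\operatorname{gr}^rP^{\mathrm{ch}}(V)(n)\to\operatorname{gr}^rP^{\mathrm{cl}}(\operatorname{gr}V)(n),\qquad \bar X\mapsto Y,\quad Y^\Gamma_{\lambda_1,\dots,\lambda_n}(\bar v)=\overline{X_{\lambda_1,\dots,\lambda_n}(v\otimes p_\Gamma)} .$$ Consequently, the homomorphism of graded operads $\operatorname{gr}P^{\mathrm{ch}}(V)\to\operatorname{gr}P^{\mathrm{cl}}(\operatorname{gr}V)$ given in each arity $n$ and degree $r$ by $\Phi$ is an isomorphism (i.e. $\Phi$ is bijective in every arity and degree).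
   Context: All vector spaces are over a field $\mathbb F$ of characteristic $0$. Write $z_{ij}=z_i-z_j$, and $\langle\Psi\rangle$ for the image of an endomorphism $\Psi$. Divided powers: $x^{(m)}=x^m/m!$ for $m\ge0$, $x^{(m)}=0$ for $m<0$. On $V^{\otimes n}$, $\partial_i$ denotes $\partial$ acting on the $i$-th factor. Polynomial variables $\lambda_i,\Lambda_\ell$ and functions of the $z_i$ are even. **Function spaces.** $\mathcal O_n=\mathbb F[z_1,\dots,z_n]$; $\mathcal O_n^\star=\mathcal O_n[z_{ij}^{-1}]_{1\le i<j\le n}$; $\mathcal O_n^{\star T}=\mathbb F[z_{ij}^{\pm1}]_{1\le i<j\le n}$ (so $\mathcal O_1^\star=\mathbb F[z_1]$, $\mathcal O_1^{\star T}=\mathbb F$). One writes $\mathcal O_n^\star(z_1,\dots,z_n)$ to specify the variables. Increasing filtration by number of poles: $\mathrm F^r\mathcal O_n^\star=\sum\mathcal O_n[z_{i_1j_1}^{-1},\dots,z_{i_rj_r}^{-1}]$ (sum over choices of $r$ pairs) for $r\ge0$, $\mathrm F^r\mathcal O_n^\star=0$ for $r<0$; $\mathrm F^r\mathcal O_n^{\star T}=\mathrm F^r\mathcal O_n^\star\cap\mathcal O_n^{\star T}$. **Chiral operations.** $P^{\mathrm{ch}}(V)(n)$ is the space of linear maps $X\colon V^{\otimes n}\otimes\mathcal O_n^{\star T}\to V[\lambda_1,\dots,\lambda_n]/\langle\partial+\lambda_1+\dots+\lambda_n\rangle$, $v\otimes f\mapsto X_{\lambda_1,\dots,\lambda_n}(v\otimes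 f)$, such that for all $i,j$: $X_{\lambda_1,\dots,\lambda_n}(v\otimes\partial_{z_i}f)=X_{\lambda_1,\dots,\lambda_n}((\partial_i+\lambda_i)v\otimes f)$ and $X_{\lambda_1,\dots,\lambda_n}(v\otimes z_{ij}f)=(\partial_{\lambda_j}-\partial_{\lambda_i})X_{\lambda_1,\dots,\lambda_n}(v\otimes f)$. If $V$ has an increasing filtration $0=\mathrm F^{-1}V\subset\mathrm F^0V\subset\mathrm F^1V\subset\cdots\subset V$ by $\mathbb F[\partial]$-submodules, put $\mathrm F^s(V^{\otimes n}\otimes\mathcal O_n^{\star T})=\sum_{s_1+\dots+s_n+q\le s}\mathrm F^{s_1}V\otimes\cdots\otimes\mathrm F^{s_n}V\otimes\mathrm F^q\mathcal O_n^{\star T}$ (zero for $s<0$), and $\mathrm F^tV^{\otimes n}=\sum_{t_1+\dots+t_n\le t}\mathrm F^{t_1}V\otimes\cdots\otimes\mathrm F^{t_n}V$. Then $\mathrm F^rP^{\mathrm{ch}}(V)(n)$, $r\in\mathbb Z$, is the set of $X$ with $X(\mathrm F^s(V^{\otimes n}\otimes\mathcal O_n^{\star T}))\subset(\mathrm F^{s-r}V)[\lambda_1,\dots,\lambda_n]/\langle\partial+\lambda_1+\dots+\lambda_n\rangle$ for all $s$; this is a decreasing filtration, and $\operatorname{gr}^rP^{\mathrm{ch}}(V)(n)=\mathrm F^rP^{\mathrm{ch}}(V)(n)/\mathrm F^{r+1}P^{\mathrm{ch}}(V)(n)$. **Graphs.** $\mathcal G(n)$ is the set of graphs with vertices labeled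 $1,\dots,n$ and an arbitrary collection $E(\Gamma)$ of oriented edges, without tadpoles (loops $i\to i$). An oriented cycle $C$ in $\Gamma$ is a collection of edges of $\Gamma$ forming a closed sequence $\{i_1\to i_2,\,i_2\to i_3,\dots,i_s\to i_1\}\subset E(\Gamma)$ (possibly with self-intersections). $\Gamma\backslash e$ is $\Gamma$ with the edge $e$ removed. For $\Gamma\in\mathcal G(n)$, $p_\Gamma=\prod_{(i\to j)\in E(\Gamma)}z_{ij}^{-1}$. $\mathcal L(n)\subset\mathcal G(n)$ is the set of graphs $\Gamma=L_1\sqcup\dots\sqcup L_p$ that are disjoint unions of oriented lines $L_\ell=(i^\ell_1\to i^\ell_2\to\cdots\to i^\ell_{k_\ell})$, $k_\ell\ge1$, $k_1+\dots+k_p=n$, where $\{i^a_b\}$ is a permutation of $\{1,\dots,n\}$ with $i^1_1=1<i^2_1<\cdots<i^p_1$ and $i^\ell_1=\min\{i^\ell_1,\dots,i^\ell_{k_\ell}\}$ for all $\ell$. $\mathcal L(n,p)$ is the subset with exactly $p$ connected components. **Classical operations.** $P^{\mathrm{cl}}(V)(n)$ is the space of maps $Y\colon\mathcal G(n)\times V^{\otimes n}\to V[\lambda_1,\dots,\lambda_n]/\langle\partial+\lambda_1+\dots+\lambda_n\rangle$, $(\Gamma,v)\mapsto Y^\Gamma_{\lambda_1,\dots,\lambda_n}(v)$, linear in $v$, such that: (cycle relations) if $\Gamma$ contains an oriented cycle $C$, then $Y^\Gamma=0$ and $\sum_{e\in C}Y^{\Gamma\backslash e}=0$; (sesquilinearity)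 for every connected component $G$ of $\Gamma$ with vertex set $I$: $(\partial_{\lambda_j}-\partial_{\lambda_i})Y^\Gamma_{\lambda_1,\dots,\lambda_n}(v)=0$ for $i,j\in I$, and $Y^\Gamma_{\lambda_1,\dots,\lambda_n}\big(\sum_{i\in I}(\partial_i+\lambda_i)v\big)=0$. By the first sesquilinearity condition, for $\Gamma\in\mathcal L(n,p)$ one may regard $Y^\Gamma(v)$ as an element $Y^\Gamma_{\Lambda_1,\dots,\Lambda_p}(v)$ of $V[\Lambda_1,\dots,\Lambda_p]/\langle\partial+\Lambda_1+\dots+\Lambda_p\rangle$, with $\Lambda_\ell=\lambda_{i^\ell_1}+\dots+\lambda_{i^\ell_{k_\ell}}$. In the formula of the theorem, $*$ is applied to any representative in $V[\Lambda_1,\dots,\Lambda_p]$; part of the assertion is that the result in $V[\lambda_1,\dots,\lambda_n]/\langle\partial+\lambda_1+\dots+\lambda_n\rangle$ does not depend on the choice. If $V=\bigoplus_{t\in\mathbb Z}\operatorname{gr}^tV$ is graded by $\mathbb F[\partial]$-submodules, with induced grading $\operatorname{gr}^tV^{\otimes n}=\sum_{t_1+\dots+t_n=t}\operatorname{gr}^{t_1}V\otimes\cdots\otimes\operatorname{gr}^{t_n}V$, then $Y\in\operatorname{gr}^rP^{\mathrm{cl}}(V)(n)$ iff $Y^\Gamma_{\lambda_1,\dots,\lambda_n}(\operatorname{gr}^tV^{\otimes n})\subset(\operatorname{gr}^{s+t-r}V)[\lambda_1,\dots,\lambda_n]/\langle\partial+\lambda_1+\dots+\lambda_n\rangle$ for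 all $t$ and all $\Gamma\in\mathcal G(n)$ with $s$ edges. (For $V=\bigoplus_{s\ge0}V_s$, take $\operatorname{gr}^tV=V_t$ for $t\ge0$ and $0$ for $t<0$.) **The canonical map $\Phi$.** For $X\in\mathrm F^rP^{\mathrm{ch}}(V)(n)$, $\Gamma\in\mathcal G(n)$ with $s$ edges and $v\in\mathrm F^tV^{\otimes n}$, let $\bar v=v+\mathrm F^{t-1}V^{\otimes n}\in\operatorname{gr}^tV^{\otimes n}$; then $Y^\Gamma_{\lambda_1,\dots,\lambda_n}(\bar v)$ is the class of $X_{\lambda_1,\dots,\lambda_n}(v\otimes p_\Gamma)\in(\mathrm F^{s+t-r}V)[\lambda_1,\dots,\lambda_n]/\langle\partial+\sum_i\lambda_i\rangle$ modulo $(\mathrm F^{s+t-r-1}V)[\lambda_1,\dots,\lambda_n]/\langle\partial+\sum_i\lambda_i\rangle$. It is known from earlier work (Bakalov–De Sole–Heluani–Kac) that $P^{\mathrm{ch}}(V)$ is a filtered operad, $P^{\mathrm{cl}}(\operatorname{gr}V)$ is a graded operad, and that $\bar X\mapsto Y$ is a well-defined injective homomorphism of graded operads. **$\Gamma$-residues.** For $i\ne j$ and $f\in\mathcal O_n^\star$ write $f=z_{ij}^{-\ell-1}g$, $\ell\in\mathbb Z$, with $g$ having neither zero nor pole at $z_i=z_j$. Then $\operatorname{Res}_{z_j}dz_i\,f=\frac1{\ell!}\frac{\partial^\ell g}{\partial z_i^\ell}\big|_{z_i=z_j}$ if $\ell\ge0$, and $0$ if $\ell<0$. For a line $L=i_1\to\cdots\to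 i_k$, $\operatorname{Res}_wdL\,f=\big(\operatorname{Res}_{z_{i_k}}dz_{i_{k-1}}\cdots\operatorname{Res}_{z_{i_2}}dz_{i_1}f\big)\big|_{z_{i_k}=w}$ (the rightmost residue is applied first; for $k=1$ this is just the substitution $z_{i_1}=w$). For $\Gamma=L_1\sqcup\dots\sqcup L_p\in\mathcal L(n,p)$, $\operatorname{Res}_{w_1,\dots,w_p}d\Gamma=\operatorname{Res}_{w_1}dL_1\circ\cdots\circ\operatorname{Res}_{w_p}dL_p\colon\mathcal O_n^\star(z_1,\dots,z_n)\to\mathcal O_p^\star(w_1,\dots,w_p)$. **$\Gamma$-Fourier transform.** For $\Gamma\in\mathcal L(n,p)$, $E^\Gamma_{\lambda_1,\dots,\lambda_n}(z_1,\dots,z_n)=\prod_{\ell=1}^p\exp\big(-\sum_{a=1}^{k_\ell-1}(z_{i^\ell_a}-z_{i^\ell_{k_\ell}})\lambda_{i^\ell_a}\big)$, and $\mathcal F^\Gamma_{\lambda_1,\dots,\lambda_n}(f;w_1,\dots,w_p)=\operatorname{Res}_{w_1,\dots,w_p}d\Gamma\,\big(f\,E^\Gamma_{\lambda_1,\dots,\lambda_n}\big)$, the residue being taken coefficientwise in the $\lambda_i$. For $f\in\mathcal O_n^{\star T}$ this lies in $\mathcal O_p^{\star T}[\lambda_1,\dots,\lambda_n]$. **Convolution product.** Let $\iota_{w_1,\dots,w_p}\colon\mathcal O_p^\star(w_1,\dots,w_p)\to\mathbb F((w_1))\cdots((w_{p-1}))[[w_p]]$ be the geometric series expansion in the domain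 $|w_1|>\dots>|w_p|$. For $F\in\mathcal O_p^\star$ with $\iota_{w_1,\dots,w_p}F=\sum_{a\in\mathbb Z^p}c_a\,w_1^{a_1}\cdots w_p^{a_p}$ and a polynomial $Q=\sum_{b\in\mathbb Z_{\ge0}^p}d_b\,\Lambda_1^{(b_1)}\cdots\Lambda_p^{(b_p)}$ (coefficients $d_b$ in $\mathbb F$, or in $V$), set $F*Q=\sum_{a,b}c_ad_b(-1)^{a_1+\dots+a_p}\Lambda_1^{(b_1-a_1)}\cdots\Lambda_p^{(b_p-a_p)}$, which is a finite sum. *)

(* Defs.v *)
From HB Require Import structures.
From mathcomp Require Import all_boot all_order all_algebra.
From mathcomp Require Import boolp classical_sets functions cardinality fsbigop.
From mathcomp Require Import finmap mpoly ring.

Set Implicit Arguments.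
Unset Strict Implicit.
Unset Printing Implicit Defensive.

Import Order.TTheory GRing.Theory Num.Theory.
Local Open Scope ring_scope.
Local Open Scope classical_set_scope.
Local Open Scope quotient_scope.

Section Submodules.
Variables (R : fieldType) (V : lmodType R).

Record submod := Submod {
  submod_set :> V -> Prop;
  submodP : submod_set 0 /\
    forall c x y, submod_set x -> submod_set y -> submod_set (c *: x + y) }.

Implicit Types (U W : submod) (S : set V).

Lemma submod0 U : U 0. Proof. by have [] := submodP U. Qed.
Lemma submodL U c x y : U x -> U y -> U (c *: x + y).
Proof. by have [_ h] := submodP U; exact: h. Qed.
Lemma submodD U x y : U x -> U y -> U (x + y).
Proof. by move=> Ux Uy; rewrite -[x]scale1r; exact: submodL. Qed.
Lemma submodZ U c x : U x -> U (c *: x).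
Proof. by move=> Ux; rewrite -[_ *: _]addr0; apply: submodL => //; exact: submod0. Qed.
Lemma submodN U x : U x -> U (- x).
Proof. by move=> Ux; rewrite -scaleN1r; exact: submodZ. Qed.
Lemma submodB U x y : U x -> U y -> U (x - y).
Proof. by move=> Ux /submodN; exact: submodD. Qed.
Lemma submod_sum U (I : Type) (r : seq I) (P : pred I) (F : I -> V) :
  (forall i, P i -> U (F i)) -> U (\sum_(i <- r | P i) F i).
Proof. by move=> h; apply: big_ind => //; [exact: submod0|exact: submodD]. Qed.

Lemma span_subproof S :
  (\bigcap_(U in [set U : submod | S `<=` U]) (U : set V)) 0 /\
  forall c x y, (\bigcap_(U in [set U : submod | S `<=` U]) (U : set V)) x ->
    (\bigcap_(U in [set U : submod | S `<=` U]) (U : set V)) y ->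
    (\bigcap_(U in [set U : submod | S `<=` U]) (U : set V)) (c *: x + y).
Proof.
split=> [U _|c x y hx hy U SU]; first exact: submod0.
by apply: submodL; [exact: hx|exact: hy].
Qed.
Definition span S : submod := Submod (span_subproof S).

Lemma sub_span S : S `<=` span S.
Proof. by move=> x Sx U; apply. Qed.
Lemma span_min S U : S `<=` U -> span S `<=` U.
Proof. by move=> SU x; apply. Qed.

Definition submod_pred U : {pred V} := fun x => `[< U x >].
Record submod_type U := SubmodType
  { submod_val : V; submod_valP : submod_val \in submod_pred U }.
HB.instance Definition _ U := [isSub of submod_type U for @submod_val U].
HB.instance Definition _ U := [Choice of submod_type U by <:].

Lemma submod_predP U : submod_closed (submod_pred U).
Proof.
split=> [|c x y /asboolP Ux /asboolP Uy]; apply/asboolP; first exact: submod0.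
exact: submodL.
Qed.
HB.instance Definition _ U :=
  GRing.isSubmodClosed.Build R V (submod_pred U) (submod_predP U).
HB.instance Definition _ U := [SubChoice_isSubLmodule of submod_type U by <:].

Definition in_submod U x (Ux : U x) : submod_type U := SubmodType (asboolT Ux).
Lemma submod_mem U (x : submod_type U) : U (submod_val x).
Proof. exact/asboolP/submod_valP. Qed.

Definition quot_rel U x y := `[< U (x - y) >].
Lemma quot_rel_refl U : reflexive (quot_rel U).
Proof. by move=> x; apply/asboolP; rewrite subrr; exact: submod0. Qed.
Lemma quot_rel_sym U : ssrbool.symmetric (quot_rel U).
Proof. by move=> x y; apply/asboolP/asboolP => /submodN; rewrite opprB. Qed.
Lemma quot_rel_trans U : transitive (quot_rel U).
Proof.
move=> y x z /asboolP xy /asboolP yz; apply/asboolP.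
by rewrite -(subrKA y); exact: submodD.
Qed.
Canonical quot_equiv U :=
  EquivRel (quot_rel U) (quot_rel_refl U) (@quot_rel_sym U) (@quot_rel_trans U).
Definition quot U := {eq_quot (quot_rel U)}.
HB.instance Definition _ U : EqQuotient _ (quot_rel U) (quot U) :=
  EqQuotient.on (quot U).
HB.instance Definition _ U := Choice.on (quot U).

Definition qclass U (x : V) : quot U := \pi_(quot U) x.
Definition qrep U (x : quot U) : V := repr x.

Lemma qrepK U (x : quot U) : qclass U (qrep x) = x.
Proof. exact: reprK. Qed.
Lemma eq_qclass U x y : qclass U x = qclass U y <-> U (x - y).
Proof.
by split=> [/eqmodP/asboolP//|h]; apply/eqmodP/asboolP.
Qed.
Lemma qclassP U x : exists2 y, U y & qrep (qclass U x) = x + y.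
Proof.
exists (qrep (qclass U x) - x); last by rewrite addrC subrK.
by apply/eq_qclass; rewrite qrepK.
Qed.

Definition quot_add U (x y : quot U) := qclass U (qrep x + qrep y).
Definition quot_opp U (x : quot U) := qclass U (- qrep x).
Definition quot_scale U c (x : quot U) := qclass U (c *: qrep x).

Lemma quot_addE U x y : quot_add (qclass U x) (qclass U y) = qclass U (x + y).
Proof.
have [u Uu hu] := qclassP U x; have [w Uw hw] := qclassP U y.
by apply/eq_qclass; rewrite hu hw [x + u + _]addrACA [_ - _]addrC addKr; exact: submodD.
Qed.
Lemma quot_scaleE U c x : quot_scale c (qclass U x) = qclass U (c *: x).
Proof.
have [u Uu hu] := qclassP U x.
by apply/eq_qclass; rewrite hu -scalerBr [_ - x]addrC addKr; exact: submodZ.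
Qed.
Lemma quot_oppE U x : quot_opp (qclass U x) = qclass U (- x).
Proof. by rewrite -scaleN1r -quot_scaleE /quot_scale scaleN1r. Qed.

Lemma quot_addA U : associative (@quot_add U).
Proof.
by move=> x y z; rewrite -(qrepK x) -(qrepK y) -(qrepK z) !quot_addE addrA.
Qed.
Lemma quot_addC U : commutative (@quot_add U).
Proof. by move=> x y; rewrite /quot_add addrC. Qed.
Lemma quot_add0 U : left_id (qclass U 0) (@quot_add U).
Proof. by move=> x; rewrite -(qrepK x) quot_addE add0r. Qed.
Lemma quot_addN U : left_inverse (qclass U 0) (@quot_opp U) (@quot_add U).
Proof. by move=> x; rewrite -(qrepK x) quot_oppE quot_addE addNr. Qed.
HB.instance Definition _ U := GRing.isZmodule.Build (quot U)
  (@quot_addA U) (@quot_addC U) (@quot_add0 U) (@quot_addN U).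

Lemma quot_scaleA U a b (x : quot U) :
  quot_scale a (quot_scale b x) = quot_scale (a * b) x.
Proof. by rewrite -(qrepK x) !quot_scaleE scalerA. Qed.
Lemma quot_scale1 U : left_id 1 (@quot_scale U).
Proof. by move=> x; rewrite -(qrepK x) quot_scaleE scale1r. Qed.
Lemma quot_scaleDr U : right_distributive (@quot_scale U) +%R.
Proof.
move=> a x y; rewrite -(qrepK x) -(qrepK y) -[_ + _]/(quot_add _ _) quot_addE.
by rewrite !quot_scaleE scalerDr -quot_addE.
Qed.
Lemma quot_scaleDl U (x : quot U) : {morph (@quot_scale U)^~ x : a b / a + b}.
Proof.
move=> a b; rewrite -(qrepK x) !quot_scaleE.
by rewrite scalerDl -quot_addE.
Qed.
HB.instance Definition _ U := GRing.Zmodule_isLmodule.Build R (quot U)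
  (@quot_scaleA U) (@quot_scale1 U) (@quot_scaleDr U) (@quot_scaleDl U).

Lemma qclass_linear U : linear (qclass U).
Proof.
by move=> c x y; rewrite -quot_addE -quot_scaleE.
Qed.
HB.instance Definition _ U :=
  GRing.isLinear.Build R V (quot U) _ (qclass U) (qclass_linear U).

Definition decomposes (I : choiceType) (U : I -> submod) (x : V) (c : I -> V) :=
  [/\ forall i, U i (c i), finite_set [set i | c i != 0]
    & x = \sum_(i \in [set: I]) c i].
Definition direct_sum (I : choiceType) (U : I -> submod) :=
  forall x, exists! c, decomposes U x c.

Lemma sub_submod_subproof U W :
  [set x : submod_type U | W (submod_val x)] 0 /\
  forall c x y, [set x : submod_type U | W (submod_val x)] x ->
    [set x : submod_type U | W (submod_val x)] y ->
    [set x : submod_type U | W (submod_val x)] (c *: x + y).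
Proof. split=> [|c x y]; [exact: submod0|exact: submodL]. Qed.

End Submodules.

(* the intersection of U and W, as a submodule of U *)
Definition sub_submod (R : fieldType) (V : lmodType R) (U W : submod V) :
  submod (submod_type U) := Submod (sub_submod_subproof U W).

Definition image_submod_set (R : fieldType) (V V' : lmodType R) (f : V -> V')
  (U : submod V) : set V' := [set f x | x in U].
Lemma image_submod_subproof (R : fieldType) (V V' : lmodType R)
    (f : {linear V -> V'}) (U : submod V) :
  image_submod_set f U 0 /\ forall c x y, image_submod_set f U x ->
    image_submod_set f U y -> image_submod_set f U (c *: x + y).
Proof.
split=> [|c _ _ [x Ux <-] [y Uy <-]].
  by exists 0; [exact: submod0|rewrite raddf0].
by exists (c *: x + y); [exact: submodL|rewrite linearP].
Qed.
Definition image_submod (R : fieldType) (V V' : lmodType R)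
  (f : {linear V -> V'}) (U : submod V) : submod V' :=
  Submod (image_submod_subproof f U).

Lemma full_submod_subproof (R : fieldType) (V : lmodType R) :
  [set: V] 0 /\ forall (c : R) x y, [set: V] x -> [set: V] y -> [set: V] (c *: x + y).
Proof. by []. Qed.
Definition full_submod (R : fieldType) (V : lmodType R) : submod V :=
  Submod (@full_submod_subproof R V).

Section QuotientRule.
Variables (K : fieldType) (p q r s p' q' r' s' : K).
Hypotheses (q0 : q != 0) (s0 : s != 0).
Lemma quotient_ruleM :
  ((p' * r + p * r') * (q * s) - p * r * (q' * s + q * s')) / (q * s) ^+ 2 =
  (p' * q - p * q') / q ^+ 2 * (r / s) + p / q * ((r' * s - r * s') / s ^+ 2).
Proof. by field; rewrite q0 s0. Qed.
Lemma quotient_ruleD :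
  ((p' * s + p * s' + (r' * q + r * q')) * (q * s)
    - (p * s + r * q) * (q' * s + q * s')) / (q * s) ^+ 2 =
  (p' * q - p * q') / q ^+ 2 + (r' * s - r * s') / s ^+ 2.
Proof. by field; rewrite q0 s0. Qed.
End QuotientRule.

(* Rational functions in z_0, ..., z_(n-1). *)
Definition ratfun (F : fieldType) (n : nat) := {fraction {mpoly F[n]}}.

Section RationalFunctions.
Variables (F : fieldType) (n : nat).
Local Notation K := (ratfun F n).
HB.instance Definition _ := GRing.Field.on K.

Definition of_poly (P : {mpoly F[n]}) : K := FracField.tofrac P.

Lemma of_polyD : {morph of_poly : x y / x + y}. Proof. exact: rmorphD. Qed.
Lemma of_polyB : {morph of_poly : x y / x - y}. Proof. exact: rmorphB. Qed.
Lemma of_polyM : {morph of_poly : x y / x * y}. Proof. exact: rmorphM. Qed.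
Lemma of_poly1 : of_poly 1 = 1. Proof. exact: rmorph1. Qed.
Lemma of_poly_eq0 P : (of_poly P == 0) = (P == 0).
Proof. exact: tofrac_eq0. Qed.
Lemma of_poly_inj : injective of_poly.
Proof. by move=> P Q /eqP; rewrite tofrac_eq => /eqP. Qed.

Definition ratfun_scale (c : F) (f : K) : K := of_poly c%:MP * f.
Lemma ratfun_scaleA a b f :
  ratfun_scale a (ratfun_scale b f) = ratfun_scale (a * b) f.
Proof. by rewrite /ratfun_scale mpolyCM of_polyM mulrA. Qed.
Lemma ratfun_scale1 : left_id 1 ratfun_scale.
Proof. by move=> f; rewrite /ratfun_scale mpolyC1 of_poly1 mul1r. Qed.
Lemma ratfun_scaleDr : right_distributive ratfun_scale +%R.
Proof. by move=> a f g; exact: mulrDr. Qed.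
Lemma ratfun_scaleDl f : {morph ratfun_scale^~ f : a b / a + b}.
Proof. by move=> a b; rewrite /ratfun_scale mpolyCD of_polyD mulrDl. Qed.
HB.instance Definition _ := GRing.Zmodule_isLmodule.Build F K
  ratfun_scaleA ratfun_scale1 ratfun_scaleDr ratfun_scaleDl.

Lemma ratfun_scaleE (c : F) (f : K) : c *: f = of_poly c%:MP * f.
Proof. by []. Qed.

Definition zvar (i : 'I_n) : K := of_poly 'X_i.
Definition zdiff (i j : 'I_n) : K := zvar i - zvar j.

Definition dz (i : 'I_n) (f : K) : K :=
  let P := (frac (repr f)).1 in let Q := (frac (repr f)).2 in
  of_poly (P^`M(i) * Q - P * Q^`M(i)) / of_poly Q ^+ 2.

Lemma ratfunP (f : K) : exists2 PQ : {mpoly F[n]} * {mpoly F[n]},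
  PQ.2 != 0 & f = of_poly PQ.1 / of_poly PQ.2 /\ PQ = frac (repr f).
Proof.
exists (frac (repr f)); first exact: denom_ratioP.
split=> //; apply: (@mulIf _ (of_poly (frac (repr f)).2)).
  by rewrite of_poly_eq0 denom_ratioP.
rewrite divfK ?of_poly_eq0 ?denom_ratioP //.
rewrite -[f in LHS]reprK /of_poly; unlock FracField.tofrac.
rewrite -[LHS]FracField.pi_mul; apply/eqmodP => /=.
by rewrite FracField.equivfE /FracField.mulf !numden_Ratio
  ?mulf_neq0 ?denom_ratioP ?oner_eq0 // ?mulr1 ?reprK 1?mulrC.
Qed.

Lemma dz_div i P Q : Q != 0 -> dz i (of_poly P / of_poly Q) =
  of_poly (P^`M(i) * Q - P * Q^`M(i)) / of_poly Q ^+ 2.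
Proof.
move=> Q0; have [[P' Q'] /= Q'0 [e eR]] := ratfunP (of_poly P / of_poly Q).
rewrite /dz -eR /=.
have nz R : R != 0 -> of_poly R ^+ 2 != 0.
  by move=> R0; rewrite expf_neq0 // of_poly_eq0.
apply/eqP. rewrite eqr_div ?nz // ?expr2 -!of_polyM; apply/eqP; congr of_poly.
have {}e : P * Q' = P' * Q.
  apply: of_poly_inj; rewrite !of_polyM; apply/eqP.
  by rewrite -eqr_div ?of_poly_eq0 //; apply/eqP.
have e' := congr1 (mderiv i) e; rewrite !mderivM in e'.
have -> : (P'^`M(i) * Q' - P' * Q'^`M(i)) * (Q * Q) =
  (P^`M(i) * Q - P * Q^`M(i)) * (Q' * Q')
  + Q' * Q * ((P'^`M(i) * Q + P' * Q^`M(i)) - (P^`M(i) * Q' + P * Q'^`M(i)))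
  + (P * Q' - P' * Q) * (Q'^`M(i) * Q + Q^`M(i) * Q') by ring.
by rewrite e e' !subrr mulr0 mul0r !addr0.
Qed.

Lemma mderiv1 i : (1 : {mpoly F[n]})^`M(i) = 0.
Proof. by rewrite -mpolyC1 mderivC. Qed.
Lemma of_poly0 : of_poly 0 = 0. Proof. exact: rmorph0. Qed.

Lemma dz_poly i P : dz i (of_poly P) = of_poly P^`M(i).
Proof.
have -> : of_poly P = of_poly P / of_poly 1 by rewrite of_poly1 divr1.
by rewrite dz_div ?oner_eq0 // of_poly1 expr1n divr1 mulr1 mderiv1 mulr0 subr0.
Qed.

Lemma dzM i f g : dz i (f * g) = dz i f * g + f * dz i g.
Proof.
have [[P Q] /= Q0 [-> _]] := ratfunP f; have [[R S] /= S0 [-> _]] := ratfunP g.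
rewrite mulf_div -!of_polyM !dz_div ?mulf_neq0 // !mderivM.
rewrite !(of_polyB, of_polyM, of_polyD).
by apply: quotient_ruleM; rewrite of_poly_eq0.
Qed.

Lemma dzD i f g : dz i (f + g) = dz i f + dz i g.
Proof.
have [[P Q] /= Q0 [-> _]] := ratfunP f; have [[R S] /= S0 [-> _]] := ratfunP g.
rewrite addf_div ?of_poly_eq0 // -!(of_polyM, of_polyD) !dz_div ?mulf_neq0 //.
rewrite !mderivD !mderivM !(of_polyB, of_polyM, of_polyD).
by apply: quotient_ruleD; rewrite of_poly_eq0.
Qed.

Lemma dz_linear i : linear (dz i).
Proof.
move=> c f g; rewrite dzD !ratfun_scaleE dzM dz_poly mderivC.
by rewrite of_poly0 mul0r add0r.
Qed.
HB.instance Definition _ i :=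
  GRing.isLinear.Build F K K _ (dz i) (dz_linear i).

Lemma dzV i f : dz i f^-1 = - dz i f / f ^+ 2.
Proof.
have [->|f0] := eqVneq f 0; first by rewrite invr0 raddf0 oppr0 mul0r.
have := dzM i f f^-1; rewrite divff // -of_poly1 dz_poly mderiv1.
rewrite of_poly0 => /eqP; rewrite eq_sym addrC addr_eq0 => /eqP e.
by apply: (mulfI f0); rewrite e expr2 invfM mulrCA mulVKf // mulNr.
Qed.

Definition subalgebra (A : set K) :=
  [/\ A 1, forall (c : F) f g, A f -> A g -> A (c *: f + g)
    & forall f g, A f -> A g -> A (f * g)].

Lemma adjoin_subproof (S : set K) :
  smallest subalgebra S 0 /\
  forall (c : F) f g, smallest subalgebra S f -> smallest subalgebra S g ->
    smallest subalgebra S (c *: f + g).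
Proof.
split=> [A [[A1 AL AM] _]|c f g hf hg A hA].
  by rewrite -(subrr 1) -scaleN1r addrC; apply: AL.
by case: (hA) => -[A1 AL AM] _; apply: AL; [exact: hf|exact: hg].
Qed.
(* the F-subalgebra generated by S *)
Definition adjoin (S : set K) : submod K := Submod (adjoin_subproof S).

Lemma adjoin_gen (S : set K) f : S f -> adjoin S f.
Proof. by move=> Sf A [_]; apply. Qed.
Lemma adjoin1 (S : set K) : adjoin S 1.
Proof. by move=> A [[]]. Qed.
Lemma adjoinM (S : set K) f g : adjoin S f -> adjoin S g -> adjoin S (f * g).
Proof.
by move=> hf hg A hA; case: (hA) => -[_ _ AM] _; apply: AM; [exact: hf|exact: hg].
Qed.
Lemma adjoin_ind (S : set K) (A : set K) :
  subalgebra A -> S `<=` A -> adjoin S `<=` A.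
Proof. by move=> hA SA f; apply. Qed.

(* O_n^{star T} = F[z_ij, z_ij^-1] *)
Definition OT_gen : set K :=
  [set f | exists i j : 'I_n, (i < j)%N /\ (f = zdiff i j \/ f = (zdiff i j)^-1)].
Definition OT_set : submod K := adjoin OT_gen.

Lemma OT_zdiff i j : OT_set (zdiff i j).
Proof.
have [ij|ji|/val_inj->] := ltngtP i j; last by rewrite /zdiff subrr; exact: submod0.
  by apply: adjoin_gen; exists i, j; split; [|left].
rewrite /zdiff -opprB; apply: submodN; apply: adjoin_gen.
by exists j, i; split; [|left].
Qed.
Lemma OT_zdiffV i j : OT_set (zdiff i j)^-1.
Proof.
have [ij|ji|/val_inj->] := ltngtP i j.
- by apply: adjoin_gen; exists i, j; split; [|right].
- rewrite /zdiff -opprB invrN; apply: submodN; apply: adjoin_gen.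
  by exists j, i; split; [|right].
- by rewrite /zdiff subrr invr0; exact: submod0.
Qed.
Lemma dz_zdiff k i j : exists c : F, dz k (zdiff i j) = c *: (1 : K).
Proof.
exists ((i == k)%:R - (j == k)%:R).
rewrite /zdiff /zvar raddfB /= !dz_poly !mderivX !mnmE.
have E (a b : 'I_n) : of_poly ((a == b)%:R *: 'X_[U_(a) - U_(b)]) = ((a == b)%:R : F) *: (1 : K).
  rewrite ratfun_scaleE mulr1; congr of_poly.
  case: eqVneq => [->|_]; last by rewrite mulr0n scale0r mpolyC0.
  rewrite mulr1n scale1r mpolyC1 -mpolyX0; congr 'X_[_].
  by apply/mnmP => l; rewrite !mnmE subnn.
by rewrite !E scalerBl.
Qed.
Lemma OT_dz k f : OT_set f -> OT_set (dz k f).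
Proof.
move=> hf; suff [] : (OT_set f /\ OT_set (dz k f)) by [].
apply: (@adjoin_ind OT_gen [set f | OT_set f /\ OT_set (dz k f)]) hf; first split.
- split; first exact: adjoin1.
  by rewrite -of_poly1 dz_poly mderiv1 of_poly0; exact: submod0.
- move=> c g h [hg hg'] [hh hh']; split; first exact: submodL.
  by rewrite linearP; exact: submodL.
- move=> g h [hg hg'] [hh hh']; split; first exact: adjoinM.
  by rewrite dzM; apply: submodD; exact: adjoinM.
- have hc (c : F) : OT_set (c *: (1 : K)) by apply: submodZ; exact: adjoin1.
  move=> g [i [j [_ hg]]]; have [c e] := dz_zdiff k i j.
  case: hg => ->; split; [exact: OT_zdiff|by rewrite e|exact: OT_zdiffV|].
  rewrite dzV e expr2 invfM; apply: adjoinM; first by apply: submodN; exact: hc.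
  by apply: adjoinM; exact: OT_zdiffV.
Qed.
Lemma OT_prodV (E : {set 'I_n * 'I_n}) :
  OT_set (\prod_(e in E) (zdiff e.1 e.2)^-1).
Proof.
apply: big_ind => [|f g|e _]; [exact: adjoin1|exact: adjoinM|exact: OT_zdiffV].
Qed.

Definition OT := submod_type OT_set.
Definition ot_dz (k : 'I_n) (f : OT) : OT :=
  in_submod (OT_dz k (submod_mem f)).
Definition ot_mulz (i j : 'I_n) (f : OT) : OT :=
  in_submod (adjoinM (OT_zdiff i j) (submod_mem f)).

(* F^r O_n^star: at most r of the z_ij, i < j, are inverted. *)
Definition pole_filtration (r : int) : submod K :=
  span (\bigcup_(A in [set A : {set 'I_n * 'I_n} |
            (#|A|%:Z <= r) /\ forall e, e \in A -> (e.1 < e.2)%N])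
          adjoin [set f | (exists i, f = zvar i) \/
                          (exists2 e, e \in A & f = (zdiff e.1 e.2)^-1)]).
End RationalFunctions.

Section Substitution.
Variables (F : fieldType) (n m : nat) (s : 'I_n -> {mpoly F[m]}).

Definition poly_subst (P : {mpoly F[n]}) : {mpoly F[m]} :=
  P \mPo [tuple s i | i < n].

(* f(s_0, ..., s_(n-1)), for f with no pole there; 0 otherwise *)
Definition ratfun_subst (f : ratfun F n) : ratfun F m :=
  xget 0 [set h | exists P Q, [/\ poly_subst Q != 0, f = of_poly P / of_poly Q
    & h = of_poly (poly_subst P) / of_poly (poly_subst Q)]].

(* f has neither zero nor pole along z = s *)
Definition ratfun_unit_at (f : ratfun F n) : Prop :=
  exists P Q, [/\ poly_subst P != 0, poly_subst Q != 0
                & f = of_poly P / of_poly Q].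
End Substitution.

Section Residues.
Variables (F : fieldType) (n : nat).

Definition merge_var (i j k : 'I_n) : {mpoly F[n]} := 'X_(if k == i then j else k).

(* Res_{z_j} dz_i; the pair (l, g) below is unique unless f = 0, whose residue
   is the default value 0. *)
Definition residue (i j : 'I_n) (f : ratfun F n) : ratfun F n :=
  xget 0 [set h | exists (l : int) g,
    [/\ ratfun_unit_at (merge_var i j) g, f = zdiff F i j ^ (- l - 1) * g
      & h = match l with
            | Posz k => k`!%:R^-1 *: ratfun_subst (merge_var i j) (iter k (dz i) g)
            | Negz _ => 0
            end]].

Definition line_edges (l : seq 'I_n) := zip l (behead l).

Definition line_residue (l : seq 'I_n) (f : ratfun F n) : ratfun F n :=
  foldl (fun g e => residue e.1 e.2 g) f (line_edges l).
End Residues.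

Section Graphs.
Variable n : nat.

Record digraph := Digraph {
  edges : {set 'I_n * 'I_n};
  loopless : [forall e in edges, e.1 != e.2] }.
HB.instance Definition _ := [isSub of digraph for edges].
HB.instance Definition _ := [Finite of digraph by <:].

Lemma simplify_subproof (E : {set 'I_n * 'I_n}) :
  [forall e in [set e in E | e.1 != e.2], e.1 != e.2].
Proof. by apply/forall_inP => e; rewrite inE => /andP[]. Qed.
Definition simplify E := Digraph (simplify_subproof E).

Definition remove_edge (G : digraph) e := simplify (edges G :\ e).

Definition cycle_edges (c : seq 'I_n) : {set 'I_n * 'I_n} :=
  [set e in zip c (rot 1 c)].
Definition oriented_cycle (G : digraph) (C : {set 'I_n * 'I_n}) :=
  exists c, [/\ c != [::], C = cycle_edges c & C \subset edges G].

Definition same_component (G : digraph) : rel 'I_n :=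
  connect (fun i j => ((i, j) \in edges G) || ((j, i) \in edges G)).

(* p lines, each given by the sequence of its vertices *)
Definition lines (p : nat) := p.-tuple (n.-bseq 'I_n).

Definition first_vertex (l : seq 'I_n) : nat := head 0%N (map val l).

(* The first line then automatically starts at the smallest vertex. *)
Definition is_lines p (L : lines p) :=
  [&& all (fun l : n.-bseq 'I_n => (0 < size l)%N) L,
      perm_eq (flatten [seq val l | l <- L]) (enum 'I_n),
      all (fun l : n.-bseq 'I_n => all (fun i : 'I_n => first_vertex l <= i)%N l) L
    & sorted ltn [seq first_vertex l | l : n.-bseq 'I_n <- L]].

Definition lines_graph p (L : lines p) : digraph :=
  simplify [set e : 'I_n * 'I_n | has (fun l : n.-bseq 'I_n => e \in line_edges l) L].

End Graphs.

Definition pGamma F n (G : digraph n) : OT F n := in_submod (@OT_prodV F n (edges G)).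

Section Fourier.
Variables (F : fieldType) (n p : nat) (L : lines n p).

(* Coefficient of \prod_i lambda_i ^ a_i / a_i! in E^Gamma, that is,
   \prod_i (z_last - z_i) ^ a_i; when i is the last vertex of its line, the
   factor 0 ^ a_i is 0 unless a_i = 0, as lambda_i does not occur in E^Gamma. *)
Definition fourier_kernel (a : 'X_{1..n}) : ratfun F n :=
  \prod_(l < p) \prod_(i <- tnth L l) zdiff F (last i (tnth L l)) i ^+ a i.

(* w_l, for i in the l-th line *)
Definition line_var (i : 'I_n) : {mpoly F[p]} :=
  \sum_(l < p | i \in tnth L l) 'X_l.

(* The substitutions of w_l for the last variable of the l-th line are made
   together, after all residues: they do not interact with the other lines. *)
Definition lines_residue (f : ratfun F n) : ratfun F p :=
  ratfun_subst line_var
    (foldr (fun (l : n.-bseq 'I_n) g => line_residue l g) f L).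

Definition fourier_coef (f : ratfun F n) (a : 'X_{1..n}) : ratfun F p :=
  lines_residue (f * fourier_kernel a).

Definition line_sum (l : 'I_p) : {mpoly F[n]} := \sum_(i <- tnth L l) 'X_i.

End Fourier.

Section Convolution.
Variables (F : fieldType) (p : nat).

(* Coefficient of \prod_l w_l ^ a_l in the expansion of
   P / \prod_(i < j) (w_i - w_j) ^ N_ij obtained from
   (w_i - w_j) ^ (- N) = \sum_k 'C(N + k - 1, k) w_j ^ k w_i ^ (- N - k). *)
Definition geom_coef (P : {mpoly F[p]}) (N : 'I_p * 'I_p -> nat)
    (a : {ffun 'I_p -> int}) : F :=
  \sum_(mk \in [set mk : 'X_{1..p} * {ffun 'I_p * 'I_p -> nat} |
      (forall e : 'I_p * 'I_p, (e.2 <= e.1)%N -> mk.2 e = 0%N) /\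
      forall l, a l = (mk.1 l)%:Z + \sum_(i < p | (i < l)%N) (mk.2 (i, l))%:Z
              - \sum_(j < p | (l < j)%N) (N (l, j) + mk.2 (l, j))%:Z])
    P@_mk.1 *
    (\prod_(e : 'I_p * 'I_p | (e.1 < e.2)%N) 'C((N e + mk.2 e).-1, mk.2 e))%N%:R.

(* Coefficients of the expansion in the domain |w_0| > ... > |w_(p-1)|; they do
   not depend on P and N. *)
Definition iota_coef (f : ratfun F p) (a : {ffun 'I_p -> int}) : F :=
  xget 0 [set c | exists P N,
    f = of_poly P /
        \prod_(e : 'I_p * 'I_p | (e.1 < e.2)%N) zdiff F e.1 e.2 ^+ N e /\
    c = geom_coef P N a].

(* the divided power x^(k) *)
Definition dpow (R : lalgType F) (x : R) (k : int) : R :=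
  if k is Posz j then j`!%:R^-1 *: x ^+ j else 0.

Definition convolution (f : ratfun F p) (Q : {mpoly F[p]}) : {mpoly F[p]} :=
  \sum_(ab \in [set: {ffun 'I_p -> int} * 'X_{1..p}])
    (iota_coef f ab.1 * (Q@_ab.2 * (\prod_(l < p) (ab.2 l)`!)%N%:R)
      * (-1) ^ (\sum_(l < p) ab.1 l)) *:
    \prod_(l < p) dpow 'X_l ((ab.2 l)%:Z - ab.1 l).
End Convolution.

Section VPolynomials.
Variables (F : fieldType) (V : lmodType F).

Section Vpoly.
Variable n : nat.

Definition finsupp_set : set ('X_{1..n} -> V) :=
  [set q | finite_set [set m | q m != 0]].
Lemma finsupp_subproof : finsupp_set 0 /\ forall c x y,
  finsupp_set x -> finsupp_set y -> finsupp_set (c *: x + y).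
Proof.
split=> [|c x y hx hy].
  by apply: (@sub_finite_set _ _ set0) => // m /=; rewrite eqxx.
apply: (@sub_finite_set _ _ ([set m | x m != 0] `|` [set m | y m != 0]));
  last by rewrite finite_setU.
move=> m /= h; apply/orP; apply: contraNT h; rewrite negb_or !negbK.
by move=> /andP[/eqP hxm /eqP hym]; rewrite /GRing.add /GRing.scale /= hxm hym scaler0 addr0.
Qed.

(* V[lambda_0, ..., lambda_(n-1)], by coefficients of the monomials *)
Definition Vpoly := submod_type (Submod finsupp_subproof).
HB.instance Definition _ := GRing.Lmodule.on Vpoly.

Definition vcoef (q : Vpoly) (m : 'X_{1..n}) : V := submod_val q m.

Lemma vcoefP q : finite_set [set m | vcoef q m != 0].
Proof. exact: (submod_mem q). Qed.
Lemma vpolyP q q' : (forall m, vcoef q m = vcoef q' m) -> q = q'.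
Proof. by move=> h; apply: val_inj; apply: funext. Qed.
Lemma vcoefL c q q' m : vcoef (c *: q + q') m = c *: vcoef q m + vcoef q' m.
Proof. by []. Qed.
Lemma vterm_subproof (P : {mpoly F[n]}) (v : V) :
  finsupp_set (fun m => P@_m *: v).
Proof.
apply: (@sub_finite_set _ _ [set` msupp P]) => // m /=.
by apply: contraNT; rewrite mcoeff_msupp negbK => /eqP->; rewrite scale0r.
Qed.
(* the product P v *)
Definition vterm P v : Vpoly :=
  @in_submod _ _ (Submod finsupp_subproof) _ (vterm_subproof P v).

Lemma vcoef_vterm P v m : vcoef (vterm P v) m = P@_m *: v.
Proof. by []. Qed.
End Vpoly.

(* phi (x) u, on F[lambda] (x) V = V[lambda] *)
Definition vmap n n' (phi : {mpoly F[n]} -> {mpoly F[n']}) (u : V -> V)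
    (q : Vpoly n) : Vpoly n' :=
  \sum_(m \in [set: 'X_{1..n}]) vterm (phi 'X_[m]) (u (vcoef q m)).

Section Vmap.
Variables (n n' : nat) (phi : {mpoly F[n]} -> {mpoly F[n']}) (u : {linear V -> V}).

Lemma vmapE (s : seq 'X_{1..n}) q : uniq s ->
  (forall m, vcoef q m != 0 -> m \in s) ->
  vmap phi u q = \sum_(m <- s) vterm (phi 'X_[m]) (u (vcoef q m)).
Proof.
move=> us hs; rewrite /vmap (fsbigE s) //.
  by apply: eq_bigl => m; rewrite in_setT.
move=> m _; apply: contraNeq => h; apply: hs; apply: contraNneq h => ->.
by apply/eqP/vpolyP => k; rewrite vcoef_vterm raddf0 scaler0.
Qed.

Lemma vsupp2 m (q q' : Vpoly m) : exists2 s, uniq s &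
  forall k, (vcoef q k != 0) || (vcoef q' k != 0) -> k \in s.
Proof.
have [s [us hs]] : exists s : seq 'X_{1..m}, uniq s /\
  forall k, (vcoef q k != 0) || (vcoef q' k != 0) -> k \in s.
  have fin : finite_set ([set k | vcoef q k != 0] `|` [set k | vcoef q' k != 0]).
    by rewrite finite_setU; split; exact: vcoefP.
  have /finite_seqP[s hs] := fin; exists (undup s); split; first exact: undup_uniq.
  move=> k hk; rewrite mem_undup.
  suff : [set` s] k by [].
  by rewrite -hs; exact/orP.
by exists s.
Qed.

Lemma vmap_linear : linear (vmap phi u).
Proof.
move=> c q q'; have [s us hs] := vsupp2 q q'.
rewrite !(@vmapE s) //; try by move=> m h; apply: hs; rewrite h ?orbT.
  rewrite scaler_sumr -big_split; apply: eq_bigr => m _.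
  apply: vpolyP => k; rewrite vcoefL !vcoef_vterm vcoefL linearP scalerDr.
  by rewrite !scalerA mulrC.
move=> m; rewrite vcoefL => h; apply: hs; apply: contraNT h.
by rewrite negb_or !negbK => /andP[/eqP-> /eqP->]; rewrite scaler0 addr0.
Qed.
HB.instance Definition _ :=
  GRing.isLinear.Build F (Vpoly n) (Vpoly n') _ (vmap phi u) vmap_linear.
End Vmap.

Lemma linear_comb n n' (phi : {mpoly F[n]} -> {mpoly F[n']}) : linear phi ->
  forall (I : Type) (s : seq I) (c : I -> F) P,
  phi (\sum_(i <- s) c i *: P i) = \sum_(i <- s) c i *: phi (P i).
Proof.
move=> hphi I s c P.
have phi0 : phi 0 = 0.
  by apply: (addrI (phi 0)); rewrite -[X in X + _]scale1r -hphi scale1r !addr0.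
by elim: s => [|i s IH]; rewrite ?big_nil // !big_cons hphi IH.
Qed.

Lemma vmap_vterm n n' (phi : {mpoly F[n]} -> {mpoly F[n']})
    (u : {linear V -> V}) P v : linear phi ->
  vmap phi u (vterm P v) = vterm (phi P) (u v).
Proof.
move=> hphi; rewrite (@vmapE _ _ _ _ (msupp P)) ?msupp_uniq //; last first.
  move=> m; rewrite vcoef_vterm; apply: contraNT.
  by rewrite mcoeff_msupp negbK => /eqP->; rewrite scale0r.
have -> : phi P = \sum_(m <- msupp P) P@_m *: phi 'X_[m].
  by rewrite -(linear_comb hphi) -mpolyE.
apply: vpolyP => k; rewrite vcoef_vterm.
rewrite raddf_sum /= scaler_suml.
elim: (msupp P) => [|m s IH]; rewrite ?big_nil // !big_cons.
rewrite -[vterm _ _ in LHS]scale1r vcoefL scale1r vcoef_vterm IH; congr (_ + _).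
by rewrite ?vcoef_vterm linearZ scalerA mcoeffZ mulrC.
Qed.

Lemma vmap_comp n n' n'' (phi : {mpoly F[n']} -> {mpoly F[n'']})
    (psi : {mpoly F[n]} -> {mpoly F[n']}) (u w : {linear V -> V}) q : linear phi ->
  vmap phi u (vmap psi w q) = vmap (phi \o psi) (u \o w) q.
Proof.
move=> hphi; have [s us hs] := vsupp2 q q.
rewrite !(@vmapE _ _ _ _ s) //; try by move=> m h; apply: hs; rewrite h.
by rewrite linear_sum /=; apply: eq_bigr => m _; rewrite vmap_vterm.
Qed.

Variable d : {linear V -> V}.

Section Shift.
Variable n : nat.
Let sum_lambda : {mpoly F[n]} := \sum_(i < n) 'X_i.

(* partial + lambda_0 + ... + lambda_(n-1) *)
Definition total_shift (q : Vpoly n) : Vpoly n :=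
  vmap idfun d q + vmap ( *%R sum_lambda) idfun q.
Lemma total_shift_linear : linear total_shift.
Proof.
by move=> c x y; rewrite /total_shift !linearP scalerDr addrACA.
Qed.
HB.instance Definition _ :=
  GRing.isLinear.Build F (Vpoly n) (Vpoly n) _ total_shift total_shift_linear.

Definition shift_image : submod (Vpoly n) :=
  image_submod total_shift (full_submod (Vpoly n)).

(* V[lambda_0, ..., lambda_(n-1)] / <partial + lambda_0 + ... + lambda_(n-1)> *)
Definition Vlam := quot shift_image.
HB.instance Definition _ := GRing.Lmodule.on Vlam.

(* The operator induced on Vlam by phi; meaningful when phi preserves the
   image of total_shift, see Vlam_op_class. *)
Definition Vlam_op (phi : {mpoly F[n]} -> {mpoly F[n]}) (x : Vlam) : Vlam :=
  qclass _ (vmap phi idfun (qrep x)).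

Lemma Vlam_op_class phi q : linear phi ->
  (forall P, phi (sum_lambda * P) = sum_lambda * phi P) ->
  Vlam_op phi (qclass _ q) = qclass _ (vmap phi idfun q).
Proof.
move=> hphi hS; rewrite /Vlam_op.
have [_ [r _ <-] ->] := qclassP shift_image q.
apply/eq_qclass; rewrite linearD [_ + _ - _]addrAC subrr add0r.
exists (vmap phi idfun r) => //; rewrite /total_shift linearD /=.
have hid : linear (idfun : {mpoly F[n]} -> _) by [].
have hmul : linear ( *%R sum_lambda).
  by move=> c x y; rewrite mulrDr scalerAr.
rewrite !(@vmap_comp _ _ _ phi) //; congr (_ + _).
  by rewrite (@vmap_comp _ _ _ idfun).
rewrite (@vmap_comp _ _ _ ( *%R sum_lambda)) //.
suff -> : ( *%R sum_lambda) \o phi = phi \o ( *%R sum_lambda) by [].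
by apply: funext => P /=; rewrite hS.
Qed.

Lemma Vlam_op_linear phi : linear phi ->
  (forall P, phi (sum_lambda * P) = sum_lambda * phi P) ->
  linear (Vlam_op phi).
Proof.
move=> hphi hS c x y; rewrite -(qrepK x) -(qrepK y) -linearP.
by rewrite !Vlam_op_class // linearP linearP.
Qed.

Definition lambda_mul (i : 'I_n) : Vlam -> Vlam := Vlam_op ( *%R 'X_i).
Definition lambda_diff (i j : 'I_n) : Vlam -> Vlam :=
  Vlam_op (fun P => P^`M(j) - P^`M(i)).

Lemma lambda_mul_linear i : linear (lambda_mul i).
Proof.
apply: Vlam_op_linear => [c x y|P]; first by rewrite mulrDr scalerAr.
by rewrite mulrCA.
Qed.
Lemma mderiv_sum_lambda i : sum_lambda^`M(i) = 1.
Proof.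
rewrite /sum_lambda raddf_sum /= (bigD1 i) //= big1 ?addr0.
  rewrite mderivX mnmE eqxx scale1r -mpolyX0; congr 'X_[_].
  by apply/mnmP => l; rewrite !mnmE subnn.
by move=> k ki; rewrite mderivX mnmE (negPf ki) scale0r.
Qed.
Lemma lambda_diff_linear i j : linear (lambda_diff i j).
Proof.
apply: Vlam_op_linear => [c x y|P].
  by rewrite !mderivD !mderivZ scalerBr opprD addrACA.
by rewrite !mderivM !mderiv_sum_lambda !mul1r opprD addrACA subrr add0r mulrBr.
Qed.
HB.instance Definition _ i :=
  GRing.isLinear.Build F Vlam Vlam _ (lambda_mul i) (lambda_mul_linear i).
HB.instance Definition _ i j :=
  GRing.isLinear.Build F Vlam Vlam _ (lambda_diff i j) (lambda_diff_linear i j).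

Lemma coef_in_subproof (U : submod V) :
  [set q : Vpoly n | forall m, U (vcoef q m)] 0 /\ forall c x y,
  [set q : Vpoly n | forall m, U (vcoef q m)] x ->
  [set q : Vpoly n | forall m, U (vcoef q m)] y ->
  [set q : Vpoly n | forall m, U (vcoef q m)] (c *: x + y).
Proof.
by split=> [m|c x y hx hy m]; [exact: submod0|rewrite vcoefL; exact: submodL].
Qed.
(* image of U[lambda_0, ..., lambda_(n-1)] in Vlam *)
Definition Vlam_in (U : submod V) : submod Vlam :=
  image_submod (qclass shift_image) (Submod (coef_in_subproof U)).
End Shift.

Section Operations.
Variable n : nat.
Local Notation tensors := ('I_n -> V).

Definition upd (v : tensors) (i : 'I_n) (x : V) : tensors :=
  fun k => if k == i then x else v k.
Definition multilinear (W : lmodType F) (g : tensors -> W) :=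
  forall v i c x y, g (upd v i (c *: x + y)) = c *: g (upd v i x) + g (upd v i y).
Definition d_at (i : 'I_n) (v : tensors) : tensors := upd v i (d (v i)).

(* Linear maps on V^{(x) n} (x) O_n^{star T} are given as maps that are
   linear in each of their n + 1 arguments. *)
Definition Pch_map := tensors -> OT F n -> Vlam n.
HB.instance Definition _ := GRing.Lmodule.on Pch_map.

Definition in_Pch (X : Pch_map) :=
  [/\ forall f, multilinear (X^~ f), forall v, linear (X v),
      forall i v f, X v (ot_dz i f) = X (d_at i v) f + lambda_mul i (X v f)
    & forall i j v f, X v (ot_mulz i j f) = lambda_diff i j (X v f)].

Definition Pch_filtration_set (FV : int -> submod V) (r : int) : set Pch_map :=
  [set X | in_Pch X /\
    forall (s q : int) (t : 'I_n -> int) v f, \sum_(i < n) t i + q <= s ->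
      (forall i, FV (t i) (v i)) -> pole_filtration F n q (submod_val f) ->
      Vlam_in n (FV (s - r)) (X v f)].

Lemma Pch_filtration_subproof FV r : Pch_filtration_set FV r 0 /\
  forall c X Y, Pch_filtration_set FV r X -> Pch_filtration_set FV r Y ->
    Pch_filtration_set FV r (c *: X + Y).
Proof.
split=> [|c X Y [[X1 X2 X3 X4] X5] [[Y1 Y2 Y3 Y4] Y5]].
  split; last by move=> *; exact: submod0.
  split=> [f v i c x y|v c f g|i v f|i j v f].
  - by rewrite scaler0 addr0.
  - by rewrite scaler0 addr0.
  - by rewrite linear0 addr0.
  - by rewrite linear0.
split=> [|s q t v f h1 h2 h3]; last first.
  by apply: submodL; [exact: X5 h1 h2 h3|exact: Y5 h1 h2 h3].
have E v f : (c *: X + Y) v f = c *: X v f + Y v f by [].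
split=> [f v i a x y|v a f g|i v f|i j v f]; rewrite !E.
- by rewrite X1 Y1 !scalerDr !scalerA ![c * a]mulrC addrACA.
- by rewrite X2 Y2 !scalerDr !scalerA ![c * a]mulrC addrACA.
- by rewrite X3 Y3 linearP scalerDr addrACA.
- by rewrite X4 Y4 linearP.
Qed.
Definition Pch_filtration FV r : submod Pch_map :=
  Submod (Pch_filtration_subproof FV r).

(* gr^r P^ch(V)(n) *)
Definition gr_Pch FV r :=
  quot (sub_submod (Pch_filtration FV r) (Pch_filtration FV (r + 1))).

Definition Pcl_map := digraph n -> tensors -> Vlam n.
HB.instance Definition _ := GRing.Lmodule.on Pcl_map.

Definition in_Pcl (Y : Pcl_map) :=
  [/\ forall G, multilinear (Y G),
      forall G C v, oriented_cycle G C ->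
        Y G v = 0 /\ \sum_(e in C) Y (remove_edge G e) v = 0,
      forall G i j v, same_component G i j -> lambda_diff i j (Y G v) = 0
    & forall G i v, \sum_(j | same_component G i j)
        (Y G (d_at j v) + lambda_mul j (Y G v)) = 0].

Definition gr_Pcl_set (grV : int -> submod V) (r : int) : set Pcl_map :=
  [set Y | in_Pcl Y /\
    forall G (t : 'I_n -> int) v, (forall i, grV (t i) (v i)) ->
      Vlam_in n (grV (#|edges G|%:Z + \sum_(i < n) t i - r)) (Y G v)].

Lemma gr_Pcl_subproof grV r : gr_Pcl_set grV r 0 /\
  forall c X Y, gr_Pcl_set grV r X -> gr_Pcl_set grV r Y ->
    gr_Pcl_set grV r (c *: X + Y).
Proof.
split=> [|c X Y [[X1 X2 X3 X4] X5] [[Y1 Y2 Y3 Y4] Y5]].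
  split; last by move=> *; exact: submod0.
  split=> [G v i c x y|G C v _|G i j v _|G i v].
  - by rewrite scaler0 addr0.
  - by split=> //; rewrite big1.
  - by rewrite linear0.
  - by rewrite big1 // => j _; rewrite linear0 addr0.
split=> [|G t v h]; last by apply: submodL; [exact: X5 h|exact: Y5 h].
have E G v : (c *: X + Y) G v = c *: X G v + Y G v by [].
split=> [G v i a x y|G C v h|G i j v h|G i v]; rewrite ?E.
- by rewrite X1 Y1 !scalerDr !scalerA ![c * a]mulrC addrACA.
- have [-> hX] := X2 G C v h; have [-> hY] := Y2 G C v h.
  split; first by rewrite scaler0 addr0.
  by rewrite big_split /= -scaler_sumr hX hY scaler0 addr0.
- by rewrite linearP /= X3 // Y3 // scaler0 addr0.
- under eq_bigr => j _ do rewrite !E linearP addrACA -scalerDr.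
  by rewrite big_split /= -scaler_sumr X4 Y4 scaler0 addr0.
Qed.
(* gr^r P^cl(V)(n), for V graded by grV *)
Definition gr_Pcl grV r := submod_type (Submod (gr_Pcl_subproof grV r)).

Definition line_subst p (L : lines n p) (Q : {mpoly F[p]}) : {mpoly F[n]} :=
  poly_subst (line_sum F L) Q.

(* q in V[Lambda_0, ..., Lambda_(p-1)] represents x, once each Lambda_l is
   replaced by the sum of the lambda_i over the l-th line. *)
Definition is_Lambda_form p (L : lines n p) (x : Vlam n) (q : Vpoly p) :=
  qclass (shift_image n) (vmap (line_subst L) idfun q) = x.

Definition d_dpow (b : 'X_{1..n}) (v : tensors) : tensors :=
  fun i => (b i)`!%:R^-1 *: iter (b i) d (v i).

(* The right-hand side of the formula for X(v (x) f), with q p L b in place of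
   Y^L_Lambda(\prod_i partial_i ^ b_i / b_i! v). *)
Definition chiral_formula (f : ratfun F n)
    (q : forall p, lines n p -> 'X_{1..n} -> Vpoly p) : Vlam n :=
  \sum_(1 <= p < n.+1) \sum_(L : lines n p | is_lines L)
    \sum_(ab \in [set: 'X_{1..n} * 'X_{1..n}])
      qclass (shift_image n)
        (vmap (fun Q => (\prod_(i < n) dpow 'X_i (ab.1 i)) *
                 line_subst L (convolution (fourier_coef L f (ab.1 + ab.2)%MM) Q))
           idfun (q p L ab.2)).
End Operations.

Section Grading.
Variable Vs : nat -> submod V.

Definition zero_submod : submod V := span set0.
Definition grV (t : int) : submod V := if t is Posz s then Vs s else zero_submod.
Definition FV (t : int) : submod V :=
  span (\bigcup_(s in [set s : nat | s%:Z <= t]) (Vs s : set V)).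

(* w is the class of v in F^t V / F^(t-1) V = V_t *)
Definition symbol (t : int) (v w : V) :=
  [/\ FV t v, grV t w & FV (t - 1) (v - w)].
Definition Vlam_symbol n (t : int) (x y : Vlam n) :=
  [/\ Vlam_in n (FV t) x, Vlam_in n (grV t) y & Vlam_in n (FV (t - 1)) (x - y)].

(* Y is the image of the class of X under the canonical map, gr V being
   identified with V *)
Definition is_Phi n (r : int) (X : Pch_map n) (Y : Pcl_map n) :=
  forall G (t : 'I_n -> int) v w, (forall i, symbol (t i) (v i) (w i)) ->
    Vlam_symbol (#|edges G|%:Z + \sum_(i < n) t i - r) (X v (pGamma F G)) (Y G w).
End Grading.
End VPolynomials.

(* Main.v *)
Require Import Defs.
From HB Require Import structures.
From mathcomp Require Import all_boot all_order all_algebra.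
From mathcomp Require Import boolp classical_sets functions cardinality fsbigop.
From mathcomp Require Import finmap mpoly.
From mathcomp Require Import ring zify.

Set Implicit Arguments.
Unset Strict Implicit.
Unset Printing Implicit Defensive.

Import Order.TTheory GRing.Theory Num.Theory.
Local Open Scope ring_scope.
Local Open Scope classical_set_scope.

(**
  The formula is a sum, over the families L of p oriented lines, of terms built from
  the restriction Y^L of Y to L; a term combines the Fourier coefficients of f, which
  are iterated residues along the edges of L, with the values of Y^L through the
  convolution product.

  Each term satisfies the two relations of a chiral operation by itself
  (line_term_mulz, line_term_chiral).  This comes from three facts.  The residue along
  z_i = z_j commutes with the other derivations and kills derivatives in z_i
  (residue_dz_self, residue_dz), so the Fourier coefficients turn z_(last) - z_i and
  the derivation in z_i into shifts of their index, and the derivation along a whole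
  line into the derivation in w_l.  The expansion of a rational function is
  characterized by a linear equation (expansion_unique), so the convolution product
  turns w_l into minus the derivative in Lambda_l and the derivation in w_l into the
  commutator with Lambda_l.  Finally Y^L is sesquilinear.  A residue along an edge
  needs a pole there and uses it up; hence a function with fewer poles than L has
  edges does not contribute (fourier_coef_few_poles), and since Y is homogeneous this
  is the filtration condition: the sum X lies in F^r (chiral_op_filtered).

  In the other direction, the symbol of an X in F^r takes, at a graph G, the component
  of the highest possible degree of X(v (x) p_G).  The cycle and sesquilinearity
  relations hold for symbols because a linear relation between the z_ij of the edges of
  G makes one pole redundant (dependent_poles), so that the corresponding values drop
  in the filtration (symbol_op_gr_Pcl).  The symbol is zero only for X in F^(r+1)
  (symbol_op_low): a translation invariant function with few poles is a combination of
  products of powers of the z_ij (few_poles_invariant); X determines its values on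
  multiples by z_ij from those on the factor, and a multiple pole either is redundant
  or is the derivative, along the vertices on one side of the edge, of a function with
  a pole of lower order (low_monomial), so all values are controlled by those on the
  functions p_G.

  It remains to compute the symbol of the X attached to Y.  The cycle relations
  determine Y from its values at families of lines (cycle_relations_vanish).  At such a
  family L', terms with fewer lines vanish for lack of poles, terms with more lines have
  lower degree, and among the families with as many lines only L' itself has a nonzero
  Fourier coefficient, which is the constant 1 (fourier_coef_self, fourier_coef_other).
  So the symbol of X is Y (symbol_op_chiral_op), and with the injectivity above both
  compositions are the identity.
*)

(** * Substitution of variables in rational functions *)

Section LinearFunctions.
Variables (F : fieldType) (U W : lmodType F) (f : U -> W).
Hypothesis hf : linear f.
Lemma linear_at0 : f 0 = 0.
Proof. by have := hf (-1) 0 0; rewrite scaler0 addr0 scaleN1r addNr. Qed.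
Lemma linear_atD x y : f (x + y) = f x + f y.
Proof. by have := hf 1 x y; rewrite !scale1r. Qed.
Lemma linear_atZ c x : f (c *: x) = c *: f x.
Proof. by rewrite -[c *: x]addr0 hf linear_at0 addr0. Qed.
Lemma linear_at_sum (I : Type) (s : seq I) (P : pred I) (G : I -> U) :
  f (\sum_(i <- s | P i) G i) = \sum_(i <- s | P i) f (G i).
Proof. by apply: big_morph; [exact: linear_atD|exact: linear_at0]. Qed.
End LinearFunctions.

Section VariableSubstitution.
Variable F : fieldType.

Lemma mpoly_gen_ind n (A : {mpoly F[n]} -> Prop) :
  (forall c, A c%:MP) -> (forall i, A 'X_i) ->
  (forall P Q, A P -> A Q -> A (P + Q)) ->
  (forall P Q, A P -> A Q -> A (P * Q)) -> forall P, A P.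
Proof.
move=> AC AX AD AM P; rewrite [P]mpolyE.
have A1 : A 1 by rewrite -(mpolyC1 n F).
apply: big_ind => [||m _]; [by rewrite -(mpolyC0 n F)|exact: AD|].
rewrite -mul_mpolyC; apply: (AM); first exact: AC.
rewrite mpolyXE_id; apply: big_ind => [||i _]; [exact: A1|exact: AM|].
by elim: (m i) => [//|k IH]; rewrite exprS; apply: (AM).
Qed.

Variables n m : nat.
Implicit Types (P Q : {mpoly F[n]}) (f g : ratfun F n).

Section GeneralSubstitution.
Variable s : 'I_n -> {mpoly F[m]}.

Lemma poly_substD P Q : poly_subst s (P + Q) = poly_subst s P + poly_subst s Q.
Proof. exact: rmorphD. Qed.
Lemma poly_substB P Q : poly_subst s (P - Q) = poly_subst s P - poly_subst s Q.
Proof. exact: rmorphB. Qed.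
Lemma poly_substM P Q : poly_subst s (P * Q) = poly_subst s P * poly_subst s Q.
Proof. exact: rmorphM. Qed.
Lemma poly_substC c : poly_subst s c%:MP = c%:MP.
Proof. exact: comp_mpolyC. Qed.
Lemma poly_subst1 : poly_subst s 1 = 1.
Proof. exact: rmorph1. Qed.
Lemma poly_substX i : poly_subst s 'X_i = s i.
Proof. by rewrite /poly_subst comp_mpolyXU -tnth_nth tnth_mktuple. Qed.
Lemma poly_subst_linear : linear (poly_subst s).
Proof. exact: linearP. Qed.

(** The local ring of the functions defined at the generic point of the locus
    z = s; the value there does not depend on the presentation. *)
Definition regular_at f :=
  exists P Q, poly_subst s Q != 0 /\ f = of_poly P / of_poly Q.

Lemma poly_subst_neq0 Q : poly_subst s Q != 0 -> Q != 0.
Proof. by apply: contraNneq => ->; rewrite /poly_subst comp_mpoly0. Qed.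

Lemma ratfun_substE P Q : poly_subst s Q != 0 ->
  ratfun_subst s (of_poly P / of_poly Q) =
    of_poly (poly_subst s P) / of_poly (poly_subst s Q).
Proof.
move=> hQ; rewrite /ratfun_subst; case: xgetP => [h _ [P' [Q' [hQ' e ->]]]|]; last first.
  by move=> /(_ (of_poly (poly_subst s P) / of_poly (poly_subst s Q))) [];
    exists P, Q.
apply/eqP; rewrite eqr_div ?of_poly_eq0 // -!of_polyM -!poly_substM.
move/eqP: e; rewrite eqr_div ?of_poly_eq0 ?poly_subst_neq0 // -!of_polyM.
by move=> /eqP/of_poly_inj->.
Qed.

Lemma regular_poly P : regular_at (of_poly P).
Proof. by exists P, 1; rewrite poly_subst1 oner_eq0 of_poly1 divr1. Qed.
Lemma regular1 : regular_at 1.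
Proof. by rewrite -of_poly1; exact: regular_poly. Qed.
Lemma ratfun_subst_poly P : ratfun_subst s (of_poly P) = of_poly (poly_subst s P).
Proof.
have -> : of_poly P = of_poly P / of_poly 1 by rewrite of_poly1 divr1.
by rewrite ratfun_substE poly_subst1 ?oner_eq0 // of_poly1 divr1.
Qed.
Lemma ratfun_subst1 : ratfun_subst s 1 = 1.
Proof. by rewrite -[in LHS]of_poly1 ratfun_subst_poly poly_subst1 of_poly1. Qed.
Lemma ratfun_subst0 : ratfun_subst s 0 = 0.
Proof. by rewrite -[in LHS]of_poly0 ratfun_subst_poly /poly_subst comp_mpoly0 of_poly0. Qed.

Lemma regularM f g : regular_at f -> regular_at g ->
  regular_at (f * g) /\ ratfun_subst s (f * g) = ratfun_subst s f * ratfun_subst s g.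
Proof.
move=> [P [Q [hQ ->]]] [P' [Q' [hQ' ->]]].
have hQQ : poly_subst s (Q * Q') != 0 by rewrite poly_substM mulf_neq0.
rewrite mulf_div -!of_polyM; split; first by exists (P * P'), (Q * Q').
by rewrite !ratfun_substE // !poly_substM mulf_div -!of_polyM.
Qed.
Lemma regularD f g : regular_at f -> regular_at g ->
  regular_at (f + g) /\ ratfun_subst s (f + g) = ratfun_subst s f + ratfun_subst s g.
Proof.
move=> [P [Q [hQ ->]]] [P' [Q' [hQ' ->]]].
have hQQ : poly_subst s (Q * Q') != 0 by rewrite poly_substM mulf_neq0.
rewrite addf_div ?of_poly_eq0 ?poly_subst_neq0 // -!of_polyM -of_polyD.
split; first by exists (P * Q' + P' * Q), (Q * Q').
rewrite !ratfun_substE // poly_substD !poly_substM addf_div ?of_poly_eq0 //.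
by rewrite -!of_polyM -of_polyD.
Qed.
Lemma regularL (c : F) f g : regular_at f -> regular_at g ->
  regular_at (c *: f + g) /\
  ratfun_subst s (c *: f + g) = c *: ratfun_subst s f + ratfun_subst s g.
Proof.
move=> hf hg; rewrite !ratfun_scaleE.
have [hcf ecf] := regularM (regular_poly c%:MP) hf.
have [h e] := regularD hcf hg; split=> //; rewrite e ecf.
by rewrite ratfun_subst_poly poly_substC.
Qed.
Lemma regularZ (c : F) f : regular_at f ->
  regular_at (c *: f) /\ ratfun_subst s (c *: f) = c *: ratfun_subst s f.
Proof.
move=> hf; rewrite !ratfun_scaleE; have [h ->] := regularM (regular_poly c%:MP) hf.
by rewrite ratfun_subst_poly poly_substC.
Qed.
Lemma regularV f : regular_at f -> ratfun_subst s f != 0 ->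
  regular_at f^-1 /\ ratfun_subst s f^-1 = (ratfun_subst s f)^-1.
Proof.
move=> [P [Q [hQ ->]]]; rewrite ratfun_substE // mulf_eq0 invr_eq0 !of_poly_eq0.
rewrite negb_or => /andP[hP _]; rewrite !invf_div; split; first by exists Q, P.
by rewrite ratfun_substE.
Qed.
Lemma regularX f k : regular_at f ->
  regular_at (f ^+ k) /\ ratfun_subst s (f ^+ k) = ratfun_subst s f ^+ k.
Proof.
move=> hf; elim: k => [|k [hk ek]].
  by rewrite !expr0 ratfun_subst1; split=> //; exact: regular1.
by rewrite !exprS -ek; exact: regularM.
Qed.

Lemma regular_sum (I : Type) (r : seq I) (A : pred I) (G : I -> ratfun F n) :
  (forall i, A i -> regular_at (G i)) -> regular_at (\sum_(i <- r | A i) G i) /\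
  ratfun_subst s (\sum_(i <- r | A i) G i) = \sum_(i <- r | A i) ratfun_subst s (G i).
Proof.
move=> hG; elim: r => [|i r [IH e]].
  by rewrite !big_nil ratfun_subst0 -of_poly0; split=> //; exact: regular_poly.
rewrite !big_cons; case: ifP => // Ai; rewrite -e; exact: regularD (hG i Ai) IH.
Qed.

Lemma regular_dz i f : regular_at f -> regular_at (dz i f).
Proof.
move=> [P [Q [hQ ->]]]; rewrite dz_div ?poly_subst_neq0 // -exprVn.
exists (P^`M(i) * Q - P * Q^`M(i)), (Q ^+ 2).
rewrite expr2 poly_substM mulf_neq0 //; split=> //.
by rewrite of_polyM exprVn expr2.
Qed.

Lemma regular_iter_dz i k f : regular_at f -> regular_at (iter k (dz i) f).
Proof. by move=> hf; elim: k => //= k; exact: regular_dz. Qed.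

Lemma adjoin_subst (S : set (ratfun F n)) (S' : set (ratfun F m)) :
  (forall f, S f -> regular_at f /\ adjoin S' (ratfun_subst s f)) ->
  forall f, adjoin S f -> regular_at f /\ adjoin S' (ratfun_subst s f).
Proof.
move=> hS f hf; move: hS; move: f hf => f hf hS.
apply: (@adjoin_ind _ _ S [set f | regular_at f /\ adjoin S' (ratfun_subst s f)]) hf => //.
split=> [|c g h [hg ag] [hh ah]|g h [hg ag] [hh ah]].
- by split; [exact: regular1|rewrite ratfun_subst1; exact: adjoin1].
- by have [r e] := regularL c hg hh; split=> //; rewrite e; exact: submodL.
- by have [r e] := regularM hg hh; split=> //; rewrite e; exact: adjoinM.
Qed.
End GeneralSubstitution.

Lemma adjoin_dz (S : set (ratfun F n)) (i : 'I_n) :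
  (forall f, S f -> adjoin S (dz i f)) ->
  forall f, adjoin S f -> adjoin S (dz i f).
Proof.
move=> hS f hf; suff [] : adjoin S f /\ adjoin S (dz i f) by [].
apply: (@adjoin_ind _ _ S [set f | adjoin S f /\ adjoin S (dz i f)]) hf => //; last first.
  by move=> g Sg; split; [exact: adjoin_gen|exact: hS].
split=> [|c g h [hg hg'] [hh hh']|g h [hg hg'] [hh hh']].
- split; first exact: adjoin1.
  by rewrite -of_poly1 dz_poly mderiv1 of_poly0; exact: submod0.
- by split; [exact: submodL|rewrite linearP; exact: submodL].
- by split; [exact: adjoinM|rewrite dzM; apply: submodD; exact: adjoinM].
Qed.

(** ** Renaming of variables *)
Section Renaming.
Variable h : 'I_n -> 'I_m.
Definition rename (i : 'I_n) : {mpoly F[m]} := 'X_(h i).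

Lemma mderivXU k (i j : 'I_k) : ('X_i : {mpoly F[k]})^`M(j) = (i == j)%:R.
Proof.
rewrite mderivX mnmE; case: eqVneq => [->|_]; last by rewrite scale0r.
rewrite scale1r -mpolyX0; congr 'X_[_]; apply/mnmP => l.
by rewrite !mnmE subnn.
Qed.

Lemma mderiv_rename l P : (poly_subst rename P)^`M(l) =
  \sum_(i | h i == l) poly_subst rename P^`M(i).
Proof.
elim/mpoly_gen_ind: P => [c|i|P Q IP IQ|P Q IP IQ].
- rewrite poly_substC mderivC big1 // => i _.
  by rewrite mderivC -(mpolyC0 n F) poly_substC mpolyC0.
- rewrite poly_substX mderivXU.
  under eq_bigr => j _ do rewrite mderivXU.
  have E (b : bool) : poly_subst rename b%:R = b%:R.
    by case: b; rewrite ?poly_subst1 // /poly_subst !mulr0n comp_mpoly0.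
  under eq_bigr => j _ do rewrite E.
  case: eqVneq => [<-|hi].
    by rewrite (bigD1 i) //= eqxx big1 ?addr0 // => j /andP[_]; rewrite eq_sym => /negPf->.
  rewrite big1 // => j /eqP hj; case: eqVneq => // ij; move: hi.
  by rewrite ij hj eqxx.
- rewrite poly_substD mderivD IP IQ -big_split; apply: eq_bigr => i _.
  by rewrite mderivD poly_substD.
- rewrite poly_substM mderivM IP IQ mulr_suml mulr_sumr -big_split.
  by apply: eq_bigr => i _; rewrite mderivM poly_substD !poly_substM.
Qed.

(** The chain rule, for a substitution of variables by variables. *)
Lemma dz_rename l f : regular_at rename f ->
  dz l (ratfun_subst rename f) = \sum_(i | h i == l) ratfun_subst rename (dz i f).
Proof.
move=> [P [Q [hQ ->]]]; have Q0 := poly_subst_neq0 hQ.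
rewrite ratfun_substE // dz_div //.
have -> : \sum_(i | h i == l) ratfun_subst rename (dz i (of_poly P / of_poly Q)) =
  \sum_(i | h i == l) of_poly (poly_subst rename P^`M(i) * poly_subst rename Q
     - poly_subst rename P * poly_subst rename Q^`M(i)) / of_poly (poly_subst rename Q) ^+ 2.
  apply: eq_bigr => i _; rewrite dz_div // expr2 -of_polyM ratfun_substE; last first.
    by rewrite poly_substM mulf_neq0.
  by rewrite poly_substB !poly_substM of_polyM -expr2.
rewrite -mulr_suml; congr (_ / _).
have <- : of_poly (\sum_(i | h i == l) (poly_subst rename P^`M(i) * poly_subst rename Q
     - poly_subst rename P * poly_subst rename Q^`M(i))) =
   \sum_(i | h i == l) of_poly (poly_subst rename P^`M(i) * poly_subst rename Q
     - poly_subst rename P * poly_subst rename Q^`M(i)) by exact: rmorph_sum.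
by rewrite !mderiv_rename mulr_suml mulr_sumr -sumrB.
Qed.

Lemma ratfun_subst_zvar i : ratfun_subst rename (zvar F i) = zvar F (h i).
Proof. by rewrite /zvar ratfun_subst_poly poly_substX. Qed.
Lemma regular_zvar i : regular_at rename (zvar F i).
Proof. exact: regular_poly. Qed.
Lemma zdiffE k (i j : 'I_k) : zdiff F i j = of_poly ('X_i - 'X_j).
Proof. by rewrite of_polyB. Qed.
Lemma regular_zdiff i j : regular_at rename (zdiff F i j).
Proof. by rewrite zdiffE; exact: regular_poly. Qed.
Lemma ratfun_subst_zdiff i j : ratfun_subst rename (zdiff F i j) = zdiff F (h i) (h j).
Proof. by rewrite zdiffE ratfun_subst_poly poly_substB !poly_substX -zdiffE. Qed.
Lemma zdiff_eq0 k (i j : 'I_k) : (zdiff F i j == 0) = (i == j).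
Proof.
rewrite zdiffE of_poly_eq0 subr_eq0; apply/eqP/eqP => [|->//].
move=> /(congr1 (mderiv i)); rewrite !mderivXU eqxx eq_sym.
by case: eqVneq => // _ /eqP; rewrite oner_eq0.
Qed.
Lemma regular_zdiffV i j : h i != h j -> regular_at rename (zdiff F i j)^-1 /\
  ratfun_subst rename (zdiff F i j)^-1 = (zdiff F (h i) (h j))^-1.
Proof.
move=> hij; rewrite -ratfun_subst_zdiff; apply: regularV; first exact: regular_zdiff.
by rewrite ratfun_subst_zdiff zdiff_eq0.
Qed.
End Renaming.
End VariableSubstitution.

(** * The residue along a diagonal *)

Section CharacteristicZero.
Variables (F : fieldType) (charF0 : [pchar F] =i pred0).
Lemma natF_eq0 k : (k%:R == 0 :> F) = (k == 0%N).
Proof. by move: k; apply/pcharf0P. Qed.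
Lemma natSF_neq0 k : k.+1%:R != 0 :> F.
Proof. by rewrite natF_eq0. Qed.
End CharacteristicZero.

Section QuotientIdentities.
Variable K : fieldType.
Lemma pole_quotient (A B c D g : K) : A != 0 -> B != 0 ->
  c * (A * D) / (B * A) * g = B^-1 * (c * (D * g)).
Proof. by move=> A0 B0; field; rewrite A0 B0. Qed.
Lemma mixed_second_derivative (P Q Pk Pl Qk Ql Pkl Qkl : K) : Q != 0 ->
  (Pkl - ((Pk - P / Q * Qk) / Q * Ql + P / Q * Qkl)) / Q
    - (Pl - P / Q * Ql) / Q * Qk / Q =
  (Pkl - ((Pl - P / Q * Ql) / Q * Qk + P / Q * Qkl)) / Q
    - (Pk - P / Q * Qk) / Q * Ql / Q.
Proof. by move=> Q0; field. Qed.
Lemma quotient_rule (P Q P' Q' : K) : Q != 0 ->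
  (P' * Q - P * Q') / Q ^+ 2 = (P' - P / Q * Q') / Q.
Proof. by move=> Q0; field. Qed.
Lemma exprN_mulACA (x g h : K) a b : x ^- a * g * (x ^- b * h) = x ^- (a + b) * (g * h).
Proof. by rewrite exprD invfM mulrACA. Qed.
Lemma exprN_mulKf (x g : K) a b : x != 0 -> x ^- (a + b) * (x ^+ b * g) = x ^- a * g.
Proof. by move=> x0; rewrite exprD invfM -mulrA mulKf // expf_neq0. Qed.
Lemma exprN_mul_expr (x g : K) a b : x != 0 -> x ^- a * g * (x ^+ b * x ^+ a) = x ^+ b * g.
Proof. by move=> x0; rewrite mulrCA mulrAC mulVf ?mul1r ?expf_neq0. Qed.
End QuotientIdentities.

Section Residue.
Variables (F : fieldType) (charF0 : [pchar F] =i pred0) (n : nat).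
Implicit Types (P Q : {mpoly F[n]}) (f g : ratfun F n).
Local Notation z := (zdiff F).
Local Notation mv := (@merge_var F n).

Definition merge (i j k : 'I_n) := if k == i then j else k.

Lemma merge_varE i j : mv i j = rename F (merge i j).
Proof. by []. Qed.

Lemma dz_zdiffE k i j : dz k (z i j) = ((i == k)%:R - (j == k)%:R) *: (1 : ratfun F n).
Proof.
rewrite zdiffE dz_poly mderivB !mderivXU ratfun_scaleE mulr1 mpolyCB.
by case: (i == k) (j == k) => -[]; rewrite ?mpolyC1 ?mpolyC0.
Qed.
Lemma dz1 k : dz k (1 : ratfun F n) = 0.
Proof. by rewrite -of_poly1 dz_poly mderiv1 of_poly0. Qed.
Lemma dzX k f m : dz k (f ^+ m.+1) = m.+1%:R *: (f ^+ m * dz k f).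
Proof.
elim: m => [|m IH]; first by rewrite expr1 expr0 mul1r scale1r.
rewrite exprS dzM IH ratfun_scaleE exprS.
rewrite [in RHS]ratfun_scaleE -(addn1 m.+1) natrD mpolyCD of_polyD mpolyC1 of_poly1.
by ring.
Qed.

Section SetDerivation.
Variable S : {set 'I_n}.
Definition dS f := \sum_(k in S) dz k f.
Lemma dS_linear : linear dS.
Proof.
move=> c f g; rewrite /dS scaler_sumr -big_split; apply: eq_bigr => k _.
by rewrite linearP.
Qed.
Lemma dSM f g : dS (f * g) = dS f * g + f * dS g.
Proof.
rewrite /dS mulr_suml mulr_sumr -big_split; apply: eq_bigr => k _ /=.
by rewrite dzM.
Qed.
Lemma dSV f : dS f^-1 = - dS f / f ^+ 2.
Proof.
rewrite /dS -sumrN mulr_suml; apply: eq_bigr => k _; exact: dzV.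
Qed.
Lemma dSX f k : dS (f ^+ k.+1) = k.+1%:R *: (f ^+ k * dS f).
Proof.
rewrite /dS mulr_sumr scaler_sumr; apply: eq_bigr => l _; exact: dzX.
Qed.
Lemma dS1 : dS 1 = 0.
Proof. by rewrite /dS big1 // => k _; rewrite dz1. Qed.
Lemma dS_zdiff i j : dS (z i j) = ((i \in S)%:R - (j \in S)%:R) *: (1 : ratfun F n).
Proof.
have h (i' : 'I_n) : \sum_(k in S) (i' == k)%:R = (i' \in S)%:R :> F.
  have [iS|iS] := boolP (i' \in S).
    rewrite (bigD1 i') //= eqxx big1 ?addr0 // => k /andP[_ /negPf].
    by rewrite eq_sym => ->.
  by rewrite big1 // => k kS; case: eqP => // e; rewrite e kS in iS.
rewrite /dS; under eq_bigr => k _ do rewrite dz_zdiffE.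
by rewrite -scaler_suml sumrB !h.
Qed.
Lemma dS_pole0 i j k : (i \in S) = (j \in S) -> dS (z i j ^- k) = 0.
Proof.
move=> e; rewrite -exprVn; case: k => [|k]; first by rewrite expr0 dS1.
by rewrite dSX dSV dS_zdiff e subrr scale0r oppr0 mul0r mulr0 scaler0.
Qed.
Lemma dS_pole i j k : i \in S -> j \notin S ->
  dS (z i j ^- k.+1) = - k.+1%:R *: z i j ^- k.+2.
Proof.
move=> iS jS; rewrite -!exprVn dSX dSV dS_zdiff iS (negPf jS) subr0 scale1r.
by rewrite mulNr mul1r -exprVn mulrN scalerN scaleNr -exprD addn2.
Qed.
End SetDerivation.

Section OneDiagonal.
Variables (i j : 'I_n) (ij : i != j).
Local Notation reg := (regular_at (mv i j)).
Local Notation sub := (ratfun_subst (mv i j)).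

Lemma zij_neq0 : z i j != 0. Proof. by rewrite zdiff_eq0. Qed.
Lemma dz_zij : dz i (z i j) = 1.
Proof. by rewrite dz_zdiffE eqxx eq_sym (negPf ij) subr0 scale1r. Qed.
Lemma sub_zij : sub (z i j) = 0.
Proof. by rewrite ratfun_subst_zdiff /merge eqxx eq_sym (negPf ij) /zdiff subrr. Qed.

(** The Leibniz rule, z_ij having derivative 1. *)
Lemma iter_dz_zijM N g :
  iter N.+1 (dz i) (z i j * g) = z i j * iter N.+1 (dz i) g + N.+1%:R *: iter N (dz i) g.
Proof.
elim: N => [|N IH]; first by rewrite /= dzM dz_zij mul1r scale1r addrC.
rewrite iterS IH dzD dzM dz_zij mul1r linearZ /= [RHS]addrC addrAC; congr (_ + _).
by rewrite -[N.+2%:R]natr1 scalerDl scale1r addrC.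
Qed.

(** The N-th Taylor coefficient of g along the diagonal, which is the coefficient
    of z_ij^(-1) in the expansion of z_ij^(-N-1) g. *)
Definition pole_coef N g : ratfun F n := N`!%:R^-1 *: sub (iter N (dz i) g).

Lemma pole_coefS N g : reg g -> pole_coef N.+1 (z i j * g) = pole_coef N g.
Proof.
move=> hg; rewrite /pole_coef iter_dz_zijM.
have [h1 e1] := regularZ N.+1%:R (regular_iter_dz i N hg).
have [h2 e2] := regularM (@regular_zdiff F n n (merge i j) i j) (regular_iter_dz i N.+1 hg).
have [_ ->] := regularD h2 h1; rewrite e2 e1 sub_zij mul0r add0r scalerA.
rewrite factS natrM invfM mulrAC mulVf ?mul1r //; exact: natSF_neq0.
Qed.
Lemma pole_coefD N k g : reg g -> pole_coef (k + N) (z i j ^+ k * g) = pole_coef N g.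
Proof.
move=> hg; elim: k => [|k IH]; first by rewrite mul1r.
rewrite exprS -mulrA addSn pole_coefS ?IH //.
have [hk _] := regularX k (@regular_zdiff F n n (merge i j) i j).
by have [] := regularM hk hg.
Qed.

Lemma pole_coef_unique N N' g g' : reg g -> reg g' ->
  z i j ^- N.+1 * g = z i j ^- N'.+1 * g' -> pole_coef N g = pole_coef N' g'.
Proof.
wlog le : N N' g g' / (N <= N')%N.
  by case: (leqP N N') => [le|/ltnW le] h hg hg' e; [|symmetry]; apply: h; rewrite ?e.
move=> hg hg' e; rewrite -(pole_coefD N (N' - N)) // subnK //.
congr (pole_coef _ _); apply: (mulfI (x := z i j ^- N'.+1)).
  by rewrite invr_neq0 // expf_neq0 ?zij_neq0.
rewrite -e mulrA; congr (_ * _).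
have -> : N'.+1 = (N' - N + N.+1)%N by rewrite addnS subnK.
by rewrite exprD invfM mulrAC mulVf ?mul1r // expf_neq0 ?zij_neq0.
Qed.

Lemma mpoly_merge_dvd P : exists Q, P - poly_subst (mv i j) P = ('X_i - 'X_j) * Q.
Proof.
elim/mpoly_gen_ind: P => [c|k|P Q [P' IP] [Q' IQ]|P Q [P' IP] [Q' IQ]].
- by exists 0; rewrite poly_substC subrr mulr0.
- rewrite poly_substX /merge_var; case: eqVneq => [->|_].
    by exists 1; rewrite mulr1.
  by exists 0; rewrite subrr mulr0.
- by exists (P' + Q'); rewrite poly_substD mulrDr -IP -IQ opprD addrACA.
- exists (P' * Q + poly_subst (mv i j) P * Q').
  transitivity ((P - poly_subst (mv i j) P) * Q
      + poly_subst (mv i j) P * (Q - poly_subst (mv i j) Q)).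
    by rewrite poly_substM; ring.
  by rewrite IP IQ; ring.
Qed.

Lemma msize_Xij : (1 < msize ('X_i - 'X_j : {mpoly F[n]}))%N.
Proof.
rewrite ltnNge; apply/negP => /msize1_polyC e.
have := congr1 (mderiv i) e; rewrite mderivB !mderivXU eqxx eq_sym (negPf ij) mderivC.
by rewrite subr0 => /eqP; rewrite oner_eq0.
Qed.

(** A polynomial vanishing on the diagonal is divisible by its equation, and the
    quotient is smaller. *)
Lemma mpoly_merge_factor P : P != 0 -> exists k Q,
  P = ('X_i - 'X_j) ^+ k * Q /\ poly_subst (mv i j) Q != 0.
Proof.
have [N] := ubnP (msize P); elim: N P => // N IH P ltN P0.
have [sP|sP] := eqVneq (poly_subst (mv i j) P) 0; last first.
  by exists 0, P; rewrite mul1r.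
have [Q] := mpoly_merge_dvd P; rewrite sP subr0 => eP.
have Q0 : Q != 0 by apply: contraNneq P0 => Q0; rewrite eP Q0 mulr0.
have X0 : 'X_i - 'X_j != 0 :> {mpoly F[n]}.
  by apply: contraNneq P0 => X0; rewrite eP X0 mul0r.
have lt : (msize Q < N)%N.
  move: ltN; rewrite eP msizeM //; have := msize_Xij.
  by case: (msize _) => [//|[//|k]] _; rewrite !addSn /= ltnS => /(leq_trans _); apply;
    rewrite ltnS leq_addl.
have [k [Q' [eQ hQ']]] := IH Q lt Q0.
by exists k.+1, Q'; rewrite exprS -mulrA -eQ.
Qed.

Lemma unit_decomposition f : f != 0 -> exists (l : int) g,
  ratfun_unit_at (mv i j) g /\ f = z i j ^ (- l - 1) * g.
Proof.
have [[P Q] /= Q0 [-> _]] := ratfunP f => f0.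
have P0 : P != 0 by apply: contraNneq f0 => ->; rewrite of_poly0 mul0r.
have [a [P' [-> hP]]] := mpoly_merge_factor P0.
have [b [Q' [-> hQ]]] := mpoly_merge_factor Q0.
exists (b%:Z - a%:Z - 1), (of_poly P' / of_poly Q'); split; first by exists P', Q'.
rewrite !of_polyM -mulf_div; congr (_ * _).
have eX k : of_poly (('X_i - 'X_j) ^+ k) = z i j ^+ k.
  by elim: k => [|k IH]; rewrite ?of_poly1 // !exprS of_polyM IH zdiffE.
rewrite !eX (_ : - (b%:Z - a%:Z - 1) - 1 = a%:Z - b%:Z); last by ring.
by rewrite expfzDr ?zij_neq0 // exprnN.
Qed.

Lemma ratfun_unit_regular g : ratfun_unit_at (mv i j) g -> reg g /\ g != 0.
Proof.
move=> [P [Q [hP hQ ->]]]; split; first by exists P, Q.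
by rewrite mulf_neq0 ?invr_eq0 ?of_poly_eq0 ?(poly_subst_neq0 hP) ?(poly_subst_neq0 hQ).
Qed.

(** The residue may be computed from any presentation with a pole of order
    at most N + 1: raising the order by one multiplies g by z_ij, and the
    Leibniz rule leaves the coefficient unchanged.  All the properties of
    residues below come from this freedom. *)
Lemma residue_pole N g : reg g -> residue i j (z i j ^- N.+1 * g) = pole_coef N g.
Proof.
move=> hg; rewrite /residue; case: xgetP => [h _ [l [g' [ug' e ->]]]|noh].
  have [hg' _] := ratfun_unit_regular ug'.
  case: l e => k e.
    symmetry; apply: pole_coef_unique => //; rewrite e; congr (_ * _).
    by rewrite -opprD -PoszD addn1 -exprnN.
  have {}e : z i j ^- N.+1 * g = z i j ^- 1 * (z i j ^+ k.+1 * g').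
    rewrite e (_ : - Negz k - 1 = k%:Z); last by lia.
    by rewrite -exprnP expr1 exprS !mulrA mulVf ?mul1r ?zij_neq0.
  have [hk ek] := regularX k.+1 (@regular_zdiff F n n (merge i j) i j).
  have [hkg ekg] := regularM hk hg'.
  rewrite (pole_coef_unique hg hkg e) /pole_coef /= ekg ek sub_zij expr0n mul0r.
  by rewrite scaler0.
have [f0|/unit_decomposition[l [g' [ug' e]]]] := eqVneq (z i j ^- N.+1 * g) 0; last first.
  by case: (noh (match l with Posz k => k`!%:R^-1 *: sub (iter k (dz i) g')
     | Negz _ => 0 end)); exists l, g'.
have g0 : g = 0.
  by move/eqP: f0; rewrite mulf_eq0 invr_eq0 expf_eq0 (negPf zij_neq0) /= => /eqP.
have it0 k : iter k (dz i) 0 = 0 by elim: k => //= k ->; rewrite raddf0.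
by rewrite /pole_coef g0 it0 ratfun_subst0 scaler0.
Qed.

Lemma pole_decomposition f : exists N g, reg g /\ f = z i j ^- N.+1 * g.
Proof.
have [->|/unit_decomposition[l [g [/ratfun_unit_regular[hg _] ->]]]] := eqVneq f 0.
  by exists 0, 0; rewrite mulr0; split=> //; rewrite -of_poly0; exact: regular_poly.
case: l => k; first by exists k, g; rewrite -opprD -PoszD addn1 -exprnN.
exists 0, (z i j ^+ k.+1 * g); split.
  have [hk _] := regularX k.+1 (@regular_zdiff F n n (merge i j) i j).
  by have [] := regularM hk hg.
rewrite (_ : - Negz k - 1 = k%:Z); last by lia.
by rewrite -exprnP expr1 exprS !mulrA mulVf ?mul1r ?zij_neq0.
Qed.
Lemma pole_decomposition2 f f' : exists N g g',
  [/\ reg g, reg g', f = z i j ^- N.+1 * g & f' = z i j ^- N.+1 * g'].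
Proof.
have [N [g [hg ->]]] := pole_decomposition f.
have [N' [g' [hg' ->]]] := pole_decomposition f'.
have hX k h : reg h -> reg (z i j ^+ k * h).
  have [hk _] := regularX k (@regular_zdiff F n n (merge i j) i j).
  by move=> hh; have [] := regularM hk hh.
exists (N + N')%N, (z i j ^+ N' * g), (z i j ^+ N * g'); split; try exact: hX.
  by rewrite -addSn exprD invfM -[RHS]mulrA mulKf // expf_neq0 ?zij_neq0.
by rewrite -addnS addnC exprD invfM -[RHS]mulrA mulKf // expf_neq0 ?zij_neq0.
Qed.

Lemma residue_regular g : reg g -> residue i j g = 0.
Proof.
move=> hg; have -> : g = z i j ^- 1 * (z i j * g).
  by rewrite expr1 mulKf ?zij_neq0.
have hz := @regular_zdiff F n n (merge i j) i j.
rewrite residue_pole; last by have [] := regularM hz hg.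
by rewrite /pole_coef /=; have [_ ->] := regularM hz hg; rewrite sub_zij mul0r scaler0.
Qed.

Lemma residue_linear : linear (residue i j : ratfun F n -> _).
Proof.
move=> c f f'; have [N [g [g' [hg hg' -> ->]]]] := pole_decomposition2 f f'.
have -> : c *: (z i j ^- N.+1 * g) + z i j ^- N.+1 * g' = z i j ^- N.+1 * (c *: g + g').
  by rewrite mulrDr !ratfun_scaleE mulrCA.
have [h _] := regularL c hg hg'.
rewrite !residue_pole // /pole_coef.
have -> : iter N (dz i) (c *: g + g') = c *: iter N (dz i) g + iter N (dz i) g'.
  by elim: N => //= N ->; rewrite linearP.
have [_ ->] := regularL c (regular_iter_dz i N hg) (regular_iter_dz i N hg').
by rewrite scalerDr !scalerA mulrC.
Qed.

Lemma pole_shift N g : z i j ^- N.+1 * g = z i j ^- N.+2 * (z i j * g).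
Proof. by rewrite [in RHS]exprSr invfM -mulrA mulKf ?zij_neq0. Qed.

(** The pole order goes up by one, with a numerator that is again regular. *)
Lemma dz_pole k N g : dz k (z i j ^- N.+1 * g) =
  z i j ^- N.+2 * (z i j * dz k g - N.+1%:R *: (dz k (z i j) * g)).
Proof.
rewrite dzM dzV dzX addrC mulrBr.
have z0 := zij_neq0; congr (_ + _).
  exact: pole_shift.
rewrite !ratfun_scaleE !mulNr; congr (- _).
rewrite -exprM mulnC; have -> : (2 * N.+1 = N.+2 + N)%N by lia.
by rewrite exprD; apply: pole_quotient; rewrite expf_neq0.
Qed.

(** The derivative of z_ij^(-N-1) g has numerator d_i (z_ij g) - (N+2) g over
    z_ij^(N+2); by the Leibniz rule the (N+1)-st derivative of this numerator is
    z_ij d_i^(N+2) g, which vanishes on the diagonal. *)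
Lemma residue_dz_self f : residue i j (dz i f) = 0.
Proof.
have [N [g [hg ->]]] := pole_decomposition f.
have hz := @regular_zdiff F n n (merge i j) i j.
have [h1 _] := regularM hz (regular_dz i hg).
have [h2 _] := regularZ N.+1%:R hg.
rewrite dz_pole dz_zij mul1r residue_pole; last first.
  by rewrite addrC -scaleN1r; have [] := regularL (-1) h2 h1.
have -> : z i j * dz i g - N.+1%:R *: g = dz i (z i j * g) - N.+2%:R *: g.
  by rewrite dzM dz_zij mul1r -[N.+2%:R]natr1 scalerDl scale1r; ring.
rewrite /pole_coef.
have -> : iter N.+1 (dz i) (dz i (z i j * g) - N.+2%:R *: g) =
  iter N.+2 (dz i) (z i j * g) - N.+2%:R *: iter N.+1 (dz i) g.
  have it k c x y : iter k (dz i) (x - c *: y) = iter k (dz i) x - c *: iter k (dz i) y.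
    by elim: k => //= k ->; rewrite linearB linearZ.
  by rewrite it [in RHS]iterSr.
rewrite iter_dz_zijM addrK.
have [_ ->] := regularM hz (regular_iter_dz i N.+2 hg).
by rewrite sub_zij mul0r scaler0.
Qed.

Lemma dzC k l f : dz k (dz l f) = dz l (dz k f).
Proof.
have [[P Q] /= Q0 [-> _]] := ratfunP f.
have Q0' : of_poly Q != 0 by rewrite of_poly_eq0.
have E a b : dz a (of_poly b / of_poly Q) =
  (of_poly b^`M(a) - of_poly b / of_poly Q * of_poly Q^`M(a)) / of_poly Q.
  by rewrite dz_div // !(of_polyB, of_polyM) quotient_rule.
rewrite !E.
have E2 a g : dz a (g / of_poly Q) = dz a g / of_poly Q
    - g / of_poly Q * of_poly Q^`M(a) / of_poly Q.
  rewrite dzM dzV dz_poly mulNr mulrN.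
  by rewrite expr2 invfM !mulrA (mulrAC g).
rewrite !E2 !raddfB /= [dz k (_ / _ * _)]dzM [dz l (_ / _ * _)]dzM !E !dz_poly.
rewrite (mderiv_comm k l P) (mderiv_comm k l Q).
exact: mixed_second_derivative.
Qed.
Lemma residue0 : residue i j (0 : ratfun F n) = 0.
Proof. exact/linear_at0/residue_linear. Qed.
Lemma residue_sum (I : Type) (s : seq I) (P : pred I) (G : I -> ratfun F n) :
  residue i j (\sum_(k <- s | P k) G k) = \sum_(k <- s | P k) residue i j (G k).
Proof.
exact/linear_at_sum/residue_linear.
Qed.

(** For k = j, the derivation in z_j after the substitution z_i = z_j corresponds
    to d_i + d_j before it, and the summand d_i contributes nothing, the residue
    of a derivative in z_i being zero. *)
Lemma residue_dz k f : k != i -> residue i j (dz k f) = dz k (residue i j f).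
Proof.
move=> ki.
have [N [g [hg ->]]] := pole_decomposition f.
rewrite residue_pole // /pole_coef linearZ /= merge_varE dz_rename; last first.
  exact: regular_iter_dz.
have it l : iter N (dz i) (dz l g) = dz l (iter N (dz i) g).
  by elim: N => //= N ->; rewrite dzC.
case: (eqVneq k j) => [kj|kj]; last first.
  rewrite (bigD1 k) /=; last by rewrite /merge (negPf ki).
  rewrite big1 ?addr0; last first.
    move=> l /andP[/eqP]; rewrite /merge; case: ifP => _ h; last by rewrite h eqxx.
    by move: kj; rewrite -h eqxx.
  rewrite dz_pole dz_zdiffE ![_ == k]eq_sym (negPf ki) (negPf kj) subrr scale0r mul0r.
  rewrite scaler0 subr0 -pole_shift.
  by rewrite residue_pole; [rewrite /pole_coef it|exact: regular_dz].
(* d_i + d_j kills z_ij, so it acts on the numerator alone *)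
have -> : residue i j (dz k (z i j ^- N.+1 * g)) =
    residue i j (dz i (z i j ^- N.+1 * g) + dz k (z i j ^- N.+1 * g)).
  by rewrite -[dz i _]scale1r residue_linear residue_dz_self scaler0 add0r.
have -> : dz i (z i j ^- N.+1 * g) + dz k (z i j ^- N.+1 * g) =
    z i j ^- N.+1 * (dz i g + dz k g).
  rewrite !dz_pole -mulrDr pole_shift; congr (_ * _).
  rewrite dz_zij dz_zdiffE -kj eqxx [i == k]eq_sym (negPf ki).
  by rewrite sub0r scaleN1r mulN1r mul1r scalerN; ring.
rewrite residue_pole; last by have [] := regularD (regular_dz i hg) (regular_dz k hg).
rewrite /pole_coef; congr (_ *: _).
rewrite (_ : iter N _ _ = dz i (iter N (dz i) g) + dz k (iter N (dz i) g)); last first.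
  by rewrite -!it; elim: N {it} => //= N ->; rewrite raddfD.
have hN := regular_iter_dz i N hg.
have [_ ->] := regularD (regular_dz i hN) (regular_dz k hN).
rewrite kj (bigD1 i) /=; last by rewrite /merge eqxx.
rewrite (bigD1 j) /=; last by rewrite /merge if_same eqxx eq_sym.
rewrite big1 ?addr0 // => l /andP[/andP[/eqP]]; rewrite /merge.
by case: eqVneq => // _ -> _; rewrite eqxx.
Qed.

Lemma dz_residue_self f : dz i (residue i j f) = 0.
Proof.
have [N [g [hg ->]]] := pole_decomposition f.
rewrite residue_pole // /pole_coef linearZ /= merge_varE dz_rename; last first.
  exact: regular_iter_dz.
rewrite big1 ?scaler0 // => l /eqP; rewrite /merge.
by case: eqVneq => [_ ji|/eqP ne /ne//]; move: ij; rewrite ji eqxx.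
Qed.

Lemma residueMr h f : reg h -> dz i h = 0 -> sub h = h ->
  residue i j (h * f) = h * residue i j f.
Proof.
move=> hh dh sh; have [N [g [hg ->]]] := pole_decomposition f.
rewrite mulrCA !residue_pole //; last by have [] := regularM hh hg.
rewrite /pole_coef.
have -> : iter N (dz i) (h * g) = h * iter N (dz i) g.
  by elim: N => //= N ->; rewrite dzM dh mul0r add0r.
have [_ ->] := regularM hh (regular_iter_dz i N hg).
by rewrite sh !ratfun_scaleE mulrCA.
Qed.

Lemma residueMzdiff k l f : k != i -> l != i ->
  residue i j (z k l * f) = z k l * residue i j f.
Proof.
move=> ki li; apply: residueMr; first by rewrite zdiffE; exact: regular_poly.
  by rewrite dz_zdiffE (negPf ki) (negPf li) subr0 scale0r.
by rewrite merge_varE ratfun_subst_zdiff /merge (negPf ki) (negPf li).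
Qed.
End OneDiagonal.
End Residue.

(** * Iterated residues *)

Section Elimination.
Variables (F : fieldType) (charF0 : [pchar F] =i pred0) (n : nat).
Implicit Types (f g : ratfun F n) (es : seq ('I_n * 'I_n)).
Local Notation z := (zdiff F).

Definition elim_residue es f := foldl (fun g e => residue e.1 e.2 g) f es.

(** Each edge (i, j) eliminates the variable z_i, which must not occur later. *)
Fixpoint elim_ok es := if es is e :: es' then
  [&& e.1 != e.2, all (fun e' => (e'.1 != e.1) && (e'.2 != e.1)) es' & elim_ok es']
  else true.

Lemma elim_okP e es : elim_ok (e :: es) ->
  [/\ e.1 != e.2, forall e', e' \in es -> (e'.1 != e.1) && (e'.2 != e.1) & elim_ok es].
Proof. by move=> /= /and3P[? /allP? ?]. Qed.

Lemma elim_residue_linear es : elim_ok es -> linear (elim_residue es).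
Proof.
elim: es => [//|e es IH] /elim_okP[ne _ /IH{}IH] c f g.
by rewrite /= residue_linear // IH.
Qed.
Lemma elim_residue0 es : elim_ok es -> elim_residue es 0 = 0.
Proof.
by move=> /elim_residue_linear/linear_at0. Qed.
Lemma elim_residue_sum es (I : Type) (s : seq I) (P : pred I) (G : I -> ratfun F n) :
  elim_ok es ->
  elim_residue es (\sum_(k <- s | P k) G k) = \sum_(k <- s | P k) elim_residue es (G k).
Proof.
by move=> /elim_residue_linear h; exact: linear_at_sum.
Qed.
Lemma elim_residueZ es c f : elim_ok es ->
  elim_residue es (c *: f) = c *: elim_residue es f.
Proof.
by move=> /elim_residue_linear h; exact: linear_atZ.
Qed.

Lemma elim_residue_dz_keep es i f : elim_ok es -> i \notin map fst es ->
  elim_residue es (dz i f) = dz i (elim_residue es f).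
Proof.
elim: es f => [//|e es IH] f /elim_okP[ne _ hes] /=; rewrite inE negb_or => /andP[ie hi].
by rewrite residue_dz // IH.
Qed.
Lemma elim_residue_dz es i f : elim_ok es -> i \in map fst es ->
  elim_residue es (dz i f) = 0.
Proof.
elim: es f => [//|e es IH] f /elim_okP[ne _ hes] /=; rewrite inE.
have [->|ie] /= := eqVneq i e.1; first by rewrite residue_dz_self // elim_residue0.
by move=> hi; rewrite residue_dz // IH.
Qed.
Lemma dz_elim_residue es i f : elim_ok es -> i \in map fst es ->
  dz i (elim_residue es f) = 0.
Proof.
elim: es f => [//|e es IH] f /elim_okP[ne hv hes] /=; rewrite inE.
have [->|ie] /= := eqVneq i e.1; last by move=> hi; rewrite IH.
move=> _; rewrite -elim_residue_dz_keep ?dz_residue_self ?elim_residue0 //.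
by apply/negP => /mapP[e' /hv/andP[/eqP h _] /esym].
Qed.
Lemma elim_residueMzdiff es i j f : elim_ok es ->
  i \notin map fst es -> j \notin map fst es ->
  elim_residue es (z i j * f) = z i j * elim_residue es f.
Proof.
elim: es f => [//|e es IH] f /elim_okP[ne hv hes] /=; rewrite !inE !negb_or.
by move=> /andP[ie hi] /andP[je hj]; rewrite residueMzdiff // IH.
Qed.

(** ** Residues of generated algebras *)

(** The generators of a ring of functions with poles allowed along the
    diagonals in A. *)
Definition pole_gen (Z : set (ratfun F n)) (A : set ('I_n * 'I_n)) : set (ratfun F n) :=
  [set f | Z f \/ exists e, [/\ A e, e.1 != e.2 & f = (z e.1 e.2)^-1]].

Lemma adjoin_sub (S S' : set (ratfun F n)) : S `<=` adjoin S' -> adjoin S `<=` adjoin S'.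
Proof.
move=> h; apply: adjoin_ind => //; split=> [|c f g hf hg|f g]; first exact: adjoin1.
  exact: submodL.
exact: adjoinM.
Qed.
Lemma adjoin_mono (S S' : set (ratfun F n)) : S `<=` S' -> adjoin S `<=` adjoin S'.
Proof. by move=> h; apply: adjoin_sub => f /h; exact: adjoin_gen. Qed.

Lemma adjoinX (S : set (ratfun F n)) f k : adjoin S f -> adjoin S (f ^+ k).
Proof.
by move=> hf; elim: k => [|k IH]; [exact: adjoin1|rewrite exprS; exact: adjoinM].
Qed.

Lemma adjoin_pole_decomposition (S0 : set (ratfun F n)) i j f : i != j ->
  adjoin S0 (z i j) -> adjoin (S0 `|` [set (z i j)^-1]) f ->
  exists N g, adjoin S0 g /\ f = z i j ^- N.+1 * g.
Proof.
move=> ij hz; have z0 := zij_neq0 F ij.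
pose A : set (ratfun F n) := [set f | exists N g, adjoin S0 g /\ f = z i j ^- N.+1 * g].
have A0 g : adjoin S0 g -> A g.
  move=> hg; exists 0, (z i j * g); split; first exact: adjoinM.
  by rewrite expr1 mulKf.
have raise N k g : adjoin S0 g -> exists2 g', adjoin S0 g' & z i j ^- N.+1 * g = z i j ^- (N + k).+1 * g'.
  move=> hg; exists (z i j ^+ k * g); first by apply: adjoinM => //; exact: adjoinX.
  by rewrite -addSn exprN_mulKf.
apply: (@adjoin_ind _ _ _ A).
  split=> [|c _ _ [N [g [hg ->]]] [N' [g' [hg' ->]]]|_ _ [N [g [hg ->]]] [N' [g' [hg' ->]]]].
  - by apply: A0; exact: adjoin1.
  - have [h hh ->] := raise N N' g hg; have [h' hh' ->] := raise N' N g' hg'.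
    exists (N + N')%N, (c *: h + h'); split; first exact: submodL.
    by rewrite [(N' + N)%N]addnC mulrDr !ratfun_scaleE mulrCA.
  - exists (N + N'.+1)%N, (g * g'); split; first exact: adjoinM.
    by rewrite -addSn exprN_mulACA.
move=> g [/adjoin_gen/A0//|->].
by exists 0, 1; rewrite mulr1; split=> //; exact: adjoin1.
Qed.

(** Taking the residue along z_i = z_j consumes the pole there, and carries
    the other poles to the diagonals to which they specialize. *)
Lemma residue_pole_gen (Z Z' : set (ratfun F n)) (A A' : set ('I_n * 'I_n)) i j f :
  i != j ->
  (forall g, Z g -> adjoin Z (dz i g)) ->
  (forall g, Z g -> regular_at (@merge_var F n i j) g /\
     adjoin Z' (ratfun_subst (@merge_var F n i j) g)) ->
  adjoin Z (z i j) ->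
  (forall e, A e -> e.1 != e.2 -> e != (i, j) -> e != (j, i) ->
     A' (merge i j e.1, merge i j e.2)) ->
  adjoin (pole_gen Z A) f ->
  adjoin (pole_gen Z' A') (residue i j f) /\
  (~ A (i, j) -> ~ A (j, i) -> residue i j f = 0).
Proof.
move=> ij hdz hsub hzij hA hf.
pose A0 := [set e : 'I_n * 'I_n | [/\ A e, e != (i, j) & e != (j, i)]].
pose S0 := pole_gen Z A0.
have ZS0 : adjoin Z `<=` adjoin S0 by apply: adjoin_mono => g; left.
have S0dz g : S0 g -> adjoin S0 (dz i g).
  case=> [/hdz/ZS0//|[e [Ae ne ->]]].
  have h : adjoin S0 (z e.1 e.2)^-1 by apply: adjoin_gen; right; exists e.
  rewrite dzV dz_zdiffE expr2 invfM; apply: adjoinM; last exact: adjoinM.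
  by apply: submodN; apply: submodZ; exact: adjoin1.
have S0sub g : S0 g -> regular_at (@merge_var F n i j) g /\
    adjoin (pole_gen Z' A') (ratfun_subst (@merge_var F n i j) g).
  case=> [/hsub[r h]|[e [[Ae n1 n2] ne ->]]].
    by split=> //; move: h; apply: adjoin_mono => h; left.
  have hne : merge i j e.1 != merge i j e.2.
    move: n1 n2 ne; case: e {Ae} => a b /=; rewrite /merge /= !xpair_eqE.
    have [->|ai] := eqVneq a i; have [->|bi] := eqVneq b i; rewrite ?eqxx //=.
    - by move=> n1 _ _; rewrite eq_sym.
    - by move=> _; rewrite andbT.
  have [r er] := regular_zdiffV F hne; rewrite merge_varE er.
  split=> //; apply: adjoin_gen; right; exists (merge i j e.1, merge i j e.2).
  by split=> //; apply: hA.
have {}hsub0 := adjoin_subst S0sub.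
have {}hdz0 := adjoin_dz S0dz.
have hff : adjoin (S0 `|` [set (z i j)^-1]) f.
  move: hf; apply: adjoin_sub => g [Zg|[e [Ae ne ->]]].
    by apply: adjoin_gen; left; left.
  have [->|n1] := eqVneq e (i, j); first by apply: adjoin_gen; right.
  have [->|n2] := eqVneq e (j, i).
    have -> : (z (j, i).1 (j, i).2)^-1 = - (z i j)^-1 by rewrite -invrN /zdiff opprB.
    apply: submodN.
    by apply: adjoin_gen; right.
  by apply: adjoin_gen; left; right; exists e.
split=> [|nA1 nA2].
  have [N [g [hg ->]]] := adjoin_pole_decomposition ij (ZS0 _ hzij) hff.
  rewrite residue_pole //; last by have [] := hsub0 g hg.
  apply: submodZ; suff hN : adjoin S0 (iter N (dz i) g) by have [] := hsub0 _ hN.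
  by elim: N => //= N; exact: hdz0.
have hf0 : adjoin S0 f.
  move: hf; apply: adjoin_mono => g [Zg|[e [Ae ne ->]]]; first by left.
  right; exists e; split=> //; split=> //.
    by apply/eqP => ee; move: nA1; rewrite -ee.
  by apply/eqP => ee; move: nA2; rewrite -ee.
by apply: residue_regular => //; have [] := hsub0 _ hf0.
Qed.

Definition diffs (S : {set 'I_n}) : set (ratfun F n) :=
  [set f | exists i j, [/\ i \in S, j \in S & f = z i j]].
Definition OTon (S : {set 'I_n}) :=
  adjoin (pole_gen (diffs S) [set e | e.1 \in S /\ e.2 \in S]).

Lemma OT_OTon f : OT_set F n f -> OTon [set: 'I_n]%SET f.
Proof.
apply: adjoin_sub => g [i [j [ij [->|->]]]]; apply: adjoin_gen.
  by left; exists i, j; rewrite !inE.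
right; exists (i, j); split=> //=; first by rewrite !inE.
by apply/eqP => e; move: ij; rewrite e ltnn.
Qed.

Lemma residue_OTon (S : {set 'I_n}) i j f : i != j -> i \in S -> j \in S ->
  OTon S f -> OTon (S :\ i) (residue i j f).
Proof.
move=> ij iS jS hf.
have hm k : k \in S -> merge i j k \in (S :\ i).
  move=> kS; rewrite /merge !inE; case: (eqVneq k i) => [_|ki]; last by rewrite kS ki.
  by rewrite eq_sym ij jS.
have [] // := @residue_pole_gen (diffs S) (diffs (S :\ i))
   [set e | e.1 \in S /\ e.2 \in S] [set e | e.1 \in (S :\ i) /\ e.2 \in (S :\ i)] i j f ij.
- move=> _ [k [l [kS lS ->]]]; rewrite dz_zdiffE; apply: submodZ; exact: adjoin1.
- move=> _ [k [l [kS lS ->]]]; rewrite merge_varE ratfun_subst_zdiff.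
  split; first exact: regular_zdiff.
  by apply: adjoin_gen; exists (merge i j k), (merge i j l); split=> //; exact: hm.
- by apply: adjoin_gen; exists i, j.
- by move=> e [/hm h1 /hm h2] _ _ _.
Qed.

Lemma elim_residue_OTon es (S : {set 'I_n}) f : elim_ok es ->
  (forall e, e \in es -> (e.1 \in S) && (e.2 \in S)) ->
  OTon S f -> OTon [set k in S | k \notin map fst es]%SET (elim_residue es f).
Proof.
elim: es S f => [|e es IH] S f.
  move=> _ _; congr (submod_set (OTon _) _).
  by apply/setP => k; rewrite !inE andbT.
move=> /elim_okP[ne hv hes] hS hf; have /andP[h1 h2] := hS e (mem_head _ _).
have hf' := residue_OTon ne h1 h2 hf.
have {}hS e' : e' \in es -> (e'.1 \in (S :\ e.1)) && (e'.2 \in (S :\ e.1)).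
  move=> he'; rewrite !inE; have /andP[-> ->] := hv _ he'.
  by have /andP[-> ->] : (e'.1 \in S) && (e'.2 \in S) by apply: hS; rewrite inE he' orbT.
have := IH _ _ hes hS hf'; congr (submod_set (OTon _) _).
by apply/setP => k; rewrite !inE negb_or; case: (k == e.1); rewrite /= ?andbF.
Qed.

(** ** Vanishing of high Fourier coefficients *)
Section Finiteness.
Variable root : 'I_n -> 'I_n.
Definition root_kernel (S : {set 'I_n}) (a : 'I_n -> nat) : ratfun F n :=
  \prod_(i in S) z (root i) i ^+ a i.

Lemma residueM_prod i j (S : {set 'I_n}) a f : i != j ->
  i \notin S -> (forall k, root k != i) ->
  residue i j (root_kernel S a * f) = root_kernel S a * residue i j f.
Proof.
move=> ij iS hroot; rewrite /root_kernel; elim/big_rec: _ f => [|k x kS IH] f.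
  by rewrite !mul1r.
rewrite -!mulrA -IH; elim: (a k) (x * f) => [|b IHb] g; first by rewrite !mul1r.
rewrite !exprS -!mulrA residueMzdiff ?IHb //.
by apply: contraNneq iS => <-.
Qed.

(** As long as a pole at z_i = z_j has order at most M, only the terms of
    degree at most M in z_ij contribute to the residue of
    u_i^a = (u_j - z_ij)^a, where u_k is z_(root k) - z_k; so a high power of
    u_i becomes a high power of u_j, and in the end of 0. *)
Lemma elim_residue_finite es (S : {set 'I_n}) f : elim_ok es ->
  (forall e, e \in es -> [/\ e.1 \in S, e.2 \in S & root e.1 = root e.2]) ->
  (forall i, root i \notin map fst es) ->
  (forall i, i \in S -> (i \in map fst es) || (root i == i)) ->
  exists N, forall a, (exists2 i, i \in S & (N <= a i)%N) ->
    elim_residue es (f * root_kernel S a) = 0.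
Proof.
elim: es S f => [|[i j] es IH] S f.
  move=> _ _ _ hS; exists 1 => a [i iS ai]; have := hS i iS; rewrite /= => /eqP ri.
  rewrite /root_kernel (bigD1 i) //= ri /zdiff subrr expr0n.
  by case: (a i) ai => // k _; rewrite mul0r mulr0.
move=> /elim_okP[/= ij hv hes] hS hroot hcov.
have hri k : root k != i by move: (hroot k); rewrite inE negb_or => /andP[].
have [iS jS rij] := hS (i, j) (mem_head _ _); rewrite /= in iS jS rij.
have [M [g [hg ef]]] := pole_decomposition ij f.
have high c : (M < c)%N -> residue i j (f * z i j ^+ c) = 0.
  move=> lt; apply: residue_regular => //.
  have [hc _] := regularX (c - M.+1) (@regular_zdiff F n n (merge i j) i j).
  have [h _] := regularM hc hg.
  rewrite ef -(subnK lt) exprD exprN_mul_expr //.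
  exact: zij_neq0.
have IHc c := IH (S :\ i) (residue i j (f * z i j ^+ c)) hes.
have [e'|k|k|NN hNN] := choice (fun c => IHc c _ _ _).
- move=> he'; have /andP[n1 n2] := hv _ he'.
  have [h1 h2 h3] := hS e' (mem_behead (s := (i, j) :: es) he').
  by rewrite !inE n1 n2 h1 h2.
- by move: (hroot k); rewrite inE negb_or => /andP[].
- by rewrite !inE => /andP[ki /hcov]; rewrite inE /= (negPf ki).
pose N := (\max_(c < M.+1) NN c)%N.
exists (N + M.+1)%N => a [k kS ak].
have jSi : j \in S :\ i by rewrite !inE eq_sym ij jS.
have eK : root_kernel S a = z (root i) i ^+ a i * root_kernel (S :\ i) a.
  by rewrite /root_kernel (big_setD1 i).
pose a' c l := if l == j then (a j + (a i - c))%N else a l.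
have eKj c : z (root j) j ^+ (a i - c) * root_kernel (S :\ i) a = root_kernel (S :\ i) (a' c).
  rewrite /root_kernel [in LHS](big_setD1 j jSi) [in RHS](big_setD1 j jSi) /=.
  rewrite mulrA -exprD addnC {1}/a' eqxx; congr (_ * _).
  by apply: eq_bigr => l; rewrite !inE /a' => /andP[/negPf->].
have eu : z (root i) i = z (root j) j - z i j.
  by rewrite rij /zdiff; ring.
rewrite eK eu exprBn mulr_suml mulr_sumr /= residue_sum // elim_residue_sum //.
apply: big1 => c _.
have -> : f * ((-1) ^+ c * z (root j) j ^+ (a i - c) * z i j ^+ c *+ 'C(a i, c) *
      root_kernel (S :\ i) a) = ((-1) ^+ c * 'C(a i, c)%:R) *:
      (root_kernel (S :\ i) (a' c) * (f * z i j ^+ c)).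
  rewrite -eKj ratfun_scaleE mpolyCM of_polyM.
  have -> : of_poly ('C(a i, c)%:R%:MP : {mpoly F[n]}) = 'C(a i, c)%:R.
    by rewrite /of_poly !rmorph_nat.
  have -> : of_poly (((-1) ^+ c)%:MP : {mpoly F[n]}) = (-1) ^+ c.
    by rewrite /of_poly !(rmorphXn, rmorphN, rmorph1).
  by rewrite -[_ *+ 'C(_, _)]mulr_natr; ring.
rewrite -[_ *: _]addr0 residue_linear // residueM_prod // ?inE ?eqxx //.
rewrite residue0 // addr0 elim_residueZ //.
case: (ltnP M c) => [lt|le]; first by rewrite high // mulr0 elim_residue0 // scaler0.
rewrite [root_kernel _ _ * _]mulrC hNN ?scaler0 //.
have leN : (NN c <= N)%N by apply: (leq_bigmax (Ordinal (le : c < M.+1)%N)).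
have [ki|ki] := eqVneq k i; last first.
  exists k; first by rewrite !inE ki kS.
  rewrite /a'; case: eqP => [kj|_]; first by rewrite -kj; lia.
  by lia.
by exists j => //; rewrite /a' eqxx; move: ak; rewrite ki; lia.
Qed.
End Finiteness.
End Elimination.

(** * Lines and their residues *)

Section LineCombinatorics.
Variable T : eqType.
Implicit Types (l : seq T) (ls : seq (seq T)).
Definition chain_edges l := zip l (behead l).
Definition chains_edges ls := flatten (map chain_edges ls).

Lemma chain_edges_cons x y l : chain_edges (x :: y :: l) = (x, y) :: chain_edges (y :: l).
Proof. by []. Qed.

Lemma chain_edges_belast x l : map fst (chain_edges (x :: l)) = belast x l.
Proof. by elim: l x => //= y l IH x; rewrite -IH. Qed.

Lemma mem_chain_edges l e : e \in chain_edges l -> (e.1 \in l) && (e.2 \in l).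
Proof.
elim: l => // x [//|y l] IH; rewrite chain_edges_cons inE => /orP[/eqP->|/IH/andP[h1 h2]].
  by rewrite /= !inE !eqxx orbT.
by rewrite ![_ \in x :: _]inE h1 h2 !orbT.
Qed.
Lemma mem_chains_edges ls e : e \in chains_edges ls ->
  (e.1 \in flatten ls) && (e.2 \in flatten ls).
Proof.
move=> /flatten_mapP[l hl /mem_chain_edges/andP[h1 h2]].
by apply/andP; split; apply/flattenP; exists l.
Qed.
End LineCombinatorics.

Lemma chains_elim_ok n (ls : seq (seq 'I_n)) : uniq (flatten ls) ->
  elim_ok (chains_edges ls).
Proof.
elim: ls => // l ls IH; rewrite [flatten _]/= cat_uniq => /and3P[ul dis uls].
have {IH} := IH uls; rewrite /chains_edges /= -/(chains_edges ls).
elim: l ul dis => // x [//|y l] IH ul dis ok.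
have /andP[xl ul'] : (x \notin y :: l) && uniq (y :: l) by move: ul; rewrite cons_uniq.
rewrite chain_edges_cons cat_cons /=; apply/and3P; split.
- by move: xl; rewrite inE negb_or => /andP[].
- apply/allP => e; rewrite mem_cat => /orP[/mem_chain_edges|/mem_chains_edges] /andP[h1 h2].
    by apply/andP; split; apply: contraNneq xl => <-.
  apply/andP; split; apply: contraNneq dis => e1; apply/hasP.
    by exists e.1 => //; rewrite e1 mem_head.
  by exists e.2 => //; rewrite e1 mem_head.
- by apply: IH => //; apply: contraNN dis => /hasP[t h1 h2]; apply/hasP; exists t => //; rewrite inE h2 orbT.
Qed.

Section Lines.
Variables (F : fieldType) (charF0 : [pchar F] =i pred0) (n p : nat).
Variables (L : lines n p) (hL : is_lines L).
Implicit Types (f g : ratfun F n) (a b : 'X_{1..n}).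
Local Notation z := (zdiff F).

Definition line_seqs : seq (seq 'I_n) := [seq val l | l <- L].
(** The residues along the last line are taken first. *)
Definition elim_edges := chains_edges (rev line_seqs).

Lemma lines_residueE f :
  lines_residue L f = ratfun_subst (line_var F L) (elim_residue elim_edges f).
Proof.
rewrite /lines_residue /elim_edges /line_seqs; congr ratfun_subst.
elim: (L : seq (n.-bseq 'I_n)) => //= l s ->.
rewrite rev_cons /chains_edges map_rcons flatten_rcons.
by rewrite /elim_residue foldl_cat.
Qed.

Lemma lines_nonempty (l : 'I_p) : (0 < size (tnth L l))%N.
Proof. by have /and4P[/allP h _ _ _] := hL; apply: h; exact: mem_tnth. Qed.
Lemma lines_perm : perm_eq (flatten line_seqs) (enum 'I_n).
Proof. by have /and4P[] := hL. Qed.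
Lemma lines_uniq : uniq (flatten line_seqs).
Proof. by rewrite (perm_uniq lines_perm) enum_uniq. Qed.
Lemma flatten_rev_perm (T : eqType) (ls : seq (seq T)) :
  perm_eq (flatten (rev ls)) (flatten ls).
Proof.
by elim: ls => //= l ls IH; rewrite rev_cons flatten_rcons perm_catC perm_cat2l.
Qed.
Lemma elim_edges_ok : elim_ok elim_edges.
Proof.
apply: chains_elim_ok.
by rewrite (perm_uniq (flatten_rev_perm _)) lines_uniq.
Qed.

Lemma line_exists i : exists l, i \in tnth L l.
Proof.
have : i \in flatten line_seqs by rewrite (perm_mem lines_perm) mem_enum.
by move=> /flattenP[s /mapP[l /tnthP[k ->] ->] hi]; exists k.
Qed.
Definition line_of i : 'I_p := xchoose (line_exists i).
Lemma mem_line_of i : i \in tnth L (line_of i).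
Proof. exact: (xchooseP (line_exists i)). Qed.

Lemma line_seqs_nth (l : 'I_p) : nth [::] line_seqs l = tnth L l :> seq 'I_n.
Proof.
rewrite /line_seqs (nth_map (insub_bseq n [::])) ?size_tuple //.
by rewrite -tnth_nth.
Qed.

Lemma uniq_flatten_nth (T : eqType) (ls : seq (seq T)) i j x : uniq (flatten ls) ->
  (i < j)%N -> x \in nth [::] ls i -> x \in nth [::] ls j -> False.
Proof.
elim: ls i j => [|l ls IH] i j /=; first by rewrite !nth_nil.
rewrite cat_uniq => /and3P[_ /hasP dis u]; case: j => // j; case: i => [_ /= hx hy|i]; last exact: (IH i j u).
apply: dis; exists x => //; apply/flattenP; exists (nth [::] ls j) => //.
by apply: mem_nth; rewrite ltnNge; apply/negP => le; move: hy; rewrite nth_default.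
Qed.

Lemma line_ofE i l : i \in tnth L l -> line_of i = l.
Proof.
have mE k : (i \in tnth L k) = (i \in nth [::] line_seqs k) by rewrite line_seqs_nth.
move=> hi; have := mem_line_of i; move: hi; rewrite !mE => hi hi'.
have u := lines_uniq.
apply/val_inj; case: (ltngtP (line_of i) l) => // lt.
  by case: (uniq_flatten_nth u lt hi' hi).
by case: (uniq_flatten_nth u lt hi hi').
Qed.
Lemma mem_line i l : (i \in tnth L l) = (line_of i == l).
Proof. by apply/idP/eqP => [/line_ofE//|<-]; exact: mem_line_of. Qed.

Lemma line_varE : line_var F L = rename F line_of.
Proof.
apply: funext => i; rewrite /line_var (big_pred1 (line_of i)) // => l /=.
by rewrite mem_line eq_sym.
Qed.

Definition line_last (l : 'I_p) (i : 'I_n) : 'I_n := last i (tnth L l).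
Definition root i := line_last (line_of i) i.

Lemma line_uniq l : uniq (tnth L l).
Proof.
have := lines_uniq; rewrite -(@line_seqs_nth l).
elim: line_seqs (l : nat) => [|s ls IH] k /=; first by rewrite nth_nil.
rewrite cat_uniq => /and3P[us _ uls]; case: k => //= k; exact: IH.
Qed.

Lemma tnth_cons l : exists x s, tnth L l = x :: s :> seq 'I_n.
Proof. by have := lines_nonempty l; case: (val (tnth L l)) => // x s _; exists x, s. Qed.

Lemma mem_tnth_seq i l : (i \in tnth L l) = (i \in bseqval (tnth L l)).
Proof. by []. Qed.
Lemma root_line i : root i \in tnth L (line_of i).
Proof.
rewrite mem_tnth_seq /root /line_last.
by have [x [s ->]] := tnth_cons (line_of i); rewrite /= mem_last.
Qed.
Lemma line_of_root i : line_of (root i) = line_of i.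
Proof. exact/line_ofE/root_line. Qed.
Lemma root_eq i j : line_of i = line_of j -> root i = root j.
Proof.
by rewrite /root /line_last => ->; have [x [s ->]] := tnth_cons (line_of j).
Qed.
Lemma root_root i : root (root i) = root i.
Proof. exact/root_eq/line_of_root. Qed.
Lemma root_inj i j : root i = i -> root j = j -> line_of i = line_of j -> i = j.
Proof. by move=> hi hj h; rewrite -hi -hj; exact: root_eq. Qed.

Lemma mem_elim_edges e :
  e \in elim_edges <-> exists l, e \in line_edges (tnth L l).
Proof.
split.
  move=> /flatten_mapP[s]; rewrite mem_rev => /mapP[t /tnthP[l ->] ->] he.
  by exists l.
move=> [l he]; apply/flatten_mapP; exists (tnth L l : seq 'I_n) => //.
by rewrite mem_rev map_f ?mem_tnth.
Qed.
Lemma elim_edges_line e : e \in elim_edges -> line_of e.1 = line_of e.2.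
Proof.
move=> /mem_elim_edges[l /mem_chain_edges/andP[h1 h2]].
by rewrite (line_ofE h1) (line_ofE h2).
Qed.

(** Along a line, each vertex but the last is the origin of one arc. *)
Lemma eliminated i : (i \in map fst elim_edges) = (root i != i).
Proof.
apply/idP/idP.
  move=> /mapP[e /mem_elim_edges[l he] ->].
  have : e.1 \in map fst (line_edges (tnth L l)) by apply: map_f.
  have /andP[h1 _] := mem_chain_edges he.
  rewrite /root /line_last (line_ofE h1); have := line_uniq l.
  have [x [s ->]] := tnth_cons l; rewrite [map _ _]chain_edges_belast lastI rcons_uniq.
  by rewrite last_rcons => /andP[nl _] h; apply: contraNneq nl => ->.
move=> ri; have := mem_line_of i; rewrite mem_tnth_seq.
have [x [s e]] := tnth_cons (line_of i).
rewrite e lastI mem_rcons inE => /orP[/eqP ei|hi].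
  by move: ri; rewrite /root /line_last e {2}ei /= eqxx.
have : i \in map fst (line_edges (tnth L (line_of i))) by rewrite e [map _ _]chain_edges_belast.
by move=> /mapP[ee he ->]; apply: map_f; apply/mem_elim_edges; exists (line_of i).
Qed.
Lemma root_not_eliminated i : root i \notin map fst elim_edges.
Proof. by rewrite eliminated root_root eqxx. Qed.

(** ** Fourier coefficients *)

Definition kernel a : ratfun F n := root_kernel F root [set: 'I_n]%SET a.

Lemma fourier_kernelE a : fourier_kernel F L a = kernel a.
Proof.
rewrite /kernel /root_kernel.
have -> : \prod_(i in [set: 'I_n]%SET) z (root i) i ^+ a i =
    \prod_(i <- enum 'I_n) z (root i) i ^+ a i.
  by rewrite big_enum; apply: eq_bigl => i; rewrite inE.
rewrite -(perm_big _ lines_perm) /= big_flatten /line_seqs big_map.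
rewrite /fourier_kernel -(big_tuple _ _ L xpredT
  (fun l => \prod_(i <- l) z (last i l) i ^+ a i)) /=.
rewrite big_seq [RHS]big_seq; apply: eq_bigr => l /tnthP[k ->].
rewrite big_seq [RHS]big_seq; apply: eq_bigr => i hi.
by rewrite /root /line_last (line_ofE hi).
Qed.

(** The Fourier coefficient in the variables z_i of the last vertices, before w_l
    is substituted for them. *)
Definition pre_coef f a := elim_residue elim_edges (f * kernel a).
Lemma fourier_coefE f a :
  fourier_coef L f a = ratfun_subst (rename F line_of) (pre_coef f a).
Proof. by rewrite /fourier_coef lines_residueE line_varE fourier_kernelE. Qed.

Lemma kernelD a b : kernel (a + b)%MM = kernel a * kernel b.
Proof.
rewrite /kernel /root_kernel -big_split; apply: eq_bigr => i _.
by rewrite mnmDE exprD.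
Qed.
Lemma kernelU i : kernel U_(i)%MM = z (root i) i.
Proof.
rewrite /kernel /root_kernel (bigD1 i) ?inE //= mnm1E eqxx expr1 big1 ?mulr1 //.
by move=> j /andP[_ /negPf h]; rewrite mnm1E eq_sym h expr0.
Qed.

(** Only one factor of the kernel involves the variable of a vertex that is not
    the last of its line. *)
Lemma dz_kernel i a : root i != i -> dz i (kernel a) = - ((a i)%:R *: kernel (a - U_(i))%MM).
Proof.
move=> ri; have dj (j : 'I_n) : j != i -> dz i (z (root j) j) = 0.
  move=> ji; rewrite dz_zdiffE (negPf ji).
  by case: eqVneq => [rj|]; [move: ri; rewrite -rj root_root eqxx|rewrite subr0 scale0r].
have dXn f k : dz i f = 0 -> dz i (f ^+ k) = 0.
  by case: k => [|k] df; rewrite ?expr0 ?dz1 // dzX df mulr0 scaler0.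
have dP : dz i (\prod_(j in [set: 'I_n]%SET | j != i) z (root j) j ^+ a j) = 0.
  apply: (big_ind (fun x => dz i x = 0)); first exact: dz1.
    by move=> x y hx hy; rewrite dzM hx hy mul0r mulr0 addr0.
  by move=> j /andP[_ ji]; apply/dXn/dj.
have e : kernel (a - U_(i))%MM = z (root i) i ^+ (a i).-1 *
    \prod_(j in [set: 'I_n]%SET | j != i) z (root j) j ^+ a j.
  rewrite /kernel /root_kernel (bigD1 i) ?inE //= mnmBE mnm1E eqxx subn1.
  congr (_ * _); apply: eq_bigr => j /andP[_ ji].
  by rewrite mnmBE mnm1E eq_sym (negPf ji) subn0.
rewrite e /kernel /root_kernel (bigD1 i) ?inE //= dzM dP mulr0 addr0.
case: (a i) => [|k]; first by rewrite expr0 dz1 mul0r scale0r oppr0.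
rewrite dzX dz_zdiffE (negPf ri) eqxx sub0r scaleN1r mulrN1 scalerN mulNr.
by rewrite !ratfun_scaleE mulrA.
Qed.

Lemma sum_dz_kernel l a : \sum_(i | line_of i == l) dz i (kernel a) = 0.
Proof.
pose S := [set i | line_of i == l]%SET.
have -> : \sum_(i | line_of i == l) dz i (kernel a) = dS S (kernel a).
  by apply: eq_bigl => i; rewrite inE.
apply: (big_ind (fun x => dS S x = 0)) => [|x y hx hy|j _]; first exact: dS1.
  by rewrite dSM hx hy mul0r mulr0 addr0.
case: (a j) => [|k]; first by rewrite expr0 dS1.
by rewrite dSX dS_zdiff !inE line_of_root subrr scale0r mulr0 scaler0.
Qed.

Lemma kernel_OT a : OT_set F n (kernel a).
Proof.
apply: big_ind => [|f g|i _]; [exact: adjoin1|exact: adjoinM|].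
by apply: adjoinX; exact: OT_zdiff.
Qed.

(** The remaining variables are the last vertices of the lines, on which the
    substitution is injective: so it meets no pole. *)
Lemma pre_coef_OT f a : OT_set F n f ->
  regular_at (rename F line_of) (pre_coef f a) /\
  OT_set F p (ratfun_subst (rename F line_of) (pre_coef f a)).
Proof.
move=> hf; have hfk : OT_set F n (f * kernel a) by apply: adjoinM => //; exact: kernel_OT.
have : OTon F [set k in [set: 'I_n] | k \notin map fst elim_edges]%SET (pre_coef f a).
  apply: elim_residue_OTon => //; first exact: elim_edges_ok.
    by move=> e _; rewrite !inE.
  exact: OT_OTon.
set S := [set k in _ | _]%SET.
have hS k : k \in S -> root k = k.
  by rewrite /S !inE eliminated negbK => /eqP.
apply: adjoin_subst => g [[i [j [iS jS ->]]]|[e [[h1 h2] ne ->]]].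
  by rewrite ratfun_subst_zdiff; split; [exact: regular_zdiff|exact: OT_zdiff].
have hne : line_of e.1 != line_of e.2.
  by apply: contraNneq ne => h; apply/eqP/root_inj => //; exact: hS.
by have [r ->] := regular_zdiffV F hne; split=> //; exact: OT_zdiffV.
Qed.

Lemma fourier_coef_OT f a : OT_set F n f -> OT_set F p (fourier_coef L f a).
Proof. by move=> hf; rewrite fourier_coefE; have [] := pre_coef_OT a hf. Qed.

Lemma pre_coef_linear a : linear (pre_coef^~ a).
Proof.
move=> c f g; rewrite /pre_coef -elim_residue_linear ?elim_edges_ok //.
by congr elim_residue; rewrite mulrDl !ratfun_scaleE mulrA.
Qed.
Lemma fourier_coef_linear c f g a : OT_set F n f -> OT_set F n g ->
  fourier_coef L (c *: f + g) a = c *: fourier_coef L f a + fourier_coef L g a.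
Proof.
move=> hf hg; rewrite !fourier_coefE pre_coef_linear.
have [h1 _] := pre_coef_OT a hf; have [h2 _] := pre_coef_OT a hg.
by have [_ ->] := regularL c h1 h2.
Qed.

Lemma fourier_coef_finite f : exists N, forall a, (exists i, (N <= a i)%N) ->
  fourier_coef L f a = 0.
Proof.
have [|||N hN] := @elim_residue_finite _ charF0 _ root elim_edges [set: 'I_n]%SET f elim_edges_ok.
- by move=> e /elim_edges_line/root_eq ->; rewrite !inE.
- exact: root_not_eliminated.
- by move=> i _; rewrite eliminated; case: eqP.
exists N => a [i ai]; rewrite fourier_coefE /pre_coef hN ?ratfun_subst0 //.
by exists i; rewrite ?inE.
Qed.

(** Multiplication of f by z_i is known from its effect for the last vertices
    and for the differences between a vertex and the last one of its line. *)
Lemma fourier_coefMu i f a :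
  fourier_coef L (z (root i) i * f) a = fourier_coef L f (a + U_(i))%MM.
Proof.
rewrite !fourier_coefE /pre_coef kernelD kernelU; congr (ratfun_subst _ (elim_residue _ _)).
by rewrite -mulrA mulrCA [kernel a * _]mulrC.
Qed.
Lemma fourier_coefMroot i j f a : OT_set F n f ->
  fourier_coef L (z (root i) (root j) * f) a =
  z (line_of i) (line_of j) * fourier_coef L f a.
Proof.
move=> hf; rewrite !fourier_coefE /pre_coef -mulrA.
rewrite elim_residueMzdiff ?elim_edges_ok ?root_not_eliminated //.
have [h _] := pre_coef_OT a hf.
have [_ ->] := regularM (@regular_zdiff F n p line_of (root i) (root j)) h.
by rewrite ratfun_subst_zdiff !line_of_root.
Qed.
(** The residue of the derivative of f times the kernel is zero, so the derivation
    can be moved to the kernel. *)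
Lemma fourier_coef_dz i f a : OT_set F n f -> root i != i ->
  fourier_coef L (dz i f) a = (a i)%:R *: fourier_coef L f (a - U_(i))%MM.
Proof.
move=> hf ri; rewrite !fourier_coefE /pre_coef.
have -> : dz i f * kernel a = (a i)%:R *: (f * kernel (a - U_(i))%MM) + dz i (f * kernel a).
  by rewrite dzM dz_kernel // mulrN ratfun_scaleE [(a i)%:R *: _]ratfun_scaleE; ring.
rewrite elim_residue_linear ?elim_edges_ok // elim_residue_dz ?elim_edges_ok ?eliminated //.
rewrite addr0; have [h _] := pre_coef_OT (a - U_(i))%MM hf.
by have [_ ->] := regularZ (a i)%:R h.
Qed.
Lemma fourier_coef_sum (I : Type) (r : seq I) (A : pred I) (G : I -> ratfun F n) a :
  (forall i, A i -> OT_set F n (G i)) ->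
  fourier_coef L (\sum_(i <- r | A i) G i) a = \sum_(i <- r | A i) fourier_coef L (G i) a.
Proof.
move=> hG; have f0 : fourier_coef L 0 a = 0 :> ratfun F p.
  have := fourier_coef_linear (-1) a (submod0 (OT_set F n)) (submod0 (OT_set F n)).
  by rewrite scaler0 addr0 => ->; rewrite scaleN1r addNr.
elim: r => [|i r IH]; first by rewrite !big_nil.
rewrite !big_cons; case: ifP => // Ai; rewrite -IH -[G i]scale1r fourier_coef_linear ?scale1r //.
  exact: hG.
exact: submod_sum.
Qed.

(** The derivations of a line sum to 0 on the kernel, and those of eliminated
    variables contribute 0 on both sides. *)
Lemma fourier_coef_dz_line l f a : OT_set F n f ->
  \sum_(i | line_of i == l) fourier_coef L (dz i f) a = dz l (fourier_coef L f a).
Proof.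
move=> hf; have [h _] := pre_coef_OT a hf.
rewrite -fourier_coef_sum; last by move=> i _; exact: OT_dz.
rewrite !fourier_coefE dz_rename //.
have [_ <-] := @regular_sum F n p (rename F line_of) _ (index_enum 'I_n)
  (fun i => line_of i == l) (fun i => dz i (pre_coef f a)) (fun i _ => regular_dz i h).
congr (ratfun_subst _ _); rewrite {1}/pre_coef.
have -> : (\sum_(i | line_of i == l) dz i f) * kernel a =
    \sum_(i | line_of i == l) dz i (f * kernel a).
  transitivity ((\sum_(i | line_of i == l) dz i f) * kernel a +
      f * \sum_(i | line_of i == l) dz i (kernel a)).
    by rewrite sum_dz_kernel mulr0 addr0.
  by rewrite mulr_suml mulr_sumr -big_split; apply: eq_bigr => i _; rewrite dzM.
rewrite elim_residue_sum ?elim_edges_ok //; apply: eq_bigr => i _.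
have [hi|hi] := boolP (i \in map fst elim_edges).
  by rewrite elim_residue_dz ?dz_elim_residue ?elim_edges_ok.
by rewrite elim_residue_dz_keep ?elim_edges_ok.
Qed.
End Lines.

(** * Expansions and the convolution product *)

Section FiniteSums.
Lemma finite_enum (T : choiceType) (S : set T) : finite_set S ->
  exists s : seq T, uniq s /\ forall x, (x \in s) <-> S x.
Proof.
move=> /finite_seqP[s ->]; exists (undup s); split; first exact: undup_uniq.
by move=> x; rewrite mem_undup.
Qed.

Lemma fsum_seq (T : choiceType) (M : nmodType) (S : set T) (f : T -> M) (s : seq T) :
  uniq s -> (forall x, S x -> f x != 0 -> x \in s) ->
  \sum_(x \in S) f x = \sum_(x <- s | `[< S x >]) f x.
Proof.
move=> us hs; rewrite (fsbigE [seq x <- s | `[< S x >]]).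
- rewrite big_filter_cond; apply: eq_bigl => x.
  by rewrite andb_idr // => /asboolP Sx; exact/mem_set.
- exact: filter_uniq.
- by move=> x /=; rewrite mem_filter => /andP[/asboolP].
- move=> x Sx; rewrite mem_filter negb_and => /orP[/asboolP//|xs].
  by apply/eqP; apply: contraNT xs => /(hs x Sx).
Qed.

Lemma fsum_enum (T : choiceType) (M : nmodType) (S : set T) (f : T -> M) (s : seq T) :
  uniq s -> (forall x, x \in s <-> S x) -> \sum_(x \in S) f x = \sum_(x <- s) f x.
Proof.
move=> us hs; rewrite (fsum_seq us); last by move=> x /hs.
rewrite big_seq_cond [RHS]big_seq; apply: eq_bigl => x.
by rewrite andb_idr // => /hs h; exact/asboolP.
Qed.

Lemma finite_box (I : finType) (M : nat) :
  finite_set [set k : {ffun I -> nat} | forall i, (k i <= M)%N].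
Proof.
have -> : [set k : {ffun I -> nat} | forall i, (k i <= M)%N] =
    (fun k : {ffun I -> 'I_M.+1} => [ffun i => val (k i)]) @` [set: {ffun I -> 'I_M.+1}].
  apply/seteqP; split=> [k hk|_ [k _ <-] i]; last by rewrite ffunE -ltnS ltn_ord.
  exists [ffun i => inord (k i)] => //; apply/ffunP => i; rewrite !ffunE /=.
  by rewrite inordK // ltnS.
by apply: finite_image; exact: finite_finset.
Qed.
Lemma finite_mnm_box p (M : nat) :
  finite_set [set m : 'X_{1..p} | forall i, (m i <= M)%N].
Proof.
apply: (@sub_finite_set _ _ ((fun k : {ffun 'I_p -> nat} => [multinom k i | i < p]) @`
   [set k : {ffun 'I_p -> nat} | forall i, (k i <= M)%N])).
  move=> m hm; exists [ffun i => m i] => [i|]; first by rewrite ffunE.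
  by apply/mnmP => i; rewrite mnmE ffunE.
by apply: finite_image; exact: finite_box.
Qed.
End FiniteSums.

Section Expansion.
Variables (F : fieldType) (charF0 : [pchar F] =i pred0) (p : nat).
Implicit Types (P Q R : {mpoly F[p]}) (f g : ratfun F p).
Local Notation E := {ffun 'I_p -> int}.
Implicit Types (a b c : E) (m : 'X_{1..p}) (x y : E -> F).

Definition mexp m : E := [ffun l => (m l)%:Z].
Definition unitE (l : 'I_p) : E := mexp U_(l)%MM.

Lemma mexpD m m' : mexp (m + m')%MM = mexp m + mexp m'.
Proof. by apply/ffunP => l; rewrite !ffunE mnmDE PoszD. Qed.
Lemma mexp0 : mexp 0%MM = 0.
Proof. by apply/ffunP => l; rewrite !ffunE mnm0E. Qed.
Lemma mexp_inj : injective mexp.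
Proof.
by move=> m m' /ffunP e; apply/mnmP => l; move: (e l); rewrite !ffunE => -[].
Qed.
Lemma unitEE l k : unitE l k = (l == k)%:Z.
Proof. by rewrite ffunE mnm1E. Qed.

Definition mfunctional (u : 'X_{1..p} -> F) P : F := \sum_(m <- msupp P) P@_m * u m.

Lemma mfunctionalE u s P : uniq s -> {subset msupp P <= s} ->
  mfunctional u P = \sum_(m <- s) P@_m * u m.
Proof.
move=> us hs; rewrite /mfunctional [RHS](bigID (mem (msupp P))) /= [X in _ + X]big1 ?addr0.
  rewrite -[RHS]big_filter; apply: perm_big; apply: uniq_perm.
  - exact: msupp_uniq.
  - exact: filter_uniq.
  - by move=> m; rewrite mem_filter andb_idr // => /hs.
by move=> m; rewrite mcoeff_msupp negbK => /eqP->; rewrite mul0r.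
Qed.
Lemma mfunctionalL u k P Q :
  mfunctional u (k *: P + Q) = k * mfunctional u P + mfunctional u Q.
Proof.
pose s := undup (msupp P ++ msupp Q).
have us : uniq s by exact: undup_uniq.
rewrite !(@mfunctionalE u s) //; try by move=> m h; rewrite mem_undup mem_cat h ?orbT.
  rewrite mulr_sumr -big_split; apply: eq_bigr => m _.
  by rewrite mcoeffD mcoeffZ mulrDl mulrA.
move=> m; rewrite mem_undup mem_cat !mcoeff_msupp mcoeffD mcoeffZ; apply: contraNT.
by rewrite negb_or !negbK => /andP[/eqP-> /eqP->]; rewrite mulr0 addr0.
Qed.
Lemma mfunctional0 u : mfunctional u 0 = 0.
Proof. by rewrite /mfunctional msupp0 big_nil. Qed.
Lemma mfunctionalX u m : mfunctional u 'X_[m] = u m.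
Proof. by rewrite /mfunctional msuppX big_seq1 mcoeffX eqxx mul1r. Qed.

(** Polynomials act on formal Laurent series without growth condition;
    these are not torsion free, but become so under the support condition
    that the partial sums of the last exponents are bounded below, which holds
    for expansions in the domain where each variable dominates the next. *)
Definition pact P x : E -> F := fun a => mfunctional (fun m => x (a - mexp m)) P.

Lemma pactL k P Q x a : pact (k *: P + Q) x a = k * pact P x a + pact Q x a.
Proof. exact: mfunctionalL. Qed.
Lemma pact0 x a : pact 0 x a = 0.
Proof. exact: mfunctional0. Qed.
Lemma pactB P Q x a : pact (P - Q) x a = pact P x a - pact Q x a.
Proof. by rewrite addrC -scaleN1r pactL mulN1r addrC. Qed.
Lemma pactX m x a : pact 'X_[m] x a = x (a - mexp m).
Proof. exact: mfunctionalX. Qed.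
Lemma pactXU l x a : pact 'X_l x a = x (a - unitE l).
Proof. exact: pactX. Qed.
Lemma pact1 x : pact 1 x = x.
Proof. by apply: funext => a; rewrite -mpolyX0 pactX mexp0 subr0. Qed.

Lemma pactXM m P x a : pact ('X_[m] * P) x a = pact P x (a - mexp m).
Proof.
elim/mpolyind: P => [|k m' P _ _ IH]; first by rewrite mulr0 !pact0.
by rewrite mulrDr -scalerAr -mpolyXD !pactL !pactX IH mexpD opprD addrA.
Qed.
Lemma pactM P Q x : pact (P * Q) x = pact P (pact Q x).
Proof.
apply: funext => a; elim/mpolyind: P => [|k m P _ _ IH]; first by rewrite mul0r !pact0.
by rewrite mulrDl -scalerAl !pactL IH pactXM pactX.
Qed.
Lemma pactLr P k x y a :
  pact P (fun b => k * x b + y b) a = k * pact P x a + pact P y a.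
Proof.
by rewrite /pact /mfunctional mulr_sumr -big_split; apply: eq_bigr => m _; rewrite mulrDr mulrCA.
Qed.
Lemma pactBr P x y a : pact P (fun b => x b - y b) a = pact P x a - pact P y a.
Proof.
by rewrite /pact /mfunctional -sumrB; apply: eq_bigr => m _; rewrite mulrBr.
Qed.

Definition tail (j : nat) a : int := \sum_(l < p | (j <= l)%N) a l.
Definition tail_bounded x := exists B : int, forall j a, tail j a < B -> x a = 0.

Lemma tailD j a b : tail j (a + b) = tail j a + tail j b.
Proof. by rewrite /tail -big_split; apply: eq_bigr => l _; rewrite ffunE. Qed.
Lemma tailN j a : tail j (- a) = - tail j a.
Proof. by rewrite /tail -sumrN; apply: eq_bigr => l _; rewrite ffunE. Qed.
Lemma tail_mexp j m : 0 <= tail j (mexp m).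
Proof. by apply: sumr_ge0 => l _; rewrite ffunE. Qed.
Lemma tail_unitE j l : tail j (unitE l) = (j <= l)%N%:Z.
Proof.
rewrite /tail; case: (leqP j l) => h; last first.
  by rewrite big1 // => k jk; rewrite unitEE; case: eqVneq => // lk; move: h; rewrite lk ltnNge jk.
by rewrite (bigD1 l) //= unitEE eqxx big1 ?addr0 // => k /andP[_]; rewrite unitEE eq_sym => /negPf->.
Qed.

Lemma tail_bounded_pact P x : tail_bounded x -> tail_bounded (pact P x).
Proof.
move=> [B hB]; exists B => j a lt; rewrite /pact /mfunctional big1 // => m _; rewrite (hB j) ?mulr0 //.
by rewrite tailD tailN; apply: le_lt_trans lt; rewrite gerBl tail_mexp.
Qed.
Lemma tail_boundedL k x y : tail_bounded x -> tail_bounded y ->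
  tail_bounded (fun a => k * x a + y a).
Proof.
move=> [B hB] [B' hB']; exists (Order.min B B') => j a; rewrite lt_min => /andP[h h'].
by rewrite (hB j) // (hB' j) // mulr0 addr0.
Qed.

(** A series killed by w_i - w_j is invariant under moving a unit of exponent from
    w_j to w_i, and repeating this leaves the domain of its support. *)
Lemma pact_zdiff_inj (i j : 'I_p) x : (i < j)%N -> tail_bounded x ->
  (forall a, pact ('X_i - 'X_j) x a = 0) -> forall a, x a = 0.
Proof.
move=> ij [B hB] h a.
have step b : x (b + (unitE i - unitE j)) = x b.
  have := h (b + unitE i); rewrite pactB !pactXU addrK => /eqP.
  by rewrite subr_eq0 -addrA => /eqP <-.
have steps t b : x (b + (unitE i - unitE j) *+ t) = x b.
  by elim: t => [|t IH]; rewrite ?mulr0n ?addr0 // mulrSr addrA step.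
pose t := (absz (tail j a - B)).+1.
rewrite -(steps t) (hB j) // tailD.
have -> : tail j ((unitE i - unitE j) *+ t) = - t%:Z.
  elim: t => [|t IH]; first by rewrite mulr0n /tail big1 // => l _; rewrite ffunE.
  rewrite mulrSr tailD IH tailD tailN !tail_unitE leqnn.
  by rewrite leqNgt ij /=; lia.
by rewrite /t; lia.
Qed.

Definition denominator (N : 'I_p * 'I_p -> nat) : {mpoly F[p]} :=
  \prod_(e : 'I_p * 'I_p | (e.1 < e.2)%N) ('X_e.1 - 'X_e.2) ^+ N e.

Lemma pact_denominator_inj N x : tail_bounded x ->
  (forall a, pact (denominator N) x a = 0) -> forall a, x a = 0.
Proof.
pose A Q := forall x, tail_bounded x -> (forall a, pact Q x a = 0) -> forall a, x a = 0.
suff : A (denominator N) by apply.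
have A1 : A 1 by move=> y _ h a; rewrite -(h a) pact1.
have AM P Q : A P -> A Q -> A (P * Q).
  move=> hP hQ y hy h; apply: hQ => //; apply: hP; first exact: tail_bounded_pact.
  by move=> a; rewrite -pactM.
apply: big_ind => // -[i j] /= ij; elim: (N _) => // k IH; rewrite exprS; apply: (AM) => //.
by move=> y; exact: pact_zdiff_inj.
Qed.

Lemma of_poly_denominator N :
  \prod_(e : 'I_p * 'I_p | (e.1 < e.2)%N) zdiff F e.1 e.2 ^+ N e = of_poly (denominator N).
Proof.
rewrite /denominator /of_poly rmorph_prod; apply: eq_bigr => e _.
by rewrite rmorphXn zdiffE.
Qed.
Lemma denominatorD N N' :
  denominator (fun e => N e + N' e)%N = denominator N * denominator N'.
Proof. by rewrite /denominator -big_split; apply: eq_bigr => e _; rewrite exprD. Qed.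
Lemma Xdiff_neq0 (i j : 'I_p) : i != j -> 'X_i - 'X_j != 0 :> {mpoly F[p]}.
Proof. by move=> ij; rewrite -of_poly_eq0 -zdiffE zdiff_eq0. Qed.
Lemma denominator_neq0 N : denominator N != 0.
Proof.
rewrite /denominator prodf_seq_neq0; apply/allP => e _; apply/implyP => h.
by rewrite expf_neq0 // Xdiff_neq0 //; apply: contraTneq h => ->; rewrite ltnn.
Qed.

Definition delta : E -> F := fun a => (a == 0)%:R.
Lemma tail_bounded_delta : tail_bounded delta.
Proof.
exists 0 => j a lt; rewrite /delta; case: eqP => // a0.
by move: lt; rewrite a0 /tail big1 ?ltxx // => l _; rewrite ffunE.
Qed.

(** The expansion of P / D is the series x with D x = P. *)
Definition is_expansion f x := tail_bounded x /\ exists P N,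
  f = of_poly P / of_poly (denominator N) /\ pact (denominator N) x = pact P delta.

Lemma expansion_unique f x y : is_expansion f x -> is_expansion f y -> x = y.
Proof.
move=> [bx [P [N [ef ex]]]] [by_ [P' [N' [ef' ey]]]].
have e : P * denominator N' = P' * denominator N.
  apply: of_poly_inj; rewrite !of_polyM; apply/eqP.
  by rewrite -eqr_div ?of_poly_eq0 ?denominator_neq0 // -ef -ef'.
apply: funext => a; apply/eqP; rewrite -subr_eq0; apply/eqP; move: a.
apply: (@pact_denominator_inj (fun e => N e + N' e)%N) => [|a].
  have -> : (fun a => x a - y a) = (fun a => -1 * y a + x a).
    by apply: funext => a; rewrite mulN1r addrC.
  exact: tail_boundedL.
rewrite pactBr denominatorD {1}mulrC !pactM ex ey -!pactM.
by rewrite [_ * P]mulrC e [_ * P']mulrC subrr.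
Qed.

(** ** The geometric series solve the defining equation *)

Definition exponents (N : 'I_p * 'I_p -> nat) (k : {ffun 'I_p * 'I_p -> nat}) : E :=
  [ffun l : 'I_p => \sum_(i < p | (i < l)%N) (k (i, l))%:Z
              - \sum_(j < p | (l < j)%N) (N (l, j) + k (l, j))%:Z].
Definition upper : set {ffun 'I_p * 'I_p -> nat} :=
  [set k | forall e : 'I_p * 'I_p, (e.2 <= e.1)%N -> k e = 0%N].
Definition geom_term (N : 'I_p * 'I_p -> nat) (k : {ffun 'I_p * 'I_p -> nat}) : F :=
  (\prod_(e : 'I_p * 'I_p | (e.1 < e.2)%N) 'C((N e + k e).-1, k e))%N%:R.
Definition geom_set N b := upper `&` [set k | exponents N k = b].
Definition geom N b : F := \sum_(k \in geom_set N b) geom_term N k.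

(** In the total exponent of the variables from w_j on, the contributions of
    k (i, l) with i >= j cancel: w_l^k is compensated by w_i^(-k). *)
Lemma tail_exponents N k j : tail j (exponents N k) =
  \sum_(l < p | (j <= l)%N) \sum_(i < p | (i < j)%N) (k (i, l))%:Z
  - \sum_(l < p | (j <= l)%N) \sum_(l' < p | (l < l')%N) (N (l, l'))%:Z.
Proof.
rewrite /tail; under eq_bigr => l _ do rewrite ffunE.
rewrite sumrB.
have -> : \sum_(l < p | (j <= l)%N) \sum_(l' < p | (l < l')%N) (N (l, l') + k (l, l'))%:Z =
  \sum_(l < p | (j <= l)%N) \sum_(l' < p | (l < l')%N) (N (l, l'))%:Z +
  \sum_(l < p | (j <= l)%N) \sum_(l' < p | (l < l')%N) (k (l, l'))%:Z.
  rewrite -big_split; apply: eq_bigr => l _; rewrite -big_split.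
  by apply: eq_bigr => l' _; rewrite PoszD.
have -> : \sum_(l < p | (j <= l)%N) \sum_(i < p | (i < l)%N) (k (i, l))%:Z =
  \sum_(l < p | (j <= l)%N) \sum_(i < p | (i < j)%N) (k (i, l))%:Z +
  \sum_(l < p | (j <= l)%N) \sum_(i < p | (j <= i)%N && (i < l)%N) (k (i, l))%:Z.
  rewrite -big_split; apply: eq_bigr => l jl.
  rewrite (bigID (fun i : 'I_p => (i < j)%N)) /=; congr (_ + _).
    by apply: eq_bigl => i; lia.
  by apply: eq_bigl => i; lia.
have -> : \sum_(l < p | (j <= l)%N) \sum_(i < p | (j <= i)%N && (i < l)%N) (k (i, l))%:Z =
  \sum_(l < p | (j <= l)%N) \sum_(l' < p | (l < l')%N) (k (l, l'))%:Z.
  rewrite (exchange_big_dep (fun i : 'I_p => (j <= i)%N)) /=; last by move=> l i _ /andP[].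
  by apply: eq_bigr => i ji; apply: eq_bigl => l; lia.
by ring.
Qed.

Definition Ntotal (N : 'I_p * 'I_p -> nat) : int :=
  \sum_(l < p) \sum_(l' < p) (N (l, l'))%:Z.

Lemma sum_le_sub (I : finType) (A B : pred I) (G : I -> int) :
  (forall i, 0 <= G i) -> (forall i, A i -> B i) ->
  \sum_(i | A i) G i <= \sum_(i | B i) G i.
Proof.
move=> hG hAB; rewrite [leRHS](bigID A) /= (eq_bigl A); last first.
  by move=> i; rewrite andb_idl //; exact: hAB.
by rewrite lerDl; apply: sumr_ge0.
Qed.

Lemma Ntotal_ge N j :
  \sum_(l < p | (j <= l)%N) \sum_(l' < p | (l < l')%N) (N (l, l'))%:Z <= Ntotal N.
Proof.
apply: (@le_trans _ _ (\sum_(l < p | (j <= l)%N) \sum_(l' < p) (N (l, l'))%:Z)).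
  by apply: ler_sum => l _; apply: sum_le_sub.
by apply: sum_le_sub => // l; apply: sumr_ge0.
Qed.

Lemma tail_exponents_ge N k j : - Ntotal N <= tail j (exponents N k).
Proof.
rewrite tail_exponents.
set A := \sum_(l < p | (j <= l)%N) \sum_(i < p | (i < j)%N) (k (i, l))%:Z.
have := Ntotal_ge N j; set B := \sum_(l < p | _) _.
have : 0 <= A.
  by apply: sumr_ge0 => l _; apply: sumr_ge0.
by move=> h1 h2; rewrite addrC; apply: ler_wpDr => //; rewrite lerN2.
Qed.

Lemma le_absz_shift (k : nat) (A B C : int) : k%:Z <= A -> B <= C ->
  (k <= absz (A - B + C)%R)%N.
Proof. lia. Qed.

Lemma geom_set_finite N b : finite_set (geom_set N b).
Proof.
pose M := (\max_(l < p) absz (tail l b + Ntotal N)%R)%N.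
apply: sub_finite_set (finite_box _ M) => k [uk hk] [i j] /=.
have [ji|ij] := leqP j i; first by rewrite uk.
apply: leq_trans (leq_bigmax j) => /=.
rewrite -hk tail_exponents.
set A := \sum_(l < p | (j <= l)%N) \sum_(i < p | (i < j)%N) (k (i, l))%:Z.
have := Ntotal_ge N j; set B := \sum_(l < p | _) _.
have : (k (i, j))%:Z <= A.
  rewrite /A (bigD1 j) //= (bigD1 i) //= -addrA lerDl.
  by apply: addr_ge0; apply: sumr_ge0 => // l _; apply: sumr_ge0.
by move=> h1 h2; exact: le_absz_shift h1 h2.
Qed.

Lemma tail_bounded_geom N : tail_bounded (geom N).
Proof.
exists (- Ntotal N) => j b lt; rewrite /geom fsbig1 // => k [_ hk].
by have := tail_exponents_ge N k j; rewrite hk leNgt lt.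
Qed.

Definition incrN (e0 : 'I_p * 'I_p) (N : 'I_p * 'I_p -> nat) :=
  fun e => (N e + (e == e0))%N.

Lemma exponents_incrN (i j : 'I_p) N k : (i < j)%N ->
  exponents (incrN (i, j) N) k = exponents N k - unitE i.
Proof.
move=> ij; apply/ffunP => l; rewrite !ffunE -addrA; congr (_ + _).
rewrite -opprD; congr (- _).
have -> : \sum_(j0 < p | (l < j0)%N) (incrN (i, j) N (l, j0) + k (l, j0))%:Z =
  \sum_(j0 < p | (l < j0)%N) (N (l, j0) + k (l, j0))%:Z +
  \sum_(j0 < p | (l < j0)%N) ((l, j0) == (i, j))%:Z.
  by rewrite -big_split; apply: eq_bigr => j0 _; rewrite /= -PoszD /incrN addnAC.
congr (_ + _); rewrite mnm1E eq_sym; have [->|li] := eqVneq l i.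
  rewrite (bigD1 j) //= eqxx big1 // => j0 /andP[_ /negPf h].
  by rewrite xpair_eqE eqxx h.
by rewrite big1 // => j0 _; rewrite xpair_eqE (negPf li).
Qed.

Definition incrk (e0 : 'I_p * 'I_p) (k : {ffun 'I_p * 'I_p -> nat}) : {ffun 'I_p * 'I_p -> nat} :=
  [ffun e => k e + (e == e0)]%N.
Lemma exponents_incrk (i j : 'I_p) N k : (i < j)%N ->
  exponents N (incrk (i, j) k) = exponents (incrN (i, j) N) k + unitE j.
Proof.
move=> ij; apply/ffunP => l; rewrite !ffunE addrAC; congr (_ - _); last first.
  by apply: eq_bigr => j0 _; rewrite ffunE /incrN addnA addnAC.
have -> : \sum_(i0 < p | (i0 < l)%N) (incrk (i, j) k (i0, l))%:Z =
  \sum_(i0 < p | (i0 < l)%N) (k (i0, l))%:Z + \sum_(i0 < p | (i0 < l)%N) ((i0, l) == (i, j))%:Z.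
  by rewrite -big_split; apply: eq_bigr => j0 _; rewrite ffunE PoszD.
congr (_ + _); rewrite mnm1E eq_sym; have [->|lj] := eqVneq l j.
  rewrite (bigD1 i) //= eqxx big1 // => j0 /andP[_ /negPf h].
  by rewrite xpair_eqE h.
by rewrite big1 // => j0 _; rewrite xpair_eqE (negPf lj) andbF.
Qed.

(** Pascal's rule, for the factor (w_i - w_j) ^ (- N - 1). *)
Lemma geom_term_pascal (i j : 'I_p) N k : (i < j)%N ->
  geom_term (incrN (i, j) N) k =
  geom_term N k + (if k (i, j) is k0.+1 then
    geom_term (incrN (i, j) N) [ffun e => if e == (i, j) then k0 else k e] else 0).
Proof.
move=> ij; rewrite /geom_term.
have H (N' : 'I_p * 'I_p -> nat) (k' : {ffun 'I_p * 'I_p -> nat}) :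
   (forall e, e != (i, j) -> N' e = N e /\ k' e = k e) ->
   (\prod_(e : 'I_p * 'I_p | (e.1 < e.2)%N) 'C((N' e + k' e).-1, k' e) =
   'C((N' (i, j) + k' (i, j)).-1, k' (i, j)) *
   \prod_(e : 'I_p * 'I_p | (e.1 < e.2)%N && (e != (i, j))) 'C((N e + k e).-1, k e))%N.
  move=> h; rewrite (bigD1 (i, j)) //=; congr (_ * _)%N.
  by apply: eq_bigr => e /andP[_ /h[-> ->]].
rewrite !(H (incrN _ _)); last by move=> e ne; rewrite /incrN (negPf ne) addn0.
rewrite (H N) //.
case E : (k (i, j)) => [|k0]; first by rewrite addr0 !bin0.
rewrite H; last by move=> e ne; rewrite ffunE /incrN (negPf ne) addn0.
rewrite ffunE eqxx -natrD -mulnDl /incrN eqxx; congr ((_ * _)%N%:R).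
have -> : (N (i, j) + 1 + k0.+1).-1 = (N (i, j) + k0).+1 by lia.
have -> : (N (i, j) + k0.+1).-1 = (N (i, j) + k0)%N by lia.
have -> : (N (i, j) + true + k0).-1 = (N (i, j) + k0)%N by lia.
by rewrite binS.
Qed.

(** The series for w_i - w_j to the power - N - 1, times w_i - w_j, telescopes to
    the series for the power - N. *)
Lemma geom_incrN (i j : 'I_p) N : (i < j)%N ->
  pact ('X_i - 'X_j) (geom (incrN (i, j) N)) = geom N.
Proof.
move=> ij; apply: funext => b; rewrite pactB !pactXU.
have e1 : geom_set (incrN (i, j) N) (b - unitE i) = geom_set N b.
  apply/seteqP; split=> k [uk /= hk]; split=> //=.
    by move: hk; rewrite exponents_incrN // => /addIr.
  by rewrite exponents_incrN // hk.
pose g (k : {ffun 'I_p * 'I_p -> nat}) : F := if k (i, j) is k0.+1 then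
    geom_term (incrN (i, j) N) [ffun e => if e == (i, j) then k0 else k e] else 0.
have e2 : geom (incrN (i, j) N) (b - unitE j) = \sum_(k \in geom_set N b) g k.
  have [s [us hs]] := finite_enum (geom_set_finite (incrN (i, j) N) (b - unitE j)).
  have [s' [us' hs']] := finite_enum (geom_set_finite N b).
  rewrite /geom (fsum_enum _ us hs) (fsum_enum _ us' hs').
  rewrite [RHS](bigID (fun k : {ffun _} => (0 < k (i, j))%N)) /=.
  rewrite [X in _ = _ + X]big1 ?addr0; last by move=> k; rewrite /g; case: (k _).
  rewrite -[RHS]big_filter.
  have /(perm_big _) -> : perm_eq [seq k : {ffun 'I_p * 'I_p -> nat} <- s' | (0 < k (i, j))%N]
      (map (incrk (i, j)) s).
    apply: uniq_perm.
    - exact: filter_uniq.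
    - rewrite map_inj_uniq // => k k' /ffunP h; apply/ffunP => e.
      by move: (h e); rewrite !ffunE => /addIn.
    move=> k; rewrite mem_filter; apply/andP/mapP.
      move=> [k0 /hs'[uk hk]]; exists [ffun e => k e - (e == (i, j))]%N.
        apply/hs; split=> /=.
          by move=> e /uk; rewrite ffunE => ->.
        have ek : k = incrk (i, j) [ffun e => k e - (e == (i, j))]%N.
          apply/ffunP => e; rewrite !ffunE subnK //.
          by case: eqP => [->|].
        by move: hk; rewrite /= {1}ek exponents_incrk // => <-; rewrite addrK.
      apply/ffunP => e; rewrite !ffunE subnK //.
      by case: eqP => [->|].
    move=> [k' /hs[uk hk] ->]; split; first by rewrite ffunE eqxx addn1.
    apply/hs'; split=> /=; last by rewrite exponents_incrk // hk subrK.
    move=> e h; rewrite ffunE uk //; case: eqP => // ee.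
    by move: h; rewrite ee /= leqNgt ij.
  rewrite big_map; apply: eq_bigr => k _; rewrite /g ffunE eqxx addn1.
  congr geom_term; apply/ffunP => e; rewrite !ffunE.
  by case: eqVneq => [->//|_]; rewrite addn0.
rewrite e2 /geom e1.
have [s' [us' hs']] := finite_enum (geom_set_finite N b).
rewrite !(fsum_enum _ us' hs') -sumrB; apply: eq_bigr => k _.
by rewrite geom_term_pascal // addrK.
Qed.

Lemma geom_eq N N' : (forall e : 'I_p * 'I_p, (e.1 < e.2)%N -> N e = N' e) ->
  geom N = geom N' /\ denominator N = denominator N'.
Proof.
move=> h; split; last by apply: eq_bigr => e /h->.
apply: funext => b; rewrite /geom.
have -> : geom_set N b = geom_set N' b.
  have ee k : exponents N k = exponents N' k.
    apply/ffunP => l; rewrite !ffunE; congr (_ - _).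
    by apply: eq_bigr => j lj; rewrite h.
  by apply/seteqP; split=> k [uk /= <-]; split=> //=; rewrite ee.
by apply: eq_fsbigr => k _; rewrite /geom_term; congr (_%:R); apply: eq_bigr => e /h->.
Qed.

Lemma geom0 N : (forall e : 'I_p * 'I_p, (e.1 < e.2)%N -> N e = 0%N) -> geom N = delta.
Proof.
move=> h; apply: funext => b; rewrite /geom.
have e0 : exponents N [ffun=> 0%N] = 0.
  apply/ffunP => l; rewrite !ffunE big1 => [|i _]; last by rewrite ffunE.
  by rewrite big1 ?subrr // => j lj; rewrite ffunE addn0 h.
rewrite (@fsum_seq _ _ _ _ [:: [ffun=> 0%N]]) //; last first.
  move=> k [uk hk]; rewrite inE; apply: contraNT => /eqP k0.
  have [e ke] : exists e, k e != 0%N.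
    by apply/not_existsP => hne; apply: k0; apply/ffunP => e; rewrite ffunE;
      apply/eqP/negPn/negP/hne.
  have elt : (e.1 < e.2)%N by rewrite ltnNge; apply: contraNN ke => /uk->.
  rewrite /geom_term (bigD1 e) //= h // add0n bin_small ?mul0n //.
  by rewrite prednK // lt0n.
rewrite big_mkcond big_seq1 /delta; case: (asboolP _) => [[_ /= hb]|nb].
  rewrite -hb e0 eqxx /geom_term big1 // => e he.
  by rewrite ffunE h.
case: eqP => // b0; case: nb; split=> [e _|/=]; first by rewrite ffunE.
by rewrite e0 b0.
Qed.

Lemma pact_denominator_geom N : pact (denominator N) (geom N) = delta.
Proof.
have [k] := ubnP (\sum_(e : 'I_p * 'I_p | (e.1 < e.2)%N) N e)%N.
elim: k N => // k IH N ltk.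
have [/existsP[[i j] /andP[/= ij Nij]]|/existsPn h0] :=
    boolP [exists e : 'I_p * 'I_p, (e.1 < e.2)%N && (0 < N e)%N]; last first.
  have {}h0 (e : 'I_p * 'I_p) : (e.1 < e.2)%N -> N e = 0%N.
    by move=> he; have := h0 e; rewrite he /=; case: (N e).
  rewrite (geom0 h0) (_ : denominator N = 1) ?pact1 //.
  by rewrite /denominator big1 // => e he; rewrite h0.
pose N' e := (N e - (e == (i, j)))%N.
have eN e : incrN (i, j) N' e = N e by 
  by rewrite /incrN /N'; case: eqP => [->|_]; rewrite ?subn1 ?addn1 ?prednK ?subn0 ?addn0.
have [<- <-] := geom_eq (fun e _ => eN e).
have -> : denominator (incrN (i, j) N') = denominator N' * ('X_i - 'X_j).
  rewrite denominatorD; congr (_ * _).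
  rewrite /denominator (bigD1 (i, j)) //= eqxx expr1 big1 ?mulr1 // => e /andP[_ /negPf->].
  by rewrite expr0.
rewrite pactM geom_incrN // IH //; move: ltk; rewrite ltnS; apply: leq_trans.
rewrite [X in (_ <= X)%N](bigD1 (i, j)) //= (bigD1 (i, j)) //= /N' eqxx -addSn leq_add //; first by rewrite subn1 prednK.
by apply: leq_sum => e /andP[_ /negPf->]; rewrite subn0.
Qed.

Lemma geom_coefE P N a : geom_coef P N a = pact P (geom N) a.
Proof.
pose K m := geom_set N (a - mexp m).
have finK m : finite_set (K m) by exact: geom_set_finite.
have finU : finite_set (\bigcup_(m in [set` msupp P]) K m).
  by apply: bigcup_finite => // m _; exact: finK.
have [s [us hs]] := finite_enum finU.
rewrite /geom_coef (@fsum_seq _ _ _ _ (allpairs pair (msupp P) s)); first last.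
- move=> [m k] /= [uk hk] nz; apply/allpairsP; exists (m, k); split=> //=.
    by rewrite mcoeff_msupp; apply: contraNneq nz => ->; rewrite mul0r.
  apply/hs; exists m.
    by rewrite /= mcoeff_msupp; apply: contraNneq nz => ->; rewrite mul0r.
  by split=> //=; apply/ffunP => l; rewrite !ffunE hk [RHS]addrC -addrA addKr.
- by apply: allpairs_uniq; rewrite ?msupp_uniq // => -[? ?] [? ?].
rewrite big_mkcond big_allpairs /pact /mfunctional big_seq [RHS]big_seq; apply: eq_bigr => m hm.
rewrite /geom (@fsum_seq _ _ _ _ s) //; last first.
  by move=> k hk _; apply/hs; exists m.
rewrite mulr_sumr [RHS]big_mkcond; apply: eq_bigr => k _ /=.
rewrite (_ : `[< _ >] = `[< geom_set N (a - mexp m) k >]) //.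
apply: asbool_equiv_eq; split=> -[uk hk]; split=> //=.
  by apply/ffunP => l; rewrite !ffunE hk [RHS]addrC -addrA addKr.
by move=> l; move/ffunP: hk => /(_ l); rewrite !ffunE -addrA => ->; rewrite [RHS]addrC subrK.
Qed.

Lemma expansion_geom P N :
  is_expansion (of_poly P / of_poly (denominator N)) (geom_coef P N).
Proof.
have -> : geom_coef P N = pact P (geom N) by apply: funext => a; exact: geom_coefE.
split; first by apply/tail_bounded_pact/tail_bounded_geom.
by exists P, N; split=> //; rewrite -pactM mulrC pactM pact_denominator_geom.
Qed.

Definition expandable f := exists P N, f = of_poly P / of_poly (denominator N).

Lemma iota_coefP f : expandable f -> is_expansion f (iota_coef f).
Proof.
move=> [P [N ef]].
have e : iota_coef f = geom_coef P N.
  apply: funext => a; rewrite /iota_coef; case: xgetP => [c _ [P' [N' [ef' ->]]]|]; last first.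
    by move=> /(_ (geom_coef P N a)) []; exists P, N; rewrite of_poly_denominator.
  have h := expansion_geom P' N'; rewrite -of_poly_denominator -ef' in h.
  have h' := expansion_geom P N; rewrite -ef in h'.
  by rewrite (expansion_unique h h').
by rewrite e ef; exact: expansion_geom.
Qed.

Lemma iota_coefE f x : is_expansion f x -> iota_coef f = x.
Proof.
move=> hx; apply: (@expansion_unique f) => //; apply: iota_coefP.
by case: hx => _ [P [N [ef _]]]; exists P, N.
Qed.

Lemma expandable_poly P : expandable (of_poly P).
Proof.
exists P, (fun=> 0%N); rewrite (_ : denominator _ = 1) ?of_poly1 ?divr1 //.
by rewrite /denominator big1.
Qed.

Lemma OT_expandable f : OT_set F p f -> expandable f.
Proof.
apply: (@adjoin_ind _ _ _ expandable).
  split=> [|c g h [P [N ->]] [P' [N' ->]]|g h [P [N ->]] [P' [N' ->]]].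
  - by rewrite -of_poly1; exact: expandable_poly.
  - exists (c *: P * denominator N' + P' * denominator N), (fun e => N e + N' e)%N.
    rewrite denominatorD of_polyM ratfun_scaleE mulrA -of_polyM mul_mpolyC.
    rewrite addf_div ?of_poly_eq0 ?denominator_neq0 //.
    by rewrite -!of_polyM -of_polyD.
  - exists (P * P'), (fun e => N e + N' e)%N.
    by rewrite denominatorD mulf_div -!of_polyM.
move=> g [i [j [ij [->|->]]]]; first by rewrite zdiffE; exact: expandable_poly.
exists 1, (fun e => (e == (i, j)) : nat); rewrite of_poly1 div1r zdiffE.
rewrite /denominator (bigD1 (i, j)) //= eqxx expr1 big1 ?mulr1 // => e /andP[_ /negPf->].
by rewrite expr0.
Qed.

Lemma iotaL k f g a : expandable f -> expandable g ->
  iota_coef (k *: f + g) a = k * iota_coef f a + iota_coef g a.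
Proof.
move=> /iota_coefP[bf [P [N [ef hf]]]] /iota_coefP[bg [P' [N' [eg hg]]]].
rewrite (@iota_coefE _ (fun a => k * iota_coef f a + iota_coef g a)) //.
split; first exact: tail_boundedL.
exists (k *: (P * denominator N') + P' * denominator N), (fun e => N e + N' e)%N; split.
  rewrite {1}ef {1}eg denominatorD of_polyM ratfun_scaleE mulrA.
  rewrite addf_div ?of_poly_eq0 ?denominator_neq0 //.
  by rewrite -!of_polyM -of_polyD -mul_mpolyC mulrA.
apply: funext => b; rewrite pactLr pactL denominatorD [pact (_ * _) (iota_coef g)]pactM hg.
rewrite [denominator N * _]mulrC [pact (_ * _) (iota_coef f)]pactM hf -!pactM.
by rewrite [denominator N' * P]mulrC [denominator N * P']mulrC.
Qed.

Lemma iotaM R f : expandable f -> expandable (of_poly R * f) /\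
  iota_coef (of_poly R * f) = pact R (iota_coef f).
Proof.
move=> /iota_coefP[bf [P [N [ef hf]]]].
have e : of_poly R * f = of_poly (R * P) / of_poly (denominator N).
  by rewrite {1}ef of_polyM mulrA.
split; first by exists (R * P), N.
apply: iota_coefE; split; first exact: tail_bounded_pact.
by exists (R * P), N; split=> //; rewrite -pactM mulrC !pactM hf.
Qed.

Definition dseries (l : 'I_p) x : E -> F := fun a => (a l + 1)%:~R * x (a + unitE l).

(** The Leibniz rule, polynomials acting on series by multiplication. *)
Lemma dseries_pact l P x a :
  dseries l (pact P x) a = pact P^`M(l) x a + pact P (dseries l x) a.
Proof.
elim/mpolyind: P => [|k m P _ _ IH]; first by rewrite raddf0 /dseries !pact0 mulr0 addr0.
have -> : dseries l (pact (k *: 'X_[m] + P) x) a =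
    k * dseries l (pact 'X_[m] x) a + dseries l (pact P x) a.
  by rewrite /dseries pactL mulrDr mulrCA.
rewrite IH mderivD mderivZ !pactL.
suff -> : dseries l (pact 'X_[m] x) a =
    pact ('X_[m])^`M(l) x a + pact 'X_[m] (dseries l x) a by ring.
rewrite mderivX -[_ *: _]addr0 pactL pact0 addr0 /dseries !pactX.
have -> : a + unitE l - mexp m = a - mexp m + unitE l by rewrite addrAC.
have al : (a - mexp m) l = a l - (m l)%:Z by rewrite !ffunE.
rewrite al; case: (posnP (m l)) => [m0|mpos].
  by rewrite m0 mul0r add0r subr0.
have -> : a - mexp (m - U_(l))%MM = a - mexp m + unitE l.
  rewrite -addrA; congr (_ + _); apply/ffunP => k'; rewrite !ffunE mnmBE mnm1E.
  by case: eqVneq => [<-|_] /=; lia.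
by rewrite -mulrDl; congr (_ * _); rewrite !intrD mulrNz; ring.
Qed.

Lemma iota_dz l f : expandable f -> expandable (dz l f) /\
  iota_coef (dz l f) = dseries l (iota_coef f).
Proof.
move=> /iota_coefP[bf [P [N [ef hf]]]].
set x := iota_coef f in bf hf *; set Q := denominator N in ef hf.
have e : dz l f = of_poly (P^`M(l) * Q - P * Q^`M(l)) / of_poly (denominator (fun e => N e + N e)%N).
  by rewrite ef dz_div ?denominator_neq0 // denominatorD expr2 -of_polyM.
split; first by exists (P^`M(l) * Q - P * Q^`M(l)), (fun e => N e + N e)%N.
apply: iota_coefE; split.
  have [B hB] := bf; exists (B - 1) => j a lt; rewrite /dseries (hB j) ?mulr0 //.
  by rewrite tailD tail_unitE; move: lt; case: (j <= l)%N; lia.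
exists (P^`M(l) * Q - P * Q^`M(l)), (fun e => N e + N e)%N; split=> //.
have d0 b : pact P (dseries l delta) b = 0.
  rewrite /pact /mfunctional big1 // => m _; rewrite /dseries /delta.
  case: eqP => [h|_]; last by rewrite !mulr0.
  have -> : (b - mexp m) l = -1.
    by have /ffunP/(_ l) := h; rewrite !ffunE mnm1E eqxx => /eqP; rewrite addr_eq0 => /eqP.
  by rewrite addNr mul0r mulr0.
apply: funext => a; rewrite denominatorD pactM.
have e1 b : pact Q (dseries l x) b = pact P^`M(l) delta b - pact Q^`M(l) x b.
  apply/eqP; rewrite eq_sym subr_eq addrC -dseries_pact hf dseries_pact.
  by rewrite d0 addr0.
have -> : pact Q (dseries l x) = fun b => pact P^`M(l) delta b - pact Q^`M(l) x b.
  by apply: funext.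
rewrite pactBr pactB -!pactM [Q * P^`M(l)]mulrC [Q * Q^`M(l)]mulrC.
by rewrite [pact (_ * Q) x]pactM hf -pactM [Q^`M(l) * P]mulrC.
Qed.

Lemma iota1 a : iota_coef 1 a = delta a.
Proof.
rewrite (@iota_coefE _ delta) //; split; first exact: tail_bounded_delta.
exists 1, (fun=> 0%N); rewrite (_ : denominator _ = 1) ?of_poly1 ?divr1 //.
by rewrite /denominator big1.
Qed.
End Expansion.

Section Convolution.
Variables (F : fieldType) (charF0 : [pchar F] =i pred0) (p : nat).
Implicit Types (P Q R : {mpoly F[p]}) (f g : ratfun F p) (b c : 'X_{1..p}).
Local Notation E := {ffun 'I_p -> int}.
Local Notation unitE := (@unitE p).
Implicit Types (a : E).

Definition mfact b : F := (\prod_(l < p) (b l)`!)%N%:R.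
Definition esign a : F := (-1) ^ (\sum_(l < p) a l).

Lemma mfact_neq0 b : mfact b != 0.
Proof.
rewrite /mfact natF_eq0 // -lt0n prodn_cond_gt0 // => l _; exact: fact_gt0.
Qed.
Lemma mfactS b l : mfact (b + U_(l))%MM = (b l).+1%:R * mfact b.
Proof.
rewrite /mfact -natrM; congr (_%:R).
rewrite (bigD1 l) //= [in RHS](bigD1 l) //= mnmDE mnm1E eqxx addn1 factS -mulnA.
congr (_ * (_ * _))%N; apply: eq_bigr => k /negPf kl.
by rewrite mnmDE mnm1E eq_sym kl addn0.
Qed.
Lemma esignD a a' : esign (a + a') = esign a * esign a'.
Proof.
rewrite /esign -expfzDr ?oppr_eq0 ?oner_eq0 //; congr (_ ^ _).
by rewrite -big_split; apply: eq_bigr => l _; rewrite ffunE.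
Qed.
Lemma esign_unitE l : esign (unitE l) = -1.
Proof.
rewrite /esign (bigD1 l) //= unitEE eqxx big1 ?addr0 ?expr1z // => k.
by rewrite unitEE eq_sym => /negPf->.
Qed.
Lemma esign_unitN l : esign (- unitE l) = -1.
Proof.
apply: (mulfI (x := esign (unitE l))); first by rewrite esign_unitE oppr_eq0 oner_eq0.
rewrite -esignD subrr esign_unitE mulrNN mulr1 /esign big1 ?expr0z // => k _.
by rewrite ffunE.
Qed.

Lemma prod_dpow c : \prod_(l < p) dpow ('X_l : {mpoly F[p]}) (c l)%:Z =
  (mfact c)^-1 *: 'X_[c].
Proof.
rewrite /dpow scaler_prod -mpolyXE_id; congr (_ *: _).
by rewrite /mfact natr_prod prodfV.
Qed.

Lemma prod_dpow_sub b c :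
  \prod_(l < p) dpow ('X_l : {mpoly F[p]}) ((b l)%:Z - (mexp b - mexp c) l) =
  (mfact c)^-1 *: 'X_[c].
Proof. by rewrite -prod_dpow; apply: eq_bigr => l _; rewrite !ffunE subKr. Qed.

(** The coefficient of Lambda^(c) in f * Lambda^(b) is, up to sign, the
    coefficient of w^(b - c) in the expansion of f. *)
Lemma convolution_coef f Q c : expandable f ->
  (convolution f Q)@_c = mfunctional (fun b =>
     iota_coef f (mexp b - mexp c) * mfact b * esign (mexp b - mexp c)) Q / mfact c.
Proof.
move=> hf; have [[B hB] _] := iota_coefP hf.
pose M := (\sum_(l < p) c l + \sum_(b <- msupp Q) \sum_(l < p) absz (tail l (mexp b) - B)%R)%N.
have [box [ubox hbox]] := finite_enum (finite_mnm_box p M).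
have hc : c \in box.
  by apply/hbox => l; rewrite /M (bigD1 l) //= -!addnA leq_addr.
have hin b c' : b \in msupp Q -> iota_coef f (mexp b - mexp c') != 0 -> c' \in box.
  move=> hb nz; apply/hbox => l.
  have h1 : (c' l)%:Z <= tail l (mexp b) - B.
    rewrite leNgt; apply: contraNN nz => lt; rewrite (hB l) //.
    rewrite tailD tailN; have : (c' l)%:Z <= tail l (mexp c').
      rewrite /tail (bigD1 l) //= ffunE lerDl; apply: sumr_ge0 => k _.
      by rewrite ffunE.
    by move: (tail l (mexp b)) (tail l (mexp c')) lt => x y; lia.
  apply: leq_trans (leq_addl _ _).
  rewrite (big_rem b) //=; apply: leq_trans (leq_addr _ _).
  rewrite (bigD1 l) //=; apply: leq_trans (leq_addr _ _).
  by move: (tail l (mexp b)) h1 => x; lia.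
have inj : injective (fun bc : 'X_{1..p} * 'X_{1..p} => (mexp bc.1 - mexp bc.2, bc.1)).
  move=> [b1 c1] [b2 c2] /= [e1 e2]; move: e1; rewrite e2 => /addrI/oppr_inj/mexp_inj.
  by move=> ->.
rewrite /convolution (@fsum_seq _ _ _ _ [seq (mexp b - mexp c', b) | b <- msupp Q, c' <- box]).
- rewrite big_mkcond big_allpairs_dep raddf_sum /= /mfunctional mulr_suml.
  apply: eq_bigr => b _; rewrite raddf_sum /= (bigD1_seq c) //= [X in _ + X]big1 ?addr0.
    rewrite asboolT // mcoeffZ.
    rewrite prod_dpow_sub mcoeffZ mcoeffX eqxx mulr1.
    by rewrite -/(mfact b) -/(esign _); ring.
  move=> c' nc; rewrite asboolT // mcoeffZ.
  by rewrite prod_dpow_sub mcoeffZ mcoeffX (negPf nc) !mulr0.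
- by apply: allpairs_uniq; rewrite ?msupp_uniq // => x y _ _; case: x y => [b1 c1] [b2 c2] e;
    exact: (inj (b1, c1) (b2, c2) e).
- move=> [a b] _ /=; rewrite scaler_eq0 !mulf_eq0 !negb_or -!andbA.
  move=> /and5P[nz Qb _ _ hp].
  have ha l : a l <= (b l)%:Z.
    rewrite leNgt; apply: contraNN hp => lt; rewrite (bigD1 l) //= /dpow.
    have : (b l)%:Z - a l < 0 by rewrite subr_lt0.
    by case: (_ - _) => // k _; rewrite mul0r.
  have ea : a = mexp b - mexp [multinom absz ((b l)%:Z - a l)%R | l < p].
    apply/ffunP => l; rewrite !ffunE mnmE; have := ha l.
    by move: (a l) => al; lia.
  apply/allpairsP; exists (b, [multinom absz ((b l)%:Z - a l)%R | l < p]).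
  have hb : b \in msupp Q by rewrite mcoeff_msupp.
  by split=> //=; [apply: (hin b) => //; rewrite -ea|rewrite -ea].
Qed.

Lemma convolution_linear f : expandable f -> linear (convolution f).
Proof.
move=> hf k P Q; apply/mpolyP => c.
by rewrite mcoeffD mcoeffZ !convolution_coef // mfunctionalL mulrDl mulrA.
Qed.
Lemma convolutionL k f g Q : expandable f -> expandable g -> expandable (k *: f + g) ->
  convolution (k *: f + g) Q = k *: convolution f Q + convolution g Q.
Proof.
move=> hf hg hfg; apply/mpolyP => c; rewrite mcoeffD mcoeffZ !convolution_coef //.
rewrite mulrA -mulrDl; congr (_ / _); rewrite /mfunctional mulr_sumr -big_split.
by apply: eq_bigr => b _; rewrite iotaL //=; ring.
Qed.

Lemma convolution_coefX f b c : expandable f -> (convolution f 'X_[b])@_c =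
  iota_coef f (mexp b - mexp c) * mfact b * esign (mexp b - mexp c) / mfact c.
Proof. by move=> hf; rewrite convolution_coef // mfunctionalX. Qed.

Lemma mpoly_linear_ext n n' (phi psi : {mpoly F[n]} -> {mpoly F[n']}) :
  linear phi -> linear psi -> (forall m, phi 'X_[m] = psi 'X_[m]) -> phi =1 psi.
Proof.
move=> hphi hpsi h P; rewrite [P]mpolyE !linear_comb //.
by apply: eq_bigr => m _; rewrite h.
Qed.

Lemma expandableM R f : expandable f -> expandable (of_poly R * f).
Proof. by move=> /(iotaM R)[]. Qed.
Lemma expandable_dz l f : expandable f -> expandable (dz l f).
Proof. by move=> /(iota_dz l)[]. Qed.

(** Multiplication by w_l shifts the exponents of the expansion by one; the quotient
    of the factorials is the factor of the derivative in Lambda_l, and the parity of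
    the exponent gives the sign. *)
Lemma convolutionMz l f Q : expandable f ->
  convolution (zvar F l * f) Q = - (convolution f Q)^`M(l).
Proof.
move=> hf; have hzf : expandable (zvar F l * f) by exact: expandableM.
move: Q; apply: mpoly_linear_ext; first exact: convolution_linear.
  by move=> k P Q; rewrite convolution_linear // mderivD mderivZ opprD scalerN.
move=> b; apply/mpolyP => c; rewrite mcoeffN mcoeff_mderiv -mulr_natl !convolution_coefX //.
have [_ ->] := iotaM 'X_l hf; rewrite pactXU mfactS mexpD opprD addrA.
rewrite [esign (_ - unitE l)]esignD esign_unitN.
have h1 := natSF_neq0 charF0 (c l); have h2 := mfact_neq0 c.
rewrite -/(unitE l); move: (_.+1%:R) h1 => N1 h1.
by field; rewrite h1 h2.
Qed.

Lemma mcoeffXM0 l R c : c l = 0%N -> ('X_l * R)@_c = 0.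
Proof.
move=> cl; elim/mpolyind: R => [|k m R _ _ IH]; first by rewrite mulr0 mcoeff0.
rewrite mulrDr -scalerAr -mpolyXD mcoeffD mcoeffZ IH addr0 mcoeffX.
case: eqP => [e|]; last by rewrite mulr0.
by move: cl; rewrite -e mnmDE mnm1E eqxx.
Qed.
Lemma mcoeffXM l R c : ('X_l * R)@_(c + U_(l))%MM = R@_c.
Proof. by rewrite mulrC addmC mcoeffMX. Qed.

(** In the coefficient of index c, the factor b_l - c_l + 1 produced by the derivation
    splits into b_l + 1, coming from Lambda_l times the argument, and c_l, coming from
    Lambda_l times the value. *)
Lemma convolution_dz l f Q : expandable f ->
  convolution (dz l f) Q = 'X_l * convolution f Q - convolution f ('X_l * Q).
Proof.
move=> hf; have hdf : expandable (dz l f) by exact: expandable_dz.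
move: Q; apply: mpoly_linear_ext; first exact: convolution_linear.
  move=> k P Q; rewrite mulrDr -scalerAr !convolution_linear // mulrDr -scalerAr.
  by rewrite scalerBr; ring.
move=> b; apply/mpolyP => c; rewrite mcoeffB -mpolyXD !convolution_coefX //.
have [_ ->] := iota_dz l hf; rewrite /dseries addmC mfactS mexpD.
rewrite (_ : mexp b + mexp U_(l)%MM - mexp c = mexp b - mexp c + unitE l); last first.
  by rewrite addrAC.
rewrite [esign (_ + unitE l)]esignD esign_unitE.
have e0 : ((mexp b - mexp c) l + 1)%:~R = (b l).+1%:R - (c l)%:R :> F.
  by rewrite !ffunE -natr1 intrD intrB; ring.
rewrite e0; case: (posnP (c l)) => [cl|cpos].
  by rewrite mcoeffXM0 // cl; ring.
have ec : c = ((c - U_(l)) + U_(l))%MM.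
  by apply/mnmP => k; rewrite mnmDE mnmBE mnm1E; case: eqVneq => [<-|_]; lia.
set c' := (c - U_(l))%MM in ec; have -> : c l = (c' l).+1 by rewrite ec mnmDE mnm1E eqxx addn1.
rewrite ec mcoeffXM convolution_coefX // mfactS mexpD.
rewrite (_ : mexp b - (mexp c' + mexp U_(l)%MM) + unitE l = mexp b - mexp c'); last first.
  by rewrite opprD addrA subrK.
rewrite opprD addrA [esign (_ - mexp U_(l)%MM)]esignD esign_unitN.
have h1 := natSF_neq0 charF0 (c' l); have h2 := mfact_neq0 c'.
move: (c' l).+1%:R h1 => N1 h1.
by field; rewrite h1 h2.
Qed.

Lemma convolution1 Q : convolution 1 Q = Q.
Proof.
have h1 : expandable (1 : ratfun F p) by rewrite -of_poly1; exact: expandable_poly.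
move: Q; apply: mpoly_linear_ext => //; first exact: convolution_linear.
move=> b; apply/mpolyP => c; rewrite convolution_coefX // iota1 // /delta mcoeffX.
have [->|bc] := eqVneq b c.
  rewrite subrr eqxx mul1r /esign big1 ?expr0z ?mulr1 ?divff ?mfact_neq0 // => k _.
  by rewrite ffunE.
by rewrite subr_eq0 (inj_eq (@mexp_inj p)) (negPf bc) !mul0r.
Qed.

Lemma convolution0l Q : convolution 0 Q = 0.
Proof.
have h1 : expandable (1 : ratfun F p) by rewrite -of_poly1; exact: expandable_poly.
have h0 : expandable (0 : ratfun F p) by rewrite -of_poly0; exact: expandable_poly.
have := @convolutionL (-1) 1 1 Q h1 h1; rewrite scaleN1r addNr => -> //.
by rewrite scaleN1r addNr.
Qed.

Let sum_Lambda : {mpoly F[p]} := \sum_(i < p) 'X_i.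

Lemma sum_dz_OT f : OT_set F p f -> \sum_(l < p) dz l f = 0.
Proof.
pose T := [set: 'I_p]%SET.
have -> : \sum_(l < p) dz l f = dS T f by apply: eq_bigl => l; rewrite inE.
have Dz i j : dS T (zdiff F i j) = 0 by rewrite dS_zdiff !inE subrr scale0r.
apply: (@adjoin_ind _ _ _ (fun g => dS T g = 0)).
  split=> [|c g h hg hh|g h hg hh]; first exact: dS1.
    by rewrite dS_linear hg hh scaler0 addr0.
  by rewrite dSM hg hh mul0r mulr0 addr0.
by move=> g [i [j [ij [->|->]]]] //; rewrite dSV Dz oppr0 mul0r.
Qed.

(** The derivations sum to zero on a translation invariant function, which
    therefore commutes with the sum of the Lambda_l, and so acts on
    V[Lambda] / <d + sum Lambda_l>. *)
Lemma convolution_sum_Lambda f Q : OT_set F p f ->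
  convolution f (sum_Lambda * Q) = sum_Lambda * convolution f Q.
Proof.
move=> hf; have hx := OT_expandable hf.
have E0 (s : seq 'I_p) : convolution (\sum_(l <- s) dz l f) Q =
   (\sum_(l <- s) 'X_l) * convolution f Q - convolution f ((\sum_(l <- s) 'X_l) * Q).
  elim: s => [|l s IH].
    rewrite !big_nil !mul0r convolution0l sub0r.
    by rewrite (linear_at0 (convolution_linear hx)) oppr0.
  have hs : expandable (\sum_(l <- s) dz l f).
    by apply/OT_expandable/submod_sum => k _; exact: OT_dz.
  rewrite !big_cons -[dz l f]scale1r convolutionL ?scale1r //; first last.
  - by apply/OT_expandable/submodD; [exact: OT_dz|apply: submod_sum => k _; exact: OT_dz].
  - exact: expandable_dz.
  rewrite IH convolution_dz // !mulrDl -['X_l * Q]scale1r convolution_linear // !scale1r.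
  by ring.
apply/eqP; rewrite eq_sym -subr_eq0 -E0; apply/eqP.
have -> : \sum_(l <- index_enum 'I_p) dz l f = 0 by exact: sum_dz_OT.
exact: convolution0l.
Qed.
End Convolution.

(** * Operators on V[lambda] modulo the total derivation *)

Section VlamMaps.
Variables (F : fieldType) (V : lmodType F) (d : {linear V -> V}).

Lemma vcoef_sum n (I : Type) (s : seq I) (A : pred I) (G : I -> Vpoly V n) k :
  vcoef (\sum_(i <- s | A i) G i) k = \sum_(i <- s | A i) vcoef (G i) k.
Proof.
elim: s => [|i s IH]; first by rewrite !big_nil.
by rewrite !big_cons; case: ifP => // _; rewrite -IH.
Qed.

Definition lambda_sum n : {mpoly F[n]} := \sum_(i < n) 'X_i.

(** The condition under which phi (x) 1 maps the image of the total derivation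
    into that of the total derivation. *)
Definition intertwiner n n' (phi : {mpoly F[n]} -> {mpoly F[n']}) :=
  linear phi /\ forall P, phi (lambda_sum n * P) = lambda_sum n' * phi P.

Definition vlam_map n n' (phi : {mpoly F[n]} -> {mpoly F[n']}) (u : V -> V)
  (x : Vlam d n) : Vlam d n' := qclass _ (vmap phi u (qrep x)).

Section Commuting.
Variables (u : {linear V -> V}) (ud : forall v, u (d v) = d (u v)).

Lemma vlam_map_class n n' (phi : {mpoly F[n]} -> {mpoly F[n']}) q : intertwiner phi ->
  vlam_map phi u (qclass _ q) = qclass _ (vmap phi u q).
Proof.
move=> [hphi hS]; rewrite /vlam_map.
have [_ [r _ <-] ->] := qclassP (shift_image d n) q.
apply/eq_qclass; rewrite linearD [_ + _ - _]addrAC subrr add0r.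
exists (vmap phi u r) => //; rewrite /total_shift linearD /=.
have hid m : linear (idfun : {mpoly F[m]} -> _) by [].
have hmul m : linear ( *%R (lambda_sum m)).
  by move=> c x y; rewrite mulrDr scalerAr.
rewrite !(@vmap_comp _ _ _ _ _ phi) //; congr (_ + _).
  rewrite (@vmap_comp _ _ _ _ _ idfun) //; congr (vmap _ _ r).
  by apply: funext => v /=; rewrite ud.
rewrite (@vmap_comp _ _ _ _ _ ( *%R (lambda_sum n'))) //.
by congr (vmap _ _ r); apply: funext => P /=; rewrite -/(lambda_sum n) hS.
Qed.

Lemma vlam_map_linear n n' (phi : {mpoly F[n]} -> {mpoly F[n']}) :
  intertwiner phi -> linear (vlam_map phi u).
Proof.
move=> hphi c x y; rewrite -(qrepK x) -(qrepK y) -linearP.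
by rewrite !vlam_map_class // linearP linearP.
Qed.
Lemma vlam_map0 n n' (phi : {mpoly F[n]} -> {mpoly F[n']}) :
  intertwiner phi -> vlam_map phi u 0 = 0.
Proof.
by move=> /vlam_map_linear; exact: linear_at0. Qed.
Lemma vlam_mapD n n' (phi : {mpoly F[n]} -> {mpoly F[n']}) x y :
  intertwiner phi -> vlam_map phi u (x + y) = vlam_map phi u x + vlam_map phi u y.
Proof. by move=> /vlam_map_linear h; exact: linear_atD. Qed.
Lemma vlam_mapZ n n' (phi : {mpoly F[n]} -> {mpoly F[n']}) c x :
  intertwiner phi -> vlam_map phi u (c *: x) = c *: vlam_map phi u x.
Proof.
by move=> /vlam_map_linear h; exact: linear_atZ.
Qed.
Lemma vlam_map_sum n n' (phi : {mpoly F[n]} -> {mpoly F[n']}) (I : Type) (s : seq I)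
    (P : pred I) (G : I -> Vlam d n) : intertwiner phi ->
  vlam_map phi u (\sum_(i <- s | P i) G i) = \sum_(i <- s | P i) vlam_map phi u (G i).
Proof.
by move=> /vlam_map_linear h; exact: linear_at_sum.
Qed.
End Commuting.

Definition vmap_ext n n' (phi psi : {mpoly F[n]} -> {mpoly F[n']}) (u w : V -> V) q :
  phi =1 psi -> u =1 w -> vmap phi u q = vmap psi w q.
Proof. by move=> /funext -> /funext ->. Qed.

Lemma vlam_map_ext n n' (phi psi : {mpoly F[n]} -> {mpoly F[n']}) (u : V -> V) x :
  phi =1 psi -> vlam_map phi u x = vlam_map psi u x.
Proof. by move=> /funext ->. Qed.

Lemma vmap_combination n n' (phi psi : {mpoly F[n]} -> {mpoly F[n']})
    (u : {linear V -> V}) c q :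
  vmap (fun P => c *: phi P + psi P) u q = c *: vmap phi u q + vmap psi u q.
Proof.
have [s us hs] := vsupp2 q q.
rewrite !(@vmapE _ _ _ _ _ _ s) //; try by move=> m h; apply: hs; rewrite h.
rewrite scaler_sumr -big_split; apply: eq_bigr => m _ /=.
by apply: vpolyP => k; rewrite vcoefL !vcoef_vterm mcoeffD mcoeffZ scalerDl scalerA.
Qed.

Lemma vlam_map_combination n n' (phi psi : {mpoly F[n]} -> {mpoly F[n']})
    (u : {linear V -> V}) c x :
  vlam_map (fun P => c *: phi P + psi P) u x = c *: vlam_map phi u x + vlam_map psi u x.
Proof. by rewrite /vlam_map vmap_combination linearP. Qed.
Lemma vlam_map_phi0 n n' (u : {linear V -> V}) x :
  vlam_map (fun _ : {mpoly F[n]} => 0 : {mpoly F[n']}) u x = 0.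
Proof.
have := @vlam_map_combination n n' (fun=> 0) (fun=> 0) u (-1) x.
by rewrite scaler0 addr0 scaleN1r addNr.
Qed.
Lemma vlam_map_phiD n n' (phi psi : {mpoly F[n]} -> {mpoly F[n']}) (u : {linear V -> V}) x :
  vlam_map (fun P => phi P + psi P) u x = vlam_map phi u x + vlam_map psi u x.
Proof.
rewrite -[vlam_map phi u x]scale1r -vlam_map_combination.
by apply: vlam_map_ext => P; rewrite scale1r.
Qed.
Lemma vlam_map_phiZ n n' (phi : {mpoly F[n]} -> {mpoly F[n']}) (u : {linear V -> V}) c x :
  vlam_map (fun P => c *: phi P) u x = c *: vlam_map phi u x.
Proof.
rewrite -[RHS]addr0 -(@vlam_map_phi0 n n' u x) -vlam_map_combination.
by apply: vlam_map_ext => P; rewrite addr0.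
Qed.
Lemma vlam_map_phi_sum n n' (I : Type) (s : seq I) (A : pred I)
    (phi : I -> {mpoly F[n]} -> {mpoly F[n']}) (u : {linear V -> V}) x :
  vlam_map (fun P => \sum_(i <- s | A i) phi i P) u x =
  \sum_(i <- s | A i) vlam_map (phi i) u x.
Proof.
elim: s => [|i s IH].
  rewrite big_nil -(@vlam_map_phi0 n n' u x).
  by apply: vlam_map_ext => P; rewrite big_nil.
rewrite big_cons -IH; case: ifP => Ai; rewrite -?vlam_map_phiD; apply: vlam_map_ext => P;
  by rewrite big_cons Ai.
Qed.

Lemma vlam_map_comp n n' n'' (phi : {mpoly F[n']} -> {mpoly F[n'']})
    (psi : {mpoly F[n]} -> {mpoly F[n']}) (u w : {linear V -> V}) x :
  (forall v, u (d v) = d (u v)) -> intertwiner phi -> linear psi ->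
  vlam_map phi u (vlam_map psi w x) = vlam_map (phi \o psi) (u \o w) x.
Proof.
move=> ud hphi hpsi; rewrite [vlam_map psi w x]/vlam_map vlam_map_class //.
by rewrite (@vmap_comp _ _ _ _ _ phi psi) //; case: hphi.
Qed.

Lemma vmap_id n q : vmap (idfun : {mpoly F[n]} -> _) (idfun : V -> V) q = q.
Proof.
have [s us hs] := vsupp2 q q.
rewrite (@vmapE _ _ _ _ idfun (idfun : {linear V -> V}) s) //; last first.
  by move=> m h; apply: hs; rewrite h.
apply: vpolyP => k; rewrite vcoef_sum.
under eq_bigr => m _ do rewrite vcoef_vterm mcoeffX.
have [ks|ks] := boolP (k \in s).
  rewrite (bigD1_seq k) //= eqxx scale1r big1 ?addr0 // => m /negPf->.
  by rewrite scale0r.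
rewrite big_seq big1 => [|m ms].
  by apply/esym/eqP; apply: contraNT ks => h; apply: hs; rewrite h.
by case: eqVneq => [mk|_]; [move: ks; rewrite -mk ms|rewrite scale0r].
Qed.
Lemma vlam_map_id n (x : Vlam d n) : vlam_map idfun idfun x = x.
Proof. by rewrite /vlam_map vmap_id qrepK. Qed.

Local Notation vlm phi := (vlam_map phi (idfun : {linear V -> V})).

Lemma vlm_comp n n' n'' (phi : {mpoly F[n']} -> {mpoly F[n'']})
    (psi : {mpoly F[n]} -> {mpoly F[n']}) x :
  intertwiner phi -> linear psi -> vlm phi (vlm psi x) = vlm (phi \o psi) x.
Proof. by move=> h1 h2; rewrite vlam_map_comp. Qed.

Lemma vlam_map_idC n n' (phi : {mpoly F[n]} -> {mpoly F[n']}) (u : {linear V -> V}) x :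
  (forall v, u (d v) = d (u v)) -> intertwiner phi ->
  vlam_map idfun u (vlm phi x) = vlm phi (vlam_map idfun u x).
Proof.
move=> ud hphi; rewrite !vlam_map_comp //; by case: hphi.
Qed.

Lemma intertwiner_mul n (P : {mpoly F[n]}) : intertwiner ( *%R P).
Proof. by split=> [c x y|Q]; [rewrite mulrDr scalerAr|rewrite mulrCA]. Qed.

Lemma intertwiner_deriv n (i j : 'I_n) :
  intertwiner (fun P : {mpoly F[n]} => P^`M(j) - P^`M(i)).
Proof.
split=> [c x y|P]; first by rewrite !mderivD !mderivZ scalerBr opprD addrACA.
by rewrite !mderivM !mderiv_sum_lambda !mul1r opprD addrACA subrr add0r mulrBr.
Qed.

Lemma lambda_mulE n (i : 'I_n) (x : Vlam d n) : lambda_mul i x = vlm ( *%R 'X_i) x.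
Proof. by []. Qed.
Lemma lambda_diffE n (i j : 'I_n) (x : Vlam d n) :
  lambda_diff i j x = vlm (fun P => P^`M(j) - P^`M(i)) x.
Proof. by []. Qed.

Lemma vlam_map_in n n' (phi : {mpoly F[n]} -> {mpoly F[n']}) (u : {linear V -> V})
    (U W : submod V) x : (forall v, u (d v) = d (u v)) -> intertwiner phi ->
  (forall v, U v -> W (u v)) -> Vlam_in d n U x -> Vlam_in d n' W (vlam_map phi u x).
Proof.
move=> ud hphi UW [q hq <-]; rewrite vlam_map_class //; exists (vmap phi u q) => // k.
have [s us hs] := vsupp2 q q.
rewrite (@vmapE _ _ _ _ _ _ s) //; last by move=> m h; apply: hs; rewrite h.
rewrite vcoef_sum.
by apply: submod_sum => m _; apply: submodZ; apply: UW; exact: hq.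
Qed.

Lemma Vlam_in_mono n (U W : submod V) x : (forall v, U v -> W v) ->
  Vlam_in d n U x -> Vlam_in d n W x.
Proof. by move=> UW [q hq <-]; exists q => // m; exact/UW/hq. Qed.

(** ** Substitutions *)
Lemma poly_subst_comp n n' n'' (s : 'I_n' -> {mpoly F[n'']}) (t : 'I_n -> {mpoly F[n']}) P :
  poly_subst s (poly_subst t P) = poly_subst (fun i => poly_subst s (t i)) P.
Proof.
elim/mpoly_gen_ind: P => [c|i|P Q IP IQ|P Q IP IQ].
- by rewrite !poly_substC.
- by rewrite !poly_substX.
- by rewrite !poly_substD IP IQ.
- by rewrite !poly_substM IP IQ.
Qed.
Lemma poly_subst_id n P : poly_subst (fun i : 'I_n => 'X_i : {mpoly F[n]}) P = P.
Proof.
elim/mpoly_gen_ind: P => [c|i|P Q IP IQ|P Q IP IQ].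
- by rewrite poly_substC.
- by rewrite poly_substX.
- by rewrite poly_substD IP IQ.
- by rewrite poly_substM IP IQ.
Qed.
Lemma poly_subst_sum n n' (s : 'I_n -> {mpoly F[n']}) (I : Type) (r : seq I) (A : pred I) G :
  poly_subst s (\sum_(i <- r | A i) G i) = \sum_(i <- r | A i) poly_subst s (G i).
Proof. exact: rmorph_sum. Qed.
Lemma intertwiner_subst n n' (s : 'I_n -> {mpoly F[n']}) :
  \sum_(i < n) s i = lambda_sum n' -> intertwiner (poly_subst s).
Proof.
move=> h; split=> [|P]; first exact: poly_subst_linear.
rewrite poly_substM; congr (_ * _); rewrite poly_subst_sum -h.
by apply: eq_bigr => i _; rewrite poly_substX.
Qed.
End VlamMaps.

(** ** The variables Lambda of the lines *)

Section LambdaForm.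
Variables (F : fieldType) (charF0 : [pchar F] =i pred0).
Variables (V : lmodType F) (d : {linear V -> V}) (n p : nat).
Variables (L : lines n p) (hL : is_lines L).
Local Notation vlm phi := (vlam_map phi (idfun : {linear V -> V})).
Local Notation rt := (root hL).
Local Notation ln := (line_of hL).

Lemma line_sumE l : line_sum F L l = \sum_(i | ln i == l) 'X_i.
Proof.
rewrite /line_sum -[RHS]big_filter; apply: perm_big; apply: uniq_perm.
- exact: line_uniq.
- by rewrite filter_uniq // index_enum_uniq.
- move=> i; rewrite mem_filter mem_index_enum andbT.
  by rewrite -(mem_line hL).
Qed.

Lemma line_substE : line_subst L =1 poly_subst (line_sum F L). Proof. by []. Qed.
Lemma intertwiner_line_subst : @intertwiner F p n (line_subst L).
Proof.
apply: intertwiner_subst; under eq_bigr => l _ do rewrite line_sumE.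
rewrite /lambda_sum (exchange_big_dep predT) //=; apply: eq_bigr => i _.
by rewrite (big_pred1 (ln i)) // => l; rewrite eq_sym.
Qed.

(** A left inverse of the substitution of the line sums, which keeps only the
    variable of the last vertex of each line; the sum of all variables is sent
    to the sum of all variables. *)
Definition line_retract : {mpoly F[n]} -> {mpoly F[p]} :=
  poly_subst (fun i => if rt i == i then 'X_(ln i) else 0).
Lemma line_retract_sum l : line_retract (line_sum F L l) = 'X_l.
Proof.
rewrite line_sumE /line_retract poly_subst_sum.
have [i hi] : exists i, ln i == l.
  have [x [s e]] := tnth_cons hL l.
  by exists x; apply/eqP/(line_ofE hL); rewrite mem_tnth_seq e mem_head.
rewrite (bigD1 (rt i)) /=; last by rewrite line_of_root.
rewrite poly_substX root_root eqxx line_of_root (eqP hi) big1 ?addr0 // => j /andP[/eqP lj ji].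
rewrite poly_substX; case: eqP => // rj; move: ji; rewrite -rj (@root_eq _ _ _ hL j i) ?eqxx //.
by rewrite lj (eqP hi).
Qed.
Lemma sum_roots : \sum_(i | rt i == i) 'X_(ln i) = lambda_sum F p.
Proof.
rewrite /lambda_sum.
rewrite (eq_bigr (fun l => line_retract (line_sum F L l))); last first.
  by move=> l _; rewrite line_retract_sum.
under [RHS]eq_bigr => l _ do rewrite line_sumE /line_retract poly_subst_sum.
rewrite (exchange_big_dep predT) //= big_mkcond; apply: eq_bigr => i _.
by rewrite (big_pred1 (ln i)) => [|l]; [rewrite poly_substX|rewrite eq_sym].
Qed.
Lemma intertwiner_retract : intertwiner line_retract.
Proof. by apply: intertwiner_subst; rewrite -big_mkcond /= sum_roots. Qed.

Definition line_emb : Vlam d p -> Vlam d n := vlm (line_subst L).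
Definition line_proj : Vlam d n -> Vlam d p := vlm line_retract.

Lemma line_embK : cancel line_emb line_proj.
Proof.
move=> x; rewrite /line_emb /line_proj.
rewrite (vlm_comp x intertwiner_retract (proj1 intertwiner_line_subst)).
rewrite -[RHS]vlam_map_id; apply: vlam_map_ext => P /=.
rewrite /line_retract /line_subst poly_subst_comp -[RHS]poly_subst_id.
by congr (poly_subst _ P); apply: funext => l; exact: line_retract_sum.
Qed.

Lemma is_Lambda_formE (x : Vlam d n) q :
  is_Lambda_form L x q <-> line_emb (qclass _ q) = x.
Proof.
rewrite /is_Lambda_form /line_emb vlam_map_class //.
exact: intertwiner_line_subst.
Qed.
Lemma Lambda_form_proj (x : Vlam d n) q : is_Lambda_form L x q ->
  qclass _ q = line_proj x.
Proof. by move=> /is_Lambda_formE <-; rewrite line_embK. Qed.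

(** The coordinates where the variable of the root (the last vertex) of each line
    is replaced by the sum of the line.  There the difference of the derivations in
    k and its root is the derivation in k up to sign, so a class that it kills is
    unchanged when the variable of k is set to zero, by integration in k.  The
    antiderivative commutes with the total derivation, which does not involve the
    variable of k in these coordinates. *)
Definition to_root : {mpoly F[n]} -> {mpoly F[n]} :=
  poly_subst (fun i => if rt i == i then 'X_i - \sum_(j | (ln j == ln i) && (j != i)) 'X_j else 'X_i).
Definition of_root : {mpoly F[n]} -> {mpoly F[n]} :=
  poly_subst (fun i => if rt i == i then line_sum F L (ln i) else 'X_i).
Definition kill (ks : seq 'I_n) : {mpoly F[n]} -> {mpoly F[n]} :=
  poly_subst (fun i => if i \in ks then 0 else 'X_i).
Definition integrate (k : 'I_n) (P : {mpoly F[n]}) : {mpoly F[n]} :=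
  \sum_(m <- msupp P) (P@_m / (m k).+1%:R) *: 'X_[m + U_(k)].

Lemma nonroot_sum_fixed (s : 'I_n -> {mpoly F[n]}) i : rt i == i ->
  (forall j, rt j != j -> s j = 'X_j) ->
  poly_subst s (\sum_(j | (ln j == ln i) && (j != i)) 'X_j) =
  \sum_(j | (ln j == ln i) && (j != i)) 'X_j.
Proof.
move=> /eqP ri hs; rewrite poly_subst_sum; apply: eq_bigr => j /andP[/eqP lj ji].
rewrite poly_substX hs //; apply: contraNneq ji => rj.
by rewrite -rj -ri (@root_eq _ _ _ hL j i).
Qed.
Lemma line_sum_root i : line_sum F L (ln i) = 'X_i + \sum_(j | (ln j == ln i) && (j != i)) 'X_j.
Proof. by rewrite line_sumE (bigD1 i) //=. Qed.

Lemma of_rootK : cancel of_root to_root.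
Proof.
move=> P; rewrite /of_root /to_root poly_subst_comp -[RHS]poly_subst_id.
congr (poly_subst _ P); apply: funext => i; case: ifP => ri; last by rewrite poly_substX ri.
rewrite line_sum_root poly_substD poly_substX ri nonroot_sum_fixed ?subrK //.
by move=> j /negPf->.
Qed.
Lemma to_rootK : cancel to_root of_root.
Proof.
move=> P; rewrite /of_root /to_root poly_subst_comp -[RHS]poly_subst_id.
congr (poly_subst _ P); apply: funext => i; case: ifP => ri; last by rewrite poly_substX ri.
rewrite poly_substB poly_substX ri nonroot_sum_fixed // ?line_sum_root ?addrK //.
by move=> j /negPf->.
Qed.
Lemma of_root_sum : of_root (\sum_(i | rt i == i) 'X_i) = lambda_sum F n.
Proof.
have [_ /(_ 1)] := intertwiner_line_subst; rewrite mulr1 => e.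
have l1 : line_subst L 1 = 1 :> {mpoly F[n]} by rewrite line_substE poly_subst1.
rewrite l1 mulr1 in e; rewrite -e -sum_roots line_substE /of_root !poly_subst_sum.
by apply: eq_bigr => i ri; rewrite !poly_substX ri.
Qed.
Lemma to_root_sum : to_root (lambda_sum F n) = \sum_(i | rt i == i) 'X_i.
Proof. by rewrite -of_root_sum of_rootK. Qed.

Lemma integrate_linear k : linear (integrate k).
Proof.
move=> c P Q; apply/mpolyP => m.
have E R : (integrate k R)@_m = mfunctional (fun m' => ((m' + U_(k))%MM == m)%:R / (m' k).+1%:R) R.
  rewrite /integrate raddf_sum; apply: eq_bigr => m' _ /=.
  by rewrite mcoeffZ mcoeffX mulrAC mulrA.
by rewrite mcoeffD mcoeffZ !E mfunctionalL.
Qed.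
Lemma integrateX k m : integrate k 'X_[m] = (m k).+1%:R^-1 *: 'X_[m + U_(k)].
Proof. by rewrite /integrate msuppX big_seq1 mcoeffX eqxx div1r. Qed.

Lemma kill_linear ks : linear (kill ks). Proof. exact: poly_subst_linear. Qed.
Lemma killX k m : kill [:: k] 'X_[m] = if m k == 0%N then 'X_[m] else 0.
Proof.
rewrite /kill /poly_subst comp_mpolyX.
rewrite (eq_bigr (fun i => (if i == k then 0 else 'X_i) ^+ m i)); last first.
  by move=> i _; rewrite tnth_mktuple inE.
have [mk|mk] := boolP (m k == 0%N).
  rewrite mpolyXE_id; apply: eq_bigr => i _; case: eqVneq => // ->.
  by rewrite (eqP mk).
by rewrite (bigD1 k) //= eqxx expr0n (negPf mk) mul0r.
Qed.

Lemma integrate_deriv k P : integrate k P^`M(k) = P - kill [:: k] P.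
Proof.
have hi := integrate_linear k; have hk := kill_linear [:: k].
move: P; apply: mpoly_linear_ext.
- by move=> c P Q; rewrite mderivD mderivZ hi.
- by move=> c P Q; rewrite hk scalerBr; ring.
move=> m; rewrite mderivX killX.
have -> : integrate k ((m k)%:R *: 'X_[m - U_(k)]) = (m k)%:R *: integrate k 'X_[m - U_(k)].
  have i0 : integrate k 0 = 0 by rewrite /integrate msupp0 big_nil.
  by have := hi (m k)%:R 'X_[m - U_(k)] 0; rewrite i0 !addr0.
rewrite integrateX; case: (posnP (m k)) => [m0|mpos].
  by rewrite m0 scale0r subrr.
rewrite subr0 mnmBE mnm1E eqxx subn1 prednK // scalerA divff ?scale1r; last first.
  by rewrite natF_eq0 // -lt0n.
congr 'X_[_]; apply/mnmP => l; rewrite mnmDE mnmBE mnm1E.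
by case: eqVneq => [<-|_]; lia.
Qed.
Lemma integrateM k i P : i != k -> integrate k ('X_i * P) = 'X_i * integrate k P.
Proof.
move=> ik; have hi := integrate_linear k; move: P; apply: mpoly_linear_ext.
- by move=> c P Q; rewrite mulrDr -scalerAr hi.
- by move=> c P Q; rewrite hi mulrDr -scalerAr.
move=> m; rewrite -mpolyXD !integrateX mnmDE mnm1E (negPf ik) add0n.
by rewrite -scalerAr -mpolyXD addmA.
Qed.

Lemma to_rootD P Q : to_root (P + Q) = to_root P + to_root Q.
Proof. exact: poly_substD. Qed.
Lemma to_rootM P Q : to_root (P * Q) = to_root P * to_root Q.
Proof. exact: poly_substM. Qed.
Lemma of_rootM P Q : of_root (P * Q) = of_root P * of_root Q.
Proof. exact: poly_substM. Qed.

Definition root_integrate k P := of_root (integrate k (to_root P)).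

Lemma root_integrate_intertwiner k : rt k != k -> intertwiner (root_integrate k).
Proof.
move=> rk; split=> [c P Q|P].
  by rewrite /root_integrate /to_root poly_subst_linear integrate_linear /of_root poly_subst_linear.
rewrite /root_integrate to_rootM to_root_sum.
have -> : integrate k ((\sum_(i | rt i == i) 'X_i) * to_root P) =
    (\sum_(i | rt i == i) 'X_i) * integrate k (to_root P).
  have i0 : integrate k 0 = 0 by rewrite /integrate msupp0 big_nil.
  have iD x y : integrate k (x + y) = integrate k x + integrate k y.
    by have := integrate_linear k 1 x y; rewrite !scale1r.
  rewrite !mulr_suml (big_morph (integrate k) iD i0); apply: eq_bigr => i ri.
  by rewrite integrateM //; apply: contraNneq rk => <-.
by rewrite of_rootM of_root_sum.
Qed.

Lemma to_root_deriv k P : rt k != k ->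
  to_root (P^`M(rt k) - P^`M(k)) = - (to_root P)^`M(k).
Proof.
move=> rk.
have hX i j : (if rt i == i then 'X_i - \sum_(j0 | (ln j0 == ln i) && (j0 != i)) 'X_j0
    else 'X_i : {mpoly F[n]})^`M(j) = (i == j)%:R - ((rt i == i) && (ln j == ln i) && (j != i))%:R.
  case: ifP => ri; last by rewrite mderivXU subr0.
  rewrite mderivB mderivXU.
  suff -> : (\sum_(j0 | (ln j0 == ln i) && (j0 != i)) 'X_j0 : {mpoly F[n]})^`M(j) =
      ((ln j == ln i) && (j != i))%:R by [].
  rewrite raddf_sum /=; under eq_bigr => j0 _ do rewrite mderivXU.
  case: (boolP ((ln j == ln i) && (j != i))) => hj.
    by rewrite (bigD1 j) //= eqxx big1 ?addr0 // => j0 /andP[_ /negPf->].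
  rewrite big1 // => j0 hj0; case: eqVneq => // e; move: hj; by rewrite -e hj0.
elim/mpoly_gen_ind: P => [c|i|P Q IP IQ|P Q IP IQ].
- rewrite !mderivC subrr [to_root c%:MP]poly_substC mderivC oppr0; exact: comp_mpoly0.
- rewrite !mderivXU /to_root poly_substX hX poly_substB.
  have E (b : bool) : poly_subst (fun i => if rt i == i then 'X_i - \sum_(j | (ln j == ln i) && (j != i)) 'X_j else 'X_i : {mpoly F[n]}) (b%:R : {mpoly F[n]}) = b%:R.
    by case: b; rewrite ?poly_subst1 // /poly_subst !mulr0n comp_mpoly0.
  rewrite !E opprB; congr (_%:R - _).
  have [->|ik] := eqVneq i (rt k).
    by rewrite root_root line_of_root !eqxx [k == _]eq_sym rk.
  have [ri|//] := eqVneq (rt i) i; rewrite /=.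
  case: eqVneq => //= lk; move: ik; by rewrite -ri (@root_eq _ _ _ hL i k) ?eqxx.
- have -> : (P + Q)^`M(rt k) - (P + Q)^`M(k) =
     (P^`M(rt k) - P^`M(k)) + (Q^`M(rt k) - Q^`M(k)) by rewrite !mderivD; ring.
  by rewrite [LHS]to_rootD IP IQ to_rootD mderivD opprD.
- have -> : (P * Q)^`M(rt k) - (P * Q)^`M(k) =
     (P^`M(rt k) - P^`M(k)) * Q + P * (Q^`M(rt k) - Q^`M(k)) by rewrite !mderivM; ring.
  by rewrite [LHS]to_rootD !to_rootM IP IQ mderivM mulNr mulrN opprD.
Qed.

(** Setting the variables of ks to zero, in the coordinates of the line sums. *)
Definition root_kill ks P := of_root (kill ks (to_root P)).
Lemma root_kill_intertwiner ks : (forall k, k \in ks -> rt k != k) ->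
  intertwiner (root_kill ks).
Proof.
move=> hks; split=> [c P Q|P].
  by rewrite /root_kill /to_root poly_subst_linear kill_linear /of_root poly_subst_linear.
rewrite /root_kill to_rootM to_root_sum.
rewrite /kill poly_substM -/(kill ks (to_root P)) poly_subst_sum.
rewrite (eq_bigr (fun i => 'X_i)); last first.
  move=> i ri; rewrite poly_substX; case: ifP => // /hks; by rewrite ri.
by rewrite of_rootM of_root_sum.
Qed.

Lemma vlm_root_kill ks (x : Vlam d n) : (forall k, k \in ks -> rt k != k) ->
  (forall k, lambda_diff k (rt k) x = 0) -> vlm (root_kill ks) x = x.
Proof.
move=> hks hx; elim: ks hks => [|k ks IH] hks.
  rewrite -[RHS]vlam_map_id; apply: vlam_map_ext => P.
  by rewrite /root_kill /kill poly_subst_id to_rootK.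
have rk : rt k != k by apply: hks; rewrite mem_head.
have hks' j : j \in ks -> rt j != j by move=> h; apply: hks; rewrite inE h orbT.
have hk1 : forall j, j \in [:: k] -> rt j != j by move=> j; rewrite inE => /eqP->.
have -> : vlm (root_kill (k :: ks)) x = vlm (root_kill [:: k]) (vlm (root_kill ks) x).
  rewrite [RHS](vlm_comp x (root_kill_intertwiner hk1) (proj1 (root_kill_intertwiner hks'))).
  apply: vlam_map_ext => P; rewrite /root_kill /= of_rootK.
  congr of_root; rewrite /kill poly_subst_comp; congr (poly_subst _ _).
  apply: funext => i; rewrite !inE; case: (i \in ks) => /=.
    by rewrite orbT /poly_subst comp_mpoly0.
  by rewrite orbF poly_substX inE.
rewrite IH //; apply/eqP; rewrite eq_sym -subr_eq0; apply/eqP.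
transitivity (- vlm (root_integrate k) (lambda_diff k (rt k) x)); last first.
  by rewrite hx vlam_map0 ?oppr0 //; exact: root_integrate_intertwiner.
rewrite lambda_diffE.
rewrite [vlm _ (vlm _ _)](vlm_comp x (root_integrate_intertwiner rk) (proj1 (intertwiner_deriv F k (rt k)))).
rewrite -{1}[x]vlam_map_id -scaleN1r -[RHS]scaleN1r -!vlam_map_phiZ -vlam_map_phiD.
apply: vlam_map_ext => P /=; rewrite /root_integrate to_root_deriv //.
rewrite -scaleN1r.
have -> : integrate k (-1 *: (to_root P)^`M(k)) = -1 *: integrate k (to_root P)^`M(k).
  have i0 : integrate k 0 = 0 by rewrite /integrate msupp0 big_nil.
  by have := integrate_linear k (-1) (to_root P)^`M(k) 0; rewrite i0 !addr0.
rewrite integrate_deriv /of_root /poly_subst linearZ /= scalerA mulrNN mulr1 scale1r.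
rewrite linearB /= -!/(poly_subst _ _) -/(of_root _) -/(of_root _) to_rootK.
by rewrite scaleN1r.
Qed.

(** With the variables of all vertices that are not roots set to zero, a polynomial
    in the coordinates of the line sums depends on these sums only. *)
Lemma line_projK (x : Vlam d n) : (forall k, lambda_diff k (rt k) x = 0) ->
  line_emb (line_proj x) = x.
Proof.
move=> hx; have hks k : k \in [seq k <- index_enum 'I_n | rt k != k] -> rt k != k.
  by rewrite mem_filter => /andP[].
rewrite -[RHS](vlm_root_kill hks hx) /line_emb /line_proj.
rewrite [LHS](vlm_comp x intertwiner_line_subst (proj1 intertwiner_retract)).
apply: vlam_map_ext => P /=.
rewrite /root_kill /of_root /kill /to_root /line_retract line_substE !poly_subst_comp.
congr (poly_subst _ P); apply: funext => i; case: ifP => ri.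
  rewrite poly_substX !poly_substB !poly_substX mem_filter ri /= poly_substX ri.
  rewrite poly_subst_sum big1 ?subr0 //.
  move=> j /andP[/eqP lj ji]; rewrite poly_substX mem_filter mem_index_enum andbT.
  case: ifP => [_|/negbFE rj]; first by rewrite /poly_subst comp_mpoly0.
  by move: ji; rewrite (@root_inj _ _ _ hL j i) ?eqxx //; apply/eqP.
by rewrite !poly_substX mem_filter mem_index_enum ri /= /poly_subst !comp_mpoly0.
Qed.
End LambdaForm.

(** * The chiral operation attached to lines *)

Section FiniteSupportSums.
Variables (T : choiceType) (M : nmodType).
Implicit Types G H : T -> M.
Definition fsupp G := exists s : seq T, forall x, x \notin s -> G x = 0.

Lemma fsuppT_seq G (s : seq T) : uniq s -> (forall x, x \notin s -> G x = 0) ->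
  \sum_(x \in [set: T]) G x = \sum_(x <- s) G x.
Proof.
move=> us hs; rewrite (fsum_seq us); last first.
  by move=> x _; apply: contraNT => /hs->.
by apply: eq_bigl => x; rewrite asboolT.
Qed.
Lemma fsupp_common G H : fsupp G -> fsupp H -> exists s : seq T, [/\ uniq s,
  forall x, x \notin s -> G x = 0 & forall x, x \notin s -> H x = 0].
Proof.
move=> [s hs] [s' hs']; exists (undup (s ++ s')); split; first exact: undup_uniq.
  by move=> x; rewrite mem_undup mem_cat negb_or => /andP[/hs].
by move=> x; rewrite mem_undup mem_cat negb_or => /andP[_ /hs'].
Qed.
Lemma fsumD G H : fsupp G -> fsupp H ->
  \sum_(x \in [set: T]) (G x + H x) =
  \sum_(x \in [set: T]) G x + \sum_(x \in [set: T]) H x.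
Proof.
move=> hG hH; have [s [us hs hs']] := fsupp_common hG hH.
rewrite !(@fsuppT_seq _ s) // -?big_split // => x xs.
by rewrite hs // hs' // addr0.
Qed.
Lemma eq_fsum H G : G =1 H ->
  \sum_(x \in [set: T]) G x = \sum_(x \in [set: T]) H x.
Proof. by move=> /funext->. Qed.
Lemma fsuppD G H : fsupp G -> fsupp H -> fsupp (fun x => G x + H x).
Proof.
move=> hG hH; have [s [_ hs hs']] := fsupp_common hG hH.
by exists s => x xs; rewrite hs // hs' // addr0.
Qed.
Lemma fsumT_reindex (T' : choiceType) (h : T' -> T) (G : T' -> M) H : injective h ->
  (forall t, H (h t) = G t) -> (forall x, (forall t, x <> h t) -> H x = 0) ->
  \sum_(x \in [set: T]) H x = \sum_(t \in [set: T']) G t.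
Proof.
move=> hi hG h0; rewrite -(@fsbig_widen _ _ _ _ (range h)) //; last first.
  by move=> x [_ /= nx]; apply: h0 => t xt; apply: nx; exists t.
rewrite (@reindex_fsbig _ _ _ _ _ h [set: T'] (range h)); first exact: eq_fsbigr.
split; [by move=> t _; exists t|by move=> x y _ _; exact: hi|].
by move=> _ [t _ <-]; exists t.
Qed.
End FiniteSupportSums.

Lemma fsum_additive (T : choiceType) (M M' : nmodType) (f : M -> M') (G : T -> M) :
  f 0 = 0 -> (forall x y, f (x + y) = f x + f y) -> fsupp G ->
  f (\sum_(x \in [set: T]) G x) = \sum_(x \in [set: T]) f (G x).
Proof.
move=> f0 fD [s hs]; rewrite !(@fsuppT_seq _ _ _ (undup s)) ?undup_uniq //.
- exact: big_morph.
- by move=> x; rewrite mem_undup => /hs ->.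
- by move=> x; rewrite mem_undup => /hs.
Qed.

Lemma fsumZ (F : fieldType) (W : lmodType F) (T : choiceType) c (G : T -> W) : fsupp G ->
  \sum_(x \in [set: T]) c *: G x = c *: \sum_(x \in [set: T]) G x.
Proof.
move=> hG; rewrite (@fsum_additive _ _ _ ( *:%R c)) ?scaler0 //.
by move=> x y; rewrite scalerDr.
Qed.
Lemma fsuppZ (F : fieldType) (W : lmodType F) (T : choiceType) c (G : T -> W) : fsupp G ->
  fsupp (fun x => c *: G x).
Proof. by move=> [s hs]; exists s => x /hs->; rewrite scaler0. Qed.

Section DividedDerivatives.
Variables (F : fieldType) (charF0 : [pchar F] =i pred0).
Variables (V : lmodType F) (d : {linear V -> V}) (n : nat).
Local Notation tensors := ('I_n -> V).
Implicit Types (v : tensors) (b : 'X_{1..n}).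

Lemma upd_id v i : upd v i (v i) = v.
Proof. by apply: funext => k; rewrite /upd; case: eqVneq => // ->. Qed.

Lemma multilinearZ (W : lmodType F) (g : tensors -> W) v i c x : multilinear g ->
  g (upd v i (c *: x)) = c *: g (upd v i x).
Proof.
move=> hg; have g0 : g (upd v i 0) = 0.
  by have := hg v i (-1) 0 0; rewrite scaler0 addr0 => ->; rewrite scaleN1r addNr.
by rewrite -[c *: x in LHS]addr0 hg g0 addr0.
Qed.

Lemma iter_dL k c x y : iter k d (c *: x + y) = c *: iter k d x + iter k d y.
Proof. by elim: k => //= k ->; rewrite linearP. Qed.
Lemma iter_dC k x : iter k d (d x) = d (iter k d x).
Proof. by rewrite -iterSr. Qed.

Lemma d_dpow_upd b v i x :
  d_dpow d b (upd v i x) = upd (d_dpow d b v) i ((b i)`!%:R^-1 *: iter (b i) d x).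
Proof. by apply: funext => k; rewrite /d_dpow /upd; case: eqVneq => [->|]. Qed.
Lemma multilinear_d_dpow (W : lmodType F) (g : tensors -> W) b : multilinear g ->
  multilinear (fun v => g (d_dpow d b v)).
Proof.
move=> hg v i c x y; rewrite !d_dpow_upd iter_dL scalerDr scalerA mulrC -scalerA.
by rewrite hg.
Qed.
Lemma d_dpow_d_at b v i : d_dpow d b (d_at d i v) = d_at d i (d_dpow d b v).
Proof.
rewrite /d_at d_dpow_upd; congr (upd _ i _).
by rewrite /d_dpow linearZ /= iter_dC.
Qed.
Lemma multilinear_d_dpowU (W : lmodType F) (g : tensors -> W) b v i : multilinear g ->
  (b i).+1%:R *: g (d_dpow d (b + U_(i))%MM v) = g (d_dpow d b (d_at d i v)).
Proof.
move=> hg; rewrite -[d_dpow d (b + _)%MM v](upd_id _ i) -multilinearZ //; congr g.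
apply: funext => k; rewrite /d_dpow /d_at /upd !mnmDE !mnm1E eqxx addn1.
rewrite [i == k]eq_sym; case: eqVneq => [->|_]; last by rewrite addn0.
rewrite scalerA factS natrM invfM mulrA divff ?mul1r; last exact: natSF_neq0.
by rewrite -iterSr.
Qed.
Lemma d_dpow0 v : d_dpow d 0%MM v = v.
Proof. by apply: funext => k; rewrite /d_dpow mnm0E fact0 invr1 scale1r. Qed.
End DividedDerivatives.

Section LineTerm.
Variables (F : fieldType) (charF0 : [pchar F] =i pred0).
Variables (V : lmodType F) (d : {linear V -> V}) (n p : nat).
Variables (L : lines n p) (hL : is_lines L).
Local Notation vlm phi := (vlam_map phi (idfun : {linear V -> V})).
Local Notation rt := (root hL).
Local Notation ln := (line_of hL).
Local Notation tensors := ('I_n -> V).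
Local Notation z := (zdiff F).
Local Notation FC := (@fourier_coef F n p L).
Local Notation emb := (@line_subst F n p L).
Implicit Types (f : ratfun F n) (a b c : 'X_{1..n}) (v : tensors).

Definition dpowX a : {mpoly F[n]} := (mfact F a)^-1 *: 'X_[a].
Lemma dpowXE a : \prod_(i < n) dpow ('X_i : {mpoly F[n]}) (a i) = dpowX a.
Proof. exact: prod_dpow. Qed.
Lemma dpowXS a i : (a i).+1%:R *: dpowX (a + U_(i))%MM = 'X_i * dpowX a.
Proof.
rewrite /dpowX mfactS scalerA invfM mulrA divff ?mul1r; last exact: natSF_neq0.
by rewrite -scalerAr -mpolyXD addmC.
Qed.
Lemma mderiv_dpowXS a i : (dpowX (a + U_(i))%MM)^`M(i) = dpowX a.
Proof.
rewrite /dpowX mderivZ mderivX mnmDE mnm1E eqxx addn1 addmK scalerA mfactS.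
by rewrite invfM mulrAC mulVf ?mul1r //; exact: natSF_neq0.
Qed.
Lemma mderiv_dpowX0 a i : a i = 0%N -> (dpowX a)^`M(i) = 0.
Proof. by move=> ai; rewrite /dpowX mderivZ mderivX ai scale0r scaler0. Qed.
Lemma mnm_predE a i : a i != 0%N -> a = ((a - U_(i)) + U_(i))%MM.
Proof.
move=> ai; apply/mnmP => k; rewrite mnmDE mnmBE mnm1E.
by case: eqVneq => [<-|_]; lia.
Qed.
Lemma mnm_addUI a b i : (a + U_(i) = b + U_(i))%MM -> a = b.
Proof. by move=> /(congr1 (fun m => (m - U_(i))%MM)); rewrite !addmK. Qed.
Lemma mnm_shift_range a b i : (forall t, (a, b) <> ((t.1 + U_(i))%MM, t.2)) -> a i = 0%N.
Proof.
by move=> h; apply/eqP/negPn/negP => ai; apply: (h ((a - U_(i))%MM, b)); rewrite -mnm_predE.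
Qed.
Lemma mnm_shift_range2 a b i : (forall t, (a, b) <> (t.1, (t.2 + U_(i))%MM)) -> b i = 0%N.
Proof.
by move=> h; apply/eqP/negPn/negP => bi; apply: (h (a, (b - U_(i))%MM)); rewrite -mnm_predE.
Qed.

Lemma mderiv_line_subst k R : (emb R)^`M(k) = emb R^`M(ln k).
Proof.
rewrite !line_substE; elim/mpoly_gen_ind: R => [c|l|P Q IP IQ|P Q IP IQ].
- by rewrite poly_substC !mderivC /poly_subst comp_mpoly0.
- rewrite poly_substX mderivXU (line_sumE F hL) raddf_sum /=.
  under eq_bigr => i _ do rewrite mderivXU.
  have E (e : bool) : poly_subst (line_sum F L) (e%:R : {mpoly F[p]}) = e%:R.
    by case: e; rewrite ?poly_subst1 // /poly_subst !mulr0n comp_mpoly0.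
  rewrite E; case: (eqVneq l (ln k)) => [->|lk].
    by rewrite (bigD1 k) //= eqxx big1 ?addr0 // => i /andP[_ /negPf->].
  rewrite big1 // => i /eqP li; case: eqVneq => // ik; move: lk.
  by rewrite -li ik eqxx.
- by rewrite mderivD !poly_substD mderivD IP IQ.
- by rewrite mderivM poly_substM poly_substD !poly_substM mderivM IP IQ.
Qed.

Lemma intertwiner_scaled_line (P : {mpoly F[n]}) (g : ratfun F p) : OT_set F p g ->
  intertwiner (fun Q => P * emb (convolution g Q)).
Proof.
move=> hg; have hx := OT_expandable hg.
have [h1 h2] := intertwiner_line_subst F hL.
split=> [k Q Q'|Q].
  by rewrite convolution_linear // h1 mulrDr -scalerAr.
by rewrite [convolution _ _](convolution_sum_Lambda charF0) // h2 mulrCA.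
Qed.

(** The index c of the Fourier coefficient is a + b in the formula, and is shifted
    independently of a and b when f is differentiated. *)
Definition term_op f a c : {mpoly F[p]} -> {mpoly F[n]} :=
  fun Q => dpowX a * emb (convolution (FC f c) Q).
Lemma intertwiner_term f a c : OT_set F n f -> intertwiner (term_op f a c).
Proof. by move=> hf; apply: intertwiner_scaled_line; exact: fourier_coef_OT. Qed.

Variable y : tensors -> Vlam d p.
Definition term f v ab := vlm (term_op f ab.1 (ab.1 + ab.2)%MM) (y (d_dpow d ab.2 v)).
(** The contribution of one family of lines L to the formula, with y in place of
    Y^L. *)
Definition line_term f v : Vlam d n :=
  \sum_(ab \in [set: 'X_{1..n} * 'X_{1..n}]) term f v ab.

Lemma emb0 : emb 0 = 0. Proof. exact: comp_mpoly0. Qed.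

Lemma fsupp_mnm (M : nmodType) (G : 'X_{1..n} * 'X_{1..n} -> M) N :
  (forall a b, (exists i, N <= (a + b)%MM i)%N -> G (a, b) = 0) -> fsupp G.
Proof.
move=> hN; have [s [_ hs]] := finite_enum (finite_mnm_box n N).
exists [seq (a, b) | a <- s, b <- s] => -[a b] nab; apply: hN.
apply: contrapT => h; move/negP: nab; apply; apply/allpairsP; exists (a, b).
have ha i : ((a + b)%MM i < N)%N by rewrite ltnNge; apply/negP => ?; apply: h; exists i.
by split=> //=; apply/hs => i; have := ha i; rewrite mnmDE; lia.
Qed.

(** Only finitely many terms matter, whatever the operators in front. *)
Lemma fsupp_fourier (M : nmodType) f (k : nat) (G : 'X_{1..n} * 'X_{1..n} -> M)
    (sh : 'X_{1..n} -> 'X_{1..n}) :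
  (forall c i, (c i <= sh c i + k)%N) ->
  (forall a b, FC f (sh (a + b)%MM) = 0 -> G (a, b) = 0) -> fsupp G.
Proof.
move=> hsh hG; have [N hN] := fourier_coef_finite charF0 hL f.
apply: (@fsupp_mnm _ _ (N + k)) => a b [i hi]; apply/hG/hN; exists i.
by have := hsh (a + b)%MM i; lia.
Qed.
Lemma fsupp_fourier0 (M : nmodType) f (G : 'X_{1..n} * 'X_{1..n} -> M) :
  (forall a b, FC f (a + b)%MM = 0 -> G (a, b) = 0) -> fsupp G.
Proof. by apply: (@fsupp_fourier _ f 0 G id) => c i; rewrite addn0. Qed.

Lemma vlm_fourier0 (P : {mpoly F[n]}) x :
  vlm (fun Q : {mpoly F[p]} => P * emb (convolution 0 Q)) x = 0 :> Vlam d n.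
Proof.
rewrite -[RHS](@vlam_map_phi0 _ _ d p n (idfun : {linear V -> V}) x).
by apply: vlam_map_ext => Q; rewrite convolution0l emb0 mulr0.
Qed.

Lemma fsupp_term f v : fsupp (term f v).
Proof.
apply: (@fsupp_fourier0 _ f) => a b e0.
by rewrite /term /term_op /= e0 vlm_fourier0.
Qed.

Lemma vlmD m m' (phi : {mpoly F[m]} -> {mpoly F[m']}) (x x' : Vlam d m) : intertwiner phi ->
  vlm phi (x + x') = vlm phi x + vlm phi x'.
Proof. exact: vlam_mapD. Qed.
Lemma vlmZ m m' (phi : {mpoly F[m]} -> {mpoly F[m']}) (c : F) (x : Vlam d m) :
  intertwiner phi ->
  vlm phi (c *: x) = c *: vlm phi x.
Proof. exact: vlam_mapZ. Qed.

Lemma conv_combination k g g' Q : OT_set F p g -> OT_set F p g' ->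
  convolution (k *: g + g') Q = k *: convolution g Q + convolution g' Q.
Proof.
by move=> hg hg'; apply: convolutionL; apply: OT_expandable => //; exact: submodL.
Qed.
Lemma convZ k g Q : OT_set F p g -> convolution (k *: g) Q = k *: convolution g Q.
Proof.
move=> hg; rewrite -[k *: g]addr0 conv_combination //; last exact: submod0.
by rewrite convolution0l addr0.
Qed.
Lemma FC_OT f a : OT_set F n f -> OT_set F p (FC f a).
Proof. exact: fourier_coef_OT. Qed.

Lemma embL k Q R : emb (k *: Q + R) = k *: emb Q + emb R.
Proof. by have [h _] := intertwiner_line_subst F hL; exact: h. Qed.
Lemma embZ k Q : emb (k *: Q) = k *: emb Q.
Proof. by rewrite -[k *: Q]addr0 embL emb0 addr0. Qed.

Lemma line_term_linear k f g v : OT_set F n f -> OT_set F n g ->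
  line_term (k *: f + g) v = k *: line_term f v + line_term g v.
Proof.
move=> hf hg; rewrite /line_term.
rewrite -fsumZ -?fsumD; try by [exact: fsupp_term|exact/fsuppZ/fsupp_term].
apply: eq_fsum => -[a b]; rewrite /term -vlam_map_combination.
apply: vlam_map_ext => Q /=; rewrite /term_op (fourier_coef_linear charF0 hL) //.
rewrite conv_combination; [|exact: FC_OT|exact: FC_OT].
by rewrite embL mulrDr -scalerAr.
Qed.

Hypothesis y_multilinear : multilinear y.
Lemma line_term_multilinear f : OT_set F n f -> multilinear (line_term f).
Proof.
move=> hf v i k x x'; rewrite /line_term.
rewrite -fsumZ -?fsumD; try by [exact: fsupp_term|exact/fsuppZ/fsupp_term].
apply: eq_fsum => -[a b]; rewrite /term.
rewrite (multilinear_d_dpow d b y_multilinear) /= vlmD; last exact: intertwiner_term.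
by rewrite vlmZ //; exact: intertwiner_term.
Qed.

Lemma OT_mul f g : OT_set F n f -> OT_set F n g -> OT_set F n (f * g).
Proof. exact: adjoinM. Qed.
Lemma OT_mulz i j f : OT_set F n f -> OT_set F n (z i j * f).
Proof. by apply: OT_mul; exact: OT_zdiff. Qed.

(** Differentiating the explicit powers of lambda_j amounts to multiplying f by
    z_(root j) - z_j, which shifts the index of the Fourier coefficients. *)
Lemma line_term_shift f v j : OT_set F n f ->
  \sum_(ab \in [set: 'X_{1..n} * 'X_{1..n}])
    vlm (fun Q => (dpowX ab.1)^`M(j) * emb (convolution (FC f (ab.1 + ab.2)%MM) Q))
      (y (d_dpow d ab.2 v)) = line_term (z (rt j) j * f) v.
Proof.
move=> hf; apply: (@fsumT_reindex _ _ _ (fun t => ((t.1 + U_(j))%MM, t.2))).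
- by move=> [a b] [a' b'] e; have /= /mnm_addUI-> := congr1 fst e; have /= -> := congr1 snd e.
- move=> [a b] /=; apply: vlam_map_ext => Q; rewrite mderiv_dpowXS /term_op /=.
  by rewrite (fourier_coefMu hL) -!addmA [(U_(j) + _)%MM]addmC.
move=> [a b] /mnm_shift_range a0; rewrite -[RHS](@vlam_map_phi0 _ _ d p n (idfun : {linear V -> V}) (y (d_dpow d b v))).
by apply: vlam_map_ext => Q; rewrite mderiv_dpowX0 // mul0r.
Qed.

(** In z_ij = (z_(root j) - z_j) + (z_(root i) - z_(root j)) - (z_(root i) - z_i),
    the outer terms differentiate the explicit powers of lambda, and the middle one
    is w_l - w_m for the lines l and m of i and j, which differentiates the powers
    of Lambda inside the convolution product. *)
Lemma line_term_mulz i j f v : OT_set F n f ->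
  line_term (z i j * f) v = lambda_diff i j (line_term f v).
Proof.
move=> hf.
have hdiff := intertwiner_deriv F i j.
rewrite lambda_diffE [in RHS]/line_term (@fsum_additive _ _ _ (vlm _)); first last.
- exact: fsupp_term.
- by move=> x x'; exact: vlmD.
- exact: vlam_map0.
pose A k ab := vlm (fun Q => (dpowX ab.1)^`M(k) * emb (convolution (FC f (ab.1 + ab.2)%MM) Q))
      (y (d_dpow d ab.2 v)) : Vlam d n.
have sA k : fsupp (A k).
  by apply: (@fsupp_fourier0 _ f) => a b e0; rewrite /A /= e0 vlm_fourier0.
rewrite (@eq_fsum _ _ (fun ab => (A j ab + term (z (rt i) (rt j) * f) v ab) + (-1) *: A i ab)); last first.
  move=> [a b]; rewrite /term vlm_comp //; last first.
    by case: (intertwiner_term a (a + b)%MM hf).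
  rewrite /A -vlam_map_phiZ -!vlam_map_phiD; apply: vlam_map_ext => Q /=.
  rewrite /term_op (fourier_coefMroot charF0 hL) // !mderivM !mderiv_line_subst.
  set g := FC f (a + b)%MM.
  have hg : expandable g by apply: OT_expandable; exact: FC_OT.
  have -> : z (ln i) (ln j) * g = (-1) *: (zvar F (ln j) * g) + zvar F (ln i) * g.
    by rewrite scaleN1r /zdiff; ring.
  have hz l : expandable (zvar F l * g) by exact: expandableM.
  rewrite convolutionL //; last first.
    have -> : (-1) *: (zvar F (ln j) * g) + zvar F (ln i) * g =
        of_poly ('X_(ln i) - 'X_(ln j)) * g.
      by rewrite of_polyB scaleN1r /zvar; ring.
    exact: expandableM.
  rewrite !(convolutionMz charF0) // embL -[- (_ ^`M(ln i))]scaleN1r embZ.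
  rewrite -[- (_ ^`M(ln j))]scaleN1r embZ !scaleN1r opprK.
  by ring.
have eA k : \sum_(ab \in [set: 'X_{1..n} * 'X_{1..n}]) A k ab = line_term (z (rt k) k * f) v.
  exact: line_term_shift.
clearbody A.
rewrite fsumD; [|by apply: fsuppD; [exact: sA|exact: fsupp_term]|exact: fsuppZ].
rewrite fsumD; [|exact: sA|exact: fsupp_term].
rewrite (fsumZ (-1) (sA i)) (eA i) (eA j).
have OTz k l : OT_set F n (z k l * f) by exact: OT_mulz.
have OTs : OT_set F n (1 *: (z (rt j) j * f) + z (rt i) (rt j) * f) by exact: submodL.
have l1 := line_term_linear 1 v (OTz (rt j) j) (OTz (rt i) (rt j)).
have l2 := line_term_linear (-1) v (OTz (rt i) i) OTs.
rewrite [1 *: line_term _ _]scale1r in l1.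
rewrite -/(line_term _ v) [RHS]addrC -l1 -l2; congr (line_term _ v).
by rewrite scale1r scaleN1r /zdiff; ring.
Qed.

(** The factor a_i + b_i in the Fourier coefficients of the derivative of f is
    shared between multiplication by lambda_i and the derivation of v_i. *)
Lemma line_term_dz i f v : OT_set F n f -> rt i != i ->
  line_term (dz i f) v = line_term f (d_at d i v) + lambda_mul i (line_term f v).
Proof.
move=> hf ri; have hdf : OT_set F n (dz i f) by exact: OT_dz.
pose A ab := vlm (term_op f ab.1 (ab.1 + ab.2 - U_(i))%MM) (y (d_dpow d ab.2 v)) : Vlam d n.
have sA (k : 'X_{1..n} * 'X_{1..n} -> F) : fsupp (fun ab => k ab *: A ab).
  apply: (@fsupp_fourier _ f 1 _ (fun c => c - U_(i))%MM) => [c l|a b e0].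
    by rewrite mnmBE mnm1E; case: eqVneq => _; lia.
  by rewrite /A /term_op /= e0 vlm_fourier0 scaler0.
rewrite {1}/line_term (@eq_fsum _ _ (fun ab : 'X_{1..n} * 'X_{1..n} =>
    (ab.2 i)%:R *: A ab + (ab.1 i)%:R *: A ab)); last first.
  move=> [a b]; rewrite /term /A -scalerDl -vlam_map_phiZ; apply: vlam_map_ext => Q /=.
  rewrite /term_op (fourier_coef_dz charF0 _ hf ri) convZ; last exact: FC_OT.
  by rewrite embZ -scalerAr mnmDE natrD addrC.
rewrite fsumD; [|exact: sA|exact: sA]; congr (_ + _).
  apply: (@fsumT_reindex _ _ _ (fun t => (t.1, (t.2 + U_(i))%MM))).
  - by move=> [a b] [a' b'] e; have /= -> := congr1 fst e; have /= /mnm_addUI-> := congr1 snd e.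
  - move=> [a b]; rewrite /A /term /= mnmDE mnm1E eqxx addn1 addmA addmK.
    by rewrite -vlmZ ?(multilinear_d_dpowU charF0) //; exact: intertwiner_term.
  by move=> [a b] /mnm_shift_range2 b0; rewrite /= b0 scale0r.
rewrite lambda_mulE /line_term (@fsum_additive _ _ _ (vlm _)); first last.
- exact: fsupp_term.
- by move=> x x'; apply: vlmD; exact: intertwiner_mul.
- by apply: vlam_map0 => //; exact: intertwiner_mul.
apply: (@fsumT_reindex _ _ _ (fun t => ((t.1 + U_(i))%MM, t.2))).
- by move=> [a b] [a' b'] e; have /= /mnm_addUI-> := congr1 fst e; have /= -> := congr1 snd e.
- move=> [a b]; rewrite /A /term vlm_comp; first last.
  + by case: (intertwiner_term a (a + b)%MM hf).
  + exact: intertwiner_mul.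
  rewrite /= -vlam_map_phiZ; apply: vlam_map_ext => Q /=; rewrite /term_op.
  rewrite mnmDE mnm1E eqxx addn1 scalerAl dpowXS -mulrA.
  by rewrite -addmA [(U_(i) + _)%MM]addmC addmA addmK.
by move=> [a b] /mnm_shift_range a0; rewrite /= a0 scale0r.
Qed.

Lemma lambda_mul_sum (A : pred 'I_n) (x : Vlam d n) :
  \sum_(i | A i) lambda_mul i x = vlm ( *%R (\sum_(i | A i) 'X_i)) x.
Proof.
rewrite -vlam_map_phi_sum; apply: vlam_map_ext => Q /=.
by rewrite mulr_suml.
Qed.

Hypothesis y_sesquilinear : forall l v,
  \sum_(i | ln i == l) y (d_at d i v) = - lambda_mul l (y v).

(** The sum of the derivations of a line acts on the Fourier coefficients as the
    derivation in w_l, hence as the commutator with Lambda_l; one half of it is the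
    sum of the lambda_i of the line, the other half is the sum of the derivations of
    the arguments, by sesquilinearity of y. *)
Lemma line_term_dz_line l f v : OT_set F n f ->
  \sum_(i | ln i == l) line_term (dz i f) v =
  \sum_(i | ln i == l) (line_term f (d_at d i v) + lambda_mul i (line_term f v)).
Proof.
move=> hf.
have lin (I : Type) (s : seq I) (B : pred I) (g : I -> ratfun F n) :
    (forall i, OT_set F n (g i)) -> line_term (\sum_(i <- s | B i) g i) v =
    \sum_(i <- s | B i) line_term (g i) v.
  move=> hg; have h0 : line_term 0 v = 0.
    have := line_term_linear (-1) v (submod0 (OT_set F n)) (submod0 (OT_set F n)).
    by rewrite scaler0 addr0 => ->; rewrite scaleN1r addNr.
  elim: s => [|i s IH]; first by rewrite !big_nil.
  rewrite !big_cons; case: ifP => // _; rewrite -IH.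
  have := line_term_linear 1 v (hg i) (submod_sum (U := OT_set F n) s (fun k _ => hg k) : OT_set F n (\sum_(k <- s | B k) g k)).
  by rewrite !scale1r.
rewrite -lin; last by move=> i; exact: OT_dz.
have hs : OT_set F n (\sum_(i | ln i == l) dz i f).
  by apply: submod_sum => i _; exact: OT_dz.
rewrite big_split /= addrC lambda_mul_sum {2}/line_term (@fsum_additive _ _ _ (vlm _)); first last.
- exact: fsupp_term.
- by move=> x x'; apply: vlmD; exact: intertwiner_mul.
- by apply: vlam_map0 => //; exact: intertwiner_mul.
have -> : \sum_(i | ln i == l) line_term f (d_at d i v) =
    \sum_(ab \in [set: 'X_{1..n} * 'X_{1..n}])
      vlm (fun Q => dpowX ab.1 * emb (convolution (FC f (ab.1 + ab.2)%MM) (- ('X_l * Q))))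
        (y (d_dpow d ab.2 v)).
  have e ab : vlm (fun Q => dpowX ab.1 * emb (convolution (FC f (ab.1 + ab.2)%MM) (- ('X_l * Q))))
        (y (d_dpow d ab.2 v)) = \sum_(i | ln i == l) term f (d_at d i v) ab.
    have -> : \sum_(i | ln i == l) term f (d_at d i v) ab =
        vlm (term_op f ab.1 (ab.1 + ab.2)%MM)
          (\sum_(i | ln i == l) y (d_at d i (d_dpow d ab.2 v))).
      rewrite vlam_map_sum //; last exact: intertwiner_term.
      by apply: eq_bigr => i _; rewrite /term d_dpow_d_at.
    rewrite y_sesquilinear -scaleN1r lambda_mulE -vlam_map_phiZ vlm_comp; first last.
    + by move=> k P Q; rewrite mulrDr -scalerAr scalerDr !scalerA mulrC.
    + exact: intertwiner_term.
    by apply: vlam_map_ext => Q; rewrite /= scaleN1r.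
  rewrite (eq_fsum e) /line_term.
  elim: (index_enum 'I_n) => [|i s IH].
    rewrite big_nil fsbig1 // => ab _; by rewrite big_nil.
  rewrite big_cons IH; case: ifP => li; last first.
    by apply: eq_fsum => ab; rewrite big_cons li.
  rewrite -fsumD; [|exact: fsupp_term|].
    by apply: eq_fsum => ab; rewrite big_cons li.
  apply: (@fsupp_fourier0 _ f) => a b e0; rewrite big1 // => k _.
  by rewrite /term /term_op /= e0 vlm_fourier0.
rewrite -fsumD; first last.
- by apply: (@fsupp_fourier0 _ f) => a b e0; rewrite /= e0;
    rewrite -[RHS](@vlam_map_phi0 _ _ d p n (idfun : {linear V -> V}) (y (d_dpow d b v)));
    apply: vlam_map_ext => Q; rewrite convolution0l emb0 mulr0.
- have [s h] := fsupp_term f v; exists s => ab /h->.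
  by rewrite vlam_map0 //; exact: intertwiner_mul.
apply: eq_fsum => -[a b]; rewrite /term vlm_comp; first last.
- by case: (intertwiner_term a (a + b)%MM hf).
- exact: intertwiner_mul.
rewrite -vlam_map_phiD; apply: vlam_map_ext => Q /=; rewrite /term_op.
rewrite (fourier_coef_sum charF0 hL) => [|i _]; last exact: OT_dz.
rewrite (fourier_coef_dz_line charF0 hL) //.
set g := FC f (a + b)%MM.
have hg : expandable g by apply: OT_expandable; exact: FC_OT.
rewrite (convolution_dz charF0) //.
have [hemb _] := intertwiner_line_subst F hL.
have embM P R : emb (P * R) = emb P * emb R by exact: poly_substM.
have embX : emb 'X_l = \sum_(i | ln i == l) 'X_i.
  by rewrite line_substE poly_substX (line_sumE F hL).
rewrite [_ * convolution g Q - _]addrC -scaleN1r embL embM embX scaleN1r.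
rewrite -[- ('X_l * Q)]scaleN1r -[-1 *: ('X_l * Q)]addr0 convolution_linear //.
rewrite (linear_at0 (convolution_linear hg)).
by rewrite addr0 embZ scaleN1r; ring.
Qed.

(** The relation for the last vertex of a line follows from the relations for
    the sum over the line and for the other vertices. *)
Lemma line_term_chiral i f v : OT_set F n f ->
  line_term (dz i f) v = line_term f (d_at d i v) + lambda_mul i (line_term f v).
Proof.
move=> hf; have [ri|ri] := eqVneq (rt i) i; last exact: line_term_dz.
have := line_term_dz_line (ln i) v hf.
rewrite (bigD1 i) //= [in RHS](bigD1 i) //=.
rewrite (eq_bigr (fun k => line_term f (d_at d k v) + lambda_mul k (line_term f v))).
  exact: addIr.
move=> k /andP[/eqP lk ki]; apply: line_term_dz => //.
by apply: contraNneq ki => rk; apply/eqP/(root_inj rk ri).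
Qed.
End LineTerm.

(** * Counting poles *)

Section PoleCount.
Variables (F : fieldType) (charF0 : [pchar F] =i pred0) (n : nat).
Implicit Types (f g : ratfun F n) (es : seq ('I_n * 'I_n)).
Local Notation z := (zdiff F).

Definition coordinates : set (ratfun F n) := [set f | exists k, f = zvar F k].

Lemma adjoin_coordinates_zdiff (S : set (ratfun F n)) i j :
  coordinates `<=` S -> adjoin S (z i j).
Proof. by move=> h; apply: submodB; apply: adjoin_gen; apply: h; [exists i|exists j]. Qed.

Lemma residue_coordinates (A A' : set ('I_n * 'I_n)) i j f : i != j ->
  (forall e, A e -> e.1 != e.2 -> e != (i, j) -> e != (j, i) ->
     A' (merge i j e.1, merge i j e.2)) ->
  adjoin (pole_gen coordinates A) f ->
  adjoin (pole_gen coordinates A') (residue i j f) /\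
  (~ A (i, j) -> ~ A (j, i) -> residue i j f = 0).
Proof.
move=> ij hA hf.
apply: (@residue_pole_gen F charF0 n coordinates coordinates A A' i j f ij) => //.
- move=> _ [k ->]; rewrite dz_poly mderivXU.
  have -> : of_poly (k == i)%:R = (k == i)%:R *: (1 : ratfun F n).
    by rewrite ratfun_scaleE mulr1; case: (k == i); rewrite ?mpolyC1 ?mpolyC0.
  by apply: submodZ; exact: adjoin1.
- move=> _ [k ->]; rewrite merge_varE ratfun_subst_zvar; split; first exact: regular_zvar.
  by apply: adjoin_gen; exists (merge i j k).
- exact: adjoin_coordinates_zdiff.
Qed.

(** Each residue consumes a pole, so there must be at least as many poles as
    edges. *)
Lemma elim_residue_few_poles es (A : {set 'I_n * 'I_n}) f : elim_ok es ->
  adjoin (pole_gen coordinates [set e | e \in A]) f -> (#|A| < size es)%N ->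
  elim_residue es f = 0.
Proof.
elim: es A f => // -[i j] es IH A f /elim_okP[/= ij _ hes] hf lt.
pose A' := [set (merge i j e.1, merge i j e.2) | e in A :\ (i, j) :\ (j, i)]%SET.
have [e|hr h0] := @residue_coordinates [set e | e \in A] [set e | e \in A'] i j f ij _ hf.
  move=> he _ n1 n2; apply/imsetP; exists e => //.
  by rewrite !inE n1 n2.
have [hA|hA] := boolP (((i, j) \in A) || ((j, i) \in A)); last first.
  move: hA; rewrite negb_or => /andP[/negP h1 /negP h2].
  by rewrite h0 // elim_residue0.
apply: (IH A') => //; rewrite -ltnS; apply: leq_trans lt; rewrite ltnS.
apply: leq_ltn_trans (leq_imset_card _ _) _.
case/orP: hA => hA.
  rewrite (cardsD1 (i, j) A) hA add1n ltnS; apply: subset_leq_card; exact: subsetDl.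
rewrite [X in (_ < X)%N](cardsD1 (j, i) A) hA add1n ltnS; apply: subset_leq_card.
by apply/fintype.subsetP => e; rewrite !inE => /and3P[-> _ ->].
Qed.

(** ** Residues of the functions attached to graphs *)

Definition edge_poles es : ratfun F n := \prod_(e <- es) (z e.1 e.2)^-1.

Fixpoint merge_all es k : 'I_n :=
  if es is e :: es' then merge_all es' (merge e.1 e.2 k) else k.

(** Along its own edges the function has only simple poles, the residues of which
    are given by substitution. *)
Lemma elim_residue_edge_poles es (P : {mpoly F[n]}) : elim_ok es ->
  elim_residue es (edge_poles es * of_poly P) =
  of_poly (poly_subst (rename F (merge_all es)) P).
Proof.
elim: es P => [|[i j] es IH] P.
  by move=> _; rewrite /edge_poles big_nil mul1r /= -[in LHS](poly_subst_id P).
move=> /elim_okP[/= ij hv hes].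
have hreg : regular_at (@merge_var F n i j) (edge_poles es) /\
    ratfun_subst (@merge_var F n i j) (edge_poles es) = edge_poles es.
  rewrite /edge_poles; elim: es hv {IH hes} => [|e es IH] hv.
    by rewrite big_nil ratfun_subst1; split=> //; exact: regular1.
  rewrite big_cons; have [|h1 h2] := IH; first by move=> e' h; apply: hv; rewrite inE h orbT.
  have /andP[/negPf n1 /negPf n2] := hv e (mem_head _ _).
  have [e12|ne] := eqVneq e.1 e.2.
    rewrite e12 /zdiff subrr invr0 mul0r ratfun_subst0; split=> //.
    by rewrite -of_poly0; exact: regular_poly.
  have [|r1 r2] := @regular_zdiffV F n n (merge i j) e.1 e.2; first by rewrite /merge n1 n2.
  rewrite merge_varE in h1 h2 *.
  have [r3 r4] := regularM r1 h1; split=> //; rewrite r4 r2 h2.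
  by rewrite /merge n1 n2.
have -> : edge_poles ((i, j) :: es) * of_poly P =
    z i j ^- 1 * (edge_poles es * of_poly P).
  by rewrite /edge_poles big_cons mulrA expr1.
rewrite /= (residue_pole charF0) //; last by have [] := regularM hreg.1 (regular_poly (@merge_var F n i j) P).
rewrite /pole_coef /= invr1 scale1r.
have [_ ->] := regularM hreg.1 (regular_poly (@merge_var F n i j) P).
rewrite hreg.2 ratfun_subst_poly IH // poly_subst_comp; congr of_poly.
congr (poly_subst _ P); apply: funext => k.
by rewrite merge_varE /rename poly_substX.
Qed.
End PoleCount.

Section ChainFilter.
Variable n : nat.
Implicit Types (s : seq 'I_n) (ls : seq (seq 'I_n)) (e : 'I_n * 'I_n).

Lemma chain_edges_cat s1 s2 (x y : 'I_n) :
  chain_edges (rcons s1 x ++ y :: s2) =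
  chain_edges (rcons s1 x) ++ (x, y) :: chain_edges (y :: s2).
Proof.
elim: s1 => [//|a s1 IH].
by case: s1 IH => [//|b s1] /= IH; rewrite /chain_edges /= -[in RHS]/(chain_edges _) -IH.
Qed.
Lemma chain_edgesP s e : e \in chain_edges s ->
  exists s1 s2, s = s1 ++ e.1 :: e.2 :: s2.
Proof.
elim: s => // x [//|y s] IH; rewrite chain_edges_cons inE => /orP[/eqP->|/IH[s1 [s2 ->]]].
  by exists [::], s.
by exists (x :: s1), s2.
Qed.

Lemma filter_notin s (i : 'I_n) : i \notin s -> filter (predC1 i) s = s.
Proof.
move=> h; apply/all_filterP/allP => x xs /=.
by apply: contraNneq h => <-.
Qed.
Lemma merge_notin s e (i j : 'I_n) : e \in chain_edges s -> i \notin s ->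
  (merge i j e.1, merge i j e.2) = e.
Proof.
move=> /mem_chain_edges/andP[h1 h2] is_.
rewrite /merge; case: eqVneq => [e1|_]; first by move: is_; rewrite -e1 h1.
case: eqVneq => [e1|_]; first by move: is_; rewrite -e1 h2.
by case: e {h1 h2}.
Qed.

(** Contracting the edge between i and j of a chain gives the chain with i
    removed. *)
Lemma chain_edges_contract s e i j : uniq s -> e \in chain_edges s ->
  e != (i, j) -> e != (j, i) ->
  [|| (i, j) \in chain_edges s, (j, i) \in chain_edges s | i \notin s] ->
  (merge i j e.1, merge i j e.2) \in chain_edges (filter (predC1 i) s).
Proof.
move=> us he n1 n2 /or3P[/chain_edgesP[s1 [s2 /= es]]|/chain_edgesP[s1 [s2 /= es]]|is_].
- have [i1 i2] : i \notin s1 /\ i \notin j :: s2.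
    move: us; rewrite es cat_uniq => /and3P[_ /hasPn h]; rewrite cons_uniq => /andP[h' _].
    by split=> //; apply: h; exact: mem_head.
  have fe : filter (predC1 i) s = s1 ++ j :: s2.
    rewrite es filter_cat (filter_notin i1) /= eqxx /=.
    by rewrite -[RHS](filter_notin (i := i)) ?filter_cat ?(filter_notin i1) // mem_cat negb_or i1.
  rewrite fe; move: he; rewrite es.
  case/lastP: s1 i1 {es fe} => [_|s1 x i1].
    rewrite chain_edges_cons inE (negPf n1) /= => he.
    by rewrite (merge_notin _ he).
  rewrite !chain_edges_cat chain_edges_cons !mem_cat !(in_cons (x, _)) [e \in (i, j) :: _]inE (negPf n1) /=.
  move=> /or3P[he|/eqP->|he]; first by rewrite (merge_notin _ he i1) he.
    apply/orP; right; apply/orP; left; rewrite /merge /= eqxx.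
    case: (eqVneq x i) => [xi|//]; move: i1; by rewrite xi mem_rcons mem_head.
  by rewrite (merge_notin _ he i2) he !orbT.
- have [i1 i2] : i \notin rcons s1 j /\ i \notin s2.
    move: us; rewrite es -cat_rcons cat_uniq => /and3P[_ /hasPn h]; rewrite cons_uniq => /andP[h' _].
    by split=> //; apply: h; exact: mem_head.
  have fe : filter (predC1 i) s = rcons s1 j ++ s2.
    by rewrite es -cat_rcons filter_cat (filter_notin i1) /= eqxx /= (filter_notin i2).
  rewrite fe; move: he; rewrite es -cat_rcons chain_edges_cat mem_cat inE (negPf n2) /=.
  case: s2 i2 {es fe} => [_|y s2 i2].
    by rewrite orbF cats0 => he; rewrite (merge_notin _ he i1).
  rewrite chain_edges_cat chain_edges_cons mem_cat !(in_cons (_, y)).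
  move=> /or3P[he|/eqP->|he]; first by rewrite (merge_notin _ he i1) he.
    apply/orP; right; apply/orP; left; rewrite /merge /= eqxx.
    case: (eqVneq y i) => [yi|//]; move: i2; by rewrite yi mem_head.
  by rewrite (merge_notin _ he i2) he !orbT.
- by rewrite filter_notin // (merge_notin _ he).
Qed.

(** Each edge of es joins, when its turn comes, neighbours of one of the chains,
    from which its origin is then removed. *)
Fixpoint compatible (es : seq ('I_n * 'I_n)) ls := if es is e :: es' then
  [&& (e \in chains_edges ls) || ((e.2, e.1) \in chains_edges ls)
    & compatible es' (map (filter (predC1 e.1)) ls)] else true.

Lemma flatten_filter (a : pred 'I_n) ls : flatten (map (filter a) ls) = filter a (flatten ls).
Proof. by elim: ls => //= s ls ->; rewrite filter_cat. Qed.

Lemma uniq_flatten_mem ls s : uniq (flatten ls) -> s \in ls -> uniq s.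
Proof.
elim: ls => // t ls IH; rewrite [flatten _]/= cat_uniq => /and3P[ut _ uls].
by rewrite inE => /orP[/eqP->|/IH]; auto.
Qed.
Lemma uniq_flatten_same ls s t x : uniq (flatten ls) -> s \in ls -> t \in ls ->
  x \in s -> x \in t -> s = t.
Proof.
elim: ls => // u ls IH; rewrite [flatten _]/= cat_uniq => /and3P[_ /hasPn h uls].
have H w : w \in ls -> x \in w -> x \notin u by move=> ws xw; apply: h; apply/flattenP; exists w.
rewrite !inE => /orP[/eqP->|sl] /orP[/eqP->|tl] xs xt //.
- by move: (H _ tl xt); rewrite xs.
- by move: (H _ sl xs); rewrite xt.
- exact: IH.
Qed.

(** A residue at a regular diagonal is zero; at a pole it moves the other poles as
    the removal of the eliminated vertex moves the edges of the chains. *)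
Lemma elim_residue_compatible (F : fieldType) (charF0 : [pchar F] =i pred0) es ls
    (f : ratfun F n) : elim_ok es -> uniq (flatten ls) ->
  adjoin (pole_gen (@coordinates F n) [set e | e \in chains_edges ls]) f ->
  elim_residue es f <> 0 -> compatible es ls.
Proof.
elim: es ls f => // -[i j] es IH ls f /elim_okP[/= ij _ hes] uls hf nz.
have uls' : uniq (flatten (map (filter (predC1 i)) ls)) by rewrite flatten_filter filter_uniq.
have [hadj|] := boolP (((i, j) \in chains_edges ls) || ((j, i) \in chains_edges ls)).
  apply: (IH _ (residue i j f)) => //.
  have [e|//] := @residue_coordinates F charF0 n [set e | e \in chains_edges ls]
    [set e | e \in chains_edges (map (filter (predC1 i)) ls)] i j f ij _ hf.
  move=> /flatten_mapP[s sls he] _ n1 n2; apply/flatten_mapP.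
  exists (filter (predC1 i) s); first exact: map_f.
  apply: chain_edges_contract => //; first exact: uniq_flatten_mem sls.
  have [is_|] := boolP (i \in s); last by rewrite !orbT.
  case/orP: hadj => /flatten_mapP[t tls ht]; have /andP[h1 h2] := mem_chain_edges ht.
    by rewrite (uniq_flatten_same uls sls tls is_ h1) ht.
  by rewrite (uniq_flatten_same uls sls tls is_ h2) ht orbT.
rewrite negb_or => /andP[/negP h1 /negP h2]; case: nz.
have [e|_ ->] // := @residue_coordinates F charF0 n [set e | e \in chains_edges ls]
  setT i j f ij _ hf.
exact: elim_residue0.
Qed.

Lemma compatible_cat es1 es2 ls : compatible (es1 ++ es2) ls ->
  compatible es1 ls /\ compatible es2 (map (filter (fun x => x \notin map fst es1)) ls).
Proof.
elim: es1 ls => [|e es1 IH] ls /=.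
  move=> h; split=> //; rewrite (eq_map (g := id)) ?map_id // => s.
  by apply/all_filterP/allP.
move=> /andP[-> /IH[-> h]]; split=> //; move: h; rewrite -map_comp.
rewrite (eq_map (g := filter (fun x => x \notin e.1 :: [seq i.1 | i <- es1]))) // => s /=.
rewrite -filter_predI; apply: eq_filter => x /=.
by rewrite inE negb_or andbC.
Qed.

Lemma compatible_same es ls e : compatible es ls -> e \in es ->
  exists2 s, s \in ls & (e.1 \in s) && (e.2 \in s).
Proof.
elim: es ls => // e0 es IH ls /= /andP[h hc]; rewrite inE => /orP[/eqP->|/(IH _ hc)].
  case/orP: h => /flatten_mapP[s sls /mem_chain_edges /andP[h1 h2]].
    by exists s => //; rewrite h1 h2.
  by exists s => //; rewrite h2 h1.
move=> [_ /mapP[s sls ->]]; rewrite !mem_filter => /andP[/andP[_ h1] /andP[_ h2]].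
by exists s => //; rewrite h1 h2.
Qed.

(** A chain compatible with a chain with the same vertices and the same origin
    is equal to it: its second vertex is the neighbour of the origin, which
    becomes the origin after contraction. *)
Lemma compatible_chain x s s' ls : uniq (flatten ls) -> (x :: s') \in ls ->
  perm_eq (x :: s) (x :: s') -> compatible (chain_edges (x :: s)) ls -> s = s'.
Proof.
elim: s x s' ls => [|y s IH] x s' ls uls xs' pe.
  by move=> _; have := perm_size pe; case: s' {xs' pe}.
rewrite chain_edges_cons /= => /andP[hadj hc].
have ux : uniq (x :: s') by exact: uniq_flatten_mem xs'.
have ys' : y \in x :: s' by rewrite -(perm_mem pe) !inE eqxx orbT.
have uy : uniq [:: x, y & s] by rewrite (perm_uniq pe).
have xy : x != y by move: uy; rewrite /= inE negb_or => /andP[/andP[]].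
have es' : exists t, s' = y :: t.
  case: s' xs' pe ux ys' => [|w t] xs' pe ux ys'.
    by have := perm_size pe.
  exists t; congr (_ :: _).
  have hx e : e \in chains_edges ls -> (e.1 == x) || (e.2 == x) -> e \in chain_edges [:: x, w & t].
    move=> /flatten_mapP[u uls' he] hx; have /andP[h1 h2] := mem_chain_edges he.
    have xu : x \in u by case/orP: hx => /eqP <-.
    by rewrite -(uniq_flatten_same uls uls' xs' xu) ?mem_head.
  have xn : x \notin w :: t by move: ux; rewrite cons_uniq => /andP[].
  have : ((x, y) \in chain_edges [:: x, w & t]) || ((y, x) \in chain_edges [:: x, w & t]).
    by case/orP: hadj => h; apply/orP; [left|right]; apply: hx => //=; rewrite eqxx ?orbT.
  rewrite chain_edges_cons !inE !xpair_eqE eqxx /= [y == x]eq_sym (negPf xy) /=.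
  case/orP => [/orP[/eqP->//|]|] /mem_chain_edges /= /andP[h1 h2].
    by move: xn; rewrite h1.
  by move: xn; rewrite h2.
move: es' => [t et]; rewrite et in xs' pe ux ys' *; congr (_ :: _).
apply: (IH y t (map (filter (predC1 x)) ls)) => //.
- by rewrite flatten_filter filter_uniq.
- apply/mapP; exists [:: x, y & t] => //=; rewrite eqxx /= [y == x]eq_sym xy /=.
  rewrite filter_notin //; move: ux; rewrite /= inE negb_or => /andP[/andP[_ h] _]; exact: h.
- by move: pe; rewrite perm_cons.
Qed.
End ChainFilter.

Section LinesOrthogonality.
Variables (n p : nat).
Implicit Types (L : lines n p).

Lemma is_lines_head L (hL : is_lines L) l x : x \in tnth L l ->
  exists s, tnth L l = head x (tnth L l) :: s :> seq 'I_n /\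
  (val (head x (tnth L l)) <= val x)%N.
Proof.
move=> hx; have [h [s e]] := tnth_cons hL l; exists s; rewrite e; split=> //=.
have /and4P[_ _ /allP hm _] := hL.
have := hm _ (mem_tnth l L); move=> /allP/(_ x hx).
by rewrite /first_vertex e.
Qed.

Lemma first_vertex_sorted L (hL : is_lines L) :
  sorted ltn [seq first_vertex l | l : n.-bseq 'I_n <- L].
Proof. by have /and4P[] := hL. Qed.

Lemma size_elim_edges L (hL : is_lines L) : size (elim_edges L) = (n - p)%N.
Proof.
have h (ls : seq (seq 'I_n)) : all (fun s => 0 < size s)%N ls ->
    (size (chains_edges ls) + size ls = size (flatten ls))%N.
  elim: ls => //= s ls IH /andP[s0 /IH e].
  rewrite /chains_edges /= !size_cat -/(chains_edges ls) -e size_zip size_behead.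
  by case: s s0 => //= x s _; rewrite (minn_idPr (leqnSn _)); lia.
have := h (rev (line_seqs L)) _; rewrite /elim_edges => e.
have : (size (chains_edges (rev (line_seqs L))) + p = n)%N.
  have sz : size (rev (line_seqs L)) = p by rewrite size_rev size_map size_tuple.
  have sf : size (flatten (rev (line_seqs L))) = n.
    rewrite (perm_size (flatten_rev_perm _)) (perm_size (lines_perm hL)).
    by rewrite size_enum_ord.
  rewrite -{2}sz e ?sf //; have /and4P[hne _ _ _] := hL.
  by rewrite all_rev /line_seqs all_map.
by move=> enp; rewrite -[RHS](congr1 (fun m => m - p)%N enp) addnK.
Qed.

(** If all residues along L are taken at poles of L', then L is L': every line
    of L lies in a line of L', so by their number they have the same vertices,
    in particular the same minimum, at which they both start. *)
Lemma compatible_lines L L' : is_lines L -> is_lines L' ->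
  compatible (elim_edges L) (line_seqs L') -> L = L'.
Proof.
move=> hL hL' hc; set ls' := line_seqs L' in hc.
have uls' : uniq (flatten ls') by exact: lines_uniq.
have same l x y : x \in tnth L l -> y \in tnth L l -> line_of hL' x = line_of hL' y.
  have [h [s e]] := tnth_cons hL l; rewrite !mem_tnth_seq e.
  suff H u : u \in h :: s -> line_of hL' u = line_of hL' h by move=> /H-> /H->.
  have hE ee : ee \in chain_edges (h :: s) -> line_of hL' ee.1 = line_of hL' ee.2.
    move=> hee; have hin : ee \in elim_edges L by apply/mem_elim_edges; exists l; rewrite e.
    have [t] := compatible_same hc hin.
    move=> /mapP[t' /tnthP[k ->] ->] /andP[h1 h2].
    by rewrite (line_ofE hL' h1) (line_ofE hL' h2).
  elim: s h hE {e} => [|w s IH] h hE; first by rewrite inE => /eqP->.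
  rewrite inE => /orP[/eqP->//|/(IH w) ->].
    by rewrite (hE (h, w)) ?chain_edges_cons ?mem_head.
  by move=> ee hee; apply: hE; rewrite chain_edges_cons inE hee orbT.
have hd l : exists x, x \in tnth L l.
  by have [x [s e]] := tnth_cons hL l; exists x; rewrite mem_tnth_seq e mem_head.
pose phi l := line_of hL' (xchoose (hd l)).
have phiE l x : x \in tnth L l -> line_of hL' x = phi l.
  by move=> hx; apply: same hx _; exact: (xchooseP (hd l)).
have phi_surj k : exists l, phi l = k.
  have [x [s e]] := tnth_cons hL' k.
  have hx : x \in tnth L' k by rewrite mem_tnth_seq e mem_head.
  by exists (line_of hL x); rewrite -(phiE _ _ (mem_line_of hL x)) (line_ofE hL' hx).
have phi_inj : injective phi.
  have [psi hpsi] := choice phi_surj.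
  have [psi' _ k2] := injF_bij (can_inj hpsi).
  by move=> x y; rewrite -(k2 x) -(k2 y) !hpsi => ->.
have mem_phi l x : (x \in tnth L l) = (x \in tnth L' (phi l)).
  apply/idP/idP => [hx|hx]; first by rewrite (mem_line hL') (phiE l).
  rewrite (mem_line hL); apply/eqP/phi_inj.
  by rewrite -(phiE _ x (mem_line_of hL x)) (line_ofE hL' hx).
have fv l : first_vertex (tnth L l) = first_vertex (tnth L' (phi l)).
  have [x [s e]] := tnth_cons hL l; have [x' [s' e']] := tnth_cons hL' (phi l).
  have hx : x \in tnth L l by rewrite mem_tnth_seq e mem_head.
  have hx' : x' \in tnth L' (phi l) by rewrite mem_tnth_seq e' mem_head.
  have [_ [_ le1]] := @is_lines_head L hL l x' (etrans (mem_phi _ _) hx').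
  have [_ [_ le2]] := @is_lines_head L' hL' (phi l) x (etrans (esym (mem_phi _ _)) hx).
  rewrite /first_vertex e e' /=; apply/eqP; rewrite eqn_leq.
  by move: le1 le2; rewrite e e' /= => -> ->.
have fs (L0 : lines n p) : is_lines L0 -> forall k : 'I_p,
    nth 0%N [seq first_vertex l | l : n.-bseq 'I_n <- L0] k = first_vertex (tnth L0 k).
  move=> hL0 k; rewrite (nth_map (tnth L0 k)) ?size_tuple //.
  by rewrite -tnth_nth.
have efv : [seq first_vertex l | l : n.-bseq 'I_n <- L] = [seq first_vertex l | l : n.-bseq 'I_n <- L'].
  apply: (irr_sorted_eq ltn_trans ltnn); try exact: first_vertex_sorted.
  move=> x; apply/mapP/mapP => -[t /tnthP[k ->] ->].
    by exists (tnth L' (phi k)); [exact: mem_tnth|exact: fv].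
  have [l <-] := phi_surj k; exists (tnth L l); [exact: mem_tnth|by rewrite fv].
have phi_id l : phi l = l.
  have := fv l; rewrite -!fs // efv => /eqP; rewrite nth_uniq ?size_map ?size_tuple //.
    by move=> /eqP/val_inj.
  by apply: (sorted_uniq ltn_trans ltnn); exact: first_vertex_sorted.
apply: eq_from_tnth => l.
suff: bseqval (tnth L l) = bseqval (tnth L' l) by move=> h; exact: val_inj.
have [x [s e]] := tnth_cons hL l; have [x' [s' e']] := tnth_cons hL' l.
have exx : x' = x.
  by apply: val_inj; move: (fv l); rewrite phi_id /first_vertex e e'.
rewrite exx in e'; rewrite e e'; congr (_ :: _).
have pe : perm_eq (x :: s) (x :: s').
  apply: uniq_perm; rewrite -?e -?e' ?line_uniq // => y.
  by have := mem_phi l y; rewrite phi_id.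
have sl : (tnth L l : seq 'I_n) \in rev (line_seqs L).
  by rewrite mem_rev; apply: map_f; exact: mem_tnth.
have [ls1 [ls2 els]] : exists ls1 ls2, rev (line_seqs L) = ls1 ++ bseqval (tnth L l) :: ls2.
  by case/splitPr: sl => l1 l2; exists l1, l2.
have ees : elim_edges L = chains_edges ls1 ++ (chain_edges (tnth L l) ++ chains_edges ls2).
  by rewrite /elim_edges els /chains_edges map_cat flatten_cat.
move: hc; rewrite ees => /compatible_cat[_ /compatible_cat[]]; rewrite e => hc _.
apply: compatible_chain hc => //.
  by rewrite flatten_filter filter_uniq.
apply/mapP; exists (x :: s').
  by rewrite -e'; apply: map_f; exact: mem_tnth.
symmetry; apply/all_filterP/allP => y hy; apply/negP => /mapP[ee hee yee].
have yl : y \in tnth L l by rewrite mem_tnth_seq e (perm_mem pe).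
have yls1 : y \in flatten ls1 by rewrite yee; have /andP[] := mem_chains_edges hee.
have : uniq (flatten (rev (line_seqs L))) by rewrite (perm_uniq (flatten_rev_perm _)) lines_uniq.
rewrite els flatten_cat cat_uniq => /and3P[_ /hasPn h _].
have := h y; rewrite /= mem_cat -mem_tnth_seq yl yls1 => /(_ isT); by [].
Qed.

Lemma edges_lines_graph L (hL : is_lines L) :
  edges (lines_graph L) = [set e in elim_edges L]%SET.
Proof.
apply/setP => e; rewrite /= !inE.
apply/andP/idP => [[/hasP[t /tnthP[l ->] he] _]|he].
  by apply/mem_elim_edges; exists l.
have [l hl] := (mem_elim_edges L e).1 he; split.
  by apply/hasP; exists (tnth L l) => //; exact: mem_tnth.
have := elim_edges_ok hL; elim: (elim_edges L) he => // e0 es IH.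
by rewrite inE => /orP[/eqP->|h] /elim_okP[] // _ _; exact: IH.
Qed.
Lemma elim_ok_uniq (es : seq ('I_n * 'I_n)) : elim_ok es -> uniq es.
Proof.
elim: es => // e es IH /elim_okP[_ h /IH u]; rewrite cons_uniq u andbT.
by apply/negP => /h; rewrite eqxx.
Qed.
Lemma card_edges_lines L (hL : is_lines L) : #|edges (lines_graph L)| = (n - p)%N.
Proof.
rewrite edges_lines_graph // cardsE -(size_elim_edges hL); apply/card_uniqP.
exact/elim_ok_uniq/elim_edges_ok.
Qed.
End LinesOrthogonality.

Section FourierOfGraphs.
Variables (F : fieldType) (charF0 : [pchar F] =i pred0) (n : nat).
Implicit Types (f g : ratfun F n).
Local Notation z := (zdiff F).

Lemma kernel_coordinates p (L : lines n p) (hL : is_lines L) S a :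
  @coordinates F n `<=` S -> adjoin S (kernel F hL a).
Proof.
move=> hS; apply: big_ind => [|f g|i _]; [exact: adjoin1|exact: adjoinM|].
by apply: adjoinX; exact: adjoin_coordinates_zdiff.
Qed.

Lemma pre_coef0 p (L : lines n p) (hL : is_lines L) a : pre_coef hL (0 : ratfun F n) a = 0.
Proof.
exact: (linear_at0 (pre_coef_linear charF0 hL a)).
Qed.

Lemma pre_coef_ker_subproof p (L : lines n p) (hL : is_lines L) a :
  [set f : ratfun F n | pre_coef hL f a = 0] 0 /\
  forall c g h, [set f : ratfun F n | pre_coef hL f a = 0] g ->
    [set f : ratfun F n | pre_coef hL f a = 0] h ->
    [set f : ratfun F n | pre_coef hL f a = 0] (c *: g + h).
Proof.
split=> [|c g h /= hg hh]; first exact: pre_coef0.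
by rewrite (pre_coef_linear charF0) hg hh scaler0 addr0.
Qed.

Lemma fourier_coef_few_poles p (L : lines n p) f a (q : int) : is_lines L ->
  pole_filtration F n q f -> q < (n - p)%N%:Z -> fourier_coef L f a = 0.
Proof.
move=> hL hf lt; rewrite (fourier_coefE hL).
suff -> : pre_coef hL f a = 0 by rewrite ratfun_subst0.
have sub := pre_coef_ker_subproof hL a.
apply: (@span_min _ _ _ (Submod sub) _ f hf) => g [A [cA _] hg] /=.
apply: (@elim_residue_few_poles F charF0 n _ A); first exact: elim_edges_ok.
  apply: adjoinM.
    move: hg; apply: adjoin_sub => h [[i ->]|[e eA ->]]; first by apply: adjoin_gen; left; exists i.
    have [e12|ne] := eqVneq e.1 e.2.
      by rewrite e12 /zdiff subrr invr0; exact: submod0.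
    by apply: adjoin_gen; right; exists e.
  by apply: kernel_coordinates => h; left.
by rewrite size_elim_edges //; move: (le_lt_trans cA lt).
Qed.

Lemma pGammaE p (L : lines n p) : is_lines L ->
  submod_val (pGamma F (lines_graph L)) = edge_poles F (elim_edges L).
Proof.
move=> hL.
have -> : submod_val (pGamma F (lines_graph L)) =
  \prod_(e in edges (lines_graph L)) (z e.1 e.2)^-1 by [].
rewrite edges_lines_graph // /edge_poles.
rewrite big_uniq /=; last exact/elim_ok_uniq/elim_edges_ok.
by apply: eq_bigl => e; rewrite inE.
Qed.

Lemma merge_all_root p (L : lines n p) (hL : is_lines L) k :
  merge_all (elim_edges L) k = root hL k.
Proof.
have H es k0 : elim_ok es -> (forall e, e \in es -> root hL e.1 = root hL e.2) ->
    root hL (merge_all es k0) = root hL k0 /\ merge_all es k0 \notin map fst es.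
  elim: es k0 => // e es IH k0 /elim_okP[ne hv hes] hr /=.
  have [|h1 h2] := IH (merge e.1 e.2 k0) hes; first by move=> e' h; apply: hr; rewrite inE h orbT.
  split.
    rewrite h1 /merge; case: eqVneq => // ->; symmetry; apply: hr; exact: mem_head.
  rewrite inE negb_or h2 andbT.
  have: e.1 != merge e.1 e.2 k0.
    by rewrite /merge; case: (eqVneq k0 e.1) => // h; rewrite eq_sym.
  elim: es (merge e.1 e.2 k0) hv {IH hes hr h1 h2} => [|e' es IH] k1 hv; first by rewrite eq_sym.
  move=> n1 /=; apply: IH; first by move=> e'' h; apply: hv; rewrite inE h orbT.
  have /andP[_ n2] := hv e' (mem_head _ _).
  by rewrite /merge; case: ifP => _; [rewrite eq_sym|].
have [h1 h2] := H _ k (elim_edges_ok hL) (fun e h => root_eq (elim_edges_line hL h)).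
by rewrite -h1; move: h2; rewrite eliminated negbK => /eqP.
Qed.

(** The substitutions made by the residues identify all vertices of a line, so each
    factor z_(root i) - z_i of the kernel becomes zero. *)
Lemma fourier_coef_self p (L : lines n p) a : is_lines L ->
  fourier_coef L (submod_val (pGamma F (lines_graph L))) a = (a == 0%MM)%:R.
Proof.
move=> hL; rewrite (fourier_coefE hL) pGammaE // /pre_coef.
have -> : kernel F hL a = of_poly (\prod_(i in [set: 'I_n]%SET) ('X_(root hL i) - 'X_i) ^+ a i).
  rewrite /kernel /root_kernel /of_poly rmorph_prod; apply: eq_bigr => i _.
  by rewrite rmorphXn zdiffE.
rewrite elim_residue_edge_poles ?ratfun_subst_poly //; last exact: elim_edges_ok.
rewrite poly_subst_comp.
have e i : poly_subst (rename F (line_of hL)) (rename F (merge_all (elim_edges L)) i) =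
    'X_(line_of hL i) :> {mpoly F[p]}.
  by rewrite /rename poly_substX merge_all_root line_of_root.
have eP s : poly_subst s (\prod_(i in [set: 'I_n]%SET) ('X_(root hL i) - 'X_i) ^+ a i : {mpoly F[n]}) =
    \prod_(i in [set: 'I_n]%SET) (s (root hL i) - s i : {mpoly F[p]}) ^+ a i.
  rewrite /poly_subst rmorph_prod; apply: eq_bigr => i _.
  rewrite rmorphXn rmorphB /=; congr ((_ - _) ^+ _); exact: poly_substX.
rewrite eP; have [->|a0] := eqVneq a 0%MM.
  by rewrite big1 ?of_poly1 // => i _; rewrite mnm0E expr0.
have [i ai] : exists i, a i != 0%N.
  apply/not_existsP => h; case/eqP: a0; apply/mnmP => i; rewrite mnm0E.
  by apply/eqP/negPn/negP/h.
rewrite (bigD1 i) ?inE //= !e line_of_root subrr expr0n.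
by case: (a i) ai => // k _; rewrite mul0r of_poly0.
Qed.

Lemma fourier_coef_other p (L L' : lines n p) a : is_lines L -> is_lines L' -> L <> L' ->
  fourier_coef L (submod_val (pGamma F (lines_graph L'))) a = 0.
Proof.
move=> hL hL' ne; rewrite (fourier_coefE hL).
suff -> : pre_coef hL (submod_val (pGamma F (lines_graph L'))) a = 0 by rewrite ratfun_subst0.
apply: contrapT => nz; apply: ne.
apply: compatible_lines => //.
apply: (elim_residue_compatible charF0) nz; first exact: elim_edges_ok.
  exact: lines_uniq.
apply: adjoinM; last by apply: kernel_coordinates => h; left.
rewrite pGammaE // /edge_poles big_seq; apply: big_ind; first exact: adjoin1.
  exact: adjoinM.
move=> e he; apply: adjoin_gen; right; exists e; split=> //=.
  apply/flatten_mapP; have [l hl] := (mem_elim_edges L' e).1 he.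
  by exists (tnth L' l : seq 'I_n) => //; apply: map_f; exact: mem_tnth.
have := elim_edges_ok hL'; elim: (elim_edges L') he => // e0 es IH.
by rewrite inE => /orP[/eqP->|h] /elim_okP[] // _ _; exact: IH.
Qed.
End FourierOfGraphs.

(** * Reduction of graphs to lines *)

Section CycleRelations.
Variables (n : nat) (W : zmodType) (Y : digraph n -> W).
Hypothesis Ycycle : forall G C, oriented_cycle G C ->
  Y G = 0 /\ \sum_(e in C) Y (remove_edge G e) = 0.
Implicit Types (E : {set 'I_n * 'I_n}) (i j k v w : 'I_n).

Definition is_loopless E := forall e, e \in E -> e.1 != e.2.
Definition arc E : rel 'I_n := fun i j => (i, j) \in E.
Definition yE E := Y (simplify E).

Lemma edges_simplify E : is_loopless E -> edges (simplify E) = E.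
Proof.
by move=> h; apply/setP => e; rewrite /= inE andb_idr //; exact: h.
Qed.
Lemma simplify_edges (G : digraph n) : simplify (edges G) = G.
Proof.
apply: val_inj => /=; apply/setP => e; rewrite inE andb_idr // => he.
by have /forall_inP := loopless G; exact.
Qed.
Lemma loopless_sub E E' : E' \subset E -> is_loopless E -> is_loopless E'.
Proof. by move=> /fintype.subsetP h hE e /h; exact: hE. Qed.
Lemma loopless_add E e : e.1 != e.2 -> is_loopless E -> is_loopless (e |: E).
Proof. by move=> ne hE e'; rewrite !inE => /orP[/eqP->|/hE]. Qed.

Lemma cycle_relation E c : is_loopless E -> c != [::] -> cycle_edges c \subset E ->
  yE E = 0 /\ \sum_(e in cycle_edges c) yE (E :\ e) = 0.
Proof.
move=> hE c0 sub.
have [|h1 h2] := @Ycycle (simplify E) (cycle_edges c); first by exists c; rewrite edges_simplify.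
split=> //; rewrite -[RHS]h2; apply: eq_bigr => e he.
by rewrite /yE /remove_edge edges_simplify.
Qed.

Lemma cycle_edges_cycle E c : cycle (arc E) c -> cycle_edges c \subset E.
Proof.
case: c => [|x p] hc; first by apply/fintype.subsetP => e; rewrite inE.
apply/fintype.subsetP => e; rewrite inE rot1_cons; move: hc => /=.
move: {2 4}x => z; elim: p x => [|y p IH] x /=.
  by rewrite andbT => xz; rewrite inE => /eqP->.
by move=> /andP[zy hp]; rewrite inE => /orP[/eqP->//|]; exact: IH.
Qed.

Lemma yE_dcycle E i j : is_loopless E -> (i, j) \in E -> connect (arc E) j i -> yE E = 0.
Proof.
move=> hE ij /connectP[p hp ei].
have [] // := @cycle_relation E (j :: p) hE; apply: cycle_edges_cycle.
by rewrite /= rcons_path hp -ei.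
Qed.

Definition replace E e e' := e' |: (E :\ e).

Lemma loopless_replace E e e' : e'.1 != e'.2 -> is_loopless E -> is_loopless (replace E e e').
Proof. by move=> ne hE; apply: loopless_add => //; apply: loopless_sub hE; exact: subsetDl. Qed.

Lemma cycle_edges2 i j : cycle_edges [:: i; j] = [set (i, j); (j, i)]%SET.
Proof. by apply/setP => e; rewrite !inE. Qed.
Lemma cycle_edges3 i j k : cycle_edges [:: i; j; k] = (i, j) |: [set (j, k); (k, i)]%SET.
Proof. by apply/setP => e; rewrite !inE. Qed.

Lemma pair_swap_neq i j : i != j -> (i, j) != (j, i).
Proof. by rewrite xpair_eqE negb_and => ->. Qed.

(** The relation for the cycle i -> j -> i. *)
Lemma yE_flip E i j : is_loopless E -> (i, j) \in E -> (j, i) \notin E ->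
  yE E = - yE (replace E (i, j) (j, i)).
Proof.
move=> hE ij ji; have ne : i != j := hE _ ij.
have hE' : is_loopless ((j, i) |: E) by apply: loopless_add => //=; rewrite eq_sym.
have [||_] := @cycle_relation _ [:: i; j] hE' => //.
  by rewrite cycle_edges2; apply/fintype.subsetP => e; rewrite !inE => /orP[/eqP->|->//]; rewrite ij orbT.
rewrite cycle_edges2 big_setU1 /= ?inE ?pair_swap_neq // big_set1.
have -> : ((j, i) |: E) :\ (j, i) = E.
  apply/setP => e; rewrite !inE; case: eqVneq => [->|//]; by rewrite (negPf ji).
have -> : ((j, i) |: E) :\ (i, j) = replace E (i, j) (j, i).
  apply/setP => e; rewrite !inE; case: (eqVneq e (j, i)) => [->|//].
  by rewrite eq_sym pair_swap_neq.
by move=> /eqP; rewrite addrC addr_eq0 => /eqP.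
Qed.

Lemma connect_replace E e e' x w : connect (arc E) x w ->
  (forall u, connect (arc E) x u -> connect (arc E) u w -> u != e.1) ->
  connect (arc (replace E e e')) x w.
Proof.
move=> /connectP[p hp ->]; elim: p x hp => [|u p IH] x /= hp h; first exact: connect0.
case/andP: hp => xu hp.
have cp : connect (arc E) u (last u p) by apply/connectP; exists p.
apply: (@connect_trans _ _ u).
  apply: connect1; rewrite /arc /replace !inE; apply/orP; right.
  apply/andP; split; last exact: xu.
  have := h x (connect0 _ _) (connect_trans (connect1 xu) cp).
  by apply: contraNneq => <-.
apply: IH => // u' h1 h2; apply: h => //; exact: connect_trans (connect1 xu) h1.
Qed.

(** The relation for the triangle i -> j -> k -> i, each of its terms being brought
    to the desired orientation by reversing arcs. *)
Lemma yE_branch E i j k : is_loopless E -> (i, j) \in E -> (i, k) \in E -> j != k ->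
  ~~ connect (arc E) j k -> ~~ connect (arc E) k j ->
  (forall u w, (u, w) \in E -> ~~ connect (arc E) w u) ->
  yE E = yE (replace E (i, k) (j, k)) + yE (replace E (i, j) (k, j)).
Proof.
move=> hE ij ik jk cjk ckj acyc.
have nij : i != j := hE _ ij; have nik : i != k := hE _ ik.
have jiE : (j, i) \notin E by apply: contra (acyc _ _ ij) => h; exact: connect1.
have kiE : (k, i) \notin E by apply: contra (acyc _ _ ik) => h; exact: connect1.
have jkE : (j, k) \notin E by apply: contra cjk => h; exact: connect1.
have kjE : (k, j) \notin E by apply: contra ckj => h; exact: connect1.
pose T := (j, k) |: replace E (i, k) (k, i).
have hR : is_loopless (replace E (i, k) (k, i)) by apply: loopless_replace => //=; rewrite eq_sym.
have hT : is_loopless T by apply: loopless_add.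
have [n1 n2] : (j != i) /\ (k != i) by rewrite ![_ == i]eq_sym.
have n3 : k != j by rewrite eq_sym.
have [||_] := @cycle_relation T [:: i; j; k] hT => //.
  rewrite cycle_edges3; apply/fintype.subsetP => e; rewrite !inE => /or3P[] /eqP->.
  - by rewrite ij !xpair_eqE eqxx (negPf jk) /= ?andbF ?orbT.
  - by rewrite eqxx.
  - by rewrite eqxx !orbT.
rewrite cycle_edges3 big_setU1 /=; last by rewrite !inE !xpair_eqE (negPf nij) (negPf nik).
rewrite big_setU1 /=; last by rewrite !inE !xpair_eqE (negPf jk).
rewrite big_set1.
have -> : T :\ (j, k) = replace E (i, k) (k, i).
  apply/setP => e; rewrite !inE; case: (eqVneq e (j, k)) => [->|//].
  by rewrite xpair_eqE (negPf jk) (negPf jkE) andbF.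
have -> : T :\ (k, i) = replace E (i, k) (j, k).
  apply/setP => e; rewrite !inE; case: (eqVneq e (k, i)) => [->|//].
  by rewrite !xpair_eqE (negPf n3) (negPf kiE) andbF.
rewrite -[yE (replace E (i, k) (k, i))]opprK -yE_flip //.
pose U := T :\ (i, j); rewrite -/U.
have hU : is_loopless U by apply: loopless_sub hT; exact: subsetDl.
have kjU : (k, j) \notin U.
  by rewrite !inE !xpair_eqE (negPf kjE) (negPf n3) (negPf n1) (negPf n2) !andbF.
have jkU : (j, k) \in U by rewrite !inE eqxx xpair_eqE (negPf n1).
rewrite (yE_flip hU jkU kjU).
pose U' := replace U (j, k) (k, j); rewrite -/U'.
have hU' : is_loopless U' by apply: loopless_replace.
have kiU : (k, i) \in U'.
  by rewrite !inE !xpair_eqE !eqxx (negPf n3) (negPf nij) (negPf n2) /= ?orbT.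
have ikU : (i, k) \notin U'.
  by rewrite !inE !xpair_eqE !eqxx (negPf nik) (negPf nij) /= ?andbF.
rewrite (yE_flip hU' kiU ikU) opprK.
have -> : replace U' (k, i) (i, k) = replace E (i, j) (k, j).
  apply/setP => e; rewrite !inE.
  case: (eqVneq e (i, k)) => [->|e1]; first by rewrite ik !xpair_eqE eqxx (negPf n3) /= ?andbF ?orbT.
  case: (eqVneq e (k, i)) => [->|e2].
    by rewrite (negPf kiE) !xpair_eqE (negPf nij) /= ?andbF ?orbF.
  case: (eqVneq e (k, j)) => [->//|e3] /=.
  case: (eqVneq e (j, k)) => [->|e4] //=; by rewrite (negPf jkE) andbF.
by move=> /eqP; rewrite addrCA addrC subr_eq0 => /eqP <-; rewrite addrC.
Qed.

(** ** Out-degree at most one *)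
Variable m : 'I_n -> 'I_n.
Hypothesis m_le : forall v, (m v <= v)%N.
Hypothesis mm : forall v, m (m v) = m v.

(** The map m chooses a root in each connected component, and every vertex is
    reached from its root. *)
Definition rooted E := [/\ is_loopless E, forall i j, (i, j) \in E -> m i = m j
  & forall v, connect (arc E) (m v) v].

(** Vertices without outgoing arc are fixed, so that the lines are the orbits of the
    roots. *)
Definition succ E v := odflt v [pick w | (v, w) \in E].

Section Unbranched.
Variable E : {set 'I_n * 'I_n}.
Hypothesis rootedE : rooted E.
Hypothesis acyc : forall u w, (u, w) \in E -> ~~ connect (arc E) w u.
Hypothesis unbranched : forall i j k, (i, j) \in E -> (i, k) \in E -> j = k.

Lemma succE v w : (v, w) \in E -> succ E v = w.
Proof.
move=> vw; rewrite /succ; case: pickP => [w' /= h|/(_ w)]; last by rewrite vw.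
exact: (unbranched h vw).
Qed.
Lemma succP v : succ E v != v -> (v, succ E v) \in E.
Proof. by rewrite /succ; case: pickP => [w' //|_]; rewrite eqxx. Qed.
Lemma m_succ v : m (succ E v) = m v.
Proof.
have [_ hm _] := rootedE.
by have [->//|/succP/hm ->] := eqVneq (succ E v) v.
Qed.
Lemma fconnect_arc v w : connect (arc E) v w = fconnect (succ E) v w.
Proof.
apply/idP/idP; apply: connect_sub => x y.
  by move=> h; apply: connect1; rewrite /= (succE h).
move=> /= /eqP <-; have [->|/succP h] := eqVneq (succ E x) x; first exact: connect0.
exact: connect1.
Qed.

Definition line_from v := orbit (succ E) v.
Lemma size_line_from v : (size (line_from v) <= n)%N.
Proof.
rewrite /line_from -[X in (_ <= X)%N]card_ord cardE uniq_leq_size ?orbit_uniq // => w _.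
exact: mem_enum.
Qed.

Lemma mem_line_from v w : (w \in line_from (m v)) -> m w = m v.
Proof.
rewrite -fconnect_orbit => /iter_findex <-.
by elim: (findex _ _ _) => [|k IH] /=; rewrite ?mm // m_succ.
Qed.
Lemma mem_line_from_self v : v \in line_from (m v).
Proof. by rewrite -fconnect_orbit -fconnect_arc; have [_ _] := rootedE; exact. Qed.

Lemma chain_edges_traject v (l : nat) : chain_edges (traject (succ E) v l.+1) =
  [seq (w, succ E w) | w <- traject (succ E) v l].
Proof.
elim: l v => [//|l IH] v; rewrite !trajectS chain_edges_cons map_cons -IH.
by rewrite trajectS.
Qed.

Lemma chain_edges_line v e : (e \in chain_edges (line_from v)) =
  (e \in E) && (e.1 \in line_from v).
Proof.
have ord : order (succ E) v = (order (succ E) v).-1.+1.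
  by rewrite prednK // order_gt0.
have eo : line_from v = traject (succ E) v (order (succ E) v).-1.+1 by rewrite -ord.
rewrite eo chain_edges_traject -eo.
apply/mapP/andP => [[w hw ->]|[he h1]].
  have hw' : w \in line_from v by rewrite eo trajectSr mem_rcons inE hw orbT.
  split=> //; apply: succP.
  apply: contraTneq (orbit_uniq (succ E) v) => sw; rewrite -/(line_from v) eo.
  move/trajectP: hw => [l ll ew]; apply/negP => u.
  have := nth_uniq v (i := l) (j := l.+1) _ _ u; rewrite !size_traject => /(_ (leqW ll) ll).
  by rewrite !nth_traject ?(leqW ll) // iterS -ew sw eqxx eqn_leq ltnn andbF.
have es : succ E e.1 = e.2 by apply: succE; rewrite -surjective_pairing.
exists e.1; last by rewrite es -surjective_pairing.
move: h1; rewrite eo trajectSr mem_rcons inE => /orP[/eqP e1|//].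
have : looping (succ E) v (order (succ E) v) by exact: looping_order.
rewrite /looping ord iterS -e1 es -ord => hin.
have hin' : e.2 \in line_from v by exact: hin.
have := acyc (u := e.1) (w := e.2); rewrite -surjective_pairing => /(_ he) /negP[].
rewrite fconnect_arc; move/trajectP: hin; rewrite ord => -[l ll ->].
rewrite e1 -(subnK (ltnSE ll)) iterD; exact: fconnect_iter.
Qed.

Definition roots := [seq r <- enum 'I_n | m r == r].
Definition unbranched_lines : lines n (size roots) :=
  [tuple of [seq Bseq (size_line_from r) | r <- in_tuple roots]].

Lemma flatten_lines (s : seq 'I_n) : uniq s -> (forall r, r \in s -> m r = r) ->
  uniq (flatten [seq line_from r | r <- s]).
Proof.
elim: s => //= r s IH /andP[rs us] h; rewrite cat_uniq orbit_uniq IH //; last first.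
  by move=> r' hr'; apply: h; rewrite inE hr' orbT.
rewrite andbT; apply/hasPn => w /flatten_mapP[r' hr' hw] /=.
apply: contra rs => hw'.
have er : m r = r by apply: h; exact: mem_head.
have er' : m r' = r' by apply: h; rewrite inE hr' orbT.
have e1 : m w = r' by rewrite -er' in hw *; rewrite (mem_line_from hw).
have e2 : m w = r by rewrite -er in hw' *; rewrite (mem_line_from hw').
by rewrite -e2 e1.
Qed.

Lemma line_from_head v : exists s, line_from v = v :: s.
Proof. by rewrite /line_from /orbit -orderSpred /=; eexists. Qed.

(** Without branching and without cycle, the graph is the union of the paths
    followed from the roots. *)
Lemma unbranched_linesP : is_lines unbranched_lines /\
  edges (lines_graph unbranched_lines) = E.
Proof.
have rootsP r : r \in roots -> m r = r by rewrite mem_filter => /andP[/eqP].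
have eL : [seq val l | l <- unbranched_lines] = [seq line_from r | r <- roots].
  by rewrite /= -map_comp; apply: eq_map.
have uroots : uniq roots by rewrite filter_uniq // enum_uniq.
split.
  apply/and4P; split.
  - apply/allP => l /mapP[r _ ->] /=.
    by have [s ->] := line_from_head r.
  - rewrite eL; apply: uniq_perm; [exact: flatten_lines|exact: enum_uniq|].
    move=> v; rewrite mem_enum; apply/flatten_mapP; exists (m v); last exact: mem_line_from_self.
    by rewrite mem_filter mm eqxx mem_enum.
  - apply/allP => l /mapP[r hr ->]; apply/allP => v hv.
    have [s e] := line_from_head r.
    rewrite /first_vertex /= e /=.
    have := hv; rewrite -[_ \in _]/(v \in line_from r) -{1}(rootsP r hr) => /mem_line_from.
    by rewrite (rootsP r hr) => <-.
  have -> : [seq first_vertex l | l : n.-bseq 'I_n <- unbranched_lines] = [seq val r | r <- roots].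
    rewrite /= -map_comp; apply: eq_map => r /=.
    by have [s e] := line_from_head r; rewrite /first_vertex /= e.
  rewrite sorted_map; apply: (sorted_filter (leT := relpre val ltn)).
    by move=> x y z; exact: ltn_trans.
  by rewrite -sorted_map val_enum_ord iota_ltn_sorted.
have [hE _ _] := rootedE.
apply/setP => e; rewrite /= !inE.
apply/andP/idP.
  move=> [/hasP[l /mapP[r _ ->]]] /=.
  by rewrite -[line_edges _]/(chain_edges (line_from r)) chain_edges_line => /andP[].
move=> he; split; last exact: hE.
apply/hasP; exists (Bseq (size_line_from (m e.1))).
  by apply: map_f; rewrite mem_filter mm eqxx mem_enum.
rewrite -[line_edges _]/(chain_edges (line_from (m e.1))) chain_edges_line he.
exact: mem_line_from_self.
Qed.
End Unbranched.

Hypothesis Ylines : forall p (L : lines n p), is_lines L -> Y (lines_graph L) = 0.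

(** Replacing a branching by the two chains strictly increases the number of
    connected pairs, so only chains remain in the end. *)
Lemma yE_rooted E : rooted E -> yE E = 0.
Proof.
pose conn E := [set ij : 'I_n * 'I_n | connect (arc E) ij.1 ij.2]%SET.
have [N] := ubnP (#|{: 'I_n * 'I_n}| - #|conn E|)%N.
elim: N E => // N IH E ltN rE; have [hE hm hr] := rE.
have [/existsP[[u w] /andP[/= uw wu]]|/existsPn acyc0] :=
  boolP [exists e, (e \in E) && connect (arc E) e.2 e.1]; first exact: yE_dcycle wu.
have acyc u w : (u, w) \in E -> ~~ connect (arc E) w u.
  by move=> uw; have := acyc0 (u, w); rewrite uw.
have [/existsP[[[i j] k] /and3P[/= ij ik jk]]|/existsPn unb] :=
  boolP [exists ijk : 'I_n * 'I_n * 'I_n, [&& (ijk.1.1, ijk.1.2) \in E,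
    (ijk.1.1, ijk.2) \in E & ijk.1.2 != ijk.2]]; last first.
  have unb' i j k : (i, j) \in E -> (i, k) \in E -> j = k.
    move=> ij ik; apply/eqP; move: (unb ((i, j), k)).
    by rewrite /= ij ik /= negbK.
  have [hL eE] := unbranched_linesP rE acyc unb'.
  by rewrite /yE -eE simplify_edges Ylines.
have flipped a b : (i, a) \in E -> (i, b) \in E -> a != b -> connect (arc E) a b -> yE E = 0.
  move=> ia ib ab cab.
  have nib : i != b := hE _ ib.
  rewrite (yE_flip hE ib); last by apply: contra (acyc _ _ ib) => h; exact: connect1.
  rewrite (@yE_dcycle _ b i) ?oppr0 //.
  - by apply: loopless_replace => //=; rewrite eq_sym.
  - by rewrite !inE eqxx.
  apply: (@connect_trans _ _ a).
    apply: connect1; rewrite /arc !inE ia andbT; apply/orP; right.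
    by rewrite xpair_eqE eqxx (negPf ab).
  apply: connect_replace => // u au _; apply: contraNneq (acyc _ _ ia) => /= <-; exact: au.
have [cjk|cjk] := boolP (connect (arc E) j k); first exact: flipped cjk.
have [ckj|ckj] := boolP (connect (arc E) k j).
  by apply: flipped ckj => //; rewrite eq_sym.
rewrite (yE_branch hE ij ik jk cjk ckj acyc).
have step a b : (i, a) \in E -> (i, b) \in E -> a != b -> ~~ connect (arc E) a b ->
    yE (replace E (i, b) (a, b)) = 0.
  move=> ia ib ab cab.
  have sub u w : connect (arc E) u w -> connect (arc (replace E (i, b) (a, b))) u w.
    apply: connect_sub => x y xy.
    have [[-> ->]|ne] := eqVneq (x, y) (i, b).
      apply: (@connect_trans _ _ a); apply: connect1; rewrite /arc !inE ?eqxx //.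
      by rewrite ia !xpair_eqE ?eqxx (negPf ab) /= ?andbF ?orbT.
    by apply: connect1; rewrite /arc !inE ne -/(arc E x y) xy orbT.
  apply: IH; last first.
    split=> [|x y|v]; first exact: loopless_replace.
      rewrite !inE => /orP[/eqP[-> ->]|/andP[_ /hm//]].
      by rewrite -(hm _ _ ia) -(hm _ _ ib).
    exact/sub/hr.
  rewrite -ltnS; apply: leq_trans ltN; rewrite ltnS ltn_sub2l //.
    apply: leq_trans (_ : #|conn (replace E (i, b) (a, b))| <= _)%N; last exact: max_card.
    apply: proper_card; apply/properP; split.
      by apply/fintype.subsetP => -[u w]; rewrite !inE; exact: sub.
    exists (a, b); rewrite !inE //=.
    by apply: connect1; rewrite /arc !inE eqxx.
  apply: proper_card; apply/properP; split.
    by apply/fintype.subsetP => -[u w]; rewrite !inE; exact: sub.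
  exists (a, b); rewrite !inE //=.
  by apply: connect1; rewrite /arc !inE eqxx.
by rewrite step // step ?addr0 // eq_sym.
Qed.

(** An arc from an unreached vertex to a reached one may be reversed. *)
Lemma yE_orient E : is_loopless E -> (forall i j, (i, j) \in E -> m i = m j) ->
  (forall v, connect (fun i j => arc E i j || arc E j i) (m v) v) -> yE E = 0.
Proof.
pose unreached E := [set v | ~~ connect (arc E) (m v) v]%SET.
have [N] := ubnP #|unreached E|; elim: N E => // N IH E ltN hE hm hc.
have [/existsP[v0 hv0]|/existsPn allr] := boolP [exists v, ~~ connect (arc E) (m v) v]; last first.
  by apply: yE_rooted; split=> // v; have := allr v; rewrite negbK.
have [a [b [ra rb ba ab]]] : exists a b, [/\ connect (arc E) (m a) a,
    ~~ connect (arc E) (m b) b, (b, a) \in E & (a, b) \notin E].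
  apply: contrapT => hno.
  pose R := [pred v | connect (arc E) (m v) v].
  have clR x y : arc E x y -> (x \in R) = (y \in R).
    move=> xy; rewrite !inE; apply/idP/idP => h.
      by rewrite -(hm _ _ xy); apply: connect_trans h (connect1 xy).
    apply/negPn/negP => nx; apply: hno; exists y, x; split=> //.
    apply: contra nx => yx; rewrite -(hm _ _ yx); exact: connect_trans h (connect1 yx).
  have clR' : closed (fun i j => arc E i j || arc E j i) R by move=> x y /orP[/clR|/clR->].
  by have := closed_connect clR' (hc v0); rewrite !inE mm connect0 (negPf hv0).
have nab : b != a := hE _ ba.
rewrite (yE_flip hE ba ab) IH ?oppr0 //.
- have keep v : connect (arc E) (m v) v -> connect (arc (replace E (b, a) (a, b))) (m v) v.
    move=> cv; apply: connect_replace => // u cu _; apply: contraNneq rb => /= ub.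
    have mE x y : connect (arc E) x y -> m x = m y.
      move=> /connectP[p hp ->]; elim: p x hp => //= y' p IHp x /andP[xy /IHp <-].
      exact: hm xy.
    by rewrite -ub -(mE _ _ cu) mm.
  rewrite -ltnS; apply: leq_trans ltN; rewrite ltnS; apply: proper_card.
  apply/properP; split; first by apply/fintype.subsetP => v; rewrite !inE; apply: contra; exact: keep.
  exists b; rewrite !inE // negbK (hm _ _ ba).
  apply: (connect_trans (keep _ ra)); apply: connect1.
  by rewrite /arc !inE eqxx.
- by apply: loopless_replace => //=; rewrite eq_sym.
- move=> x y; rewrite !inE => /orP[/eqP[-> ->]|/andP[_ /hm//]].
  by rewrite (hm _ _ ba).
move=> v; apply: connect_sub (hc v) => x y xy.
apply: connect1; rewrite /arc !inE.
have [[-> ->]|n1] := eqVneq (x, y) (a, b); first by rewrite eqxx.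
have [[-> ->]|n2] := eqVneq (y, x) (a, b); first by rewrite eqxx orbT.
have n3 : (x, y) != (b, a) by move: n2; rewrite !xpair_eqE andbC.
have n4 : (y, x) != (b, a) by move: n1; rewrite !xpair_eqE andbC.
by rewrite n3 n4 /=; exact: xy.
Qed.
End CycleRelations.

(** Rooting every connected component at its minimum, reversing arcs up to sign so
    that the root reaches all vertices, then replacing branchings by chains,
    expresses the value at any graph through the values at disjoint unions of lines
    that start at their minimum. *)
Lemma cycle_relations_vanish n (W : zmodType) (Y : digraph n -> W) :
  (forall G C, oriented_cycle G C ->
     Y G = 0 /\ \sum_(e in C) Y (remove_edge G e) = 0) ->
  (forall p (L : lines n p), is_lines L -> Y (lines_graph L) = 0) ->
  forall G, Y G = 0.
Proof.
move=> Ycycle Ylines G; rewrite -(simplify_edges G) -/(yE Y _).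
pose e : rel 'I_n := fun i j => arc (edges G) i j || arc (edges G) j i.
have sym : connect_sym e by apply: sym_connect_sym => i j; rewrite /e orbC.
pose m v := [arg min_(u < v | connect e v u) (u : nat)].
have mP v : connect e v (m v) /\ forall u, connect e v u -> (m v <= u)%N.
  by rewrite /m; case: arg_minnP; [exact: connect0|move=> u h1 h2].
have mE i j : connect e i j -> m i = m j.
  move=> ij; have [h1 h2] := mP i; have [h3 h4] := mP j.
  apply: val_inj; apply/eqP; rewrite eqn_leq h2 ?h4 //.
    by apply: connect_trans h1; rewrite sym.
  exact: connect_trans h3.
apply: (yE_orient Ycycle (m := m)) => //.
- by move=> v; have [_ h] := mP v; apply: h; exact: connect0.
- by move=> v; apply/esym/mE; have [] := mP v.
- by move=> ee he; have /forall_inP := loopless G; exact.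
- by move=> i j ij; apply: mE; apply: connect1; rewrite /e /arc ij.
- by move=> v; rewrite -/e sym; have [] := mP v.
Qed.

(** * Homogeneous components *)

Section MultilinearInduction.
Variables (F : fieldType) (V W : lmodType F) (n : nat).
Implicit Types (v : 'I_n -> V).

(** The arguments are replaced by generators one at a time. *)
Lemma multilinear_span (g : ('I_n -> V) -> W) (S : 'I_n -> set V) (U : submod W) v :
  multilinear g -> (forall i, Defs.span (S i) (v i)) ->
  (forall u, (forall i, S i (u i)) -> U (g u)) -> U (g v).
Proof.
move=> hg hv hS.
suff: forall (s : seq 'I_n) u, (forall i, i \notin s -> S i (u i)) ->
    (forall i, Defs.span (S i) (u i)) -> U (g u).
  by move/(_ (enum 'I_n)); apply=> // i; rewrite mem_enum.
elim=> [|i s IH] u h1 h2; first by apply: hS => i; exact: h1.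
have g_ok : (U : set W) (g (upd u i 0)) /\ forall c x y, U (g (upd u i x)) -> U (g (upd u i y)) ->
    U (g (upd u i (c *: x + y))).
  split=> [|c x y hx hy]; last by rewrite hg; exact: submodL.
  have := multilinearZ u i 0 0 hg; rewrite !scale0r => ->; exact: submod0.
pose U' := @Submod F V (fun x => U (g (upd u i x))) g_ok.
have : U' (u i).
  apply: (@Defs.span_min _ _ (S i) U') (h2 i) => x hx /=; apply: IH => k.
    rewrite /upd; case: eqVneq => [->//|ki ks]; apply: h1.
    by rewrite inE negb_or ki.
  by rewrite /upd; case: eqVneq => [->|//]; exact: Defs.sub_span.
by rewrite /= upd_id.
Qed.
End MultilinearInduction.

Section Grading.
Variables (F : fieldType) (V : lmodType F) (d : {linear V -> V}).
Variables (Vs : nat -> submod V) (Vs_direct : direct_sum Vs).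
Hypothesis Vs_d : forall s v, Vs s v -> Vs s (d v).

Definition component (x : V) : nat -> V := sval (cid (Vs_direct x)).
Lemma componentP x : decomposes Vs x (component x).
Proof. by have [] := svalP (cid (Vs_direct x)). Qed.
Lemma component_unique x c : decomposes Vs x c -> component x = c.
Proof. by have [_] := svalP (cid (Vs_direct x)); apply. Qed.

Lemma decomposes_fsupp x c : decomposes Vs x c -> fsupp c.
Proof.
case=> _ /finite_enum[s [_ hs]] _; exists s => i.
by apply: contraNeq => h; apply/hs.
Qed.
Lemma fsupp_finite (c : nat -> V) : fsupp c -> finite_set [set i | c i != 0].
Proof.
case=> s hs; apply: (@sub_finite_set _ _ [set` s]) => // i /=.
by apply: contraNT => /hs ->.
Qed.

Lemma component_linear k x y s : component (k *: x + y) s = k *: component x s + component y s.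
Proof.
have [x1 x2 x3] := componentP x; have [y1 y2 y3] := componentP y.
have fx := decomposes_fsupp (componentP x); have fy := decomposes_fsupp (componentP y).
have fkx : fsupp (fun s => k *: component x s).
  by case: fx => l hl; exists l => i /hl->; rewrite scaler0.
rewrite (@component_unique _ (fun s => k *: component x s + component y s)) //; split.
- by move=> i; exact: submodL.
- apply: fsupp_finite; case: fkx fy => l hl [l' hl']; exists (l ++ l') => i.
  by rewrite mem_cat negb_or => /andP[/hl-> /hl'->]; rewrite addr0.
- by rewrite fsumD // fsumZ // -x3 -y3.
Qed.

Lemma component_id s v t : Vs s v -> component v t = if t == s then v else 0.
Proof.
move=> hv; rewrite (@component_unique _ (fun t => if t == s then v else 0)) //; split.
- by move=> i; case: eqVneq => [->|_]; [|exact: submod0].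
- apply: fsupp_finite; exists [:: s] => i; rewrite inE => /negPf->; exact: erefl.
rewrite (@fsuppT_seq _ _ _ [:: s]) ?big_seq1 ?eqxx // => i.
by rewrite inE => /negPf->.
Qed.

Definition prj (t : int) (v : V) : V := if t is Posz s then component v s else 0.
Lemma prj_linear t : linear (prj t).
Proof.
move=> k x y; case: t => s /=; first exact: component_linear.
by rewrite scaler0 addr0.
Qed.
HB.instance Definition _ t := GRing.isLinear.Build F V V _ (prj t) (prj_linear t).

Lemma prj_in t v : grV Vs t (prj t v).
Proof.
case: t => s; last exact: submod0 (zero_submod V).
by have [h _ _] := componentP v; exact: h.
Qed.
Lemma grV_neg s v : grV Vs (Negz s) v -> v = 0.
Proof.
move=> /= h.
have z : [set 0 : V] 0 /\ forall (c : F) x y, [set 0 : V] x -> [set 0 : V] y -> [set 0 : V] (c *: x + y).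
  by split=> // c x y -> ->; rewrite scaler0 addr0.
exact: (h (Submod z)).
Qed.
Lemma prj_grV s t v : grV Vs s v -> prj t v = if t == s then v else 0.
Proof.
case: s => s hv; last by rewrite (grV_neg hv) raddf0; case: ifP.
case: t => t /=; last by [].
by rewrite (component_id _ hv).
Qed.
Lemma prj_id t v : grV Vs t v -> prj t v = v.
Proof. by move=> /(prj_grV t)->; rewrite eqxx. Qed.

(** The components vanish beyond some degree; the degree bound is left free, so that
    one bound serves several vectors. *)
Lemma prj_sum v : exists N, forall M, (N <= M)%N -> v = \sum_(s < M) prj s%:Z v.
Proof.
have [_ _ h] := componentP v; have [l hl] := decomposes_fsupp (componentP v).
exists (\max_(i <- l) i).+1 => M hM.
rewrite {1}h (@fsuppT_seq _ _ _ (iota 0 M)) ?iota_uniq //.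
  by rewrite -{1}[M]subn0 -[iota _ _]/(index_iota 0 M) big_mkord.
move=> i; rewrite mem_iota add0n /= -leqNgt => hi; apply: hl; apply/negP => il.
have := @leq_bigmax_seq _ l xpredT (fun x : nat => x) i il isT.
by move=> /leq_ltn_trans/(_ hM); rewrite ltnNge hi.
Qed.

Lemma prj_d t v : prj t (d v) = d (prj t v).
Proof.
have [N hN] := prj_sum v; rewrite {1}(hN N) // !raddf_sum /=.
have hv := hN N (leqnn _).
rewrite {2}hv !raddf_sum /=; apply: eq_bigr => s _.
have hs : grV Vs s (prj s v) := prj_in s v.
have hds : grV Vs s (d (prj s v)) by exact: Vs_d.
by rewrite (prj_grV t hds) (prj_grV t hs); case: ifP => // _; rewrite raddf0.
Qed.

Lemma grV_FV s t v : s <= t -> grV Vs s v -> FV Vs t v.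
Proof.
case: s => s st hv; last by rewrite (grV_neg hv); exact: submod0.
by apply: Defs.sub_span; exists s.
Qed.
(** Since FV is a sum of homogeneous subspaces, membership is read off from the
    components. *)
Lemma FVP t v : FV Vs t v <-> forall s, t < s -> prj s v = 0.
Proof.
split=> [h s ts|h].
  have z : [set v | prj s v = 0] 0 /\ forall c x y, [set v | prj s v = 0] x ->
     [set v | prj s v = 0] y -> [set v | prj s v = 0] (c *: x + y).
    by split=> [|c x y /= hx hy] /=; [rewrite raddf0|rewrite linearP /= hx hy scaler0 addr0].
  apply: (Defs.span_min (U := Submod z)) h => x [s' /= s't hx].
  by rewrite (@prj_grV s'%:Z) //; case: eqP => // e; move: s't ts; rewrite e; lia.
have [N hN] := prj_sum v; rewrite (hN N) //; apply: submod_sum => s _.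
have [st|ts] := leP s%:Z t; first exact: grV_FV st (prj_in _ _).
by rewrite h //; exact: submod0.
Qed.
Lemma FV_mono s t v : s <= t -> FV Vs s v -> FV Vs t v.
Proof. by move=> st /FVP h; apply/FVP => k tk; apply: h; exact: le_lt_trans tk. Qed.

(** ** Homogeneous components in V[lambda] / <d + sum lambda> *)
Section Vlam.
Variable n : nat.
Local Notation W := (Vlam d n).
Definition part (t : int) : W -> W := vlam_map idfun (prj t).

Lemma intertwiner_id : intertwiner (idfun : {mpoly F[n]} -> _).
Proof. by split. Qed.
Lemma part_linear t : linear (part t).
Proof. by apply: vlam_map_linear; [exact: prj_d|exact: intertwiner_id]. Qed.
HB.instance Definition _ t := GRing.isLinear.Build F W W _ (part t) (part_linear t).

Lemma part_map t (phi : {mpoly F[n]} -> {mpoly F[n]}) x : intertwiner phi ->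
  part t (vlam_map phi idfun x) = vlam_map phi idfun (part t x).
Proof. by move=> h; apply: vlam_map_idC; [exact: prj_d|]. Qed.
Lemma part_lambda_mul t i x : part t (lambda_mul i x) = lambda_mul i (part t x).
Proof. exact/part_map/intertwiner_mul. Qed.
Lemma part_lambda_diff t i j x : part t (lambda_diff i j x) = lambda_diff i j (part t x).
Proof. exact/part_map/intertwiner_deriv. Qed.

Lemma Vlam_in_full x : Vlam_in d n (full_submod V) x.
Proof. by rewrite -(qrepK x); eexists. Qed.
Lemma part_in t x : Vlam_in d n (grV Vs t) (part t x).
Proof.
apply: (@vlam_map_in _ _ _ _ _ _ (prj t) (full_submod V) _ _ (prj_d t) intertwiner_id) (Vlam_in_full x) => v _.
exact: prj_in.
Qed.
Lemma part_class t q : part t (qclass _ q) = qclass _ (vmap idfun (prj t) q).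
Proof. by apply: vlam_map_class; [exact: prj_d|exact: intertwiner_id]. Qed.
Lemma vmap_coef (u : {linear V -> V}) (q : Vpoly V n) m :
  vcoef (vmap idfun u q) m = u (vcoef q m).
Proof.
have [s us hs] := vsupp2 q q.
rewrite (@vmapE _ _ _ _ _ _ s) //; last by move=> k h; apply: hs; rewrite h.
rewrite vcoef_sum; under eq_bigr => k _ do rewrite vcoef_vterm mcoeffX.
have [ms|ms] := boolP (m \in s).
  by rewrite (bigD1_seq m) //= eqxx scale1r big1 ?addr0 // => k /negPf->; rewrite scale0r.
rewrite big_seq big1 => [|k ks].
  have -> : vcoef q m = 0; last by rewrite raddf0.
  by apply/eqP; apply: contraNT ms => h; apply: hs; rewrite h.
by case: eqVneq => [km|_]; [move: ms; rewrite -km ks|rewrite scale0r].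
Qed.
Lemma part_grV s t x : Vlam_in d n (grV Vs s) x -> part t x = if t == s then x else 0.
Proof.
case=> q hq <-; rewrite part_class.
have E m : vcoef (vmap idfun (prj t) q) m = if t == s then vcoef q m else 0.
  by rewrite vmap_coef /= (prj_grV _ (hq m)).
case: ifP E => _ E.
  by congr qclass; apply: vpolyP => m; rewrite E.
rewrite -[RHS](raddf0 (qclass (shift_image d n))); congr qclass.
by apply: vpolyP => m; rewrite E.
Qed.
Lemma part_id t x : Vlam_in d n (grV Vs t) x -> part t x = x.
Proof. by move=> /(part_grV t)->; rewrite eqxx. Qed.
Lemma part_FV0 s t x : Vlam_in d n (FV Vs s) x -> s < t -> part t x = 0.
Proof.
case=> q hq <- st; rewrite part_class -[RHS](raddf0 (qclass (shift_image d n))).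
congr qclass; apply: vpolyP => m; rewrite vmap_coef /=.
by have /FVP -> := hq m.
Qed.
(** As for vectors; the coefficients of a representative are finitely many. *)
Lemma part_sum x : exists N, forall M, (N <= M)%N -> x = \sum_(s < M) part s%:Z x.
Proof.
rewrite -(qrepK x); set q := qrep x.
have [N hN] : exists N, forall m M, (N <= M)%N -> vcoef q m = \sum_(s < M) prj s%:Z (vcoef q m).
  have [s us hs] := vsupp2 q q.
  have [N hN] : exists N, forall m M, m \in s -> (N <= M)%N ->
      vcoef q m = \sum_(s < M) prj s%:Z (vcoef q m).
    elim: s {us hs} => [|m s [N IH]]; first by exists 0%N.
    have [N' hN'] := prj_sum (vcoef q m); exists (maxn N N') => k M.
    rewrite inE geq_max => /orP[/eqP->|ks] /andP[h1 h2]; first exact: hN'.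
    exact: IH.
  exists N => m M NM; have [/hN|ms] := boolP (m \in s); first exact.
  have -> : vcoef q m = 0.
    by apply/eqP; apply: contraNT ms => h; apply: hs; rewrite h.
  by rewrite big1 // => i _; rewrite raddf0.
exists N => M NM; under eq_bigr => s _ do rewrite part_class.
rewrite -raddf_sum; congr qclass; apply: vpolyP => m.
by rewrite vcoef_sum (hN m M NM); apply: eq_bigr => s _; rewrite vmap_coef.
Qed.
Lemma Vlam_in_FVP t x : Vlam_in d n (FV Vs t) x <-> forall s, t < s -> part s x = 0.
Proof.
split=> [h s|h]; first exact: part_FV0.
have [N hN] := part_sum x; rewrite (hN N) //; apply: submod_sum => s _.
have [st|ts] := leP s%:Z t; last by rewrite h //; exact: submod0.
apply: Vlam_in_mono (part_in _ _) => v; exact: grV_FV.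
Qed.
Lemma Vlam_in_FV_mono s t x : s <= t -> Vlam_in d n (FV Vs s) x -> Vlam_in d n (FV Vs t) x.
Proof. by move=> st; apply: Vlam_in_mono => v; exact: FV_mono. Qed.

End Vlam.

Definition homogeneous : set V := \bigcup_s (Vs s : set V).
Lemma span_homogeneous v : Defs.span homogeneous v.
Proof.
have [N hN] := prj_sum v; rewrite (hN N) //; apply: submod_sum => s _.
by apply: Defs.sub_span; exists (nat_of_ord s) => //; exact: (prj_in s%:Z).
Qed.
End Grading.

(** * From classical to chiral operations *)

Section ClassicalToChiral.
Variables (F : fieldType) (charF0 : [pchar F] =i pred0).
Variables (V : lmodType F) (d : {linear V -> V}) (n : nat).
Implicit Types (Y : Pcl_map d n) (v : 'I_n -> V) (f : OT F n).

Lemma submod_fsum (W : lmodType F) (T : choiceType) (U : submod W) (G : T -> W) :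
  fsupp G -> (forall x, U (G x)) -> U (\sum_(x \in [set: T]) G x).
Proof.
move=> [s hs] h; rewrite (@fsuppT_seq _ _ _ (undup s)) ?undup_uniq //.
  by apply: submod_sum => x _.
by move=> x; rewrite mem_undup => /hs.
Qed.

Section Lines.
Variables (p : nat) (L : lines n p) (hL : is_lines L).
Local Notation G := (lines_graph L).
Local Notation rt := (root hL).
Local Notation ln := (line_of hL).

Lemma connect_chain (e : rel 'I_n) x s : (forall ij, ij \in chain_edges (x :: s) -> e ij.1 ij.2) ->
  forall i, i \in x :: s -> connect e x i.
Proof.
elim: s x => [|y s IH] x h i; first by rewrite inE => /eqP->; exact: connect0.
rewrite inE => /orP[/eqP->|hi]; first exact: connect0.
apply: (@connect_trans _ _ y).
  by apply: connect1; apply: (h (x, y)); rewrite chain_edges_cons mem_head.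
by apply: IH hi => ij hij; apply: h; rewrite chain_edges_cons inE hij orbT.
Qed.

Lemma same_component_lines i j : same_component G i j = (ln i == ln j).
Proof.
rewrite /same_component; set e := (fun i j => _).
have eE i' j' : e i' j' = ((i', j') \in elim_edges L) || ((j', i') \in elim_edges L).
  by rewrite /e edges_lines_graph // !inE.
have sym : connect_sym e by apply: sym_connect_sym => x y; rewrite !eE orbC.
apply/idP/eqP => [/connectP[s hs ->]|el].
  elim: s i hs => // y s IH i; rewrite [path _ _ _]/= => /andP[iy /IH <-].
  by move: iy; rewrite eE => /orP[] /(elim_edges_line hL).
have [x [s es]] := tnth_cons hL (ln i).
have h k : ln k = ln i -> connect e x k.
  move=> ek; apply: (@connect_chain _ x s).
    move=> [a b] hab; rewrite eE; apply/orP; left.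
    by apply/mem_elim_edges; exists (ln i); rewrite es.
  by have := mem_line_of hL k; rewrite ek mem_tnth_seq es.
by apply: (@connect_trans _ _ x); [rewrite sym|]; exact: h.
Qed.

(** The projection keeps only the variables of the last vertices of the lines. *)
Lemma line_proj_mul j (x : Vlam d n) :
  line_proj hL (lambda_mul j x) = if rt j == j then lambda_mul (ln j) (line_proj hL x) else 0.
Proof.
have hr := intertwiner_retract F hL; have [hr1 hr2] := hr.
have hm := intertwiner_mul ('X_j : {mpoly F[n]}).
rewrite /line_proj lambda_mulE (vlm_comp x hr (proj1 hm)).
have rX P : line_retract hL ('X_j * P) =
    (if rt j == j then 'X_(ln j) else 0) * line_retract hL P :> {mpoly F[p]}.
  by rewrite /line_retract poly_substM poly_substX.
case: ifP rX => e rX; last first.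
  rewrite -[RHS](@vlam_map_phi0 _ _ d n p idfun x).
  by apply: vlam_map_ext => P /=; rewrite rX mul0r.
rewrite lambda_mulE [RHS](vlm_comp x (intertwiner_mul _) hr1).
by apply: vlam_map_ext => P /=; rewrite rX.
Qed.
End Lines.

(** The value at a disjoint union of lines, as an element of
    [V[Lambda_1, ..., Lambda_p] / <d + sum Lambda>]. *)
Definition line_part Y p (L : lines n p) v : Vlam d p :=
  if pselect (is_lines L) is left hL then line_proj hL (Y (lines_graph L) v) else 0.
Lemma line_partE Y p (L : lines n p) (hL : is_lines L) v :
  line_part Y L v = line_proj hL (Y (lines_graph L) v).
Proof. by rewrite /line_part; case: pselect => [hL'|//]; rewrite (bool_irrelevance hL' hL). Qed.

Lemma line_proj_linear p (L : lines n p) (hL : is_lines L) : linear (line_proj hL : Vlam d n -> _).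
Proof. by apply: vlam_map_linear => //; exact: intertwiner_retract. Qed.
Lemma line_projB p (L : lines n p) (hL : is_lines L) k (x y : Vlam d n) :
  line_proj hL (k *: x + y) = k *: line_proj hL x + line_proj hL y.
Proof. exact: line_proj_linear. Qed.

Lemma line_part_multilinear Y p (L : lines n p) : is_lines L -> in_Pcl Y ->
  multilinear (line_part Y L).
Proof.
move=> hL [Yl _ _ _] v i c x y; rewrite !(line_partE Y hL) Yl.
exact: line_projB.
Qed.

(** Projecting the relation for the component of a line keeps, among the
    multiplications by the lambda_j, that of its last vertex. *)
Lemma line_part_sesqui Y p (L : lines n p) (hL : is_lines L) : in_Pcl Y -> forall l v,
  \sum_(i | line_of hL i == l) line_part Y L (d_at d i v) = - lambda_mul l (line_part Y L v).
Proof.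
move=> [_ _ _ Ys] l v.
have [x [s es]] := tnth_cons hL l.
have lx : line_of hL x = l by apply: line_ofE; rewrite mem_tnth_seq es mem_head.
have := Ys (lines_graph L) x v.
under eq_bigl => j do rewrite (same_component_lines hL) lx eq_sym.
move=> /(congr1 (line_proj hL)).
have lin := @line_proj_linear _ _ hL.
have p0 := linear_at0 lin; have pD := linear_atD lin.
rewrite p0 (big_morph _ pD p0).
under eq_bigr => j _ do rewrite pD line_proj_mul -(line_partE Y hL).
rewrite big_split /= => /eqP; rewrite addr_eq0 => /eqP ->; congr (- _).
rewrite -(line_partE Y hL).
have lr : line_of hL (root hL x) = l by rewrite line_of_root.
rewrite (bigD1 (root hL x)) ?lr //= root_root eqxx big1 ?addr0 // => j /andP[/eqP lj nj].
case: eqP => // rj; move: nj; rewrite -rj (root_eq (j := x)) ?eqxx //.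
by rewrite lj lx.
Qed.

Lemma line_part_emb Y p (L : lines n p) v : is_lines L -> in_Pcl Y ->
  line_emb L (line_part Y L v) = Y (lines_graph L) v.
Proof.
move=> hL [_ _ Yd _]; rewrite (line_partE Y hL); apply: line_projK => // k.
by apply: Yd; rewrite same_component_lines line_of_root.
Qed.

(** The right-hand side of the formula, a sum of chiral operations attached to
    the families of lines. *)
Definition chiral_op Y : Pch_map d n := fun v f =>
  \sum_(1 <= p < n.+1) \sum_(L : lines n p | is_lines L)
    line_term L (line_part Y L) (submod_val f) v.

Lemma chiral_opE Y v f (q : forall p, lines n p -> 'X_{1..n} -> Vpoly V p) :
  (forall p (L : lines n p) b, is_lines L ->
     is_Lambda_form L (Y (lines_graph L) (d_dpow d b v)) (q p L b)) ->
  chiral_op Y v f = chiral_formula d (submod_val f) q.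
Proof.
move=> hq; apply: eq_bigr => p _; apply: eq_bigr => L hL.
apply: eq_fsum => -[a b]; rewrite /term /= (line_partE Y hL).
rewrite -(Lambda_form_proj hL (hq _ _ _ hL)).
rewrite vlam_map_class //; last by apply: intertwiner_term => //; exact: submod_mem.
congr qclass; apply: vmap_ext => // Q /=.
by rewrite /term_op dpowXE.
Qed.

Lemma chiral_op_in_Pch Y : in_Pcl Y -> in_Pch (chiral_op Y).
Proof.
move=> hY; split.
- move=> f v i c x y; rewrite /chiral_op scaler_sumr -big_split; apply: eq_bigr => p _ /=.
  rewrite scaler_sumr -big_split; apply: eq_bigr => L hL /=.
  have hm := line_part_multilinear hL hY.
  exact: (line_term_multilinear charF0 hL hm (submod_mem f)).
- move=> v c f g; rewrite /chiral_op scaler_sumr -big_split; apply: eq_bigr => p _ /=.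
  rewrite scaler_sumr -big_split; apply: eq_bigr => L hL /=.
  by apply: (line_term_linear charF0 hL); exact: submod_mem.
- move=> i v f; rewrite /chiral_op raddf_sum -big_split; apply: eq_bigr => p _ /=.
  rewrite raddf_sum -big_split; apply: eq_bigr => L hL /=.
  have hm := line_part_multilinear hL hY.
  apply: (line_term_chiral charF0 (hL := hL) hm); last exact: submod_mem.
  exact: line_part_sesqui.
- move=> i j v f; rewrite /chiral_op raddf_sum; apply: eq_bigr => p _ /=.
  rewrite raddf_sum; apply: eq_bigr => L hL /=.
  by apply: (line_term_mulz charF0 hL); exact: submod_mem.
Qed.

Lemma line_term_y_linear p (L : lines n p) k (y y' : ('I_n -> V) -> Vlam d p) g v :
  is_lines L -> OT_set F n g ->
  line_term L (fun u => k *: y u + y' u) g v = k *: line_term L y g v + line_term L y' g v.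
Proof.
move=> hL hg; rewrite /line_term -fsumZ; last exact: fsupp_term.
rewrite -fsumD; [|exact/fsuppZ/fsupp_term|exact: fsupp_term].
apply: eq_fsum => -[a b]; rewrite /term /=.
by rewrite (vlam_map_linear (u := idfun)) //; exact: intertwiner_term.
Qed.

Lemma chiral_op_linear : linear chiral_op.
Proof.
move=> k Y Y'; apply: funext => v; apply: funext => f.
have E (X X' : Pch_map d n) : (k *: X + X') v f = k *: X v f + X' v f by [].
rewrite E /chiral_op scaler_sumr -big_split; apply: eq_bigr => p _ /=.
rewrite scaler_sumr -big_split; apply: eq_bigr => L hL /=.
rewrite -line_term_y_linear //; last exact: submod_mem.
suff -> : line_part (k *: Y + Y') L = fun u => k *: line_part Y L u + line_part Y' L u by [].
by apply: funext => u; rewrite !(line_partE _ hL) -line_projB.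
Qed.

Lemma line_term_fourier0 p (L : lines n p) (y : ('I_n -> V) -> Vlam d p) g v :
  (forall a, fourier_coef L g a = 0) -> line_term L y g v = 0.
Proof.
move=> h; rewrite /line_term fsbig1 // => -[a b] _; rewrite /term /=.
rewrite -(@vlam_map_phi0 _ _ d p n idfun (y (d_dpow d b v))); apply: vlam_map_ext => Q.
by rewrite /term_op h convolution0l /line_subst -[0 in LHS](mpolyC0 p F) poly_substC mpolyC0 mulr0.
Qed.

Section Filtered.
Variables (Vs : nat -> submod V) (Vs_direct : direct_sum Vs).
Hypothesis Vs_d : forall s x, Vs s x -> Vs s (d x).

Lemma line_term_in p (L : lines n p) (y : ('I_n -> V) -> Vlam d p) g v (U : submod V) :
  is_lines L -> OT_set F n g -> (forall b, Vlam_in d p U (y (d_dpow d b v))) ->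
  Vlam_in d n U (line_term L y g v).
Proof.
move=> hL hg hy; apply: submod_fsum; first exact: fsupp_term.
move=> [a b]; rewrite /term /=.
by apply: (vlam_map_in (u := idfun) (U := U)) => //; exact: intertwiner_term.
Qed.

Lemma d_dpow_graded (t : 'I_n -> int) b v : (forall i, grV Vs (t i) (v i)) ->
  forall i, grV Vs (t i) (d_dpow d b v i).
Proof.
move=> h i; rewrite /d_dpow; apply: submodZ.
elim: (b i) => [|k IH] /=; first exact: h.
case: (t i) IH => s hs; first exact: Vs_d.
by rewrite (grV_neg hs) raddf0; exact: submod0 (zero_submod V).
Qed.

(** A family of p lines has n - p edges, which fixes the degree of its term. *)
Lemma line_term_graded r Y p (L : lines n p) (t : 'I_n -> int) v f :
  gr_Pcl_set (grV Vs) r Y -> is_lines L -> (forall i, grV Vs (t i) (v i)) ->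
  Vlam_in d n (grV Vs ((n - p)%N%:Z + \sum_(i < n) t i - r))
    (line_term L (line_part Y L) (submod_val f) v).
Proof.
move=> [hY Ygr] hL hv; apply: line_term_in => //; first exact: submod_mem.
move=> b; rewrite (line_partE Y hL).
apply: (vlam_map_in (u := idfun) (U := grV Vs ((n - p)%N%:Z + \sum_(i < n) t i - r))) => //.
  exact: intertwiner_retract.
by rewrite -(card_edges_lines hL); apply: Ygr; exact: d_dpow_graded.
Qed.

Lemma line_term_few_poles Y p (L : lines n p) q v f : is_lines L ->
  pole_filtration F n q (submod_val f) -> q < (n - p)%N%:Z ->
  line_term L (line_part Y L) (submod_val f) v = 0.
Proof.
move=> hL hf few; apply: line_term_fourier0 => a.
exact: fourier_coef_few_poles few.
Qed.

(** Either f has at least the n - p poles of the edges, and the degree of the term is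
    at most the required one, or the term is zero. *)
Lemma line_term_FV r Y p (L : lines n p) (t : 'I_n -> int) q s v f :
  gr_Pcl_set (grV Vs) r Y -> is_lines L -> (forall i, grV Vs (t i) (v i)) ->
  pole_filtration F n q (submod_val f) -> \sum_(i < n) t i + q <= s ->
  Vlam_in d n (FV Vs (s - r)) (line_term L (line_part Y L) (submod_val f) v).
Proof.
move=> hY hL hv hf hs; have [few|enough] := ltP q (n - p)%N%:Z.
  by rewrite (line_term_few_poles _ _ hL hf few); exact: submod0.
apply: Vlam_in_mono (line_term_graded f hY hL hv) => u; apply: grV_FV; lia.
Qed.

Lemma chiral_op_filtered r Y : gr_Pcl_set (grV Vs) r Y ->
  Pch_filtration_set (FV Vs) r (chiral_op Y).
Proof.
move=> hY; have [hY1 _] := hY; have hX := chiral_op_in_Pch hY1; split=> // s q t v f hs hv hf.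
have [Xl _ _ _] := hX.
apply: (multilinear_span (Xl f) (S := fun i => \bigcup_(k in [set k : nat | k%:Z <= t i]) (Vs k : set V))).
  exact: hv.
move=> u hu.
have {hu} /choice[k hk] : forall i, exists k : nat, k%:Z <= t i /\ Vs k (u i).
  by move=> i; have [k] := hu i; exists k.
apply: submod_sum => p _; apply: submod_sum => L hL.
apply: (@line_term_FV r Y p L (fun i => (k i)%:Z) q s u f) => //.
  by move=> i; have [] := hk i.
apply: le_trans hs; rewrite lerD2r; apply: ler_sum => i _.
by have [] := hk i.
Qed.
End Filtered.
End ClassicalToChiral.

(** * Functions with few poles *)

Lemma trade_pole (K : fieldType) (x y M : K) a b : x != 0 ->
  x * (y^-1 * (y ^- a * (x ^- b.+1 * M))) = y ^- a.+1 * (x ^- b * M).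
Proof.
move=> x0; rewrite !exprS !invfM -!mulrA mulrCA; congr (_ * _).
by rewrite mulrCA; congr (_ * _); rewrite mulVKf.
Qed.

Section FewPoles.
Variables (F : fieldType) (charF0 : [pchar F] =i pred0) (n : nat).
Implicit Types (f g h : ratfun F n) (A : {set 'I_n * 'I_n}) (m : 'I_n * 'I_n -> nat).
Local Notation z := (zdiff F).
Local Notation ze e := (zdiff F e.1 e.2).

Definition with_poles A : set (ratfun F n) :=
  [set f | (exists i, f = zvar F i) \/ (exists2 e, e \in A & f = (ze e)^-1)].

Lemma with_poles_filtration A (q : int) : #|A|%:Z <= q ->
  adjoin (with_poles A) `<=` pole_filtration F n q.
Proof.
move=> hq f hf.
pose B := [set e : 'I_n * 'I_n | (e.1 < e.2)%N & (e \in A) || ((e.2, e.1) \in A)]%SET.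
apply: Defs.sub_span; exists B => /=.
  split; last by move=> e; rewrite inE => /andP[].
  apply: le_trans hq; rewrite lez_nat.
  pose o (e : 'I_n * 'I_n) := if (e.1 < e.2)%N then e else (e.2, e.1).
  apply: (@leq_trans #|[set o e | e in A]%SET|); last exact: leq_imset_card.
  apply: subset_leq_card; apply/fintype.subsetP => -[a b]; rewrite inE /= => /andP[ab].
  case/orP => h; apply/imsetP.
    by exists (a, b) => //; rewrite /o /= ab.
  by exists (b, a) => //; rewrite /o /= ltnNge (ltnW ab).
apply: adjoin_sub hf => g [[i ->]|[e eA ->]].
  by apply: adjoin_gen; left; exists i.
have [lt|gt|/val_inj eq] := ltngtP e.1 e.2.
- by apply: adjoin_gen; right; exists e => //; rewrite inE lt eA.
- rewrite -[ze e]opprB invrN; apply: submodN; apply: adjoin_gen; right.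
  by exists (e.2, e.1) => //; rewrite inE /= gt -surjective_pairing eA orbT.
by rewrite /zdiff eq subrr invr0; exact: submod0.
Qed.

Definition monomial A m : ratfun F n := \prod_(e in A) ze e ^- m e.

Lemma adjoin_zdiffVX (S : set (ratfun F n)) i j k : S (z i j)^-1 -> adjoin S (z i j ^- k).
Proof. by move=> h; rewrite -exprVn; apply: adjoinX; exact: adjoin_gen. Qed.
Lemma adjoin_prod (S : set (ratfun F n)) (I : Type) (s : seq I) (P : pred I) (G : I -> ratfun F n) :
  (forall i, P i -> adjoin S (G i)) -> adjoin S (\prod_(i <- s | P i) G i).
Proof. by move=> h; apply: big_ind => //; [exact: adjoin1|exact: adjoinM]. Qed.
Lemma monomial_with_poles A m : adjoin (with_poles A) (monomial A m).
Proof. by apply: adjoin_prod => e eA; apply: adjoin_zdiffVX; right; exists e. Qed.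
Lemma monomial_OT A m : OT_set F n (monomial A m).
Proof.
apply: adjoin_prod => e eA; rewrite -exprVn; apply: adjoinX; exact: OT_zdiffV.
Qed.

Lemma monomialD1 A m e : e \in A -> monomial A m = ze e ^- m e * monomial (A :\ e) m.
Proof. by move=> eA; rewrite /monomial (big_setD1 e). Qed.
Lemma eq_monomial A m m' : {in A, m =1 m'} -> monomial A m = monomial A m'.
Proof. by move=> h; apply: eq_bigr => e /h ->. Qed.

(** Multiplying by the relation 1 = sum_e c_e z_e / z_e0 lowers one of the other
    exponents at a time, until some factor has disappeared from each term. *)
Lemma dependent_poles A e0 (c : 'I_n * 'I_n -> F) m : e0 \in A -> e0.1 != e0.2 ->
  (forall e, e \in A -> e.1 != e.2) ->
  ze e0 = \sum_(e in A :\ e0) c e *: ze e ->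
  pole_filtration F n (#|A|%:Z - 1) (monomial A m).
Proof.
move=> eA ne hA ez.
have [N] := ubnP (\sum_(e in A :\ e0) m e)%N; elim: N m => // N IH m ltN.
have drop e m' : e \in A -> m' e = 0%N -> pole_filtration F n (#|A|%:Z - 1) (monomial A m').
  move=> he h0; rewrite (monomialD1 _ he) h0 expr0 invr1 mul1r.
  apply: (@with_poles_filtration (A :\ e)); last exact: monomial_with_poles.
  by rewrite (cardsD1 e A) he; lia.
have [/existsP[e /andP[he /eqP h0]]|/existsPn pos] := boolP [exists e, (e \in A) && (m e == 0%N)].
  exact: drop h0.
have z0 : ze e0 != 0 by rewrite zdiff_eq0.
have -> : monomial A m = \sum_(e in A :\ e0) c e *: (ze e * ((ze e0)^-1 * monomial A m)).
  transitivity (ze e0 * ((ze e0)^-1 * monomial A m)); first by rewrite mulrA divff // mul1r.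
  rewrite {1}ez mulr_suml; apply: eq_bigr => e _.
  by rewrite !ratfun_scaleE mulrA.
apply: submod_sum => e; rewrite in_setD1 => /andP[ee0 he]; apply: submodZ.
have me : m e = (m e).-1.+1.
  by have := pos e; rewrite he /=; case: (m e).
pose m' e' := if e' == e then (m e).-1 else if e' == e0 then (m e0).+1 else m e'.
have -> : ze e * ((ze e0)^-1 * monomial A m) = monomial A m'.
  have he1 : e \in A :\ e0 by rewrite in_setD1 ee0.
  have eM : monomial (A :\ e0 :\ e) m' = monomial (A :\ e0 :\ e) m.
    apply: eq_monomial => k; rewrite !in_setD1 => /and3P[/negPf n1 /negPf n2 _].
    by rewrite /m' n1 n2.
  rewrite !(monomialD1 _ eA) !(monomialD1 _ he1) eM /m' eqxx [e0 == e]eq_sym (negPf ee0) eqxx.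
  rewrite {1}me; set M := monomial _ _.
  have ze0 : ze e != 0 by rewrite zdiff_eq0 hA.
  exact: trade_pole.
apply: IH; rewrite -ltnS; apply: leq_trans ltN; rewrite ltnS.
have he1 : e \in A :\ e0 by rewrite in_setD1 ee0.
have m'e : m' e = (m e).-1 by rewrite /m' eqxx.
rewrite (big_setD1 e) //= [X in (_ < X)%N](big_setD1 e) //= m'e.
rewrite [X in (_ < X + _)%N]me addSn ltnS leq_add2l; apply: leq_sum => k.
rewrite !in_setD1 => /and3P[/negPf n1 /negPf n2 _]; rewrite /m' n1 n2.
exact: leqnn.
Qed.

Definition linked A : rel 'I_n := fun i j => ((i, j) \in A) || ((j, i) \in A).

(** Along an undirected path the [z_ij] add up. *)
Lemma linked_zdiff A i j : connect (linked A) i j ->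
  exists c : 'I_n * 'I_n -> F, z i j = \sum_(e in A) c e *: ze e.
Proof.
move=> /connectP[s]; elim: s i => [|k s IH] i /=.
  move=> _ ->; exists (fun=> 0); rewrite big1 => [|e _]; last by rewrite scale0r.
  by rewrite /zdiff subrr.
case/andP => ik hs ej; have [c hc] := IH k hs ej.
have [c' hc'] : exists c' : 'I_n * 'I_n -> F, z i k = \sum_(e in A) c' e *: ze e.
  have one e0 (a : F) : e0 \in A -> \sum_(e in A) (if e == e0 then a else 0) *: ze e = a *: ze e0.
    move=> he0; rewrite (big_setD1 e0) //= eqxx big1 ?addr0 // => e.
    by rewrite in_setD1 => /andP[/negPf->]; rewrite scale0r.
  case/orP: ik => h.
    by exists (fun e => if e == (i, k) then 1 else 0); rewrite one // scale1r.
  by exists (fun e => if e == (k, i) then -1 else 0); rewrite one // scaleN1r opprB.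
exists (fun e => c' e + c e).
under eq_bigr => e _ do rewrite scalerDl.
by rewrite big_split /= -hc -hc' /zdiff addrA subrK.
Qed.

(** An edge of an undirected cycle is a combination of the others. *)
Lemma cyclic_poles A e0 m : e0 \in A -> (forall e, e \in A -> e.1 != e.2) ->
  connect (linked (A :\ e0)) e0.1 e0.2 ->
  pole_filtration F n (#|A|%:Z - 1) (monomial A m).
Proof.
move=> eA hA /linked_zdiff[c hc].
by apply: (@dependent_poles A e0 c m) => //; exact: hA.
Qed.

Variable S : {set 'I_n}.
Lemma dS_monomial0 A m : (forall e, e \in A -> (e.1 \in S) = (e.2 \in S)) ->
  dS S (monomial A m) = 0.
Proof.
move=> h; apply: (big_ind (fun f => dS S f = 0)) => [|f g hf hg|e /h]; first exact: dS1.
  by rewrite dSM hf hg mul0r mulr0 addr0.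
exact: dS_pole0.
Qed.
End FewPoles.

(** * Translation invariant functions with few poles *)

Lemma common_denominator (K : fieldType) (x c P Q : K) a b : x != 0 ->
  c * (P * x ^- a) + Q * x ^- b = (c * P * x ^+ b + Q * x ^+ a) * x ^- (a + b).
Proof.
move=> x0; rewrite exprD invfM [RHS]mulrDl; congr (_ + _); rewrite -!mulrA.
  by do 2 congr (_ * _); rewrite mulrCA divff ?expf_neq0 // mulr1.
by congr (_ * _); rewrite mulrA divff ?expf_neq0 // mul1r.
Qed.

Lemma inverse_quotient (K : fieldType) (x y : K) : y != 0 -> x^-1 = y / (x * y).
Proof. by move=> y0; rewrite invfM mulrCA divff // mulr1. Qed.

Section TranslationInvariance.
Variables (F : fieldType) (charF0 : [pchar F] =i pred0) (n : nat).
Implicit Types (f g h : ratfun F n) (A : {set 'I_n * 'I_n}).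
Local Notation z := (zdiff F).
Local Notation ze e := (zdiff F e.1 e.2).

Definition edge_product A : {mpoly F[n]} := \prod_(e in A) ('X_(e.1) - 'X_(e.2)).
Lemma of_poly_edge_product A : of_poly (edge_product A) = \prod_(e in A) ze e.
Proof.
rewrite /edge_product (big_morph _ (@of_polyM F n) (@of_poly1 F n)).
by apply: eq_bigr => e _; rewrite zdiffE.
Qed.
Lemma monomial_const A N : monomial F A (fun=> N) = of_poly (edge_product A) ^- N.
Proof. by rewrite of_poly_edge_product -exprVn -prodfV -prodrXl; apply: eq_bigr => e _; rewrite exprVn. Qed.

Lemma with_poles_fraction A f : (forall e, e \in A -> e.1 != e.2) ->
  adjoin (with_poles A) f -> exists P N, f = of_poly P * monomial F A (fun=> N).
Proof.
move=> hA.
have D0 : of_poly (edge_product A) != 0.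
  by rewrite of_poly_edge_product; apply/prodf_neq0 => e /hA; rewrite zdiff_eq0.
apply: (@adjoin_ind F n _ [set f | exists P N, f = of_poly P * monomial F A (fun=> N)]).
  split=> [|c _ _ [P [N ->]] [Q [N' ->]]|_ _ [P [N ->]] [Q [N' ->]]].
  - by exists 1, 0%N; rewrite monomial_const expr0 invr1 mulr1 of_poly1.
  - exists (c%:MP * P * edge_product A ^+ N' + Q * edge_product A ^+ N), (N + N')%N.
    rewrite !monomial_const ratfun_scaleE common_denominator // of_polyD !of_polyM.
    by rewrite /of_poly !rmorphXn.
  - exists (P * Q), (N + N')%N; rewrite !monomial_const exprD invfM of_polyM.
    by rewrite mulrACA.
move=> _ [[i ->]|[e eA ->]].
  by exists 'X_i, 0%N; rewrite monomial_const expr0 invr1 mulr1.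
exists (edge_product (A :\ e)), 1%N; rewrite monomial_const expr1 !of_poly_edge_product.
have -> : \prod_(e' in A) ze e' = ze e * \prod_(e' in A :\ e) ze e' by exact: big_setD1.
apply: inverse_quotient.
by apply/prodf_neq0 => e'; rewrite in_setD1 => /andP[_ /hA]; rewrite zdiff_eq0.
Qed.

Variable k : 'I_n.
Definition recenter (i : 'I_n) : {mpoly F[n]} := 'X_i - 'X_k.

Lemma recenter_zdiff i j : ratfun_subst recenter (z i j) = z i j.
Proof.
by rewrite !zdiffE ratfun_subst_poly poly_substB !poly_substX /recenter opprB addrA subrK.
Qed.
Lemma OT_recenter f : OT_set F n f -> regular_at recenter f /\ ratfun_subst recenter f = f.
Proof.
apply: (@adjoin_ind F n _ [set f | regular_at recenter f /\ ratfun_subst recenter f = f]).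
  split=> [|c f1 f2 [h1 e1] [h2 e2]|f1 f2 [h1 e1] [h2 e2]].
  - by split; [exact: regular1|exact: ratfun_subst1].
  - by have [h e] := regularL c h1 h2; split=> //; rewrite e e1 e2.
  - by have [h e] := regularM h1 h2; split=> //; rewrite e e1 e2.
have reg i j : regular_at recenter (z i j) by rewrite zdiffE; exact: regular_poly.
move=> _ [i [j [ij [->|->]]]]; first by split; [exact: reg|exact: recenter_zdiff].
have [|h e] := regularV (reg i j); last by split=> //; rewrite e recenter_zdiff.
by rewrite recenter_zdiff zdiff_eq0; apply/eqP => eij; rewrite eij ltnn in ij.
Qed.

Definition differences : set (ratfun F n) := [set f | exists i j, f = z i j].

Lemma recenter_poly P : adjoin differences (of_poly (poly_subst recenter P)).
Proof.
have hC (c : F) : of_poly c%:MP = c *: (1 : ratfun F n) by rewrite ratfun_scaleE mulr1.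
move: P; apply: mpoly_gen_ind => [c|i|P Q hP hQ|P Q hP hQ].
- by rewrite poly_substC hC; apply: submodZ; exact: adjoin1.
- by rewrite poly_substX -zdiffE; apply: adjoin_gen; exists i, k.
- by rewrite poly_substD of_polyD; exact: submodD.
- by rewrite poly_substM of_polyM; exact: adjoinM.
Qed.

Definition invariant_monomials (q : int) : set (ratfun F n) :=
  [set g | exists A m h, [/\ #|A|%:Z <= q, forall e, e \in A -> e.1 != e.2,
     adjoin differences h & g = h * monomial F A m]].

(** Substituting [z_i - z_k] for [z_i] fixes a translation invariant function
    and turns its numerators into polynomials in the [z_ij]. *)
Lemma few_poles_invariant q f : pole_filtration F n q f -> OT_set F n f ->
  Defs.span (invariant_monomials q) f.
Proof.
move=> hq /OT_recenter[_ <-].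
have sub_ok : [set f | regular_at recenter f /\
      Defs.span (invariant_monomials q) (ratfun_subst recenter f)] 0 /\
    forall c x y, [set f | regular_at recenter f /\
      Defs.span (invariant_monomials q) (ratfun_subst recenter f)] x ->
    [set f | regular_at recenter f /\
      Defs.span (invariant_monomials q) (ratfun_subst recenter f)] y ->
    [set f | regular_at recenter f /\
      Defs.span (invariant_monomials q) (ratfun_subst recenter f)] (c *: x + y).
  split=> [|c x y [x1 x2] [y1 y2]].
    split; first by rewrite -of_poly0; exact: regular_poly.
    by rewrite ratfun_subst0; exact: submod0.
  have [h e] := regularL c x1 y1; split=> //; rewrite e; exact: submodL.
suff [] : Submod sub_ok f by [].
apply: (Defs.span_min (U := Submod sub_ok)) hq => g [A [/= cA ltA] hg].
have hA e : e \in A -> e.1 != e.2 by move=> /ltA; case: eqP => // ->; rewrite ltnn.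
have [P [N ->]] := with_poles_fraction hA hg.
have [m1 m2] := OT_recenter (monomial_OT A (fun=> N)).
have [h e] := regularM (regular_poly recenter P) m1; split=> //.
rewrite e m2 ratfun_subst_poly; apply: Defs.sub_span.
by exists A, (fun=> N), (of_poly (poly_subst recenter P)); split=> //; exact: recenter_poly.
Qed.
End TranslationInvariance.

(** * Vanishing of symbols *)

Section Symbols.
Variables (F : fieldType) (charF0 : [pchar F] =i pred0).
Variables (V : lmodType F) (d : {linear V -> V}) (n : nat).
Variables (Vs : nat -> submod V) (Vs_direct : direct_sum Vs).
Hypothesis Vs_d : forall s x, Vs s x -> Vs s (d x).
Local Notation z := (zdiff F).
Local Notation ze e := (zdiff F e.1 e.2).
Variable X : Pch_map d n.
Implicit Types (v w : 'I_n -> V) (U : submod (Vlam d n)) (A : {set 'I_n * 'I_n}).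

Section Values.
Hypothesis hX : in_Pch X.

Lemma values_subproof v U :
  [set f | exists g : OT F n, submod_val g = f /\ U (X v g)] 0 /\
  forall c f g, [set f | exists g : OT F n, submod_val g = f /\ U (X v g)] f ->
    [set f | exists g : OT F n, submod_val g = f /\ U (X v g)] g ->
    [set f | exists g : OT F n, submod_val g = f /\ U (X v g)] (c *: f + g).
Proof.
have [_ Xl _ _] := hX.
split=> [|c _ _ [f [<- hf]] [g [<- hg]]].
  exists 0; split=> //.
  rewrite (linear_at0 (Xl v)); exact: submod0.
by exists (c *: f + g); split=> //; rewrite Xl; exact: submodL.
Qed.
Definition values v U : submod (ratfun F n) := Submod (values_subproof v U).

Lemma valuesE v U (f : OT F n) : values v U (submod_val f) <-> U (X v f).
Proof. by split=> [[g [/val_inj->]]|h]; [|exists f]. Qed.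

Lemma values_dS v U (S : {set 'I_n}) f :
  (forall k, k \in S -> values (d_at d k v) U f) ->
  OT_set F n f -> (forall k x, U x -> U (lambda_mul k x)) -> values v U f ->
  values v U (dS S f).
Proof.
have [_ Xl Xd _] := hX; move=> h1 hf hU [f' [e hf']]; apply: submod_sum => k kS.
exists (ot_dz k f'); split; first by rewrite /= e.
rewrite Xd; apply: submodD; last exact: hU.
by have [g [eg]] := h1 k kS; rewrite (val_inj (etrans e (esym eg)) : f' = g).
Qed.

Lemma values_differences v U h f : (forall i j x, U x -> U (lambda_diff i j x)) ->
  adjoin (@differences F n) h -> values v U f -> values v U (h * f).
Proof.
have [_ Xl Xd Xz] := hX; move=> hU hh; move: f.
apply: (@adjoin_ind F n _ [set h | forall f, values v U f -> values v U (h * f)]) hh.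
  split=> [f|c f g hf hg k hk|f g hf hg k hk].
  - by rewrite mul1r.
  - have -> : (c *: f + g) * k = c *: (f * k) + g * k.
      by rewrite mulrDl !ratfun_scaleE mulrA.
    by apply: submodL; [exact: hf|exact: hg].
  - by rewrite -mulrA; apply: hf; exact: hg.
move=> _ [i [j ->]] f [g [<- hg]]; exists (ot_mulz i j g); split=> //.
by rewrite Xz; exact: hU.
Qed.
End Values.

Variable r : int.
Hypothesis hX : Pch_filtration_set (FV Vs) r X.
Let hX0 : in_Pch X := proj1 hX.

Lemma filtered_pole q (t : 'I_n -> int) v f : (forall i, grV Vs (t i) (v i)) ->
  pole_filtration F n q f -> OT_set F n f ->
  values hX0 v (Vlam_in d n (FV Vs (q + \sum_(i < n) t i - r))) f.
Proof.
move=> hv hq hf; exists (in_submod hf); split=> //.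
have [_ h] := hX; apply: (h _ q t) => //; first by rewrite addrC.
by move=> i; apply: grV_FV (hv i).
Qed.

Lemma d_at_graded (t : 'I_n -> int) k v : (forall i, grV Vs (t i) (v i)) ->
  forall i, grV Vs (t i) (d_at d k v i).
Proof.
move=> h i; rewrite /d_at /upd; case: eqP => [->|_]; last exact: h.
case: (t k) (h k) => s hs; first exact: Vs_d.
by rewrite (grV_neg hs) raddf0; exact: submod0 (zero_submod V).
Qed.

Lemma Vlam_in_lambda_mul t k (x : Vlam d n) : Vlam_in d n (FV Vs t) x ->
  Vlam_in d n (FV Vs t) (lambda_mul k x).
Proof. by apply: (vlam_map_in (u := idfun)) => //; exact: intertwiner_mul. Qed.
Lemma Vlam_in_lambda_diff t i j (x : Vlam d n) : Vlam_in d n (FV Vs t) x ->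
  Vlam_in d n (FV Vs t) (lambda_diff i j x).
Proof. by apply: (vlam_map_in (u := idfun)) => //; exact: intertwiner_deriv. Qed.

Hypothesis low : forall (G : digraph n) (t : 'I_n -> int) w, (forall i, grV Vs (t i) (w i)) ->
  Vlam_in d n (FV Vs (#|edges G|%:Z + \sum_(i < n) t i - r - 1)) (X w (pGamma F G)).

(** A multiple pole at [e] is a derivative along one side of [e] when [e]
    separates the graph, and is redundant otherwise. *)
Lemma low_monomial A m (t : 'I_n -> int) v : (forall i, grV Vs (t i) (v i)) ->
  (forall e, e \in A -> e.1 != e.2) ->
  values hX0 v (Vlam_in d n (FV Vs (#|A|%:Z + \sum_(i < n) t i - r - 1))) (monomial F A m).
Proof.
move=> hv hA; have [N] := ubnP (\sum_(e in A) m e)%N.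
elim: N m v hv => // N IH m v hv ltN.
have redundant : pole_filtration F n (#|A|%:Z - 1) (monomial F A m) ->
    values hX0 v (Vlam_in d n (FV Vs (#|A|%:Z + \sum_(i < n) t i - r - 1))) (monomial F A m).
  move=> h; have := filtered_pole hv h (monomial_OT A m).
  by rewrite (_ : #|A|%:Z - 1 + _ - r = #|A|%:Z + \sum_(i < n) t i - r - 1) //; ring.
have [/existsP[e /andP[he /eqP h0]]|/existsPn pos] := boolP [exists e, (e \in A) && (m e == 0%N)].
  apply: redundant; rewrite (monomialD1 _ _ he) h0 expr0 invr1 mul1r.
  apply: (@with_poles_filtration _ _ (A :\ e)); last exact: monomial_with_poles.
  by rewrite (cardsD1 e A) he; lia.
have [/existsP[e /andP[he h2]]|/existsPn one] := boolP [exists e, (e \in A) && (1 < m e)%N]; last first.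
  have eA : edges (simplify A) = A.
    by apply/setP => e; rewrite /= inE andb_idr //; exact: hA.
  have es : submod_val (pGamma F (simplify A)) = monomial F A m.
    have -> : submod_val (pGamma F (simplify A)) = \prod_(e in edges (simplify A)) (ze e)^-1 by [].
    rewrite eA; apply: eq_bigr => e he; have := pos e; have := one e; rewrite he /=.
    by case: (m e) => [|[|k]].
  by have := low (simplify A) hv; rewrite eA -es => /valuesE.
have [cyc|sep] := boolP (connect (linked (A :\ e)) e.1 e.2).
  by apply: redundant; exact: cyclic_poles cyc.
pose S := [set k | connect (linked (A :\ e)) e.1 k]%SET.
have sym : connect_sym (linked (A :\ e)) by apply: sym_connect_sym => x y; rewrite /linked orbC.
have closedS e' : e' \in A :\ e -> (e'.1 \in S) = (e'.2 \in S).
  move=> he'; rewrite !inE; have h : connect (linked (A :\ e)) e'.1 e'.2.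
    by apply: connect1; rewrite /linked -surjective_pairing he'.
  apply/idP/idP => h'; first exact: connect_trans h.
  by apply: connect_trans h' _; rewrite sym.
have e1S : e.1 \in S by rewrite inE connect0.
have e2S : e.2 \notin S by rewrite inE.
pose m' e' := if e' == e then (m e).-1 else m e'.
have [k mk] : exists k, m e = k.+2 by case: (m e) h2 => [|[|k]] // _; exists k.
have mA' : monomial F (A :\ e) m' = monomial F (A :\ e) m.
  by apply: eq_monomial => e'; rewrite in_setD1 => /andP[/negPf n1 _]; rewrite /m' n1.
have sA (a : F) (x y : ratfun F n) : (a *: x) * y = a *: (x * y) by rewrite !ratfun_scaleE mulrA.
have eD : monomial F A m = - (k.+1%:R)^-1 *: dS S (monomial F A m').
  rewrite !(monomialD1 _ _ he) mA' dSM [dS _ (monomial _ _ _)]dS_monomial0 // mulr0 addr0.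
  rewrite /m' eqxx mk /= dS_pole // sA scalerA mulrNN mulVf ?scale1r //.
  exact: natSF_neq0.
have lt' : (\sum_(e' in A) m' e' < N)%N.
  rewrite -ltnS; apply: leq_trans ltN; rewrite ltnS.
  have m'e : m' e = k.+1 by rewrite /m' eqxx mk.
  rewrite (big_setD1 e) //= [X in (_ < X)%N](big_setD1 e) //= m'e mk.
  rewrite -addSn leq_add2l; apply: leq_sum => e'.
  by rewrite in_setD1 /m' => /andP[/negPf-> _].
rewrite eD; apply: submodZ; apply: values_dS => //; try exact: monomial_OT.
- move=> l _; apply: IH; first exact: d_at_graded.
  exact: lt'.
- by move=> l x; exact: Vlam_in_lambda_mul.
exact: IH.
Qed.

Lemma low_filtered : (0 < n)%N -> Pch_filtration_set (FV Vs) (r + 1) X.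
Proof.
move=> n0; split=> // s q t v f hs hv hf; have [Xl _ _ _] := hX0.
apply: (multilinear_span (Xl f) (S := fun i => \bigcup_(k in [set k : nat | k%:Z <= t i]) (Vs k : set V))).
  exact: hv.
move=> u hu.
have {hu} /choice[k hk] : forall i, exists k : nat, k%:Z <= t i /\ Vs k (u i).
  by move=> i; have [k] := hu i; exists k.
have hku i : grV Vs (k i)%:Z (u i) by have [] := hk i.
have hks : \sum_(i < n) (k i)%:Z <= \sum_(i < n) t i.
  by apply: ler_sum => i _; have [] := hk i.
apply/(valuesE hX0).
apply: (Defs.span_min (U := values hX0 u _)) (few_poles_invariant (Ordinal n0) hf (submod_mem f)).
move=> _ [A [m [h [cA hA hh ->]]]]; apply: values_differences => //.
  by move=> i j x; exact: Vlam_in_lambda_diff.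
have [g [<- hg]] := low_monomial m hku hA; exists g; split=> //.
apply: Vlam_in_FV_mono hg => //.
move: hs cA hks; rewrite opprD addrA; set a := \sum_(i < n) t i; set b := \sum_(i < n) _.
lia.
Qed.
End Symbols.

(** * From chiral to classical operations *)

Section GraphPoles.
Variables (F : fieldType) (charF0 : [pchar F] =i pred0) (n : nat).
Implicit Types (E : {set 'I_n * 'I_n}) (G : digraph n) (c : seq 'I_n).
Local Notation z := (zdiff F).
Local Notation ze e := (zdiff F e.1 e.2).

Lemma pGamma_monomial G : submod_val (pGamma F G) = monomial F (edges G) (fun=> 1%N).
Proof. by []. Qed.
Lemma edges_loopless G e : e \in edges G -> e.1 != e.2.
Proof. by move: e; have /forall_inP := loopless G. Qed.
Lemma edges_remove G e : edges (remove_edge G e) = edges G :\ e.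
Proof.
apply/setP => e'; rewrite /= inE andb_idr // in_setD1 => /andP[_]; exact: edges_loopless.
Qed.

Lemma uniq_zip_l (s t : seq 'I_n) : uniq s -> size s = size t -> uniq (zip s t).
Proof.
move=> us e; apply: (@map_uniq _ _ fst).
by rewrite -/(unzip1 _) unzip1_zip // e.
Qed.
Lemma sum_cycle c : uniq c -> \sum_(e in cycle_edges c) ze e = 0.
Proof.
move=> uc; have sz : size c = size (rot 1 c) by rewrite size_rot.
rewrite (eq_bigl (fun e => e \in zip c (rot 1 c))); last by move=> e; rewrite inE.
rewrite -big_uniq ?uniq_zip_l //= /zdiff sumrB.
rewrite -(big_map fst xpredT (@zvar F n)) -(big_map snd xpredT (@zvar F n)).
rewrite -/(unzip1 _) -/(unzip2 _) unzip1_zip ?sz // unzip2_zip ?sz //.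
have -> : \sum_(i <- rot 1 c) zvar F i = \sum_(i <- c) zvar F i.
  by apply: perm_big; rewrite perm_rot.
exact: subrr.
Qed.

(** The closed walk is cut at its last arc, and the path that remains is made
    simple. *)
Lemma simple_cycle c : c != [::] -> exists c', [/\ c' != [::], uniq c' &
  cycle_edges c' \subset cycle_edges c].
Proof.
case: c => // x p _; pose C := cycle_edges (x :: p).
have hC : path (arc C) x (rcons p x).
  suff h (s : seq 'I_n) a y : (forall e, e \in zip (a :: s) (rcons s y) -> e \in C) ->
      path (arc C) a (rcons s y).
    by apply: h => e he; rewrite inE rot1_cons.
  elim: s a => [|b s IH] a h /=; first by rewrite andbT; apply: h; rewrite mem_head.
  rewrite {1}/arc h /=; last by rewrite mem_head.
  by apply: IH => e he; apply: h; rewrite /= inE he orbT.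
move: hC; rewrite rcons_path => /andP[hp hl]; move: hl.
case/shortenP: hp => p' hp' up' _ hl; exists (x :: p'); split=> //.
by apply: cycle_edges_cycle; rewrite /= rcons_path hp'.
Qed.

(** The z_ij of a simple cycle sum to zero. *)
Lemma cycle_poles E c m : (forall e, e \in E -> e.1 != e.2) -> c != [::] -> uniq c ->
  cycle_edges c \subset E -> pole_filtration F n (#|E|%:Z - 1) (monomial F E m).
Proof.
move=> hE c0 uc /fintype.subsetP sub.
have [e0 he0] : exists e0, e0 \in cycle_edges c.
  case: c c0 {uc sub} => // x p _; exists (x, head x (rcons p x)).
  by rewrite inE rot1_cons; case: p => [|y p] /=; rewrite mem_head.
have e0E := sub _ he0.
apply: (@dependent_poles F n E e0 (fun e => if e \in cycle_edges c then -1 else 0)) => //.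
  exact: hE.
have := sum_cycle uc; rewrite (big_setD1 e0) //= => /eqP; rewrite addr_eq0 => /eqP ->.
rewrite -sumrN [RHS](big_setID (cycle_edges c)) /=.
rewrite [X in _ = _ + X]big1 ?addr0; last first.
  by move=> e; rewrite finset.in_setD => /andP[/negPf-> _]; rewrite scale0r.
apply: eq_big => [e|e]; last by rewrite in_setD1 => /andP[_ ->]; rewrite scaleN1r.
by rewrite finset.in_setI !in_setD1; have := sub e; case: (e \in cycle_edges c) => [->|]; rewrite ?andbT ?andbF.
Qed.

Lemma pGamma_remove G e : e \in edges G ->
  submod_val (pGamma F (remove_edge G e)) = ze e * submod_val (pGamma F G).
Proof.
move=> he; rewrite !pGamma_monomial edges_remove (monomialD1 _ _ he) mulrA expr1.
by rewrite divff ?mul1r // zdiff_eq0 (edges_loopless he).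
Qed.

Lemma card_edges_remove G e : e \in edges G -> #|edges (remove_edge G e)|%:Z = #|edges G|%:Z - 1.
Proof. by move=> he; rewrite edges_remove (cardsD1 e (edges G)) he; lia. Qed.

Lemma pGamma_poles G : pole_filtration F n #|edges G|%:Z (submod_val (pGamma F G)).
Proof.
rewrite pGamma_monomial.
have h : adjoin (with_poles (edges G)) (monomial F (edges G) (fun=> 1%N)).
  exact: monomial_with_poles.
exact: (with_poles_filtration (lexx _) h).
Qed.

(** Removing an edge outside of the simple cycle leaves the cycle, so one pole is
    redundant; the terms of the edges of the cycle sum to p_G times the sum of the
    z_ij along the cycle, which is zero. *)
Lemma oriented_cycle_poles G C : oriented_cycle G C ->
  pole_filtration F n (#|edges G|%:Z - 1) (submod_val (pGamma F G)) /\
  pole_filtration F n (#|edges G|%:Z - 2)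
    (\sum_(e in C) submod_val (pGamma F (remove_edge G e))).
Proof.
move=> [c [c0 -> sub]]; have [c' [c'0 uc' sub']] := simple_cycle c0.
have hE := @edges_loopless G; have sub2 := fintype.subset_trans sub' sub.
split; first by rewrite pGamma_monomial; exact: (cycle_poles _ hE c'0 uc' sub2).
pose T e := submod_val (pGamma F (remove_edge G e)).
have T0 : \sum_(e in cycle_edges c') T e = 0.
  transitivity (\sum_(e in cycle_edges c') ze e * submod_val (pGamma F G)).
    by apply: eq_bigr => e he; rewrite /T pGamma_remove ?(fintype.subsetP sub2).
  by rewrite -mulr_suml sum_cycle // mul0r.
have -> : \sum_(e in cycle_edges c) T e = \sum_(e in cycle_edges c :\: cycle_edges c') T e.
  by rewrite (big_setID (cycle_edges c')) (finset.setIidPr sub') T0; exact: add0r.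
apply: submod_sum => e; rewrite finset.in_setD => /andP[n1 /(fintype.subsetP sub) he].
rewrite /T pGamma_monomial edges_remove.
have -> : #|edges G|%:Z - 2 = #|edges G :\ e|%:Z - 1.
  by rewrite (cardsD1 e (edges G)) he; lia.
apply: (cycle_poles _ _ c'0 uc') => [e'|]; first by rewrite in_setD1 => /andP[_]; exact: hE.
apply/fintype.subsetP => e' he'; rewrite in_setD1 (fintype.subsetP sub2) // andbT.
by apply: contraNneq n1 => <-.
Qed.

(** A path from i to j writes z_ij as a combination of factors of the denominator. *)
Lemma same_component_poles G i j : same_component G i j ->
  pole_filtration F n (#|edges G|%:Z - 1) (z i j * submod_val (pGamma F G)).
Proof.
move=> /(linked_zdiff F)[c ->]; rewrite mulr_suml; apply: submod_sum => e he.
have -> : c e *: ze e * submod_val (pGamma F G) =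
    c e *: submod_val (pGamma F (remove_edge G e)).
  by rewrite pGamma_remove // !ratfun_scaleE mulrA.
by apply: submodZ; rewrite -(card_edges_remove he); exact: pGamma_poles.
Qed.

Lemma dS_component G i :
  dS [set j | same_component G i j]%SET (submod_val (pGamma F G)) = 0.
Proof.
rewrite pGamma_monomial; apply: dS_monomial0 => e he; rewrite !inE.
have sym : connect_sym (linked (edges G)) by apply: sym_connect_sym => x y; rewrite /linked orbC.
have h : connect (linked (edges G)) e.1 e.2.
  by apply: connect1; rewrite /linked -surjective_pairing he.
rewrite /same_component -/(linked (edges G)).
apply/idP/idP => h'; first exact: connect_trans h.
by apply: connect_trans h' _; rewrite sym.
Qed.
End GraphPoles.

Section ChiralToClassical.
Variables (F : fieldType) (charF0 : [pchar F] =i pred0).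
Variables (V : lmodType F) (d : {linear V -> V}) (n : nat).
Variables (Vs : nat -> submod V) (Vs_direct : direct_sum Vs).
Hypothesis Vs_d : forall s x, Vs s x -> Vs s (d x).
Implicit Types (X : Pch_map d n) (v w : 'I_n -> V) (t : 'I_n -> int) (G : digraph n).
Local Notation prj := (prj Vs_direct).
Local Notation part := (part Vs_direct).
Lemma part_lin (t : int) : linear (part t : Vlam d n -> _).
Proof. exact: part_linear. Qed.
Lemma part0 (t : int) : part t (0 : Vlam d n) = 0.
Proof. exact: linear_at0 (part_lin t). Qed.
Lemma partD (t : int) (x y : Vlam d n) : part t (x + y) = part t x + part t y.
Proof. exact: (linear_atD (part_lin t)). Qed.
Lemma partB (t : int) (x y : Vlam d n) : part t (x - y) = part t x - part t y.
Proof. by have := part_lin t (-1) y x; rewrite !scaleN1r ![- _ + _]addrC. Qed.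
Lemma part_bigsum (t : int) (I : Type) (s : seq I) (P : pred I) (G : I -> Vlam d n) :
  part t (\sum_(i <- s | P i) G i) = \sum_(i <- s | P i) part t (G i).
Proof. exact: (linear_at_sum (part_lin t)). Qed.
Definition graded t w := forall i, grV Vs (t i) (w i).

Lemma multilinear0 (W : lmodType F) (g : ('I_n -> V) -> W) w i :
  multilinear g -> w i = 0 -> g w = 0.
Proof.
move=> hg h; rewrite -(upd_id w i) h -[0 in LHS](scale0r 0) (multilinearZ _ _ _ _ hg).
by rewrite scale0r.
Qed.

Lemma multilinear_graded0 (W : lmodType F) (g : ('I_n -> V) -> W) w : multilinear g ->
  (forall t u, graded t u -> g u = 0) -> g w = 0.
Proof.
move=> hg h.
have z : [set 0 : W] 0 /\ forall (c : F) x y, [set 0 : W] x -> [set 0 : W] y -> [set 0 : W] (c *: x + y).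
  by split=> // c x y -> ->; rewrite scaler0 addr0.
apply: (multilinear_span (U := Submod z) (S := fun=> homogeneous Vs) hg).
  by move=> i; exact: span_homogeneous.
move=> u hu /=.
have /choice[k hk] : forall i, exists k : nat, Vs k (u i).
  by move=> i; have [k] := hu i; exists k.
exact: (h (fun i => (k i)%:Z)).
Qed.

(** Changing the arguments of a multilinear map one at a time. *)
Lemma multilinear_diff (W : lmodType F) (g : ('I_n -> V) -> W) (U : submod W) v w :
  multilinear g ->
  (forall i u, u i = v i - w i -> (forall k, k != i -> u k = v k \/ u k = w k) -> U (g u)) ->
  U (g v - g w).
Proof.
move=> hg h.
pose mix (s : seq 'I_n) : 'I_n -> V := fun i => if i \in s then v i else w i.
suff hs (s : seq 'I_n) : uniq s -> U (g (mix s) - g w).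
  have := hs (enum 'I_n) (enum_uniq _).
  by rewrite (_ : mix _ = v) //; apply: funext => i; rewrite /mix mem_enum.
elim: s => [_|i s IH /andP[is_ us]]; first by rewrite (_ : mix [::] = w) // subrr; exact: submod0.
rewrite -[_ - _](subrKA (g (mix s))) //; apply: submodD; last exact: IH.
have e1 : mix (i :: s) = upd (mix s) i (v i).
  by apply: funext => k; rewrite /mix /upd inE; case: eqVneq => [->|].
have e2 : mix s = upd (mix s) i (w i).
  apply: funext => k; rewrite /mix /upd; case: eqVneq => [->|//].
  by rewrite (negPf is_).
have -> : g (mix (i :: s)) - g (mix s) = g (upd (mix s) i (v i - w i)).
  rewrite e1 {2}e2 -scaleN1r addrC -hg; congr (g (upd _ _ _)).
  by rewrite scaleN1r addrC.
apply: (h i); first by rewrite /upd eqxx.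
move=> k /negPf ki; rewrite /upd ki /mix; case: ifP; by [left|right].
Qed.

Lemma d_at_upd j v i x : d_at d j (upd v i x) = upd (d_at d j v) i (if i == j then d x else x).
Proof.
apply: funext => k; rewrite /d_at /upd.
case: (eqVneq i j) => [->|ij]; first by case: (eqVneq k j) => //; rewrite eqxx.
case: (eqVneq k j) => [->|//]; by rewrite eq_sym (negPf ij).
Qed.
Lemma multilinear_d_at (W : lmodType F) (g : ('I_n -> V) -> W) j : multilinear g ->
  multilinear (fun w => g (d_at d j w)).
Proof.
move=> hg v i c x y; rewrite !d_at_upd -hg; congr (g (upd _ _ _)).
by case: ifP => // _; rewrite linearP.
Qed.
Lemma multilinear_sum (W : lmodType F) (I : Type) (s : seq I) (P : pred I)
    (g : I -> ('I_n -> V) -> W) : (forall i, P i -> multilinear (g i)) ->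
  multilinear (fun w => \sum_(i <- s | P i) g i w).
Proof.
move=> hg v i c x y; rewrite scaler_sumr -big_split; apply: eq_bigr => k Pk.
exact: hg.
Qed.
Lemma multilinear_linear (W W' : lmodType F) (u : {linear W -> W'}) (g : ('I_n -> V) -> W) :
  multilinear g -> multilinear (fun w => u (g w)).
Proof. by move=> hg v i c x y; rewrite hg linearP. Qed.

Definition degree r G (t : 'I_n -> int) : int := #|edges G|%:Z + \sum_(i < n) t i - r.

(** The symbol of X takes, on homogeneous tensors, the component of the highest degree
    that the filtration allows; other tensors are decomposed first. *)
Definition symbol_term r X G w (k : {ffun 'I_n -> nat}) : Vlam d n :=
  part (degree r G (fun i => (k i)%:Z)) (X (fun i => prj (k i)%:Z (w i)) (pGamma F G)).
Definition symbol_op r X : Pcl_map d n := fun G w =>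
  \sum_(k \in [set: {ffun 'I_n -> nat}]) symbol_term r X G w k.

Section Multilinear.
Variables (X : Pch_map d n) (hX : forall f, multilinear (X^~ f)).
Variable r : int.

Lemma fsupp_symbol_term G w : fsupp (symbol_term r X G w).
Proof.
have [N hN] : exists N, forall i (s : nat), (N <= s)%N -> prj s%:Z (w i) = 0.
  have /choice[N hN] : forall i, exists N, forall s : nat, (N <= s)%N -> prj s%:Z (w i) = 0.
    move=> i; have [l hl] := decomposes_fsupp (componentP Vs_direct (w i)).
    exists (\max_(j <- l) j).+1 => s ls; apply: hl; apply/negP => sl.
    have := @leq_bigmax_seq _ l xpredT (fun x : nat => x) s sl isT.
    by move=> /leq_ltn_trans/(_ ls); rewrite ltnn.
  by exists (\max_i N i)%N => i s hs; apply: hN; apply: leq_trans hs; exact: leq_bigmax.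
exists [seq [ffun i => nat_of_ord (k i)] | k : {ffun 'I_n -> 'I_N}] => k hk.
have [/existsP[i hi]|/existsPn small] := boolP [exists i, (N <= k i)%N].
  rewrite /symbol_term (multilinear0 (hX _) (i := i)) ?part0 //.
  exact: hN.
have lt i : (k i < N)%N by have := small i; rewrite -ltnNge.
move/negP: hk => []; apply/mapP; exists [ffun i => Ordinal (lt i)]; first by rewrite mem_enum.
by apply/ffunP => i; rewrite !ffunE.
Qed.

Lemma symbol_op_multilinear G : multilinear (symbol_op r X G).
Proof.
move=> v i c x y; rewrite /symbol_op -fsumZ; last exact: fsupp_symbol_term.
rewrite -fsumD; [|exact/fsuppZ/fsupp_symbol_term|exact: fsupp_symbol_term].
apply: eq_fsum => k; rewrite /symbol_term -part_lin; congr (part _ _).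
have E u : (fun j => prj (k j)%:Z (upd v i u j)) =
    upd (fun j => prj (k j)%:Z (v j)) i (prj (k i)%:Z u).
  by apply: funext => j; rewrite /upd; case: eqP => // ->.
by rewrite !E -hX linearP.
Qed.

Lemma symbol_op_graded G t w : graded t w ->
  symbol_op r X G w = part (degree r G t) (X w (pGamma F G)).
Proof.
move=> hw; have [/existsP[i hi]|/existsPn pos] := boolP [exists i, t i < 0].
  have wi : w i = 0 by move: hi (hw i); case: (t i) => // s _; exact: grV_neg.
  rewrite (multilinear0 (hX _) wi) part0.
  exact: multilinear0 (symbol_op_multilinear G) wi.
have ht i : t i = (absz (t i))%:Z by rewrite gez0_abs // leNgt.
pose k0 := [ffun i => absz (t i)].
have ek : (fun i => prj (k0 i)%:Z (w i)) = w.
  by apply: funext => i; rewrite ffunE -ht; exact: prj_id (hw i).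
have ed : degree r G (fun i => (k0 i)%:Z) = degree r G t.
  by rewrite /degree; congr (_ + _ - _); apply: eq_bigr => i _; rewrite ffunE -ht.
rewrite /symbol_op (@fsuppT_seq _ _ _ [:: k0]) // => [|k].
  by rewrite big_seq1 /symbol_term ek ed.
rewrite inE => nk; have [i hi] : exists i, (k i)%:Z != t i.
  apply: contrapT => h; move/eqP: nk; apply; apply/ffunP => i; rewrite ffunE.
  by have [e|ne] := eqVneq (k i)%:Z (t i); [rewrite -e|case: h; exists i].
rewrite /symbol_term (multilinear0 (hX _) (i := i)) ?part0 //.
by rewrite (prj_grV _ _ (hw i)) (negPf hi).
Qed.
End Multilinear.

Section Filtered.
Variables (r : int) (X : Pch_map d n).
Hypothesis hX : Pch_filtration_set (FV Vs) r X.
Let Xl f : multilinear (X^~ f). Proof. by have [[h _ _ _] _] := hX; exact: h. Qed.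
Let Xlin w : linear (X w). Proof. by have [[_ h _ _] _] := hX; exact: h. Qed.

Lemma filtered_graded t w q f : graded t w -> pole_filtration F n q (submod_val f) ->
  Vlam_in d n (FV Vs (q + \sum_(i < n) t i - r)) (X w f).
Proof.
move=> hw hf; have [_ h] := hX; apply: (h _ q t) => //; first by rewrite addrC.
by move=> i; apply: grV_FV (hw i).
Qed.

Lemma filtered_part0 t w q f k : graded t w -> pole_filtration F n q (submod_val f) ->
  q + \sum_(i < n) t i - r < k -> part k (X w f) = 0.
Proof. by move=> hw hf; apply: (part_FV0 Vs_direct Vs_d); exact: filtered_graded. Qed.

Lemma X_sum w (I : Type) (s : seq I) (P : pred I) (f : I -> OT F n) :
  X w (\sum_(i <- s | P i) f i) = \sum_(i <- s | P i) X w (f i).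
Proof.
exact: (linear_at_sum (Xlin w)).
Qed.
Lemma submod_val_sum (I : Type) (s : seq I) (P : pred I) (f : I -> OT F n) :
  submod_val (\sum_(i <- s | P i) f i) = \sum_(i <- s | P i) submod_val (f i).
Proof. exact: big_morph. Qed.

Let Y := symbol_op r X.
Let Yl G : multilinear (Y G) := symbol_op_multilinear Xl r G.

(** The function attached to the relation has fewer poles than expected, so the
    component selected by the symbol is zero; the next two relations hold for the
    same reason. *)
Lemma symbol_op_cycle G C w : oriented_cycle G C ->
  Y G w = 0 /\ \sum_(e in C) Y (remove_edge G e) w = 0.
Proof.
move=> hC; have [h1 h2] := oriented_cycle_poles F hC.
split; first apply: (multilinear_graded0 w (Yl G)) => t u hu.
  rewrite /Y (symbol_op_graded Xl r G hu).
  by apply: (filtered_part0 hu h1); rewrite /degree; lia.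
apply: (@multilinear_graded0 _ (fun w => \sum_(e in C) Y (remove_edge G e) w)).
  by apply: multilinear_sum => e _; exact: Yl.
move=> t u hu.
have sub : C \subset edges G by have [c [_ _ ]] := hC.
transitivity (part (#|edges G|%:Z - 1 + \sum_(i < n) t i - r)
    (X u (\sum_(e in C) pGamma F (remove_edge G e)))).
  rewrite X_sum part_bigsum; apply: eq_bigr => e he.
  rewrite /Y (symbol_op_graded Xl r _ hu) /degree card_edges_remove //.
  exact: (fintype.subsetP sub).
apply: (@filtered_part0 t u (#|edges G|%:Z - 2)) => //; first by rewrite submod_val_sum.
lia.
Qed.

Lemma symbol_op_diff G i j w : same_component G i j -> lambda_diff i j (Y G w) = 0.
Proof.
move=> hij; apply: (@multilinear_graded0 _ (fun w => lambda_diff i j (Y G w))).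
  exact: multilinear_linear (Yl G).
move=> t u hu; rewrite /Y (symbol_op_graded Xl r G hu) -part_lambda_diff //.
have [[_ _ _ hz] _] := hX; rewrite -hz.
apply: (filtered_part0 hu (q := #|edges G|%:Z - 1)); last by rewrite /degree; lia.
exact: same_component_poles.
Qed.

Lemma symbol_op_sesqui G i w :
  \sum_(j | same_component G i j) (Y G (d_at d j w) + lambda_mul j (Y G w)) = 0.
Proof.
apply: (@multilinear_graded0 _ (fun w =>
  \sum_(j | same_component G i j) (Y G (d_at d j w) + lambda_mul j (Y G w)))).
  apply: multilinear_sum => j _ v k c x y.
  have h1 := multilinear_d_at j (Yl G); have h2 := multilinear_linear (lambda_mul j) (Yl G).
  by rewrite h1 h2 scalerDr addrACA.
move=> t u hu.
transitivity (part (degree r G t) (X u (\sum_(j | same_component G i j) ot_dz j (pGamma F G)))).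
  rewrite X_sum part_bigsum; apply: eq_bigr => j _.
  have [[_ _ hd _] _] := hX; rewrite hd partD part_lambda_mul //.
  rewrite /Y (symbol_op_graded Xl r G hu).
  by rewrite (symbol_op_graded Xl r G (d_at_graded Vs_d j hu)).
have -> : \sum_(j | same_component G i j) ot_dz j (pGamma F G) = 0.
  apply: val_inj; rewrite /= submod_val_sum -[RHS](dS_component F G i).
  by apply: eq_bigl => j; rewrite inE.
by rewrite (linear_at0 (Xlin u)) part0.
Qed.

Lemma symbol_op_gr_Pcl : gr_Pcl_set (grV Vs) r Y.
Proof.
split; first split.
- exact: Yl.
- by move=> G C w; exact: symbol_op_cycle.
- by move=> G i j w; exact: symbol_op_diff.
- by move=> G i w; exact: symbol_op_sesqui.
by move=> G t w hw; rewrite /Y (symbol_op_graded Xl r G hw); exact: part_in.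
Qed.

Lemma symbol_op_is_Phi : is_Phi Vs r X Y.
Proof.
move=> G t v w hs.
have hw : graded t w by move=> i; have [] := hs i.
have hv i : FV Vs (t i) (v i) by have [] := hs i.
have [_ hXf] := hX; have pG := @pGamma_poles F n G.
split.
- by apply: (hXf _ #|edges G|%:Z t) => //; rewrite addrC.
- by have [_ h] := symbol_op_gr_Pcl; exact: h.
rewrite /Y (symbol_op_graded Xl r G hw) -(subrKA (X w (pGamma F G))); apply: submodD; last first.
  apply/(Vlam_in_FVP Vs_direct Vs_d) => s hs'; rewrite partB.
  rewrite (part_grV Vs_direct Vs_d _ (part_in Vs_direct Vs_d _ _)).
  case: eqP => [->|ne]; first by rewrite subrr.
  rewrite subr0; apply: (filtered_part0 hw pG).
  by move: ne hs'; rewrite /degree; lia.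
apply: (multilinear_diff (g := X^~ (pGamma F G))) => // i u ui uk.
pose t' k := if k == i then t i - 1 else t k.
have et : \sum_(k < n) t' k = \sum_(k < n) t k - 1.
  rewrite (bigD1 i) //= [X in _ = X - 1](bigD1 i) //= {1}/t' eqxx addrAC; congr (_ + _ - 1).
  by apply: eq_bigr => k /negPf ki; rewrite /t' ki.
have -> : #|edges G|%:Z + \sum_(k < n) t k - r - 1 = #|edges G|%:Z + \sum_(k < n) t' k - r.
  by rewrite et; ring.
apply: (hXf _ #|edges G|%:Z t') => //; first by rewrite addrC.
move=> k; rewrite /t'; have [->|ki] := eqVneq k i.
  by rewrite ui; have [] := hs i.
by have [->|->] := uk k ki; [exact: hv|apply: grV_FV (hw k)].
Qed.

(** The graphs control the components of highest degree on the functions p_G, and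
    these determine them on all functions. *)
Lemma symbol_op_low : symbol_op r X = 0 -> (0 < n)%N -> Pch_filtration_set (FV Vs) (r + 1) X.
Proof.
move=> h0 n0; apply: (low_filtered charF0 Vs_direct Vs_d hX) => // G t w hw.
apply/(Vlam_in_FVP Vs_direct Vs_d) => s hs.
have [lt|] := ltP (degree r G t) s; first exact: (filtered_part0 hw (@pGamma_poles F n G)).
move=> le; have -> : s = degree r G t by move: hs le; rewrite /degree; lia.
by rewrite -(symbol_op_graded Xl r G hw) h0.
Qed.
End Filtered.

Lemma symbol_op_next r X : Pch_filtration_set (FV Vs) (r + 1) X -> symbol_op r X = 0.
Proof.
move=> hX; have [[Xl _ _ _] _] := hX; apply: funext => G; apply: funext => w.
apply: (multilinear_graded0 w (symbol_op_multilinear Xl r G)) => t u hu.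
rewrite (symbol_op_graded Xl r G hu).
by apply: (filtered_part0 hX hu (@pGamma_poles F n G)); rewrite /degree; lia.
Qed.

Lemma symbol_op_linear r c X X' : (forall f, multilinear (X^~ f)) -> (forall f, multilinear (X'^~ f)) ->
  symbol_op r (c *: X + X') = c *: symbol_op r X + symbol_op r X'.
Proof.
move=> hX hX'; apply: funext => G; apply: funext => w.
have -> : (c *: symbol_op r X + symbol_op r X') G w =
  c *: symbol_op r X G w + symbol_op r X' G w by [].
rewrite /symbol_op -fsumZ; last exact: fsupp_symbol_term.
rewrite -fsumD; [|exact/fsuppZ/fsupp_symbol_term|exact: fsupp_symbol_term].
by apply: eq_fsum => k; rewrite /symbol_term -part_lin.
Qed.
End ChiralToClassical.

(** * The two constructions are mutually inverse *)

Section Inverse.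
Variables (F : fieldType) (charF0 : [pchar F] =i pred0).
Variables (V : lmodType F) (d : {linear V -> V}) (n : nat).
Variables (Vs : nat -> submod V) (Vs_direct : direct_sum Vs).
Hypothesis Vs_d : forall s x, Vs s x -> Vs s (d x).
Hypothesis n_gt0 : (0 < n)%N.
Implicit Types (v w : 'I_n -> V) (t : 'I_n -> int).
Local Notation part := (part Vs_direct).

Lemma lines_bounds p (L : lines n p) : is_lines L -> (0 < p <= n)%N.
Proof.
move=> hL; apply/andP; split.
  by case: p L hL => // L hL; case: (line_of hL (Ordinal n_gt0)).
have hd (l : 'I_p) : exists x, line_of hL x == l.
  have [x [s e]] := tnth_cons hL l; exists x; apply/eqP/line_ofE.
  by rewrite mem_tnth_seq e mem_head.
rewrite -[X in (X <= _)%N]card_ord -[X in (_ <= X)%N]card_ord.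
apply: (@leq_card _ _ (fun l => xchoose (hd l))) => l l' e.
by rewrite -(eqP (xchooseP (hd l))) e (eqP (xchooseP (hd l'))).
Qed.

(** Only a = b = 0 contributes, with Fourier coefficient 1. *)
Lemma line_term_self p (L : lines n p) (y : ('I_n -> V) -> Vlam d p) w : is_lines L ->
  line_term L y (submod_val (pGamma F (lines_graph L))) w = line_emb L (y w).
Proof.
move=> hL; rewrite /line_term (@fsuppT_seq _ _ _ [:: (0%MM, 0%MM)]) //; last first.
  move=> [a b]; rewrite inE => ab; rewrite /term /=.
  rewrite -(@vlam_map_phi0 _ _ d p n idfun (y (d_dpow d b w))); apply: vlam_map_ext => Q.
  rewrite /term_op fourier_coef_self // mnmD_eq0.
  move: ab; rewrite xpair_eqE => /negPf->.
  by rewrite convolution0l /line_subst -[0 in LHS](mpolyC0 p F) poly_substC mpolyC0 mulr0.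
rewrite big_seq1 /term /= d_dpow0; apply: vlam_map_ext => Q.
rewrite /term_op fourier_coef_self // mnmD_eq0 !eqxx /= convolution1 //.
rewrite -dpowXE big1 ?mul1r // => i _.
by rewrite mnm0E /dpow /= fact0 invr1 scale1r expr0.
Qed.

(** Families with fewer lines than L ask for more poles than p_L has, those with more
    lines take values in lower degree, and among those with the same number of lines
    orthogonality leaves only L itself. *)
Lemma part_chiral_op_lines r (Y : Pcl_map d n) p (L : lines n p) t w :
  gr_Pcl_set (grV Vs) r Y -> is_lines L -> graded Vs t w ->
  part (degree r (lines_graph L) t) (chiral_op Y w (pGamma F (lines_graph L))) =
  Y (lines_graph L) w.
Proof.
move=> hY hL hw; have [hY1 Ygr] := hY; have /andP[p0 pn] := lines_bounds hL.
rewrite /chiral_op (part_bigsum Vs_direct Vs_d).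
have card := card_edges_lines hL.
have poles := @pGamma_poles F n (lines_graph L); rewrite card in poles.
rewrite (bigD1_seq p) ?iota_uniq ?mem_index_iota ?p0 //=.
set T := (X in X + _); rewrite big_seq_cond big1 ?addr0 /T {T}; last first.
  move=> p'; rewrite mem_index_iota => /andP[/andP[p'0 p'n] p'p].
  rewrite (part_bigsum Vs_direct Vs_d) big1 // => L' hL'.
  have [few|] := boolP ((n - p)%N%:Z < (n - p')%N%:Z :> int).
    by rewrite (line_term_few_poles charF0 _ _ hL' poles few) (part0 n Vs_direct Vs_d).
  rewrite -leNgt => many.
  rewrite (part_grV Vs_direct Vs_d _ (line_term_graded charF0 Vs_d (pGamma F (lines_graph L)) hY hL' hw)).
  rewrite /degree card ifN //; apply: contraNneq p'p.
  by move: p'n pn; lia.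
rewrite (part_bigsum Vs_direct Vs_d) (bigD1 L) //= [X in _ + X]big1 ?addr0; last first.
  move=> L' /andP[hL' ne]; rewrite line_term_fourier0 ?(part0 n Vs_direct Vs_d) //.
  by move=> a; apply: fourier_coef_other => //; apply/eqP.
rewrite line_term_self // line_part_emb //.
by apply: part_id => //; rewrite /degree; exact: Ygr.
Qed.

(** The difference satisfies the cycle relations and vanishes at families of lines. *)
Lemma symbol_op_chiral_op r (Y : Pcl_map d n) : gr_Pcl_set (grV Vs) r Y ->
  symbol_op Vs_direct r (chiral_op Y) = Y.
Proof.
move=> hY; have hX := chiral_op_filtered charF0 Vs_d hY.
have [[Xl _ _ _] _] := hX; have [[Yl Yc _ _] _] := hY.
have [[Zl Zc _ _] _] := symbol_op_gr_Pcl Vs_direct Vs_d hX.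
apply: funext => G; apply: funext => w; apply/eqP; rewrite -subr_eq0; apply/eqP.
move: G; apply: cycle_relations_vanish => [G C hC|p L hL].
  have [y0 ys] := Yc G C w hC; have [z0 zs] := Zc G C w hC.
  by rewrite z0 y0 subrr sumrB zs ys subrr.
pose D w' := symbol_op Vs_direct r (chiral_op Y) (lines_graph L) w' - Y (lines_graph L) w'.
apply: (@multilinear_graded0 _ _ _ _ Vs_direct _ D) => [v i c x y|t u hu].
  by rewrite /D Zl Yl scalerBr opprD addrACA.
by rewrite /D (symbol_op_graded Vs_direct Vs_d Xl r _ hu) (part_chiral_op_lines hY hL hu) subrr.
Qed.
End Inverse.

Lemma exists_linear (F : fieldType) (U W : lmodType F) (f : U -> W) : linear f ->
  exists g : {linear U -> W}, g =1 f.
Proof.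
move=> hf; pose h := GRing.isLinear.Build F U W _ f hf.
by exists (HB.pack_for {linear U -> W} f h).
Qed.

Lemma submod_val_linear (F : fieldType) (U : lmodType F) (W : submod U) c (x y : submod_type W) :
  submod_val (c *: x + y) = c *: submod_val x + submod_val y.
Proof. by []. Qed.

Theorem theorem5p1 (F : fieldType) (charF0 : [pchar F] =i pred0)
    (V : lmodType F) (d : {linear V -> V})
    (* the parity decomposition V = par false (+) par true *)
    (par : bool -> submod V) (par_direct : direct_sum par)
    (d_even : forall b v, par b v -> par b (d v))
    (* the grading by sub-superspaces stable under d *)
    (Vs : nat -> submod V) (Vs_direct : direct_sum Vs)
    (Vs_d : forall s v, Vs s v -> Vs s (d v))
    (Vs_par : forall s v c, Vs s v -> decomposes par v c ->
       forall b, Vs s (c b))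
    (n : nat) (n_gt0 : (0 < n)%N) (r : int) :
  [/\ forall p (L : lines n p) (f : OT F n), is_lines L ->
        finite_set [set a | fourier_coef L (submod_val f) a != 0] /\
        forall a, OT_set F p (fourier_coef L (submod_val f) a),
      forall (Y : gr_Pcl d n (grV Vs) r) p (L : lines n p) (v : 'I_n -> V),
        is_lines L ->
        exists q, is_Lambda_form L (submod_val Y (lines_graph L) v) q
    & exists (Psi : {linear gr_Pcl d n (grV Vs) r ->
                       submod_type (Pch_filtration d n (FV Vs) r)})
             (Phi : {linear gr_Pch d n (FV Vs) r -> gr_Pcl d n (grV Vs) r}),
      [/\ forall Y (v : 'I_n -> V) (f : OT F n)
            (q : forall p, lines n p -> 'X_{1..n} -> Vpoly V p),
            (forall p (L : lines n p) b, is_lines L ->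
               is_Lambda_form L
                 (submod_val Y (lines_graph L) (d_dpow d b v)) (q p L b)) ->
            submod_val (Psi Y) v f = chiral_formula d (submod_val f) q,
          forall X, is_Phi Vs r (submod_val X) (submod_val (Phi (qclass _ X))),
          cancel (fun Y => qclass _ (Psi Y)) Phi,
          cancel Phi (fun Y => qclass _ (Psi Y))
        & bijective Phi]].
Proof.
split=> [p L f hL|Y p L v hL|].
- split=> [|a]; last by apply: fourier_coef_OT => //; exact: submod_mem.
  have [N hN] := fourier_coef_finite charF0 hL (submod_val f).
  apply: sub_finite_set (finite_mnm_box n N) => a /= a0 i.
  by rewrite leqNgt; apply: contraNN a0 => hi; apply/eqP/hN; exists i; exact: ltnW.
- have [hY _] := submod_mem Y.
  exists (qrep (line_part (submod_val Y) L v)); apply/(is_Lambda_formE hL).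
  by rewrite qrepK line_part_emb.
pose psi (Y : gr_Pcl d n (grV Vs) r) : submod_type (Pch_filtration d n (FV Vs) r) :=
  in_submod (U := Pch_filtration d n (FV Vs) r) (chiral_op_filtered charF0 Vs_d (submod_mem Y)).
have psi_linear : linear psi.
  move=> c Y Y'; apply: val_inj; rewrite [RHS]submod_val_linear.
  change (chiral_op (submod_val (c *: Y + Y')) =
    c *: chiral_op (submod_val Y) + chiral_op (submod_val Y')).
  by rewrite submod_val_linear; exact: chiral_op_linear.
pose symb := @symbol_op F V d n Vs Vs_direct r.
have symb_gr (X : submod_type (Pch_filtration d n (FV Vs) r)) :
    gr_Pcl_set (grV Vs) r (symb (submod_val X)).
  by apply: symbol_op_gr_Pcl => //; exact: submod_mem X.
have symb_linear c (X X' : submod_type (Pch_filtration d n (FV Vs) r)) :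
    symb (c *: submod_val X + submod_val X') = c *: symb (submod_val X) + symb (submod_val X').
  have [[h _ _ _] _] := submod_mem X; have [[h' _ _ _] _] := submod_mem X'.
  exact: symbol_op_linear.
pose phi (x : gr_Pch d n (FV Vs) r) : gr_Pcl d n (grV Vs) r :=
  in_submod (U := Submod (gr_Pcl_subproof d n (grV Vs) r)) (symb_gr (qrep x)).
have phi_class X : submod_val (phi (qclass _ X)) = symb (submod_val X).
  rewrite /=; have [y hy ->] := qclassP (sub_submod (Pch_filtration d n (FV Vs) r)
    (Pch_filtration d n (FV Vs) (r + 1))) X.
  have := symb_linear 1 X y; rewrite !scale1r => -> /=.
  by rewrite [symb (submod_val y)]symbol_op_next ?addr0.
have phi_linear : linear phi.
  move=> c x y; apply: val_inj => /=; rewrite -[x in LHS]qrepK -[y in LHS]qrepK -linearP.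
  by rewrite [LHS]phi_class /=; exact: symb_linear.
have [Psi ePsi] := exists_linear psi_linear.
have [Phi ePhi] := exists_linear phi_linear.
have K1 : cancel (fun Y => qclass _ (Psi Y)) Phi.
  move=> Y; rewrite ePhi; apply: val_inj; rewrite [LHS]phi_class ePsi /=.
  by apply: symbol_op_chiral_op => //; exact: submod_mem Y.
have K2 : cancel Phi (fun Y => qclass _ (Psi Y)).
  move=> x; rewrite -[RHS]qrepK; apply/eq_qclass.
  set Z := _ - _; have hZ : symb (submod_val Z) = 0.
    have := phi_class Z; rewrite -ePhi.
    have -> : Phi (qclass _ Z) = 0.
      by rewrite /Z linearB /= qrepK linearB /= K1 subrr.
    by move=> /= <-.
  change (Pch_filtration_set (FV Vs) (r + 1) (submod_val Z)).
  exact: (@symbol_op_low F charF0 V d n Vs Vs_direct Vs_d r (submod_val Z) (submod_mem Z) hZ n_gt0).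
exists Psi, Phi; split=> //.
- move=> Y v f q hq; rewrite ePsi; exact: chiral_opE.
- move=> X; rewrite ePhi phi_class; exact: (@symbol_op_is_Phi F V d n Vs Vs_direct Vs_d r (submod_val X) (submod_mem X)).
exact: (Bijective K2 K1).
Qed.
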